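(* In the setting of the context (Neimark--Sacker bifurcation of an autonomous system), assume $\omega^\star\notin\{\frac13,\frac14\}$. For $|\varepsilon|$ sufficiently small, the system $$\mathsf S_{\infty,3}\boldsymbol G(\boldsymbol z_3(\theta,\phi),\lambda,\eta,\theta;\varepsilon)-\eta\boldsymbol e_n-\left[(1+\varepsilon\eta)\frac{\partial}{\partial\theta}+\omega\frac{\partial}{\partial\phi}\right]\boldsymbol z_3(\theta,\phi)=\boldsymbol 0,\qquad\boldsymbol\gamma_1(\boldsymbol z_3)-\widehat{\boldsymbol e}_1=\boldsymbol 0,\qquad\gamma_2(\boldsymbol z_3)=0,$$ for $\lambda,\omega,\eta\in\mathbb R$ and $\boldsymbol z_3:\mathbb S^1\times\mathbb S^1\to\mathbb R^n$ having only Fourier $\phi$-modes $0,1,2,3$, has a locally unique solution (near $\lambda=\lambda^\star$, $\omega=\omega^\star$, $\eta=0$, $\boldsymbol z_3=\boldsymbol a^\star(\phi)$) $$\lambda^F(\varepsilon),\ \omega^F(\varepsilon),\ \eta^F(\varepsilon),\quad\boldsymbol z^F(\theta,\phi;\varepsilon)=\boldsymbol a^\star(\phi)+\boldsymbol a_0^F(\theta;\varepsilon)+\sum_{m=1}^3\left\{\boldsymbol a_m^F(\theta;\varepsilon)\cos m\phi+\boldsymbol b_m^F(\theta;\varepsilon)\sin m\phi\right\}.$$ The amplitude and phase conditions force $$\langle\boldsymbol a_1^F(\theta;\varepsilon),\boldsymbol e_1\rangle+\langle\boldsymbol b_1^F(\theta;\varepsilon),\boldsymbol e_2\rangle=0,\quad\langle\boldsymbol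 a_1^F(\theta;\varepsilon),\boldsymbol e_2\rangle-\langle\boldsymbol b_1^F(\theta;\varepsilon),\boldsymbol e_1\rangle=0\quad\text{and}\quad\langle\boldsymbol a_0^F(\theta;\varepsilon),\boldsymbol e_n\rangle=0.$$ Comparison with the asymptotic solution $\lambda^E(\varepsilon),\omega^E(\varepsilon),\eta^E(\varepsilon),\boldsymbol z^E(\theta,\phi;\varepsilon)$ defined in the context gives, as $\varepsilon\to0$, $$|\eta^E(\varepsilon)-\eta^F(\varepsilon)|=O(\varepsilon^3),\qquad|\lambda^E(\varepsilon)-\lambda^F(\varepsilon)|=O(\varepsilon^4),\qquad|\omega^E(\varepsilon)-\omega^F(\varepsilon)|=O(\varepsilon^4),$$ $$\|\boldsymbol a_m^E(\theta;\varepsilon)-\boldsymbol a_m^F(\theta;\varepsilon)\|=O(\varepsilon^3)\ (m=0,2),\qquad\|\boldsymbol b_m^E(\theta;\varepsilon)-\boldsymbol b_m^F(\theta;\varepsilon)\|=O(\varepsilon^3)\ (m=2),$$ $$\|\boldsymbol a_m^E(\theta;\varepsilon)-\boldsymbol a_m^F(\theta;\varepsilon)\|=O(\varepsilon^4)\ (m=1,3),\qquad\|\boldsymbol b_m^E(\theta;\varepsilon)-\boldsymbol b_m^F(\theta;\varepsilon)\|=O(\varepsilon^4)\ (m=1,3),$$ uniformly in $\theta$.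
   Context: Setting (autonomous Neimark--Sacker bifurcation). $\mathbb S^1=\mathbb R/2\pi\mathbb Z$; $\boldsymbol F:\mathbb R^n\times\mathbb R\to\mathbb R^n$ is smooth; the system is $\frac{d\boldsymbol x}{dt}=\boldsymbol F(\boldsymbol x,\lambda)$; $\mathsf J(\boldsymbol x,\lambda)$ is the Jacobian matrix of $\boldsymbol F$ with respect to $\boldsymbol x$. Assume: (1) At $\lambda=\lambda^\star$ the system has a periodic orbit of period $2\pi T^\star$; rescaled to $\boldsymbol v^\star:\mathbb S^1\to\mathbb R^n$ it satisfies $T^\star\boldsymbol F(\boldsymbol v^\star(\theta),\lambda^\star)-\frac{d}{d\theta}\boldsymbol v^\star(\theta)=\boldsymbol 0$. (2) There are $\mathsf E^\star\in\mathbb R^{n\times n}$ and $\mathsf P^\star:\mathbb S^1\to\mathbb R^{n\times n}$ with $\mathsf P^\star(\theta)$ non-singular for all $\theta$ (so all Floquet vectors are taken $2\pi$-periodic) such that $T^\star\mathsf J(\boldsymbol v^\star(\theta),\lambda^\star)\mathsf P^\star(\theta)-\dot{\mathsf P}^\star(\theta)=\mathsf P^\star(\theta)\mathsf E^\star$, $\mathsf E^\star=\mathrm{diag}(\widehat{\mathsf E}^\star,\widetilde{\mathsf E}^\star,0)$, $\widehat{\mathsf E}^\star=\begin{pmatrix}0&-\omega^\star\\ \omega^\star&0\end{pmatrix}$, $\omega^\star>0$, and $\widetilde{\mathsf E}^\star\in\mathbb R^{(n-3)\times(n-3)}$ with no eigenvalues on the imaginary axis. The imaginary parts of the eigenvalues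 of $\mathsf E^\star$ (Floquet exponents) are taken in $(-\frac12,\frac12)$, so that $0<\omega^\star<\frac12$. Consequently, for $\lambda$ near $\lambda^\star$ there are smooth continuations $T^\star(\lambda)$, $\boldsymbol v^\star(\theta;\lambda)$, $\mathsf P(\theta;\lambda)$ (non-singular, $2\pi$-periodic in $\theta$), $\mathsf E(\lambda)$ with $T^\star(\lambda)\boldsymbol F(\boldsymbol v^\star(\theta;\lambda),\lambda)=\frac{d}{d\theta}\boldsymbol v^\star(\theta;\lambda)$, $T^\star(\lambda)\mathsf J(\boldsymbol v^\star(\theta;\lambda),\lambda)\mathsf P(\theta;\lambda)-\dot{\mathsf P}(\theta;\lambda)=\mathsf P(\theta;\lambda)\mathsf E(\lambda)$ (here $\dot{\mathsf P}=\partial\mathsf P/\partial\theta$), $\mathsf E(\lambda)=\mathrm{diag}(\widehat{\mathsf E}(\lambda),\widetilde{\mathsf E}(\lambda),0)$, $\widehat{\mathsf E}(\lambda)=\begin{pmatrix}\alpha_R(\lambda)&-\alpha_I(\lambda)\\ \alpha_I(\lambda)&\alpha_R(\lambda)\end{pmatrix}$. The last column of $\mathsf P(\theta;\lambda)$ is $\frac{d}{d\theta}\boldsymbol v^\star(\theta;\lambda)$. (3) Transversality: $\dot\alpha_R(\lambda^\star)\ne0$ (dot on $\alpha_R$ denotes $d/d\lambda$). Notation. $\boldsymbol a^\star(\phi)=(\cos\phi,\sin\phi,0,\dots,0)^T$, $\dot{\boldsymbol a}^\star(\phi)=(-\sin\phi,\cos\phi,0,\dots,0)^T\in\mathbb R^n$;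 $\boldsymbol e_j$ is the $j$-th unit vector of $\mathbb R^n$; $\widehat{\boldsymbol e}_1=(1,0)^T$; $\|\cdot\|$ is the Euclidean norm. $\langle\boldsymbol w_1,\boldsymbol w_2\rangle=\frac1{2\pi}\int_0^{2\pi}\boldsymbol w_1(\theta)\cdot\boldsymbol w_2(\theta)\,d\theta$; $\langle\langle\boldsymbol w_1,\boldsymbol w_2\rangle\rangle=\frac1{(2\pi)^2}\int_0^{2\pi}\int_0^{2\pi}\boldsymbol w_1(\theta,\phi)\cdot\boldsymbol w_2(\theta,\phi)\,d\theta\,d\phi$. For $\boldsymbol z:\mathbb S^1\times\mathbb S^1\to\mathbb R^n$, $\boldsymbol\gamma_1(\boldsymbol z)=(\langle\langle\boldsymbol z,\boldsymbol a^\star(\phi)\rangle\rangle,\langle\langle\boldsymbol z,\dot{\boldsymbol a}^\star(\phi)\rangle\rangle)^T$ and $\gamma_2(\boldsymbol z)=\langle\langle\boldsymbol z,\boldsymbol e_n\rangle\rangle$ (the equations $\boldsymbol\gamma_1(\boldsymbol z)=\widehat{\boldsymbol e}_1$, $\gamma_2(\boldsymbol z)=0$ are the amplitude and phase conditions), and for $\lambda,\eta\in\mathbb R$ $$\boldsymbol G(\boldsymbol z,\lambda,\eta,\theta;\varepsilon)=\tfrac1\varepsilon\mathsf P(\theta;\lambda)^{-1}\Big\{T^\star(\lambda)\boldsymbol F\big(\boldsymbol v^\star(\theta;\lambda)+\varepsilon\mathsf P(\theta;\lambda)\boldsymbol z,\lambda\big)-T^\star(\lambda)\boldsymbol F\big(\boldsymbol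 v^\star(\theta;\lambda),\lambda\big)-\varepsilon[1+\varepsilon\eta]\dot{\mathsf P}(\theta;\lambda)\boldsymbol z\Big\}$$ (with $\boldsymbol G=\mathsf E(\lambda)\boldsymbol z$ at $\varepsilon=0$). $\mathsf S_{\infty,3}:L^2\to L^2$ truncates a double Fourier series to $\phi$-modes $0,\dots,3$, keeping all $\theta$-modes. Asymptotic solution. $\lambda^E(\varepsilon)=\lambda^\star+\varepsilon^2\lambda_2^E$, $\omega^E(\varepsilon)=\omega^\star+\varepsilon^2\omega_2^E$, $\eta^E(\varepsilon)=\varepsilon\eta_2^E$, $\boldsymbol z^E(\theta,\phi;\varepsilon)=\boldsymbol a^\star(\phi)+\varepsilon\boldsymbol z_2^E(\theta,\phi)+\varepsilon^2\boldsymbol z_3^E(\theta,\phi)$, with $\boldsymbol z_2^E$ having only $\phi$-modes $0,2$ and $\boldsymbol z_3^E$ only $\phi$-modes $1,3$, is the asymptotic solution of $$\boldsymbol G(\boldsymbol z,\lambda,\eta,\theta;\varepsilon)-\eta\boldsymbol e_n-[(1+\varepsilon\eta)\partial_\theta+\omega\partial_\phi]\boldsymbol z=\boldsymbol 0,\quad\boldsymbol\gamma_1(\boldsymbol z)=\widehat{\boldsymbol e}_1,\quad\gamma_2(\boldsymbol z)=0$$ up to and including $\varepsilon^2$ terms (remainder $O(\varepsilon^3)$), which exists when $\omega^\star\notin\{\frac13,\frac14\}$. It is written in $\phi$-modes as $\boldsymbol z^E=\boldsymbol a^\star(\phi)+\boldsymbol a_0^E(\theta;\varepsilon)+\sum_{m=1}^3\{\boldsymbol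 a_m^E(\theta;\varepsilon)\cos m\phi+\boldsymbol b_m^E(\theta;\varepsilon)\sin m\phi\}$, with $\boldsymbol a_0^E,\boldsymbol a_2^E,\boldsymbol b_2^E$ being $\varepsilon$-terms and $\boldsymbol a_1^E,\boldsymbol b_1^E,\boldsymbol a_3^E,\boldsymbol b_3^E$ being $\varepsilon^2$-terms. *)

(* Defs.v *)
From mathcomp Require Import all_boot all_order all_algebra.
From mathcomp Require Import all_classical all_reals all_analysis.
From mathcomp Require Import complex.

Set Implicit Arguments.
Unset Strict Implicit.
Unset Printing Implicit Defensive.

Import Order.TTheory GRing.Theory Num.Theory.
Import numFieldNormedType.Exports.

Local Open Scope classical_set_scope.
Local Open Scope ring_scope.

(* Class C^j on an open set U of a finite-dimensional V, by iterating
   directional derivatives in all (fixed) directions. *)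
Fixpoint Cdiff (R : realType) (V W : normedModType R) (j : nat) (U : set V)
    (f : V -> W) : Prop :=
  match j with
  | 0 => forall x, U x -> {for x, continuous f}
  | j'.+1 => (forall x, U x -> differentiable f x) /\
             (forall d : V, Cdiff j' U (fun x => 'D_d f x))
  end.

Definition smooth (R : realType) (V W : normedModType R) (U : set V)
    (f : V -> W) : Prop := forall j, Cdiff j U f.

Section Vectors.
Context {R : realType}.

Definition enorm n (u : 'cV[R]_n) : R := Num.sqrt (\sum_i u i 0 ^+ 2).

Definition dotv n (u w : 'cV[R]_n) : R := \sum_i u i 0 * w i 0.

(* R^n with n = 2 + k + 1, k >= 0, so that matrices split into blocks of
   sizes 2, n - 3 = k and 1. *)
Definition e1 k : 'cV[R]_(2 + k + 1) := delta_mx (lshift 1 (lshift k ord0)) 0.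
Definition e2 k : 'cV[R]_(2 + k + 1) :=
  delta_mx (lshift 1 (lshift k ord_max)) 0.
Definition en k : 'cV[R]_(2 + k + 1) := delta_mx (rshift (2 + k) ord0) 0.

Definition ehat1 : 'cV[R]_2 := delta_mx ord0 0.

Definition astar k (phi : R) : 'cV[R]_(2 + k + 1) :=
  cos phi *: e1 k + sin phi *: e2 k.
Definition dastar k (phi : R) : 'cV[R]_(2 + k + 1) :=
  - sin phi *: e1 k + cos phi *: e2 k.

Definition jacobian_mx n (f : 'cV[R]_n -> 'cV[R]_n) (x : 'cV[R]_n) : 'M[R]_n :=
  \matrix_(i, j) ('D_(delta_mx j 0) f x) i 0.

End Vectors.

Arguments e1 {R} k.
Arguments e2 {R} k.
Arguments en {R} k.
Arguments ehat1 {R}.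
Arguments astar {R} k phi.
Arguments dastar {R} k phi.

(* Functions on S^1 (resp. S^1 x S^1) are represented by functions on R (resp.
   functions theta |-> phi |-> z theta phi) that are 2 pi-periodic. *)
Section Torus.
Context {R : realType}.

Definition circle_int (f : R -> R) : R :=
  (\int[@lebesgue_measure R]_(t in `[0%R, 2 * pi]) f t)%R.

Definition inner1 n (w1 w2 : R -> 'cV[R]_n) : R :=
  (2 * pi)^-1 * circle_int (fun theta => dotv (w1 theta) (w2 theta)).

Definition inner2 n (w1 w2 : R -> R -> 'cV[R]_n) : R :=
  ((2 * pi) ^+ 2)^-1 * circle_int (fun phi => circle_int (fun theta =>
     dotv (w1 theta phi) (w2 theta phi))).

Definition torus_C1 n (z : R -> R -> 'cV[R]_n) : Prop :=
  [/\ forall phi, periodic (z ^~ phi) (2 * pi),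
      forall theta, periodic (z theta) (2 * pi)
    & Cdiff 1 setT (fun p : R * R => z p.1 p.2)].

Definition fourier_weight (m : nat) : R :=
  if m is 0 then (2 * pi)^-1 else pi^-1.

(* Coefficients of cos (m phi) and sin (m phi) in the Fourier series of z in
   phi, as functions of theta. *)
Definition acoef n (m : nat) (z : R -> R -> 'cV[R]_n) (theta : R) : 'cV[R]_n :=
  \col_i (fourier_weight m *
    circle_int (fun phi => z theta phi i 0 * cos (m%:R * phi))).
Definition bcoef n (m : nat) (z : R -> R -> 'cV[R]_n) (theta : R) : 'cV[R]_n :=
  \col_i (fourier_weight m *
    circle_int (fun phi => z theta phi i 0 * sin (m%:R * phi))).

Definition phi_mode n (m : nat) (z : R -> R -> 'cV[R]_n) (theta phi : R) :
    'cV[R]_n :=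
  cos (m%:R * phi) *: acoef m z theta + sin (m%:R * phi) *: bcoef m z theta.

(* Keeping every theta-mode leaves the dependence on theta untouched, so the
   truncation is a partial sum of the Fourier series in phi. *)
Definition S_inf n (M : nat) (z : R -> R -> 'cV[R]_n) (theta phi : R) :
    'cV[R]_n :=
  \sum_(m < M.+1) phi_mode m z theta phi.

Definition has_only_phi_modes n (s : seq nat) (z : R -> R -> 'cV[R]_n) : Prop :=
  forall theta phi, z theta phi = \sum_(m <- s) phi_mode m z theta phi.

Definition gamma1 k (z : R -> R -> 'cV[R]_(2 + k + 1)) : 'cV[R]_2 :=
  \col_i (if i == ord0 then inner2 z (fun _ => astar k)
          else inner2 z (fun _ => dastar k)).

Definition gamma2 k (z : R -> R -> 'cV[R]_(2 + k + 1)) : R :=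
  inner2 z (fun _ _ => en k).

End Torus.

(* The vector field F, the critical parameter value, and the continuations of
   the periodic orbit and of its Floquet normal form, which are meaningful for
   |lambda - lambda_star| < lambda_radius.  Their values at lambda_star are the data
   T^*, v^*, P^*, E^* of the bifurcation point. *)
Record ns_data (R : realType) (k : nat) := NSData {
  vfield : 'cV[R]_(2 + k + 1) -> R -> 'cV[R]_(2 + k + 1);
  lambda_star : R;
  lambda_radius : R;
  period : R -> R;                          (* T^*(lambda) *)
  orbit : R -> R -> 'cV[R]_(2 + k + 1);     (* v^*(theta; lambda) *)
  floquet : R -> R -> 'M[R]_(2 + k + 1);    (* P(theta; lambda) *)
  alphaR : R -> R;
  alphaI : R -> R;
  Etilde : R -> 'M[R]_k
}.

Section Setting.
Context {R : realType} {k : nat}.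
Local Notation n := (2 + k + 1)%N.
Variable D : ns_data R k.

Definition omega_star : R := alphaI D (lambda_star D).

Definition Ehat (lam : R) : 'M[R]_2 :=
  \matrix_(i, j) (if i == j then alphaR D lam
                  else if (i < j)%N then - alphaI D lam else alphaI D lam).

Definition Emat (lam : R) : 'M[R]_n :=
  block_mx (block_mx (Ehat lam) 0 0 (Etilde D lam)) 0 0 0.

Definition jac (x : 'cV[R]_n) (lam : R) : 'M[R]_n :=
  jacobian_mx (vfield D ^~ lam) x.

Definition near_lambda (lam : R) : Prop :=
  `|lam - lambda_star D| < lambda_radius D.

Definition floquet_dot (theta lam : R) : 'M[R]_n :=
  derive1 (fun t => floquet D t lam) theta.

Record neimark_sacker : Prop := NeimarkSacker {
  ns_radius_gt0 : 0 < lambda_radius D;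
  ns_smooth_vfield :
    smooth setT (fun p : 'cV[R]_n * R => vfield D p.1 p.2);
  ns_smooth_period : smooth [set lam | near_lambda lam] (period D);
  ns_smooth_orbit :
    smooth [set p : R * R | near_lambda p.2] (fun p => orbit D p.1 p.2);
  ns_smooth_floquet :
    smooth [set p : R * R | near_lambda p.2] (fun p => floquet D p.1 p.2);
  ns_smooth_alphaR : smooth [set lam | near_lambda lam] (alphaR D);
  ns_smooth_alphaI : smooth [set lam | near_lambda lam] (alphaI D);
  ns_smooth_Etilde : smooth [set lam | near_lambda lam] (Etilde D);
  ns_period_gt0 : 0 < period D (lambda_star D);
  ns_orbit_periodic :
    forall lam, near_lambda lam -> periodic (orbit D ^~ lam) (2 * pi);
  ns_orbit_eq : forall lam theta, near_lambda lam ->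
    period D lam *: vfield D (orbit D theta lam) lam =
    derive1 (fun t => orbit D t lam) theta;
  ns_floquet_periodic :
    forall lam, near_lambda lam -> periodic (floquet D ^~ lam) (2 * pi);
  ns_floquet_unit : forall lam theta, near_lambda lam ->
    floquet D theta lam \in unitmx;
  ns_floquet_eq : forall lam theta, near_lambda lam ->
    period D lam *: (jac (orbit D theta lam) lam *m floquet D theta lam)
      - floquet_dot theta lam = floquet D theta lam *m Emat lam;
  ns_floquet_last_col : forall lam theta, near_lambda lam ->
    col (rshift (2 + k) ord0) (floquet D theta lam) =
    derive1 (fun t => orbit D t lam) theta;
  ns_alphaR_star : alphaR D (lambda_star D) = 0;
  ns_omega_gt0 : 0 < omega_star;
  ns_Etilde_hyperbolic : forall a : R[i],
    eigenvalue (map_mx (real_complex R) (Etilde D (lambda_star D))) a ->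
    complex.Re a != 0;
  ns_floquet_exponents : forall a : R[i],
    eigenvalue (map_mx (real_complex R) (Emat (lambda_star D))) a ->
    - 2^-1 < complex.Im a < 2^-1;
  ns_transversal : derive1 (alphaR D) (lambda_star D) != 0
}.

(* The division by eps is a removable singularity, with value E(lambda) z at
   eps = 0. *)
Definition Gmap (z : 'cV[R]_n) (lam eta theta eps : R) : 'cV[R]_n :=
  if eps == 0 then Emat lam *m z
  else eps^-1 *: (invmx (floquet D theta lam) *m
    (period D lam *:
       vfield D (orbit D theta lam + eps *: (floquet D theta lam *m z)) lam
     - period D lam *: vfield D (orbit D theta lam) lam
     - (eps * (1 + eps * eta)) *: (floquet_dot theta lam *m z))).

Definition Gfun (z : R -> R -> 'cV[R]_n) (lam eta eps theta phi : R) :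
    'cV[R]_n :=
  Gmap (z theta phi) lam eta theta eps.

Definition flow_terms (z : R -> R -> 'cV[R]_n) (omega eta eps theta phi : R) :
    'cV[R]_n :=
  eta *: en k + (1 + eps * eta) *: derive1 (z ^~ phi) theta
              + omega *: derive1 (z theta) phi.

Definition full_residual z (lam omega eta eps theta phi : R) : 'cV[R]_n :=
  Gfun z lam eta eps theta phi - flow_terms z omega eta eps theta phi.

Definition truncated_residual z (lam omega eta eps theta phi : R) : 'cV[R]_n :=
  S_inf 3 (Gfun z lam eta eps) theta phi
  - flow_terms z omega eta eps theta phi.

Definition fourier_solution (eps lam omega eta : R) (z : R -> R -> 'cV[R]_n) :
    Prop :=
  [/\ torus_C1 z, has_only_phi_modes [:: 0; 1; 2; 3]%N z,
      forall theta phi, truncated_residual z lam omega eta eps theta phi = 0,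
      gamma1 z - ehat1 = 0 & gamma2 z = 0].

Definition close_to_star (delta lam omega eta : R) (z : R -> R -> 'cV[R]_n) :
    Prop :=
  [/\ `|lam - lambda_star D| < delta, `|omega - omega_star| < delta,
      `|eta| < delta & forall theta phi, enorm (z theta phi - astar k phi) < delta].

Definition lambdaE (lam2 eps : R) : R := lambda_star D + eps ^+ 2 * lam2.
Definition omegaE (omega2 eps : R) : R := omega_star + eps ^+ 2 * omega2.
Definition etaE (eta2 eps : R) : R := eps * eta2.
Definition zE (z2 z3 : R -> R -> 'cV[R]_n) (eps theta phi : R) : 'cV[R]_n :=
  astar k phi + eps *: z2 theta phi + eps ^+ 2 *: z3 theta phi.

Definition asymptotic_solution (lam2 omega2 eta2 : R)
    (z2 z3 : R -> R -> 'cV[R]_n) : Prop :=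
  [/\ torus_C1 z2 /\ torus_C1 z3,
      has_only_phi_modes [:: 0; 2]%N z2, has_only_phi_modes [:: 1; 3]%N z3
    & exists C : R, \forall eps \near (0 : R),
        [/\ forall theta phi,
              enorm (full_residual (zE z2 z3 eps) (lambdaE lam2 eps)
                (omegaE omega2 eps) (etaE eta2 eps) eps theta phi)
              <= C * `|eps| ^+ 3,
            enorm (gamma1 (zE z2 z3 eps) - ehat1) <= C * `|eps| ^+ 3
          & `|gamma2 (zE z2 z3 eps)| <= C * `|eps| ^+ 3]].

(* The functions a_m, b_m in the phi-expansions of z^E and z^F are the Fourier
   coefficients of the deviation from astar. *)
Definition dev (z : R -> R -> 'cV[R]_n) (theta phi : R) : 'cV[R]_n :=
  z theta phi - astar k phi.

End Setting.

(* f(t; eps) = g(t; eps) + O(eps^j) as eps -> 0, uniformly in t. *)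
Definition unif_bigO (R : realType) n (j : nat) (f g : R -> R -> 'cV[R]_n) :
    Prop :=
  exists C : R, \forall eps \near (0 : R),
    forall t, enorm (f eps t - g eps t) <= C * `|eps| ^+ j.

(* Main.v *)
(* Divided by 1 + eps eta, the truncated system becomes
     d zeta/dtheta + omega^* d zeta/dphi - E^* zeta
       = S g + lambda' alpha_R' a^* + lambda' alpha_I' da^* - omega' da^* - eta e_n
   for zeta = z - a^*, lambda' = lambda - lambda^*, omega' = omega - omega^*, where g
   is small.  Its phi-modes decouple into periodic linear equations
   c' = E^* c - i m omega^* c + f.  As omega^* is neither 1/3 nor 1/4 and is less
   than 1/2, the only resonances for m <= 3 are the critical plane for m = 1 and the
   last coordinate for m = 0; there the average of f is absorbed by lambda', omega'
   (transversality) and eta, and the average of c is fixed by the amplitude and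
   phase conditions.  The bounded solution operator thus obtained also controls
   dz/dphi, which makes the equation a contraction in
   (z, dz/dphi, lambda, omega, eta) for the sup norm.

   The asymptotic solution solves the system up to O(eps^3), hence is O(eps^3)-close.
   The nonlinear remainders then differ by O(eps^4) only, and the system is invariant
   under z(theta, phi) -> - z(theta, phi + pi), eps -> - eps, eta -> - eta, so that the
   eps^3-term of the residual has even phi-modes only; therefore lambda, omega and the
   odd modes gain one order. *)
From HB Require Import structures.
Require Import Defs.
From mathcomp Require Import all_boot all_order all_algebra.
From mathcomp Require Import all_classical all_reals all_analysis.
From mathcomp Require Import complex ring lra zify.
Import Order.TTheory GRing.Theory Num.Theory.
Import numFieldNormedType.Exports.
Local Open Scope classical_set_scope.
Local Open Scope ring_scope.

Set Implicit Arguments.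
Unset Strict Implicit.
Unset Printing Implicit Defensive.

(** * Functions of class C^j *)

(** Division by [1 + eps * eta] removes [dtheta z] from the nonlinear remainder. The only derivative
    left there is [dphi z], which for phi-modes at most 3 is controlled in the sup norm; so no
    derivative is lost, and theta is merely the time of finitely many ODEs, without small divisors.
    The unknown of the fixed point is a continuous map to tuples (z, y, lambda, omega, eta) in which
    y is not tied to [dphi z]; that relation is recovered at the fixed point, since the solution
    operator returns genuine pairs. The remainder is estimated on a ball of radius [kap] about the
    base solution, with size and Lipschitz constant both O([kap]) for all [|eps| <= kap]. A fixed
    [kap] gives existence and uniqueness; [kap] proportional to [|eps|] gives the extra order in the
    comparison. For the parity step the residual has to be expanded in eps, but [z2] and [z3] are
    merely C^1 on the torus; their values are therefore frozen as parameters. Multiplying the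
    residual by eps P clears the pole of [Gmap], at the price of one more Taylor order. *)

Section CkClass.
Context {R : realType}.
Implicit Types V W X : normedModType R.

(* A variant of [Cdiff] whose derivatives need only agree with a witness on the
   open set, so that the closure properties need no extensionality there. *)
Fixpoint Ck V W (j : nat) (U : set V) (f : V -> W) : Prop :=
  match j with
  | 0 => forall x, U x -> {for x, continuous f}
  | j'.+1 => (forall x, U x -> differentiable f x) /\
      forall d : V, exists2 g, (forall x, U x -> 'D_d f x = g x) & Ck j' U g
  end.

Lemma Cdiff_Ck V W j (U : set V) (f : V -> W) : Cdiff j U f -> Ck j U f.
Proof.
elim: j f => [//|j IH] f /= [df cf]; split => // d.
by exists (fun x => 'D_d f x) => //; exact/IH/cf.
Qed.

Lemma Ck_Cdiff V W j (f : V -> W) : Ck j setT f -> Cdiff j setT f.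
Proof.
elim: j f => [//|j IH] f /= [df cf]; split => // d.
have [g fg cg] := cf d.
by rewrite (_ : (fun x => _) = g); [exact: IH | apply/funext => x; exact: fg].
Qed.

Lemma CkS V W j (U : set V) (f : V -> W) : Ck j.+1 U f -> Ck j U f.
Proof.
elim: j f => [|j IH] f /= [df cf].
  by move=> x Ux; exact/differentiable_continuous/df.
by split => // d; have [g fg cg] := cf d; exists g => //; exact: IH.
Qed.

Lemma Ck_le V W i j (U : set V) (f : V -> W) : (i <= j)%N -> Ck j U f -> Ck i U f.
Proof.
by move=> /subnK <-; elim: (j - i)%N => [//|m IH] /= cf; apply/IH/CkS.
Qed.

Lemma Ck_continuous V W j (U : set V) (f : V -> W) x :
  Ck j U f -> U x -> {for x, continuous f}.
Proof. by move=> /(Ck_le (leq0n j)) /= h /h. Qed.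

Lemma Ck_cst V W j (U : set V) (c : W) : Ck j U (fun=> c).
Proof.
elim: j c => [|j IH] c /=; first by move=> x _; exact: cvg_cst.
split=> [x _|d]; first exact: differentiable_cst.
by exists (fun=> 0) => // x _; rewrite derive_cst.
Qed.

Lemma Ck_add V W j (U : set V) (f g : V -> W) :
  Ck j U f -> Ck j U g -> Ck j U (fun x => f x + g x).
Proof.
elim: j f g => [|j IH] f g /=.
  by move=> cf cg x Ux; apply: cvgD; [exact: cf|exact: cg].
move=> [df cf] [dg cg]; split=> [x Ux|d].
  by apply: differentiableD; [exact: df|exact: dg].
have [f' ff' cf'] := cf d; have [g' gg' cg'] := cg d.
exists (fun x => f' x + g' x); last exact: IH.
move=> x Ux; rewrite -ff' // -gg' // deriveD //; apply: diff_derivable.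
  exact: df.
exact: dg.
Qed.

Lemma Ck_sum V W j (U : set V) (I : Type) (s : seq I) (f : I -> V -> W) :
  (forall i, Ck j U (f i)) -> Ck j U (fun x => \sum_(i <- s) f i x).
Proof.
move=> h; elim: s => [|i s IH].
  rewrite (_ : (fun x => _) = fun=> 0); first exact: Ck_cst.
  by apply/funext => x; rewrite big_nil.
rewrite (_ : (fun x => _) = fun x => f i x + \sum_(i <- s) f i x).
  exact: Ck_add.
by apply/funext => x; rewrite big_cons.
Qed.

Lemma is_diff_linear V W (L : V -> W) : linear L -> continuous L ->
  forall x, is_diff x L L.
Proof.
move=> linL cL x.
pose LM := GRing.isLinear.Build _ _ _ _ _ linL.
pose L' : {linear V -> W} := HB.pack L LM.
have -> : L = L' by [].
apply: DiffDef; first exact: linear_differentiable.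
by rewrite diff_lin.
Qed.

Lemma Ck_lin V W X j (U : set V) (L : W -> X) (f : V -> W) :
  linear L -> continuous L -> Ck j U f -> Ck j U (fun x => L (f x)).
Proof.
move=> linL cL; have dL := is_diff_linear linL cL.
have eL : forall y, 'd L y = L :> (W -> X) by move=> y; exact: diff_val.
elim: j f => [|j IH] f /=.
  by move=> cf x Ux; apply: continuous_comp; [exact: cf|exact: cL].
move=> [df cf]; split=> [x Ux|d].
  by apply: (differentiable_comp (df _ Ux)).
have [f' ff' cf'] := cf d; exists (fun x => L (f' x)); last exact: IH.
move=> x Ux; rewrite (_ : (fun x => L (f x)) = L \o f) // deriveE; last first.
  by apply: (differentiable_comp (df _ Ux)).
rewrite diff_comp //=; last exact: df.
by rewrite eL -deriveE ?ff' //; exact: df.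
Qed.

Lemma Ck_id V j (U : set V) : Ck j U id.
Proof.
case: j => [|j] /=; first by move=> x _; exact: cvg_id.
split => [x _|d]; first by have := is_diff_id x => h; exact: ex_diff.
by exists (fun=> d); [move=> x _; rewrite derive_id | exact: Ck_cst].
Qed.

Lemma Ck_mulR V j (U : set V) (f g : V -> R) :
  Ck j U f -> Ck j U g -> Ck j U (fun x => f x * g x).
Proof.
elim: j f g => [|j IH] f g cf cg.
  by move=> x Ux; apply: cvgM; [exact: cf|exact: cg].
move: (cf) (cg) => [df ddf] [dg ddg]; split=> [x Ux|d].
  by apply: differentiableM; [exact: df|exact: dg].
have [f' ff' cf'] := ddf d; have [g' gg' cg'] := ddg d.
exists (fun x => f x * g' x + g x * f' x).
  move=> x Ux; rewrite -ff' // -gg' // deriveM //; apply: diff_derivable.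
    exact: df.
  exact: dg.
by apply: Ck_add; apply: IH => //; exact: CkS.
Qed.

Lemma scaler_linear W (w : W) : linear (fun a : R => a *: w).
Proof. by move=> a x y; rewrite scalerDl scalerA. Qed.

Lemma Ck_scalel V W j (U : set V) (f : V -> R) (w : W) :
  Ck j U f -> Ck j U (fun x => f x *: w).
Proof.
apply: (@Ck_lin V R W _ _ (fun a : R => a *: w)); first exact: scaler_linear.
exact: scalel_continuous.
Qed.

Lemma Ck_scaler V W j (U : set V) (a : R) (f : V -> W) :
  Ck j U f -> Ck j U (fun x => a *: f x).
Proof.
apply: (@Ck_lin V W W); last exact: scaler_continuous.
by move=> b x y; rewrite scalerDr !scalerA mulrC.
Qed.

Lemma Ck_opp V W j (U : set V) (f : V -> W) :
  Ck j U f -> Ck j U (fun x => - f x).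
Proof.
move=> /(@Ck_scaler _ _ _ _ (-1)); rewrite (_ : (fun x => -1 *: f x) = fun x => - f x) //.
by apply/funext => x; rewrite scaleN1r.
Qed.

Lemma Ck_sub_fun V W j (U : set V) (f g : V -> W) :
  Ck j U f -> Ck j U g -> Ck j U (fun x => f x - g x).
Proof. by move=> cf cg; apply: Ck_add => //; exact: Ck_opp. Qed.

Lemma Ck_fst V W X j (U : set V) (f : V -> W * X) :
  Ck j U f -> Ck j U (fun x => (f x).1).
Proof. by apply: (@Ck_lin _ _ _ _ _ fst) => // x; exact: cvg_fst. Qed.

Lemma Ck_snd V W X j (U : set V) (f : V -> W * X) :
  Ck j U f -> Ck j U (fun x => (f x).2).
Proof. by apply: (@Ck_lin _ _ _ _ _ snd) => // x; exact: cvg_snd. Qed.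

Lemma Ck_pair V W X j (U : set V) (f : V -> W) (g : V -> X) :
  Ck j U f -> Ck j U g -> Ck j U (fun x => (f x, g x)).
Proof.
elim: j f g => [|j IH] f g /=.
  by move=> cf cg x Ux; apply: cvg_pair; [exact: cf|exact: cg].
move=> [df cf] [dg cg].
have dfg x : U x -> differentiable (fun x => (f x, g x)) x.
  by move=> Ux; apply: differentiable_pair; [exact: df|exact: dg].
split=> // d.
have [f' ff' cf'] := cf d; have [g' gg' cg'] := cg d.
exists (fun x => (f' x, g' x)); last exact: IH.
move=> x Ux; rewrite deriveE; last exact: dfg.
rewrite diff_pair /=; [|exact: df|exact: dg].
by rewrite -!deriveE ?ff' ?gg' //; [exact: dg|exact: df].
Qed.

Lemma mxcoord_linear m n (i : 'I_m) (j : 'I_n) :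
  linear (fun M : 'M[R]_(m, n) => M i j).
Proof. by move=> a x y; rewrite !mxE. Qed.

Lemma Ck_coord V m n j (U : set V) (f : V -> 'M[R]_(m, n)) p q :
  Ck j U f -> Ck j U (fun x => f x p q).
Proof.
apply: (@Ck_lin _ _ R _ _ (fun M : 'M[R]_(m, n) => M p q)).
  exact: mxcoord_linear.
exact: coord_continuous.
Qed.

Lemma Ck_mx V m n j (U : set V) (f : V -> 'M[R]_(m, n)) :
  (forall p q, Ck j U (fun x => f x p q)) -> Ck j U f.
Proof.
move=> h; rewrite (_ : f = fun x => \sum_p \sum_q f x p q *: delta_mx p q).
  by apply: Ck_sum => p; apply: Ck_sum => q; exact: Ck_scalel.
by apply/funext => x; exact: matrix_sum_delta.
Qed.

Lemma Ck_mulmx V m n p j (U : set V) (f : V -> 'M[R]_(m, n)) (g : V -> 'M[R]_(n, p)) :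
  Ck j U f -> Ck j U g -> Ck j U (fun x => f x *m g x).
Proof.
move=> cf cg; apply: Ck_mx => a b.
rewrite (_ : (fun x => _) = fun x => \sum_c f x a c * g x c b).
  by apply: Ck_sum => c; apply: Ck_mulR; exact: Ck_coord.
by apply/funext => x; rewrite mxE.
Qed.

(** Finite dimension as explicit data: a spanning family with linear coordinates bounded by the
    norm, hence continuous. It covers [R], matrices and their products alike. *)
Definition fin_basis X : Prop :=
  exists (I : finType) (e : I -> X) (l : I -> X -> R),
    [/\ forall i, linear (l i), forall i x, `|l i x| <= `|x|
      & forall x, x = \sum_i l i x *: e i].

Lemma linear_le_continuous V (l : V -> R) : linear l ->
  (forall x, `|l x| <= `|x|) -> continuous l.
Proof.
move=> linl bl x; apply/cvgrPdist_le => /= e e0.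
near=> y.
have -> : l x - l y = l (x - y).
  rewrite (_ : x - y = -1 *: y + x) ?linl; last by rewrite scaleN1r addrC.
  by rewrite addrC -[-1 *: l y]/(-1 * l y) mulN1r.
apply: (le_trans (bl _)); near: y.
by move: e e0; apply/cvgrPdist_le; exact: cvg_id.
Unshelve. all: by end_near. Qed.

Lemma fin_basisR : fin_basis R.
Proof.
exists unit, (fun=> 1), (fun=> id); split=> // x.
by rewrite big_const card_unit /= addr0 [RHS]mulr1.
Qed.

Lemma fin_basis_mx m n : fin_basis 'M[R]_(m, n).
Proof.
exists ('I_m * 'I_n)%type, (fun p => delta_mx p.1 p.2),
  (fun p (M : 'M[R]_(m, n)) => M p.1 p.2); split.
- by move=> i; exact: mxcoord_linear.
- by move=> i x; rewrite [leRHS]/Num.norm /= mx_normrE; exact: le_bigmax.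
- by move=> x; rewrite [LHS]matrix_sum_delta pair_bigA.
Qed.

Lemma fin_basis_prod V W : fin_basis V -> fin_basis W -> fin_basis (V * W)%type.
Proof.
move=> [I [e [l [linl bl el]]]] [J [f [m [linm bm em]]]].
exists (I + J)%type, (fun k => match k with inl i => (e i, 0) | inr j => (0, f j) end),
  (fun k x => match k with inl i => l i x.1 | inr j => m j x.2 end); split.
- by move=> [i|j] a x y; [exact: linl|exact: linm].
- move=> [i|j] x; rewrite prod_normE.
    by rewrite (le_trans (bl i _)) // le_max lexx.
  by rewrite (le_trans (bm j _)) // le_max lexx orbT.
- have fstE (K : finType) (F : K -> V * W) : (\sum_k F k).1 = \sum_k (F k).1.
    exact: (big_morph fst (fun _ _ => erefl) erefl).
  have sndE (K : finType) (F : K -> V * W) : (\sum_k F k).2 = \sum_k (F k).2.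
    exact: (big_morph snd (fun _ _ => erefl) erefl).
  move=> [x y]; rewrite [RHS]surjective_pairing fstE sndE !big_sumType /=.
  congr pair.
    by rewrite {1}(el x) [X in _ + X]big1 ?addr0 // => i _; exact: scaler0.
  by rewrite {1}(em y) [X in X + _]big1 ?add0r // => i _; exact: scaler0.
Qed.

Lemma Ck_scale V W j (U : set V) (f : V -> R) (g : V -> W) : fin_basis W ->
  Ck j U f -> Ck j U g -> Ck j U (fun x => f x *: g x).
Proof.
move=> [I [e [l [linl bl el]]]] cf cg.
rewrite (_ : (fun x => _) = fun x => \sum_i (f x * l i (g x)) *: e i).
  apply: Ck_sum => i; apply: Ck_scalel; apply: Ck_mulR => //.
  by apply: Ck_lin => //; apply: linear_le_continuous.
apply/funext => x; rewrite {1}(el (g x)) scaler_sumr.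
by apply: eq_bigr => i _; rewrite scalerA.
Qed.

(** The chain rule produces the derivative of [f] in the moving direction [g' x], while [Ck] only
    knows fixed directions; expanding [g' x] in the basis turns it into coordinates times
    derivatives along the [e i]. *)
Lemma Ck_comp V X W j (U : set V) (Y : set X) (g : V -> X) (f : X -> W) :
  fin_basis X -> fin_basis W -> (forall x, U x -> Y (g x)) ->
  Ck j U g -> Ck j Y f -> Ck j U (fun x => f (g x)).
Proof.
move=> [I [e [l [linl bl el]]]] fW UY; elim: j f => [|j IH] f cg cf.
  move=> x Ux; apply: continuous_comp; first exact: cg.
  by apply: cf; exact: UY.
have [dg ddg] := cg; have [df ddf] := cf.
have dfg x : U x -> differentiable (fun x => f (g x)) x.
  by move=> Ux; apply: differentiable_comp; [exact: dg|apply: df; exact: UY].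
split=> // d.
have [g' gg' cg'] := ddg d.
have /choice[f' hf'] i : exists f', (forall y, Y y -> 'D_(e i) f y = f' y) /\ Ck j Y f'.
  by have [f' h1 h2] := ddf (e i); exists f'.
exists (fun x => \sum_i l i (g' x) *: f' i (g x)).
  move=> x Ux; rewrite deriveE; last exact: dfg.
  rewrite (_ : (fun x => f (g x)) = f \o g) // diff_comp /=; last 2 first.
  - exact: dg.
  - by apply: df; exact: UY.
  rewrite (_ : 'd g x d = g' x); last by rewrite -deriveE ?gg' //; exact: dg.
  rewrite {1}(el (g' x)) linear_sum; apply: eq_bigr => i _.
  rewrite linearZ -deriveE; last by apply: df; exact: UY.
  by rewrite (hf' i).1 //; exact: UY.
apply: Ck_sum => i; apply: Ck_scale => //.
  by apply: Ck_lin => //; apply: linear_le_continuous.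
by apply: IH; [exact: CkS|exact: (hf' i).2].
Qed.
End CkClass.

(** * Mean value, Taylor and Lipschitz estimates, and compact balls of matrices *)

Section Calculus.
Context {R : realType}.
Implicit Types V W X : normedModType R.

Lemma is_derive_continuous (f : R -> R) (x d : R) :
  is_derive x (1 : R) f d -> {for x, continuous f}.
Proof.
move=> h; apply: differentiable_continuous; apply/derivable1_diffP.
exact: ex_derive.
Qed.

Lemma mvt_le (f f' : R -> R) (a b B : R) : a <= b ->
  (forall x, x \in `[a, b] -> is_derive x (1 : R) f (f' x)) ->
  (forall x, x \in `[a, b] -> `|f' x| <= B) -> `|f b - f a| <= B * (b - a).
Proof.
move=> ab df bf.
have df' x : x \in `]a, b[ -> is_derive x (1 : R) f (f' x).
  by move=> xab; apply: df; exact: subset_itv_oo_cc.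
have cf : {within `[a, b], continuous f}.
  by apply: derivable_within_continuous => x xab; have h := df x xab; exact: ex_derive.
have [c cab ->] := MVT_segment ab df' cf.
by rewrite normrM (ger0_norm (x := b - a)) ?subr_ge0 // ler_wpM2r ?subr_ge0 // bf.
Qed.

(** Mean value inequality on the segment between 0 and [x], where [|f'|] is at most [M * |x| ^+ j];
    the sign of [x] only decides which end comes first. *)
Lemma antiderivative_growth (f f' : R -> R) (r M : R) j : 0 <= M -> f 0 = 0 ->
  (forall x : R, `|x| < r -> is_derive x (1 : R) f (f' x)) ->
  (forall x : R, `|x| < r -> `|f' x| <= M * `|x| ^+ j) ->
  forall x : R, `|x| < r -> `|f x| <= M * `|x| ^+ j.+1.
Proof.
move=> M0 f0 df bf x xr; rewrite exprSr mulrA.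
have hr (y : R) : `|y| <= `|x| -> `|y| < r by move=> /le_lt_trans; exact.
have hM (y : R) : `|y| <= `|x| -> `|f' y| <= M * `|x| ^+ j.
  by move=> yx; rewrite (le_trans (bf _ (hr _ yx))) // ler_wpM2l // lerXn2r ?nnegrE.
have [x0|x0] := leP 0 x.
  have xy (y : R) : y \in `[0, x] -> `|y| <= `|x|.
    by rewrite in_itv /= => /andP[y0 yx]; rewrite !ger0_norm.
  have := @mvt_le f f' 0 x (M * `|x| ^+ j) x0 (fun y h => df y (hr y (xy y h)))
    (fun y h => hM y (xy y h)).
  by rewrite f0 !subr0 (ger0_norm x0).
have xy (y : R) : y \in `[x, 0] -> `|y| <= `|x|.
  by rewrite in_itv /= => /andP[y0 yx]; rewrite !ler0_norm ?lerN2 // ltW.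
have := @mvt_le f f' x 0 (M * `|x| ^+ j) (ltW x0) (fun y h => df y (hr y (xy y h)))
    (fun y h => hM y (xy y h)).
by rewrite f0 !sub0r normrN (ltr0_norm x0).
Qed.

Lemma is_derive_taylor_poly n (c : nat -> R) (x : R) :
  is_derive x (1 : R) (fun x => \sum_(j < n.+1) c j / j`!%:R * x ^+ j)
    (\sum_(j < n) c j.+1 / j`!%:R * x ^+ j).
Proof.
elim: n => [|n IH].
  rewrite big_ord0 (_ : (fun x => _) = cst (c 0%N)); first exact: is_derive_cst.
  by apply/funext => y; rewrite big_ord1 expr0 mulr1 fact0 divr1.
rewrite (_ : (fun x => _) = (fun x => \sum_(j < n.+1) c j / j`!%:R * x ^+ j)
   + (c n.+1 / n.+1`!%:R) *: (@id R ^+ n.+1)); last first.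
  by apply/funext => y; rewrite big_ord_recr /= !fctE.
have h0 := is_deriveX n.+1 (is_derive_id x (1 : R)).
have h1 := is_deriveD IH (is_deriveZ (c n.+1 / n.+1`!%:R) h0).
rewrite big_ord_recr /= (_ : c n.+1 / n`!%:R * x ^+ n =
  c n.+1 / n.+1`!%:R *: ((n.+1%:R * id x ^+ n.+1.-1) *: (1 : R))) //.
rewrite /GRing.scale /= mulr1 factS natrM invfM.
have h : n.+1%:R != 0 :> R by rewrite pnatr_eq0.
have h' : n`!%:R != 0 :> R by rewrite pnatr_eq0 -lt0n fact_gt0.
by field; rewrite h' addrC natr1 h.
Qed.

(** Induction on [n]: the difference of [fs 0] and its polynomial vanishes at 0, and its derivative
    is the same difference for the shifted family, so [antiderivative_growth] raises the order by
    one. The factor 1/n! is given away. *)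
Lemma taylor_bound n (fs : nat -> R -> R) (r M : R) : 0 <= M -> 
  (forall j (x : R), (j < n)%N -> `|x| < r -> is_derive x (1 : R) (fs j) (fs j.+1 x)) ->
  (forall x : R, `|x| < r -> `|fs n x| <= M) ->
  forall x : R, `|x| < r ->
    `|fs 0%N x - \sum_(j < n) fs j 0 / j`!%:R * x ^+ j| <= M * `|x| ^+ n.
Proof.
move=> M0; elim: n fs => [|n IH] fs dfs bfs x xr.
  by rewrite big_ord0 subr0 expr0 mulr1; exact: bfs.
have {}IH := IH (fun j => fs j.+1) (fun j x h => dfs j.+1 x h) bfs.
apply: (@antiderivative_growth (fun x => fs 0%N x - \sum_(j < n.+1) fs j 0 / j`!%:R * x ^+ j) _ r _ n M0 _ _ IH) => //.
  rewrite big_ord_recl /= expr0 fact0 divr1 mulr1 big1 ?addr0 ?subrr // => i _.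
  by rewrite expr0n mulr0.
move=> y yr; have h1 := dfs 0%N y isT yr.
by have h2 := is_derive_taylor_poly n (fs ^~ 0) y; apply: is_deriveB.
Qed.

Lemma is_derive_line V W (f : V -> W) (x d : V) (t : R) :
  differentiable f (x + t *: d) ->
  is_derive t (1 : R) (fun s : R => f (x + s *: d)) ('D_d f (x + t *: d)).
Proof.
move=> df.
have dl : is_diff t (fun s : R => x + s *: d) (fun s : R => s *: d).
  have := is_diffD (is_diff_cst x t) (is_diff_scalel t d).
  by rewrite add0r.
have dl' : differentiable (fun s : R => x + s *: d) t by exact: ex_diff.
have dc := differentiable_comp dl' df.
apply: DeriveDef; first exact: diff_derivable.
rewrite deriveE // diff_comp //= deriveE //.
by rewrite diff_val scale1r.
Qed.

(** Keeps the iterated derivatives along one fixed direction as a sequence of functions, the form in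
    which [taylor_bound] consumes them. *)
Lemma Ck_chain V W n (U : set V) (f : V -> W) (d : V) : Ck n U f ->
  exists gs : nat -> V -> W, [/\ gs 0%N = f,
    forall j, (j <= n)%N -> Ck (n - j) U (gs j) &
    forall j x, (j < n)%N -> U x -> 'D_d (gs j) x = gs j.+1 x].
Proof.
elim: n f => [|n IH] f cf.
  by exists (fun=> f); split => // -[].
have [_ ddf] := cf; have [g fg cg] := ddf d.
have [gs [g0 gc gd]] := IH _ cg.
exists (fun j => if j is j'.+1 then gs j' else f); split=> //.
  by move=> [|j] //= jn; rewrite subSS; exact: gc.
by move=> [|j] x jn Ux /=; [rewrite g0; exact: fg|exact: gd].
Qed.

Lemma Ck_differentiable V W j (U : set V) (f : V -> W) x : (0 < j)%N ->
  Ck j U f -> U x -> differentiable f x.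
Proof. by case: j => // j _ [df _]; exact: df. Qed.

Lemma compact_bound (T : topologicalType) W (f : T -> W) (K : set T) : compact K ->
  (forall x, K x -> {for x, continuous f}) ->
  exists2 M, 0 <= M & forall x, K x -> `|f x| <= M.
Proof.
move=> cK cf.
have /compact_bounded[M [_ hM]] : compact (f @` K).
  apply: continuous_compact => //; apply: continuous_in_subspaceT => x.
  by rewrite inE; exact: cf.
exists (`|M| + 1); first by rewrite addr_ge0.
move=> x Kx; apply: hM; last by exists x.
by rewrite (le_lt_trans (ler_norm _)) // ltrDl.
Qed.

Definition convex_set V (K : set V) :=
  forall x y (t : R), K x -> K y -> 0 <= t <= 1 -> K (x + t *: (y - x)).

(** Each coordinate of [f] along the segment from [x] to [y], which stays in the convex set, is a
    scalar function whose derivative is bounded by compactness through the derivatives along the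
    basis. The constant sums these bounds and weights them with the norms of the basis of the
    target. *)
Lemma Ck_lipschitz V W (U K : set V) (f : V -> W) :
  fin_basis V -> fin_basis W -> K `<=` U -> compact K -> convex_set K -> Ck 1 U f ->
  exists2 L, 0 <= L & forall x y, K x -> K y -> `|f y - f x| <= L * `|y - x|.
Proof.
move=> [I [e [l [linl bl el]]]] [J [e' [l' [linl' bl' el']]]] KU cK vK [df cf].
have /choice[M hM] i : exists M, 0 <= M /\ forall x, K x -> `|'D_(e i) f x| <= M.
  have [g fg cg] := cf (e i).
  have [x Kx|M M0 gM] := @compact_bound _ _ g K cK; first exact/cg/KU.
  by exists M; split => // x Kx; rewrite fg ?gM //; exact: KU.
have lb j x y : K x -> K y ->
    `|l' j (f y - f x)| <= (\sum_i M i) * `|y - x|.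
  move=> Kx Ky.
  have Kt t : t \in `[0 : R, 1] -> K (x + t *: (y - x)).
    by rewrite in_itv /= => t01; exact: vK.
  have ll' : forall a, is_diff a (l' j) (l' j).
    by apply: is_diff_linear => //; exact: linear_le_continuous.
  pose g t := l' j (f (x + t *: (y - x))).
  have dg t : t \in `[0 : R, 1] ->
      is_derive t (1 : R) g (l' j ('D_(y - x) f (x + t *: (y - x)))).
    move=> /Kt/KU/df d1; have d2 := is_derive_line d1.
    have d3 : differentiable (fun s : R => f (x + s *: (y - x))) t.
      by apply/derivable1_diffP; exact: ex_derive.
    have d4 : differentiable (l' j) (f (x + t *: (y - x))) by exact: ex_diff.
    have d5 : differentiable g t by exact: (differentiable_comp d3 d4).
    apply: DeriveDef; first exact: diff_derivable.
    rewrite deriveE // /g (diff_comp d3 d4) /= diff_val -deriveE //.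
    by congr (l' j _); exact: derive_val.
  have := @mvt_le g _ 0 1 ((\sum_i M i) * `|y - x|) ler01 dg.
  rewrite subr0 mulr1 /g scale1r scale0r addr0 [x + (y - x)]addrC subrK.
  rewrite (_ : l' j (f y) - l' j (f x) = l' j (f y - f x)); last first.
    rewrite (_ : f y - f x = -1 *: f x + f y) ?linl' ?scaleN1r; last by rewrite addrC.
    by rewrite addrC.
  apply => t /Kt Kxt; rewrite (le_trans (bl' _ _)) //.
  rewrite deriveE; last exact/df/KU.
  move: Kxt; set c := x + _ => Kxt; rewrite {1}(el (y - x)) linear_sum (le_trans (ler_norm_sum _ _ _)) //.
  rewrite mulr_suml ler_sum // => i _.
  rewrite linearZ -deriveE; last exact/df/KU.
  by rewrite normrZ mulrC ler_pM // (hM i).2.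
exists (\sum_j (\sum_i M i) * `|e' j|).
  by apply: sumr_ge0 => j _; rewrite mulr_ge0 // sumr_ge0 // => i _; case: (hM i).
move=> x y Kx Ky; rewrite {1}(el' (f y - f x)) (le_trans (ler_norm_sum _ _ _)) //.
rewrite mulr_suml ler_sum // => j _.
by rewrite normrZ mulrAC ler_wpM2r // lb.
Qed.

Lemma mx_normP m n (M : 'M[R]_(m, n)) r : 0 <= r ->
  reflect (forall i j, `|M i j| <= r) (`|M| <= r).
Proof.
move=> r0; apply: (iffP idP) => [h i j|h].
  apply: le_trans h; rewrite [leRHS]/Num.norm /= mx_normrE.
  exact: (le_bigmax _ _ (i, j)).
by rewrite /Num.norm /= mx_normrE; apply: bigmax_le => // -[i j] _; exact: h.
Qed.

(** Row vectors with entries in a segment form a product of compact segments; [vec_mx] carries this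
    to matrices because the norm is the largest entry. *)
Lemma mx_ball_compact m n (r : R) : compact [set M : 'M[R]_(m, n) | `|M| <= r].
Proof.
have [r0|r0] := ltP r 0.
  rewrite (_ : mkset _ = set0); first exact: compact0.
  by apply/seteqP; split=> // M /= /le_lt_trans /(_ r0); rewrite normr_lt0.
pose B := [set v : 'rV[R]_(m * n) | forall i, `[-r, r]%classic (v 0 i)].
have cB : compact B by apply: (@rV_compact R _ (fun=> `[-r, r]%classic)) => _; exact: segment_compact.
rewrite (_ : mkset _ = vec_mx @` B).
  have cv : continuous (vec_mx : 'rV[R]_(m * n) -> 'M[R]_(m, n)).
    move=> v; have : Ck 0 setT (vec_mx : 'rV[R]_(m * n) -> 'M[R]_(m, n)).
      apply: Ck_mx => p q.
      rewrite (_ : (fun x => _) = fun v : 'rV[R]_(m * n) => v 0 (mxvec_index p q)).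
        by apply: Ck_coord; exact: Ck_id.
      by apply/funext => w; rewrite mxE.
    exact.
  apply: continuous_compact => //; exact: continuous_subspaceT.
apply/seteqP; split => [M /= /(mx_normP _ r0) hM|_ [v vB <-] /=].
  exists (mxvec M); last by rewrite mxvecK.
  move=> i /=; rewrite in_itv /= -ler_norml.
  by case/mxvec_indexP: i => i j; rewrite mxvecE; exact: hM.
apply/mx_normP => // i j; rewrite mxE ler_norml.
by have := vB (mxvec_index i j); rewrite /= in_itv.
Qed.

End Calculus.

(** * Periodic linear equations *)

Section CircleIntegral.
Context {R : realType}.
Implicit Types f F : R -> R.
Local Notation mu := (@lebesgue_measure R).

Lemma is_derive_cst_eq F (c : R) : (forall x, is_derive x (1 : R) F 0) -> F c = F 0.
Proof. by move=> dF; exact: is_derive_0_is_cst. Qed.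

Lemma continuous_integrable f (a b : R) : continuous f ->
  mu.-integrable `[a, b] (EFin \o f).
Proof.
move=> cf; apply: continuous_compact_integrable; first exact: segment_compact.
exact: continuous_subspaceT.
Qed.

Lemma mvt_eq f F G (a b : R) : a < 0 -> 0 < b ->
  (forall x, a < x < b -> is_derive x (1 : R) F (f x)) ->
  (forall x, a < x < b -> is_derive x (1 : R) G (f x)) ->
  F 0 = G 0 -> forall x, a < x < b -> F x = G x.
Proof.
move=> a0 b0 dF dG FG0 x xab; apply/eqP; rewrite -subr_eq0 -normr_le0.
have dH y : a < y < b -> is_derive y (1 : R) (F - G) 0.
  move=> yab; have h1 := dF y yab; have h2 := dG y yab.
  by rewrite -(subrr (f y)); exact: is_deriveB.
have /andP[ax xb] := xab.
have [x0|/ltW x0] := leP 0 x.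
  have := @mvt_le R (F - G) (fun=> 0) 0 x 0 x0; rewrite mul0r !fctE FG0 subrr subr0.
  apply=> [y|y _]; last by rewrite normr0.
  by rewrite in_itv /= => /andP[y0 yx]; apply: dH; lra.
have := @mvt_le R (F - G) (fun=> 0) x 0 0 x0; rewrite mul0r !fctE FG0 subrr sub0r normrN.
apply=> [y|y _]; last by rewrite normr0.
by rewrite in_itv /= => /andP[y0 yx]; apply: dH; lra.
Qed.

(** The integral from a left end [- N] is an antiderivative only to the right of [- N]. Normalized
    to vanish at 0, these integrals agree wherever two of them are available, by [mvt_eq], and glue
    to a function on the whole line. *)
Lemma antiderivative_exists f : continuous f ->
  exists2 F, F 0 = 0 & forall x, is_derive x (1 : R) F (f x).
Proof.
move=> cf.
pose FN (N x : R) : R := \int[mu]_(t in `[-N, x]) f t - \int[mu]_(t in `[-N, 0]) f t.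
have dFN (N x : R) : - N < x -> is_derive x (1 : R) (FN N) (f x).
  move=> Nx.
  have x1 : x < x + 1 by rewrite ltrDl.
  have [d1 d2] := continuous_FTC1_closed x1 (continuous_integrable (- N) (x + 1) cf) Nx (cf x).
  have h : is_derive x (1 : R) (fun y => \int[mu]_(t in `[-N, y]) f t : R) (f x).
    exact: (DeriveDef d1 (etrans (esym (derive1E _ _)) d2)).
  have := is_deriveB h (is_derive_cst (\int[mu]_(t in `[-N, 0]) f t) x (1 : R)).
  by rewrite subr0.
have FN0 N : FN N 0 = 0 by rewrite /FN subrr.
pose F x := FN (`|x| + 1) x.
exists F => [|x]; first exact: FN0.
have FE (y : R) : `|y| < `|x| + 1 -> FN (`|x| + 1) y = F y.
  move=> yx; rewrite /F.
  have y1 : 0 < `|x| + 1 by rewrite ltr_wpDl.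
  have := @mvt_eq f (FN (`|x| + 1)) (FN (`|y| + 1)) (- Num.min (`|x| + 1) (`|y| + 1)) (`|y| + 1).
  have y2 : 0 < `|y| + 1 by rewrite ltr_wpDl.
  have y3 : - Num.min (`|x| + 1) (`|y| + 1) < 0 by rewrite oppr_lt0 lt_min y1.
  rewrite !FN0; apply => //.
  - by move=> z /andP[h _]; apply: dFN; rewrite (le_lt_trans _ h) // lerN2 ge_min lexx.
  - by move=> z /andP[h _]; apply: dFN; rewrite (le_lt_trans _ h) // lerN2 ge_min lexx orbT.
  - rewrite (le_lt_trans (ler_norm y)) ?ltrDl // andbT ltrNl lt_min.
    have h : - y <= `|y| by rewrite -normrN ler_norm.
    by rewrite (le_lt_trans h yx) (le_lt_trans h) // ltrDl.
apply: (near_eq_is_derive (f := FN (`|x| + 1))).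
- near=> y; apply: FE; near: y.
  have : `|x| < `|x| + 1 by rewrite ltrDl.
  by move/(cvgr_lt `|x|); apply; apply: cvg_norm; exact: cvg_id.
- apply: dFN; rewrite ltrNl.
  have h : - x <= `|x| by rewrite -normrN ler_norm.
  by rewrite (le_lt_trans h) // ltrDl.
Unshelve. all: by end_near. Qed.

(** Turns circle integrals of continuous functions into increments of antiderivatives; linearity,
    bounds and shifts are then read off derivatives instead of measure theory. *)
Lemma circle_intE f F : continuous f -> (forall x, is_derive x (1 : R) F (f x)) ->
  circle_int f = F (2 * pi) - F 0.
Proof.
move=> cf dF; have pi0 := @pi_gt0 R.
have cF x : {for x, continuous F} by apply: is_derive_continuous; exact: dF.
rewrite /circle_int /Rintegral (@continuous_FTC2 R f F) //=; first lra.
- by apply: continuous_subspaceT; exact: cf.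
- split=> [x _||]; first by have h := dF x; exact: ex_derive.
    by apply: cvg_at_right_filter; exact: cF.
  by apply: cvg_at_left_filter; exact: cF.
- by move=> x _; rewrite derive1E; have h := dF x; exact: derive_val.
Qed.

Lemma circle_intD f g : continuous f -> continuous g ->
  circle_int (fun x => f x + g x) = circle_int f + circle_int g.
Proof.
move=> cf cg; have [F F0 dF] := antiderivative_exists cf.
have [G G0 dG] := antiderivative_exists cg.
rewrite (circle_intE cf dF) (circle_intE cg dG) (@circle_intE _ (F + G)).
- by rewrite !fctE F0 G0 addr0 !subr0.
- by move=> x; apply: cvgD; [exact: cf|exact: cg].
Qed.

Lemma circle_intZ (a : R) f : continuous f ->
  circle_int (fun x => a * f x) = a * circle_int f.
Proof.
move=> cf; have [F F0 dF] := antiderivative_exists cf.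
rewrite (circle_intE cf dF) (@circle_intE _ (a *: F)).
- by rewrite !fctE F0 scaler0 !subr0.
- by move=> x; apply: cvgM; [exact: cvg_cst|exact: cf].
Qed.

Lemma circle_int_le f (M : R) : continuous f -> 
  (forall x, 0 <= x <= 2 * pi -> `|f x| <= M) -> `|circle_int f| <= 2 * pi * M.
Proof.
move=> cf bf; have [F F0 dF] := antiderivative_exists cf.
rewrite (circle_intE cf dF); have pi0 := @pi_gt0 R.
have := @mvt_le R F f 0 (2 * pi) M; rewrite subr0 [M * _]mulrC; apply => //; first lra.
Qed.

Lemma is_derive_mull (c x : R) : is_derive x (1 : R) (fun x => c * x) c.
Proof.
have h : is_derive x (1 : R) (c *: id) (c *: (1 : R)) by exact: is_deriveZ.
by rewrite -[c in is_derive _ _ _ c]mulr1.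
Qed.

Lemma circle_int_cst (c : R) : circle_int (fun=> c) = 2 * pi * c.
Proof.
rewrite (circle_intE _ (is_derive_mull c)); first by rewrite mulr0 subr0 mulrC.
by move=> x; exact: cvg_cst.
Qed.

Lemma circle_int_sum (I : Type) (s : seq I) (f : I -> R -> R) : (forall i, continuous (f i)) ->
  circle_int (fun x => \sum_(i <- s) f i x) = \sum_(i <- s) circle_int (f i).
Proof.
move=> cf; elim: s => [|i s IH].
  by rewrite big_nil (_ : (fun x => _) = fun=> 0) ?circle_int_cst ?mulr0 //;
    apply/funext => x; rewrite big_nil.
have cs : continuous (fun x => \sum_(i <- s) f i x).
  by move=> x; apply: (@Ck_sum _ _ _ 0 setT) => // j y _; exact: cf.
rewrite big_cons -IH -circle_intD //.
by congr circle_int; apply/funext => x; rewrite big_cons.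
Qed.

Lemma is_derive_sinM (c x : R) : is_derive x (1 : R) (fun x => sin (c * x)) (c * cos (c * x)).
Proof.
rewrite mulrC.
exact: (is_derive1_comp (is_derive_sin (c * x)) (is_derive_mull c x)).
Qed.

Lemma is_derive_cosM (c x : R) : is_derive x (1 : R) (fun x => cos (c * x)) (- c * sin (c * x)).
Proof.
rewrite mulrC mulrN -mulNr.
exact: (is_derive1_comp (is_derive_cos (c * x)) (is_derive_mull c x)).
Qed.

Lemma continuous_cosM (c : R) : continuous (fun x => cos (c * x)).
Proof. by move=> x; apply: is_derive_continuous; exact: is_derive_cosM. Qed.

Lemma continuous_sinM (c : R) : continuous (fun x => sin (c * x)).
Proof. by move=> x; apply: is_derive_continuous; exact: is_derive_sinM. Qed.

Lemma sinM2pi (m : nat) (x : R) : sin (m%:R * (x + 2 * pi)) = sin (m%:R * x).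
Proof.
rewrite mulrDr (_ : m%:R * (2 * pi) = pi *+ 2 *+ m); last first.
  by rewrite -[RHS]mulr_natl -[pi *+ 2]mulr_natl.
by rewrite (periodicn (@sinD2pi R)).
Qed.

Lemma cosM2pi (m : nat) (x : R) : cos (m%:R * (x + 2 * pi)) = cos (m%:R * x).
Proof.
rewrite mulrDr (_ : m%:R * (2 * pi) = pi *+ 2 *+ m); last first.
  by rewrite -[RHS]mulr_natl -[pi *+ 2]mulr_natl.
by rewrite (periodicn (@cosD2pi R)).
Qed.

Lemma circle_int_cos (m : nat) : circle_int (fun x : R => cos (m%:R * x)) = if m is 0 then 2 * pi else 0.
Proof.
case: m => [|m].
  rewrite (_ : (fun x => _) = fun=> 1) ?circle_int_cst ?mulr1 //.
  by apply/funext => x; rewrite mul0r cos0.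
have d (x : R) : is_derive x (1 : R) (m.+1%:R^-1 *: (fun x => sin (m.+1%:R * x)))
    (cos (m.+1%:R * x)).
  have := is_deriveZ m.+1%:R^-1 (is_derive_sinM m.+1%:R x).
  by rewrite -[_ *: (_ * _)]/(_ * (_ * _)) mulKf // pnatr_eq0.
rewrite (circle_intE (@continuous_cosM m.+1%:R) d).
by rewrite !fctE -[2 * pi]add0r sinM2pi subrr.
Qed.

Lemma circle_int_sin (m : nat) : circle_int (fun x : R => sin (m%:R * x)) = 0.
Proof.
case: m => [|m].
  rewrite (_ : (fun x => _) = fun=> 0) ?circle_int_cst ?mulr0 //.
  by apply/funext => x; rewrite mul0r sin0.
have d (x : R) : is_derive x (1 : R) ((- m.+1%:R^-1) *: (fun x => cos (m.+1%:R * x)))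
    (sin (m.+1%:R * x)).
  have := is_deriveZ (- m.+1%:R^-1) (is_derive_cosM m.+1%:R x).
  by rewrite -[_ *: (_ * _)]/(_ * (_ * _)) mulrA mulrNN mulVf ?mul1r // pnatr_eq0.
rewrite (circle_intE (@continuous_sinM m.+1%:R) d).
by rewrite !fctE -[2 * pi]add0r cosM2pi subrr.
Qed.

(** With truncated subtraction, [(m - k) + (k - m)] is the distance of [m] and [k]. It keeps all
    frequencies natural numbers, and the cosine does not see the sign. *)
Lemma cos_distn (m k : nat) (x : R) :
  cos (((m - k) + (k - m))%N%:R * x) = cos (m%:R * x - k%:R * x).
Proof.
have [mk|/ltnW mk] := leqP m k.
  rewrite (_ : (m - k)%N = 0%N) ?add0n; last by apply/eqP; rewrite subn_eq0.
  by rewrite natrB // mulrBl -cosN opprB.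
rewrite (_ : (k - m)%N = 0%N) ?addn0; last by apply/eqP; rewrite subn_eq0.
by rewrite natrB // mulrBl.
Qed.

Lemma circle_int_coscos (m k : nat) :
  circle_int (fun x : R => cos (m%:R * x) * cos (k%:R * x)) =
  if m == k then (if m is 0 then 2 * pi else pi) else 0.
Proof.
rewrite (_ : (fun x => _) = fun x : R => 2^-1 * (cos ((m + k)%N%:R * x) +
   cos (((m - k) + (k - m))%N%:R * x))); last first.
  by apply/funext => x; rewrite cos_distn cosB natrD mulrDl cosD; field.
rewrite circle_intZ; last by move=> x; apply: cvgD; exact: continuous_cosM.
rewrite circle_intD; [|exact: continuous_cosM..].
rewrite !circle_int_cos; have [<-|mk] := eqVneq.
  by rewrite subnn addn0; case: m => [|m] /=; field.
have -> : (m - k + (k - m))%N = ((m - k + (k - m))%N.-1).+1 by lia.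
have -> : (m + k)%N = ((m + k)%N.-1).+1 by lia.
by rewrite addr0 mulr0.
Qed.

Lemma circle_int_sinsin (m k : nat) :
  circle_int (fun x : R => sin (m%:R * x) * sin (k%:R * x)) =
  if m == k then (if m is 0 then 0 else pi) else 0.
Proof.
rewrite (_ : (fun x => _) = fun x : R => 2^-1 * (cos (((m - k) + (k - m))%N%:R * x) +
   -1 * cos ((m + k)%N%:R * x))); last first.
  by apply/funext => x; rewrite cos_distn cosB natrD mulrDl cosD; field.
have c1 : continuous (fun x : R => -1 * cos ((m + k)%N%:R * x)).
  by move=> x; apply: cvgM; [exact: cvg_cst|exact: continuous_cosM].
rewrite circle_intZ; last by move=> x; apply: cvgD; [exact: continuous_cosM|exact: c1].
rewrite circle_intD; [|exact: continuous_cosM|exact: c1].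
rewrite circle_intZ; last exact: continuous_cosM.
rewrite !circle_int_cos; have [<-|mk] := eqVneq.
  by rewrite subnn addn0; case: m {c1} => [|m] /=; field.
have -> : (m - k + (k - m))%N = ((m - k + (k - m))%N.-1).+1 by lia.
have -> : (m + k)%N = ((m + k)%N.-1).+1 by lia.
by rewrite !mulr0 addr0 mulr0.
Qed.

Lemma circle_int_sincos (m k : nat) :
  circle_int (fun x : R => sin (m%:R * x) * cos (k%:R * x)) = 0.
Proof.
pose d := ((m - k) + (k - m))%N.
(* The sine is odd, so [s] restores the sign that is lost when [m - k] is replaced by the
   distance. *)
pose s : R := if (m <= k)%N then -1 else 1.
have sE x : s * sin (d%:R * x) = sin (m%:R * x - k%:R * x).
  rewrite /s /d; have [mk|/ltnW mk] := leqP m k.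
    rewrite (_ : (m - k)%N = 0%N) ?add0n; last by apply/eqP; rewrite subn_eq0.
    by rewrite natrB // mulrBl mulN1r -sinN opprB.
  rewrite (_ : (k - m)%N = 0%N) ?addn0; last by apply/eqP; rewrite subn_eq0.
  by rewrite natrB // mulrBl mul1r.
rewrite (_ : (fun x => _) = fun x : R => 2^-1 * (sin ((m + k)%N%:R * x) +
   s * sin (d%:R * x))); last first.
  by apply/funext => x; rewrite sE sinB natrD mulrDl sinD; field.
have c1 : continuous (fun x : R => s * sin (d%:R * x)).
  by move=> x; apply: cvgM; [exact: cvg_cst|exact: continuous_sinM].
rewrite circle_intZ; last by move=> x; apply: cvgD; [exact: continuous_sinM|exact: c1].
rewrite circle_intD; [|exact: continuous_sinM|exact: c1].
rewrite circle_intZ; last exact: continuous_sinM.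
by rewrite !circle_int_sin !mulr0 addr0 mulr0.
Qed.

End CircleIntegral.

(** * Periodic solutions of scalar complex linear equations *)

Section ComplexCurves.
Context {R : realType}.
Notation C := R[i].
Implicit Types (f g x y : R -> C) (mu z : C).

(** The l^1 norm on C: it is submultiplicative, and bounds pass to and from real and imaginary parts
    without square roots. *)
Definition cn (z : C) : R := `|complex.Re z| + `|complex.Im z|.

Lemma cn_ge0 z : 0 <= cn z. Proof. exact: addr_ge0. Qed.

Lemma cn0 : cn 0 = 0. Proof. by rewrite /cn /= !normr0 addr0. Qed.

Lemma cnD z w : cn (z + w) <= cn z + cn w.
Proof.
case: z w => [a b] [c d]; rewrite /cn /= addrACA.
by rewrite lerD // ler_normD.
Qed.

Lemma cnN z : cn (- z) = cn z.
Proof. by case: z => a b; rewrite /cn /= !normrN. Qed.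

Lemma cnB z w : cn (z - w) <= cn z + cn w.
Proof. by rewrite (le_trans (cnD _ _)) // cnN. Qed.

Lemma cnM z w : cn (z * w) <= cn z * cn w.
Proof.
case: z w => [a b] [c d]; rewrite /cn /=.
rewrite (le_trans (lerD (ler_normB _ _) (ler_normD _ _))) //.
by rewrite !normrM le_eqVlt; apply/orP; left; apply/eqP; ring.
Qed.

Lemma cn_sum (I : Type) (s : seq I) (F : I -> C) :
  cn (\sum_(i <- s) F i) <= \sum_(i <- s) cn (F i).
Proof.
elim: s => [|i s IH]; first by rewrite !big_nil cn0.
by rewrite !big_cons (le_trans (cnD _ _)) // lerD2l.
Qed.

Definition cder f f' := forall t,
  is_derive t (1 : R) (fun s => complex.Re (f s)) (complex.Re (f' t)) /\
  is_derive t (1 : R) (fun s => complex.Im (f s)) (complex.Im (f' t)).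

Definition ccont f :=
  continuous (fun s => complex.Re (f s)) /\ continuous (fun s => complex.Im (f s)).

Definition cper f := forall t, f (t + 2 * pi) = f t.

Lemma cder_eq f f' g : (forall t, f' t = g t) -> cder f f' -> cder f g.
Proof. by move=> e df t; rewrite -e; exact: df. Qed.

Lemma cder_ccont f f' : cder f f' -> ccont f.
Proof. by move=> df; split=> t; have [h1 h2] := df t; exact: is_derive_continuous. Qed.

Lemma cderD f f' g g' : cder f f' -> cder g g' ->
  cder (fun t => f t + g t) (fun t => f' t + g' t).
Proof.
move=> df dg t; have [h1 h2] := df t; have [h3 h4] := dg t.
have := is_deriveD h2 h4; have := is_deriveD h1 h3.
case: (f' t) (g' t) {h1 h2 h3 h4} => [a b] [c d] /= h1 h2.
split.
  rewrite (_ : (fun s => _) = (fun s => complex.Re (f s)) + (fun s => complex.Re (g s))) //.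
  by apply/funext => s; rewrite fctE; case: (f s) (g s) => [? ?] [].
rewrite (_ : (fun s => _) = (fun s => complex.Im (f s)) + (fun s => complex.Im (g s))) //.
by apply/funext => s; rewrite fctE; case: (f s) (g s) => [? ?] [].
Qed.

Lemma cder_cst z : cder (fun=> z) (fun=> 0).
Proof. by move=> t; split; exact: is_derive_cst. Qed.

Lemma cderM f f' g g' : cder f f' -> cder g g' ->
  cder (fun t => f t * g t) (fun t => f' t * g t + f t * g' t).
Proof.
move=> df dg t; have [h1 h2] := df t; have [h3 h4] := dg t.
have e1 := is_deriveB (is_deriveM h1 h3) (is_deriveM h2 h4).
have e2 := is_deriveD (is_deriveM h1 h4) (is_deriveM h2 h3).
split.
- rewrite (_ : (fun s => _) = (fun s => complex.Re (f s)) * (fun s => complex.Re (g s))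
    - (fun s => complex.Im (f s)) * (fun s => complex.Im (g s))); last first.
    by apply/funext => s; rewrite !fctE; case: (f s) (g s) => [? ?] [].
  apply: (@is_derive_eq _ _ _ _ _ _ _ _ e1); rewrite /GRing.scale /=.
  by case: (f' t) (g' t) (f t) (g t) => [? ?] [? ?] [? ?] [? ?] /=; ring.
- rewrite (_ : (fun s => _) = (fun s => complex.Re (f s)) * (fun s => complex.Im (g s))
    + (fun s => complex.Im (f s)) * (fun s => complex.Re (g s))); last first.
    by apply/funext => s; rewrite !fctE; case: (f s) (g s) => [? ?] [].
  apply: (@is_derive_eq _ _ _ _ _ _ _ _ e2); rewrite /GRing.scale /=.
  by case: (f' t) (g' t) (f t) (g t) => [? ?] [? ?] [? ?] [? ?] /=; ring.
Qed.

Lemma cderZ z f f' : cder f f' -> cder (fun t => z * f t) (fun t => z * f' t).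
Proof.
move=> df; apply: cder_eq (cderM (cder_cst z) df) => t.
by rewrite mul0r add0r.
Qed.

Lemma cderN f f' : cder f f' -> cder (fun t => - f t) (fun t => - f' t).
Proof.
move=> /(cderZ (-1)); rewrite (_ : (fun t => -1 * f t) = fun t => - f t).
  by apply: cder_eq => t; rewrite mulN1r.
by apply/funext => t; rewrite mulN1r.
Qed.

Lemma cderB f f' g g' : cder f f' -> cder g g' ->
  cder (fun t => f t - g t) (fun t => f' t - g' t).
Proof. by move=> df dg; apply: cderD => //; exact: cderN. Qed.

Lemma cder_sum (I : Type) (s : seq I) (F F' : I -> R -> C) :
  (forall i, cder (F i) (F' i)) ->
  cder (fun t => \sum_(i <- s) F i t) (fun t => \sum_(i <- s) F' i t).
Proof.
move=> dF; elim: s => [|i s IH].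
  rewrite (_ : (fun t => _) = fun=> 0); last by apply/funext => t; rewrite big_nil.
  by apply: cder_eq (cder_cst 0) => t; rewrite big_nil.
rewrite (_ : (fun t => _) = fun t => F i t + \sum_(i <- s) F i t); last first.
  by apply/funext => t; rewrite big_cons.
by apply: cder_eq (cderD (dF i) IH) => t; rewrite big_cons.
Qed.

Lemma cder_shift f f' (a : R) : cder f f' ->
  cder (fun t => f (t + a)) (fun t => f' (t + a)).
Proof.
move=> df t; have [h1 h2] := df (t + a).
have h3 : is_derive t (1 : R) (fun s => s + a) 1.
  by have := is_deriveD (is_derive_id t (1 : R)) (is_derive_cst a t (1 : R)); rewrite addr0.
split.
  by have := is_derive1_comp (f := fun s => complex.Re (f s)) (g := fun s => s + a) h1 h3; rewrite mulr1.
by have := is_derive1_comp (f := fun s => complex.Im (f s)) (g := fun s => s + a) h2 h3; rewrite mulr1.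
Qed.

Lemma cder0_cst f t : cder f (fun=> 0) -> f t = f 0.
Proof.
move=> df.
have e1 := is_derive_cst_eq t (fun s => (df s).1).
have e2 := is_derive_cst_eq t (fun s => (df s).2).
by case: (f t) (f 0) e1 e2 => [a b] [c d] /= -> ->.
Qed.

Lemma cder_exists f : ccont f -> exists2 F, F 0 = 0 & cder F f.
Proof.
move=> [c1 c2]; have [F1 F10 dF1] := antiderivative_exists c1.
have [F2 F20 dF2] := antiderivative_exists c2.
exists (fun t => Complex (F1 t) (F2 t)); first by rewrite F10 F20.
by move=> t; split; [exact: dF1|exact: dF2].
Qed.

(** The factor 2 pays for treating real and imaginary parts separately by the real mean value
    inequality. *)
Lemma cder_bound F f (M a : R) : cder F f -> F 0 = 0 -> 0 <= M ->
  (forall t, 0 <= t <= a -> cn (f t) <= M) ->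
  forall t, 0 <= t <= a -> cn (F t) <= 2 * a * M.
Proof.
move=> dF F0 M0 fM t /andP[t0 ta].
have sa s : s \in `[0 : R, t] -> cn (f s) <= M.
  by rewrite in_itv /= => /andP[s0 st]; apply: fM; rewrite s0 (le_trans st).
have b1 : `|complex.Re (F t)| <= M * t.
  have := mvt_le t0 (fun s _ => (dF s).1) (B := M); rewrite F0 /= !subr0; apply.
  by move=> s /sa; apply: le_trans; rewrite lerDl.
have b2 : `|complex.Im (F t)| <= M * t.
  have := mvt_le t0 (fun s _ => (dF s).2) (B := M); rewrite F0 /= !subr0; apply.
  by move=> s /sa; apply: le_trans; rewrite lerDr.
rewrite (le_trans (lerD b1 b2)) //.
have h : M * t <= a * M by rewrite mulrC ler_wpM2r.
by rewrite -mulrA; lra.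
Qed.

Lemma ccontM f g : ccont f -> ccont g -> ccont (fun t => f t * g t).
Proof.
move=> [f1 f2] [g1 g2]; split.
- rewrite (_ : (fun s => _) = fun s => complex.Re (f s) * complex.Re (g s)
    - complex.Im (f s) * complex.Im (g s)); last first.
    by apply/funext => s; case: (f s) (g s) => [? ?] [].
  by move=> t; apply: cvgB; apply: cvgM; [exact: f1|exact: g1|exact: f2|exact: g2].
- rewrite (_ : (fun s => _) = fun s => complex.Re (f s) * complex.Im (g s)
    + complex.Im (f s) * complex.Re (g s)); last first.
    by apply/funext => s; case: (f s) (g s) => [? ?] [].
  by move=> t; apply: cvgD; apply: cvgM; [exact: f1|exact: g2|exact: f2|exact: g1].
Qed.

Lemma ccontD f g : ccont f -> ccont g -> ccont (fun t => f t + g t).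
Proof.
move=> [f1 f2] [g1 g2]; split.
- rewrite (_ : (fun s => _) = fun s => complex.Re (f s) + complex.Re (g s)); last first.
    by apply/funext => s; case: (f s) (g s) => [? ?] [].
  by move=> t; apply: cvgD; [exact: f1|exact: g1].
- rewrite (_ : (fun s => _) = fun s => complex.Im (f s) + complex.Im (g s)); last first.
    by apply/funext => s; case: (f s) (g s) => [? ?] [].
  by move=> t; apply: cvgD; [exact: f2|exact: g2].
Qed.

Lemma ccont_cst z : ccont (fun=> z).
Proof. by split=> t; exact: cvg_cst. Qed.

Lemma ccont_sum (I : Type) (s : seq I) (F : I -> R -> C) :
  (forall i, ccont (F i)) -> ccont (fun t => \sum_(i <- s) F i t).
Proof.
move=> dF; elim: s => [|i s IH].
  by rewrite (_ : (fun t => _) = fun=> 0);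
    [exact: ccont_cst | apply/funext => t; rewrite big_nil].
rewrite (_ : (fun t => _) = fun t => F i t + \sum_(i <- s) F i t).
  exact: ccontD.
by apply/funext => t; rewrite big_cons.
Qed.

(** The representative in one period is the same for every periodic function, so that several
    functions, or a pair of them, can be moved at once. *)
Lemma circle_rep (t : R) : exists2 s, 0 <= s <= 2 * pi &
  forall (T : Type) (f : R -> T), (forall u, f (u + 2 * pi) = f u) -> f t = f s.
Proof.
have pi0 : 0 < 2 * pi :> R by rewrite mulr_gt0 ?pi_gt0.
pose n := Num.floor (t / (2 * pi)).
exists (t - n%:~R * (2 * pi)).
  have := floor_itv (t / (2 * pi)); rewrite -/n => /andP[h1 h2].
  rewrite subr_ge0 lerBlDr -ler_pdivlMr // h1 /=.
  rewrite -[X in X + _]mul1r -mulrDl -ler_pdivrMr // ltW //.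
  by rewrite (lt_le_trans h2) // intrD addrC.
move=> T f pf.
have pn (m : nat) u : f (u + m%:R * (2 * pi)) = f u.
  elim: m u => [|m IH] u; first by rewrite mul0r addr0.
  by rewrite -natr1 mulrDl mul1r addrA pf IH.
case: n => m; last rewrite NegzE mulrNz mulNr opprK.
  by rewrite -[in LHS](subrK (m%:R * (2 * pi)) t) pn.
by rewrite pn.
Qed.

Lemma cper_bound f (M : R) : cper f -> (forall t, 0 <= t <= 2 * pi -> cn (f t) <= M) ->
  forall t, cn (f t) <= M.
Proof. by move=> pf bf t; have [s s01 /(_ _ f pf) ->] := circle_rep t; exact: bf. Qed.

Definition cexp mu (t : R) : C :=
  Complex (expR (complex.Re mu * t) * cos (complex.Im mu * t))
          (expR (complex.Re mu * t) * sin (complex.Im mu * t)).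

Lemma cder_cexp mu : cder (cexp mu) (fun t => mu * cexp mu t).
Proof.
case: mu => a b t; rewrite /cexp /=.
have e1 := is_derive1_comp (is_derive_expR (a * t)) (is_derive_mull a t).
have e2 := is_derive_cosM b t; have e3 := is_derive_sinM b t.
split.
  apply: (@is_derive_eq _ _ _ _ _ _ _ _ (is_deriveM e1 e2)).
  by rewrite /GRing.scale /=; ring.
apply: (@is_derive_eq _ _ _ _ _ _ _ _ (is_deriveM e1 e3)).
by rewrite /GRing.scale /=; ring.
Qed.

Lemma cexp0 mu : cexp mu 0 = 1.
Proof. by rewrite /cexp !mulr0 expR0 cos0 sin0 mulr1 mulr0. Qed.

Lemma cexpN mu t : cexp mu t * cexp (- mu) t = 1.
Proof.
have d : cder (fun t => cexp mu t * cexp (- mu) t) (fun=> 0).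
  apply: cder_eq (cderM (cder_cexp mu) (cder_cexp (- mu))) => s.
  by ring.
by rewrite (cder0_cst t d) !cexp0 mulr1.
Qed.

(** Integrating factor: [cexp (- mu) t * y t] has derivative zero. *)
Lemma cder_linear_eq mu y : cder y (fun t => mu * y t) ->
  forall t, y t = cexp mu t * y 0.
Proof.
move=> dy t.
have d : cder (fun t => cexp (- mu) t * y t) (fun=> 0).
  apply: cder_eq (cderM (cder_cexp (- mu)) dy) => s.
  by ring.
have := cder0_cst t d; rewrite cexp0 mul1r => <-.
by rewrite mulrA cexpN mul1r.
Qed.

(** The Floquet multiplier of y' = mu y over one period differs from 1, that is, [mu] is no integer
    multiple of the imaginary unit. *)
Definition nonres mu := cexp mu (2 * pi) != 1.

Lemma scalar_uniq mu y : nonres mu -> cder y (fun t => mu * y t) -> cper y ->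
  forall t, y t = 0.
Proof.
move=> nr dy py t; rewrite (cder_linear_eq dy t).
have := cder_linear_eq dy (2 * pi); rewrite -[2 * pi]add0r py add0r => /eqP.
rewrite -subr_eq0 -{1}[y 0]mul1r -mulrBl mulf_eq0 subr_eq0 eq_sym (negPf nr) /=.
by move=> /eqP ->; rewrite mulr0.
Qed.

Lemma cexp_bound mu : exists2 B, 0 <= B & forall t, 0 <= t <= 2 * pi -> cn (cexp mu t) <= B.
Proof.
have [c1 c2] := cder_ccont (cder_cexp mu).
have [B1 B10 h1] := compact_bound (@segment_compact R 0 (2 * pi)) (fun s _ => c1 s).
have [B2 B20 h2] := compact_bound (@segment_compact R 0 (2 * pi)) (fun s _ => c2 s).
exists (B1 + B2); first exact: addr_ge0.
by move=> t t0; rewrite lerD ?h1 ?h2 //= in_itv.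
Qed.

(** Variation of constants, with the starting value fixed by periodicity; [nonres mu] makes the
    equation for that value solvable. *)
Lemma scalar_solve mu : nonres mu -> exists2 K, 0 <= K &
  forall f, ccont f -> cper f -> exists x, [/\ cder x (fun t => mu * x t + f t), cper x
    & forall M, (forall t, cn (f t) <= M) -> forall t, cn (x t) <= K * M].
Proof.
move=> nr.
have [B1 B10 hB1] := cexp_bound mu; have [B2 B20 hB2] := cexp_bound (- mu).
(* Periodicity asks for [cexp mu (2 * pi) * (c + H (2 * pi)) = c]; solving for [c] gives
   [kap * H (2 * pi)]. *)
pose kap := cexp mu (2 * pi) / (1 - cexp mu (2 * pi)).
have pi0 : 0 < 2 * pi :> R by rewrite mulr_gt0 ?pi_gt0.
exists (B1 * ((cn kap + 1) * (2 * (2 * pi) * B2))).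
  rewrite mulr_ge0 // mulr_ge0 ?addr_ge0 ?cn_ge0 // mulr_ge0 //.
  by rewrite mulr_ge0 // ltW.
move=> f cf pf.
have cg : ccont (fun t => cexp (- mu) t * f t).
  by apply: ccontM => //; exact: cder_ccont (cder_cexp _).
have [H H0 dH] := cder_exists cg.
pose c := kap * H (2 * pi).
pose x t := cexp mu t * (c + H t).
have dx : cder x (fun t => mu * x t + f t).
  apply: cder_eq (cderM (cder_cexp mu) (cderD (cder_cst c) dH)) => t.
  by rewrite add0r [cexp mu t * (_ * _)]mulrA cexpN mul1r /x mulrA.
have px : cper x.
  move=> t; apply/eqP; rewrite -subr_eq0; apply/eqP.
  (* As [f] is periodic, the increment over a period solves the homogeneous equation, so it vanishes
     identically once it vanishes at 0; that is what the choice of [c] achieves. *)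
  have dy : cder (fun t => x (t + 2 * pi) - x t) (fun t => mu * (x (t + 2 * pi) - x t)).
    apply: cder_eq (cderB (cder_shift (2 * pi) dx) dx) => s.
    by rewrite pf; ring.
  rewrite (cder_linear_eq dy t) add0r /x H0 cexp0 mul1r addr0 /c /kap.
  have nz : 1 - cexp mu (2 * pi) != 0 by rewrite subr_eq0 eq_sym.
  rewrite (_ : _ - _ = 0) ?mulr0 //.
  by field.
exists x; split=> // M fM.
have M0 : 0 <= M by exact: le_trans (cn_ge0 _) (fM 0).
apply: cper_bound => // t t0.
have hH s : 0 <= s <= 2 * pi -> cn (H s) <= 2 * (2 * pi) * (B2 * M).
  apply: (cder_bound dH H0); first exact: mulr_ge0.
  by move=> u u0; rewrite (le_trans (cnM _ _)) // ler_pM ?cn_ge0 // hB2.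
set Q := 2 * (2 * pi) * (B2 * M) in hH.
rewrite (_ : _ * M = B1 * ((cn kap + 1) * Q)); last by rewrite /Q; ring.
rewrite (le_trans (cnM _ _)) // ler_pM ?cn_ge0 ?hB1 //.
rewrite (le_trans (cnD _ _)) // mulrDl mul1r lerD ?hH //.
by rewrite (le_trans (cnM _ _)) // ler_wpM2l ?cn_ge0 // hH // lexx ltW.
Qed.

Lemma cexp_abs mu t : complex.Re (cexp mu t) ^+ 2 + complex.Im (cexp mu t) ^+ 2 =
  expR (complex.Re mu * t) ^+ 2.
Proof. by rewrite /= !exprMn -mulrDr cos2Dsin2 mulr1. Qed.

(** If the multiplier were 1, its modulus exp(2 pi Re mu) would be 1, forcing Re mu = 0. *)
Lemma nonres_hyperbolic mu : complex.Re mu != 0 -> nonres mu.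
Proof.
move=> mu0; apply/negP => /eqP e; have := cexp_abs mu (2 * pi).
have pi0 : 0 < 2 * pi :> R by rewrite mulr_gt0 ?pi_gt0.
rewrite e /= expr1n expr0n addr0 => /eqP; rewrite eq_sym sqrf_eq1 => /orP[]/eqP h.
  have := expR_inj (etrans h (esym (@expR0 R))) => /eqP.
  by rewrite mulf_eq0 (negPf mu0) gt_eqF.
by have := expR_gt0 (complex.Re mu * (2 * pi)); rewrite h ltr0N1.
Qed.

(** A multiplier 1 gives cos(2 pi |nu|) = 1, hence sin(pi |nu|) = 0, and for 0 < |nu| < 2 this sine
    vanishes only at |nu| = 1. *)
Lemma nonres_imag (nu : R) : 0 < `|nu| < 2 -> `|nu| != 1 -> nonres (Complex 0 nu).
Proof.
move=> /andP[n0 n2] n1; apply/negP => /eqP.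
rewrite /cexp /= mul0r expR0 !mul1r => -[h _].
have pi0 := @pi_gt0 R.
have : sin (`|nu| * pi) = 0.
  have : cos (`|nu| * (2 * pi)) = 1.
    by case: (ler0P nu) h => _ // h; rewrite mulNr cosN.
  rewrite (_ : `|nu| * (2 * pi) = `|nu| * pi *+ 2); last by rewrite -[RHS]mulr_natl; ring.
  rewrite cos_mulr2n cos2sin2 => e; apply/eqP; rewrite -sqrf_eq0; apply/eqP.
  by move: e; set s := sin _ ^+ 2; rewrite -mulr_natl; lra.
have [n01|n01|] := ltgtP `|nu| 1; last by move=> e; rewrite e eqxx in n1.
  have := @sin_gt0_pi R (`|nu| * pi); rewrite mulr_gt0 //= gtr_pMl // n01 => /(_ isT).
  by move=> h1 h2; rewrite h2 ltxx in h1.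
rewrite (_ : `|nu| * pi = (`|nu| - 1) * pi + pi); last by ring.
rewrite sinDpi => /eqP; rewrite oppr_eq0 => /eqP h2.
have : 0 < sin ((`|nu| - 1) * pi).
  apply: sin_gt0_pi; rewrite mulr_gt0 ?subr_gt0 //= gtr_pMl //.
  by rewrite ltrBlDr.
by rewrite h2 ltxx.
Qed.

Definition cavg f : C := Complex ((2 * pi)^-1 * circle_int (fun t => complex.Re (f t)))
  ((2 * pi)^-1 * circle_int (fun t => complex.Im (f t))).

Lemma cavgE F f : cder F f -> ccont f -> cavg f = ((2 * pi)^-1)%:C%C * (F (2 * pi) - F 0).
Proof.
move=> dF [c1 c2]; rewrite /cavg (circle_intE c1 (fun t => (dF t).1)).
rewrite (circle_intE c2 (fun t => (dF t).2)).
by case: (F (2 * pi)) (F 0) => [a b] [c d]; simpc.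
Qed.

Lemma cavg_cst z : cavg (fun=> z) = z.
Proof.
have pi0 : 2 * pi != 0 :> R by rewrite mulf_neq0 ?gt_eqF ?pi_gt0.
by case: z => a b; rewrite /cavg /= !circle_int_cst !mulKf.
Qed.

Lemma cavgB f g : ccont f -> ccont g -> cavg (fun t => f t - g t) = cavg f - cavg g.
Proof.
move=> cf cg; have [F F0 dF] := cder_exists cf; have [G G0 dG] := cder_exists cg.
rewrite (cavgE dF cf) (cavgE dG cg) (cavgE (cderB dF dG)).
  by rewrite F0 G0; ring.
apply: ccontD => //; rewrite (_ : (fun t => - g t) = fun t => -1 * g t).
  by apply: ccontM => //; exact: ccont_cst.
by apply/funext => t; rewrite mulN1r.
Qed.

Lemma cavg_bound f M : ccont f -> (forall t, cn (f t) <= M) -> cn (cavg f) <= 2 * M.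
Proof.
move=> [c1 c2] fM; have pi0 : 0 < 2 * pi :> R by rewrite mulr_gt0 ?pi_gt0.
have b (g : R -> R) : continuous g -> (forall t, `|g t| <= M) -> `|(2 * pi)^-1 * circle_int g| <= M.
  have h : 0 <= (2 * pi)^-1 :> R by rewrite invr_ge0 ltW.
  move=> cg gM; rewrite normrM (ger0_norm h).
  by rewrite ler_pdivrMl // circle_int_le.
rewrite mulr_natl mulr2n /cn /cavg /= lerD //; apply: b => // t;
  by apply: le_trans (fM t); rewrite ?lerDl ?lerDr.
Qed.

(* The resonant exponent [mu = 0]: the average of the forcing is an obstruction,
   and the average of the solution is free. *)
Lemma resonant_solve : exists2 K, 0 <= K &
  forall f, ccont f -> cper f -> exists x (tau : C),
    [/\ cder x (fun t => f t - tau), cper x, cavg x = 0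
      & forall M, (forall t, cn (f t) <= M) -> cn tau <= K * M /\ forall t, cn (x t) <= K * M].
Proof.
have pi0 : 0 < 2 * pi :> R by rewrite mulr_gt0 ?pi_gt0.
(* The average [tau] costs 2, the primitive of [f - tau] costs [2 * (2 * pi) * 3], and removing the
   average of the primitive triples the latter. *)
exists (2 + 3 * (2 * (2 * pi) * 3)); first by rewrite addr_ge0 // !mulr_ge0 ?pi_ge0.
move=> f cf pf; pose tau := cavg f.
have cg : ccont (fun t => f t - tau) by apply: ccontD => //; exact: ccont_cst.
have [H H0 dH] := cder_exists cg.
have cH := cder_ccont dH.
(* The increment of [H] over a period is constant in [t] and proportional to the average of
   [f - tau], which is zero by the choice of [tau]. *)
have pH : cper H.
  move=> t; apply/eqP; rewrite -subr_eq0; apply/eqP.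
  have dy : cder (fun t => H (t + 2 * pi) - H t) (fun=> 0).
    by apply: cder_eq (cderB (cder_shift (2 * pi) dH) dH) => s; rewrite pf subrr.
  rewrite (cder0_cst t dy) add0r H0 subr0.
  have := cavgE dH cg; rewrite cavgB ?cavg_cst //; last exact: ccont_cst.
  have nz : ((2 * pi)^-1)%:C%C != 0 :> C.
    by apply/eqP => -[] /eqP; rewrite invr_eq0 gt_eqF.
  by rewrite subrr H0 subr0 => /esym/eqP; rewrite mulf_eq0 (negPf nz) => /eqP.
exists (fun t => H t - cavg H), tau; split.
- by apply: cder_eq (cderB dH (cder_cst _)) => t; rewrite subr0.
- by move=> t; rewrite pH.
- by rewrite cavgB ?cavg_cst ?subrr //; exact: ccont_cst.
- move=> M fM; have M0 : 0 <= M by exact: le_trans (cn_ge0 _) (fM 0).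
  have btau : cn tau <= 2 * M by exact: cavg_bound.
  have bH : forall t, cn (H t) <= 2 * (2 * pi) * (3 * M).
    apply: cper_bound => //; apply: (cder_bound dH H0); first by rewrite mulr_ge0.
    move=> t _; rewrite (le_trans (cnB _ _)) //.
    by have := fM t; lra.
  split.
    by rewrite (le_trans btau) // ler_wpM2r // lerDl !mulr_ge0 ?pi_ge0.
  move=> t; rewrite (le_trans (cnB _ _)) // (le_trans (lerD (bH t) (cavg_bound cH bH))) //.
  set q := 2 * (2 * pi) * (3 * M).
  rewrite [leRHS](_ : _ = 2 * M + 3 * q); last by rewrite /q; ring.
  by lra.
Qed.

(** The derivative of a periodic function averages to zero over a period, which kills [tau]; then
    [x] is constant and equal to its average. *)
Lemma resonant_uniq x tau : cder x (fun=> tau) -> cper x -> cavg x = 0 ->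
  tau = 0 /\ forall t, x t = 0.
Proof.
move=> dx px ax.
have t0 : tau = 0.
  have h : x (2 * pi) = x 0 by rewrite -[2 * pi]add0r px.
  have := cavgE dx (ccont_cst tau); rewrite h subrr mulr0.
  by rewrite cavg_cst.
split=> // t; rewrite t0 in dx.
have xE : x = fun=> x 0 by apply/funext => s; exact: cder0_cst.
by move: ax; rewrite xE cavg_cst.
Qed.

End ComplexCurves.

(** * Periodic linear systems whose eigenvalues are all nonresonant *)

Section VectorCurves.
Context {R : realType}.
Notation C := R[i].

(** Treats both kinds of exponents at once: in the resonant case [tau] is an unknown and the average
    of [x] is prescribed; otherwise [tau] is zero and the equation alone determines [x]. *)
Lemma linear_solve (mu : C) (res : bool) : (if res then mu = 0 else nonres mu) ->
  exists2 K : R, 0 <= K & forall f : R -> C, ccont f -> cper f -> exists x tau,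
    [/\ cder x (fun t => mu * x t + f t - tau), cper x,
        if res then cavg x = 0 else tau = 0
      & forall M, (forall t, cn (f t) <= M) -> cn tau <= K * M /\ forall t, cn (x t) <= K * M].
Proof.
case: res => [->|nr].
  have [K K0 hK] := @resonant_solve R; exists K => // f cf pf.
  have [x [tau [dx px ax bx]]] := hK f cf pf; exists x, tau; split=> //.
  by apply: cder_eq dx => t; rewrite mul0r add0r.
have [K K0 hK] := scalar_solve nr; exists K => // f cf pf.
have [x [dx px bx]] := hK f cf pf; exists x, 0; split=> //.
  by apply: cder_eq dx => t; rewrite subr0.
move=> M fM; rewrite cn0; split; last exact: bx.
by rewrite mulr_ge0 // (le_trans (cn_ge0 _) (fM 0)).
Qed.

Lemma linear_uniq (mu : C) (res : bool) x tau : (if res then mu = 0 else nonres mu) ->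
  cder x (fun t => mu * x t - tau) -> cper x -> (if res then cavg x = 0 else tau = 0) ->
  tau = 0 /\ forall t, x t = 0.
Proof.
case: res => [->|nr] dx px h.
  have dx' : cder x (fun=> - tau) by apply: cder_eq dx => t; rewrite mul0r add0r.
  have [/eqP] := resonant_uniq dx' px h.
  by rewrite oppr_eq0 => /eqP.
rewrite h; split=> //; apply: scalar_uniq nr _ px.
by apply: cder_eq dx => t; rewrite h subr0.
Qed.

Definition vder k (x x' : R -> 'cV[C]_k) :=
  forall i, cder (fun t => x t i 0) (fun t => x' t i 0).
Definition vcont k (x : R -> 'cV[C]_k) := forall i, ccont (fun t => x t i 0).
Definition vper k (x : R -> 'cV[C]_k) := forall t, x (t + 2 * pi) = x t.
Definition vbound k (M : R) (x : R -> 'cV[C]_k) := forall t i, cn (x t i 0) <= M.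

Lemma vder_eq k (x x' y : R -> 'cV[C]_k) : (forall t, x' t = y t) -> vder x x' -> vder x y.
Proof. by move=> e dx i; apply: cder_eq (dx i) => t; rewrite e. Qed.

Lemma vder_vcont k (x x' : R -> 'cV[C]_k) : vder x x' -> vcont x.
Proof. by move=> dx i; exact: cder_ccont (dx i). Qed.

Lemma vderD k (x x' y y' : R -> 'cV[C]_k) : vder x x' -> vder y y' ->
  vder (fun t => x t + y t) (fun t => x' t + y' t).
Proof.
move=> dx dy i; rewrite (_ : (fun t => _) = fun t => x t i 0 + y t i 0).
  by apply: cder_eq (cderD (dx i) (dy i)) => t; rewrite mxE.
by apply/funext => t; rewrite mxE.
Qed.

Lemma vderM k l (A : 'M[C]_(l, k)) (x x' : R -> 'cV[C]_k) : vder x x' ->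
  vder (fun t => A *m x t) (fun t => A *m x' t).
Proof.
move=> dx i; rewrite (_ : (fun t => _) = fun t => \sum_j A i j * x t j 0).
  apply: cder_eq (cder_sum (index_enum _) (fun j => cderZ (A i j) (dx j))) => t.
  by rewrite mxE.
by apply/funext => t; rewrite mxE.
Qed.

Definition mxcn k l (A : 'M[C]_(k, l)) : R := \sum_i \sum_j cn (A i j).

Lemma mxcn_ge0 k l (A : 'M[C]_(k, l)) : 0 <= mxcn A.
Proof. by apply: sumr_ge0 => i _; apply: sumr_ge0 => j _; exact: cn_ge0. Qed.

Lemma vboundM k l (A : 'M[C]_(l, k)) (x : R -> 'cV[C]_k) M : 0 <= M -> vbound M x ->
  vbound (mxcn A * M) (fun t => A *m x t).
Proof.
move=> M0 bx t i; rewrite mxE (le_trans (cn_sum _ _)) //.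
apply: (@le_trans _ _ (\sum_j cn (A i j) * M)).
  by apply: ler_sum => j _; rewrite (le_trans (cnM _ _)) // ler_wpM2l ?cn_ge0.
rewrite -mulr_suml ler_wpM2r // /mxcn (bigD1 i) //= lerDl.
by apply: sumr_ge0 => a _; apply: sumr_ge0 => j _; exact: cn_ge0.
Qed.

Lemma vboundD k (x y : R -> 'cV[C]_k) M N : vbound M x -> vbound N y ->
  vbound (M + N) (fun t => x t + y t).
Proof. by move=> bx by' t i; rewrite mxE (le_trans (cnD _ _)) // lerD. Qed.

Fixpoint root_prod k (A : 'M[C]_k) (rs : seq C) : 'M[C]_k :=
  if rs is z :: rs' then (A - z%:M) *m root_prod A rs' else 1%:M.

Lemma root_prod_comm k (A : 'M[C]_k) rs : A *m root_prod A rs = root_prod A rs *m A.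
Proof.
elim: rs => [|z rs IH] /=; first by rewrite mul1mx mulmx1.
have e : A *m (A - z%:M) = (A - z%:M) *m A by rewrite mulmxBr mulmxBl scalar_mxC.
by rewrite mulmxA e -!mulmxA IH.
Qed.

(* With [chi = prod (X - z_j)], the telescoping of [chi(d/dt) - chi(A)] solves
   [x' = A x + f] up to the error [chi(A) y]. *)
Lemma root_prod_solve k (A : 'M[C]_k) rs : (forall z, z \in rs -> nonres z) ->
  exists2 K : R, 0 <= K & forall f, vcont f -> vper f -> exists x y,
    [/\ vder x (fun t => A *m x t + f t - root_prod A rs *m y t), vper x, vper y, vcont y
      & forall M, 0 <= M -> vbound M f -> vbound (K * M) x /\ vbound (K * M) y].
Proof.
elim: rs => [|z rs IH] nr.
  exists 1 => // f cf pf; exists (fun=> 0), f; split=> //.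
  - move=> i; rewrite (_ : (fun t => _) = fun=> 0); last by apply/funext => t; rewrite mxE.
    by apply: cder_eq (cder_cst 0) => t /=; rewrite mulmx0 add0r mul1mx subrr mxE.
  - by move=> M M0 fM; rewrite mul1r; split=> // t i; rewrite mxE cn0.
have [|K K0 hK] := IH; first by move=> y yrs; apply: nr; rewrite inE yrs orbT.
have [|K1 K10 hK1] := @scalar_solve R z; first by apply: nr; rewrite inE eqxx.
pose B := root_prod A rs.
exists (K + mxcn B * (K1 * K) + K1 * K); first by rewrite !addr_ge0 ?mulr_ge0 ?mxcn_ge0.
move=> f cf pf; have [x1 [y1 [dx1 px1 py1 cy1 b1]]] := hK f cf pf.
have /choice[y2 hy2] i := hK1 (fun t => y1 t i 0) (cy1 i) (fun t => congr1 (fun v : 'cV[C]_k => v i 0) (py1 t)).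
pose y t := \col_i y2 i t.
have dy : vder y (fun t => z *: y t + y1 t).
  move=> i; rewrite (_ : (fun t => y t i 0) = y2 i); last by apply/funext => t; rewrite mxE.
  by have [d _ _] := hy2 i; apply: cder_eq d => t; rewrite !mxE.
(* Since y' = z y + y1, adding [B *m y] to [x1] replaces the error [B *m y1] by [(A - z) B y], which
   is the error for the longer list. *)
exists (fun t => x1 t + B *m y t), y; split.
- apply: vder_eq (vderD dx1 (vderM B dy)) => t /=.
  have e (a b c d e : 'cV[C]_k) : a + e - d + (c + d) = a + b + e - (b - c).
    by apply/colP => i; rewrite !mxE; ring.
  rewrite -/B !mulmxDr !mulmxBl -scalemxAr mul_scalar_mx !mulmxA -scalemxAl.
  exact: e.
- by move=> t; rewrite px1; congr (_ + _ *m _); apply/colP => i; rewrite !mxE; have [_ p _] := hy2 i; exact: p.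
- by move=> t; apply/colP => i; rewrite !mxE; have [_ p _] := hy2 i; exact: p.
- exact: vder_vcont dy.
- move=> M M0 fM; have [b11 b12] := b1 M M0 fM.
  have by' : vbound (K1 * (K * M)) y.
    by move=> t i; rewrite mxE; have [_ _ b] := hy2 i; apply: b => s; exact: b12.
  have KM : 0 <= K1 * (K * M) by rewrite !mulr_ge0.
  split=> t i.
    apply: le_trans (vboundD b11 (vboundM B KM by') t i) _.
    by rewrite !mulrDl !mulrA lerDl !mulr_ge0.
  rewrite (le_trans (by' t i)) // !mulrDl !mulrA lerDr addr_ge0 ?mulr_ge0 ?mxcn_ge0 //.
Qed.

(** Peels off one factor at a time: [root_prod A rs *m x] is again a solution, and as [A - z]
    annihilates it, it solves the scalar equation with the nonresonant exponent [z]. *)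
Lemma root_prod_uniq k (A : 'M[C]_k) rs (x : R -> 'cV[C]_k) : (forall z, z \in rs -> nonres z) ->
  vder x (fun t => A *m x t) -> vper x -> (forall t, root_prod A rs *m x t = 0) ->
  forall t, x t = 0.
Proof.
move=> + dx px; elim: rs => [|z rs IH] nr; first by move=> h t; rewrite -[x t]mul1mx h.
move=> h; apply: IH => [y yrs|t]; first by apply: nr; rewrite inE yrs orbT.
pose w t := root_prod A rs *m x t.
have dw : vder w (fun t => z *: w t).
  apply: vder_eq (vderM (root_prod A rs) dx) => s.
  rewrite mulmxA -root_prod_comm -mulmxA -mul_scalar_mx; apply/eqP.
  by rewrite -subr_eq0 -mulmxBl mulmxA h.
apply/colP => i; rewrite [RHS]mxE; apply: (@scalar_uniq R z (fun t => w t i 0)).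
- by apply: nr; rewrite inE eqxx.
- by apply: cder_eq (dw i) => s; rewrite mxE.
- by move=> s; rewrite /w px.
Qed.

(** Cayley-Hamilton for the characteristic polynomial, split over the algebraically closed field.
    With these roots the error term of [root_prod_solve] vanishes, which takes the place of a Jordan
    form. *)
Lemma root_prod_char_poly k (A : 'M[C]_k) : exists2 rs : seq C,
  (forall z, z \in rs -> eigenvalue A z) & root_prod A rs = 0.
Proof.
case: k A => [|k] A; first by exists [::] => //; apply/matrixP => -[].
have [rs ers] := closed_field_poly_normal (char_poly A).
rewrite (monicP (char_poly_monic A)) scale1r in ers.
exists rs => [z zrs|].
  by rewrite eigenvalue_root_char ers root_prod_XsubC.
have := Cayley_Hamilton A; rewrite ers rmorph_prod /= => <-.
elim: rs {ers} => [|z rs IH] /=; first by rewrite big_nil.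
by rewrite big_cons IH rmorphB /= horner_mx_X horner_mx_C.
Qed.

End VectorCurves.

(** * The mode equations: critical plane, hyperbolic block and phase direction *)

Section FloquetModes.
Context {R : realType} {k : nat}.
Notation C := R[i].
Notation n := (2 + k + 1)%N.
Variable D : ns_data R k.
Hypothesis hD : neimark_sacker D.

Let w0 := omega_star D.
Local Notation rc := (real_complex R).

(** Names for the block positions: the two critical coordinates, the [k] hyperbolic ones and the
    last coordinate, tangent to the orbit. *)
Definition ix1 : 'I_n := lshift 1 (lshift k (ord0 : 'I_2)).
Definition ix2 : 'I_n := lshift 1 (lshift k (ord_max : 'I_2)).
Definition ixm (j : 'I_k) : 'I_n := lshift 1 (rshift 2 j).
Definition ixn : 'I_n := rshift (2 + k) (ord0 : 'I_1).

Variant ix_spec : 'I_n -> Type :=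
  | Ix1 : ix_spec ix1 | Ix2 : ix_spec ix2 | Ixm j : ix_spec (ixm j) | Ixn : ix_spec ixn.

Lemma ixP i : ix_spec i.
Proof.
case: (split_ordP i) => [j|j] ->; last by rewrite ord1; exact: Ixn.
case: (split_ordP j) => [a|a] ->; last exact: Ixm.
case: a => -[|[|//]] ha.
  by rewrite (_ : Ordinal ha = ord0); [exact: Ix1|exact/val_inj].
by rewrite (_ : Ordinal ha = ord_max); [exact: Ix2|exact/val_inj].
Qed.

Definition EC : 'M[C]_n := map_mx rc (Emat D (lambda_star D)).

Definition ECt : 'M[C]_k := map_mx rc (Etilde D (lambda_star D)).

Definition midpart (c : 'cV[C]_n) : 'cV[C]_k := \col_j c (ixm j) 0.

Lemma EC_mul (c : 'cV[C]_n) : EC *m c = \col_i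
  (if i == ix1 then - rc w0 * c ix2 0 else if i == ix2 then rc w0 * c ix1 0 else
   if i == ixn then 0 else (col_mx (col_mx 0 (ECt *m midpart c)) 0 : 'cV_n) i 0).
Proof.
rewrite -[in LHS](vsubmxK c) -[in LHS](vsubmxK (usubmx c)) /EC /Emat.
rewrite !map_block_mx !map_mx0 !mul_block_col !mul0mx !addr0 !add0r.
apply/colP => i; rewrite [RHS]mxE; case: (ixP i).
- rewrite eqxx /ix1 !col_mxEu !mxE !big_ord_recl big_ord0 !mxE /= (ns_alphaR_star hD).
  rewrite rmorph0 mul0r add0r addr0 rmorphN; congr (_ * c _ 0); exact/val_inj.
- rewrite /= /ix2 !col_mxEu !mxE !big_ord_recl big_ord0 !mxE /= (ns_alphaR_star hD).
  rewrite rmorph0 mul0r !addr0; congr (_ * c _ 0); exact/val_inj.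
- move=> j; rewrite /= /ixm !col_mxEu !col_mxEd eq_lrshift; congr ((_ *m _) _ _).
  by apply/colP => a; rewrite !mxE.
- by rewrite /= eqxx /ixn col_mxEd mxE.
Qed.

Lemma EC_ix1 (c : 'cV[C]_n) : (EC *m c) ix1 0 = - rc w0 * c ix2 0.
Proof. by rewrite EC_mul mxE eqxx. Qed.
Lemma EC_ix2 (c : 'cV[C]_n) : (EC *m c) ix2 0 = rc w0 * c ix1 0.
Proof. by rewrite EC_mul mxE ?eqxx. Qed.
Lemma EC_ixn (c : 'cV[C]_n) : (EC *m c) ixn 0 = 0.
Proof. by rewrite EC_mul mxE ?eqxx. Qed.
Lemma EC_ixm (c : 'cV[C]_n) j : (EC *m c) (ixm j) 0 = (ECt *m midpart c) j 0.
Proof. by rewrite EC_mul mxE /= /ixm eq_lrshift col_mxEu col_mxEd. Qed.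

(** The row vector (1, i), padded by zeros, is an eigenvector of [Emat] at the bifurcation with
    eigenvalue i omega, and the imaginary parts of the Floquet exponents lie below 1/2. *)
Lemma omega_lt_half : w0 < 2^-1.
Proof.
suff h : eigenvalue (map_mx rc (Emat D (lambda_star D))) (Complex 0 w0).
  by have /andP[_] := ns_floquet_exponents hD h.
apply/eigenvalueP.
exists (row_mx (row_mx (\row_j (if j == ord0 then 1 else Complex 0 1)) 0) 0 : 'rV[C]_n).
  rewrite /Emat !map_block_mx !map_mx0 !mul_row_block !mul0mx !mulmx0 !addr0.
  rewrite !scale_row_mx !scaler0; congr (row_mx (row_mx _ _) _).
  apply/rowP => j; rewrite !mxE !big_ord_recl big_ord0 !mxE /= (ns_alphaR_star hD).
  case: j => -[|[|//]] hj /=; rewrite ?mul0r ?mulr0 ?add0r ?addr0.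
    by rewrite -/w0; simpc.
  by rewrite -/(omega_star D) -/w0 rmorphN /=; simpc.
apply/eqP => /rowP/(_ ix1); rewrite /ix1 !row_mxEl !mxE /= => /eqP.
by rewrite oner_eq0.
Qed.

Hypothesis h13 : w0 != 3^-1.
Hypothesis h14 : w0 != 4^-1.

(** The frequencies met are [j * w0] with [j] at most 4, so they stay below 2 and could be resonant
    only at 1. For [j = 1, 2] this is excluded by [w0 < 2^-1], for [j = 3, 4] by the two hypotheses
    on [w0]. *)
Lemma nonres_multiple (j : nat) (s : R) : (0 < j <= 4)%N -> `|s| = j%:R * w0 -> nonres (Complex 0 s).
Proof.
move=> j14 hs; have w00 := ns_omega_gt0 hD; rewrite -/w0 in w00.
have wh := omega_lt_half.
have h3 : 3 * w0 != 1 by apply: contra h13 => /eqP h; apply/eqP; lra.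
have h4 : 4 * w0 != 1 by apply: contra h14 => /eqP h; apply/eqP; lra.
by apply: nonres_imag; case: j j14 hs => [|[|[|[|[|]]]]] //= _ ->;
  try (by apply/andP; split; lra); try (by apply: lt_eqF; lra) => //; rewrite ?mul1r // lt_eqF; lra.
Qed.

(** Shifting by an imaginary number keeps the real parts of the eigenvalues, which are nonzero by
    hyperbolicity; hence all roots of the characteristic polynomial are nonresonant. *)
Lemma mid_shift_solve (m : nat) : let A := ECt - (Complex 0 (m%:R * w0))%:M in
  (exists2 K : R, 0 <= K & forall f : R -> 'cV[C]_k, vcont f -> vper f -> exists x,
    [/\ vder x (fun t => A *m x t + f t), vper x
      & forall M, 0 <= M -> vbound M f -> vbound (K * M) x])
  /\ forall x : R -> 'cV[C]_k, vder x (fun t => A *m x t) -> vper x -> forall t, x t = 0.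
Proof.
move=> A; have [rs rsE rs0] := root_prod_char_poly A.
have nr z : z \in rs -> nonres z.
  move=> /rsE/eigenvalueP[v vA v0]; apply: nonres_hyperbolic.
  have := @ns_Etilde_hyperbolic _ _ _ hD (z + Complex 0 (m%:R * w0)).
  rewrite (_ : complex.Re (z + _) = complex.Re z); last by case: (z) => a b /=; rewrite addr0.
  apply; apply/eigenvalueP; exists v => //.
  by rewrite scalerDl -vA mulmxBr mul_mx_scalar subrK.
split.
  have [K K0 hK] := root_prod_solve A nr; exists K => // f cf pf.
  have [x [y [dx px _ _ b]]] := hK f cf pf; exists x; split=> //.
    by apply: vder_eq dx => t; rewrite rs0 mul0mx subr0.
  by move=> M M0 fM; case: (b M M0 fM).
by move=> x dx px; apply: (root_prod_uniq nr dx px) => t; rewrite rs0 mul0mx.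
Qed.

(** The eigenvector of the critical block for i omega. The real part of e^(i phi) times it is
    [astar], so its complex multiples in mode 1 are the combinations of [astar] and [dastar]. *)
Definition rvec : 'cV[C]_n :=
  \col_i (if i == ix1 then 1 else if i == ix2 then Complex 0 (-1) else 0).
Definition nvec : 'cV[C]_n := \col_i (if i == ixn then 1 else 0).

(** The two scalars act like Lagrange multipliers: [tau1] absorbs the average along the critical
    eigenvector and [tau0] the one along the last coordinate. [mode_norm] frees each of them only in
    its resonant mode, where an average of [c] is prescribed in exchange. *)
Definition mode_eq (m : nat) (c f : R -> 'cV[C]_n) (tau1 tau0 : C) :=
  vder c (fun t => EC *m c t - Complex 0 (m%:R * w0) *: c t + f t
    - tau1 *: rvec - tau0 *: nvec).

Definition mode_norm (m : nat) (c : R -> 'cV[C]_n) (tau1 tau0 : C) :=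
  (if m == 1%N then cavg (fun t => c t ix1 0 + Complex 0 1 * c t ix2 0) = 0 else tau1 = 0) /\
  (if m == 0%N then cavg (fun t => c t ixn 0) = 0 else tau0 = 0).

(** Exponents of mode [m] after diagonalization: on c1 + i c2, on c1 - i c2 and on the last
    coordinate. *)
Let muu (m : nat) : C := Complex 0 ((1 - m%:R) * w0).
Let muw (m : nat) : C := Complex 0 (- ((1 + m%:R) * w0)).
Let mul (m : nat) : C := Complex 0 (- (m%:R * w0)).

Lemma muu_cond m : (m <= 3)%N -> if m == 1%N then muu m = 0 else nonres (muu m).
Proof.
have w00 := ns_omega_gt0 hD; rewrite -/w0 in w00.
case: m => [|[|[|[|//]]]] _ /=.
- by apply: (@nonres_multiple 1) => //; rewrite subr0 !mul1r gtr0_norm.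
- by rewrite /muu subrr mul0r.
- by apply: (@nonres_multiple 1) => //; rewrite (_ : (1 - 2) * w0 = - w0) ?normrN ?gtr0_norm ?mul1r //; ring.
- apply: (@nonres_multiple 2) => //; rewrite (_ : (1 - 3) * w0 = - (2 * w0)); last by ring.
  by rewrite normrN gtr0_norm // mulr_gt0.
Qed.

(** The frequency [4 * w0] occurs here, at [m = 3]; [3 * w0] occurs here at [m = 2] and in
    [mul_cond] at [m = 3]. *)
Lemma muw_cond m : (m <= 3)%N -> nonres (muw m).
Proof.
move=> m3; have w00 := ns_omega_gt0 hD; rewrite -/w0 in w00.
apply: (@nonres_multiple m.+1) => //.
by rewrite normrN nat1r gtr0_norm // mulr_gt0.
Qed.

Lemma mul_cond m : (m <= 3)%N -> if m == 0%N then mul m = 0 else nonres (mul m).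
Proof.
have w00 := ns_omega_gt0 hD; rewrite -/w0 in w00.
case: m => [|m] m3 /=; first by rewrite /mul mul0r oppr0.
apply: (@nonres_multiple m.+1); first by lia.
by rewrite normrN gtr0_norm // mulr_gt0.
Qed.

(** Inverse of the passage to u = c1 + i c2 and w = c1 - i c2, completed by the hyperbolic block [v]
    and the last coordinate [l]. *)
Definition assemble (u w : C) (v : 'cV[C]_k) (l : C) : 'cV[C]_n :=
  \col_i (if i == ix1 then 2^-1 * (u + w) else if i == ix2 then Complex 0 (-1) * (2^-1 * (u - w))
    else if i == ixn then l else (col_mx (col_mx 0 v) 0 : 'cV_n) i 0).

Lemma assemble1 u w v l : assemble u w v l ix1 0 = 2^-1 * (u + w).
Proof. by rewrite mxE eqxx. Qed.
Lemma assemble2 u w v l : assemble u w v l ix2 0 = Complex 0 (-1) * (2^-1 * (u - w)).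
Proof. by rewrite mxE. Qed.
Lemma assemblen u w v l : assemble u w v l ixn 0 = l.
Proof. by rewrite mxE /= eqxx. Qed.
Lemma assemblem u w v l j : assemble u w v l (ixm j) 0 = v j 0.
Proof. by rewrite mxE /= /ixm eq_lrshift col_mxEu col_mxEd. Qed.

Lemma rvec1 : rvec ix1 0 = 1. Proof. by rewrite mxE eqxx. Qed.
Lemma rvec2 : rvec ix2 0 = Complex 0 (-1). Proof. by rewrite mxE. Qed.
Lemma rvecm j : rvec (ixm j) 0 = 0. Proof. by rewrite mxE. Qed.
Lemma rvecn : rvec ixn 0 = 0. Proof. by rewrite mxE. Qed.
Lemma nvec1 : nvec ix1 0 = 0. Proof. by rewrite mxE. Qed.
Lemma nvec2 : nvec ix2 0 = 0. Proof. by rewrite mxE. Qed.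
Lemma nvecm j : nvec (ixm j) 0 = 0. Proof. by rewrite mxE /ixm eq_lrshift. Qed.
Lemma nvecn : nvec ixn 0 = 1. Proof. by rewrite mxE eqxx. Qed.

Let ii : C := Complex 0 1.
Lemma ii_sq : ii * ii = -1. Proof. by rewrite /ii; simpc. Qed.
Lemma iiN : Complex 0 (-1) = - ii. Proof. by rewrite /ii; simpc. Qed.
Lemma iiM (a : R) : Complex 0 a = ii * rc a. Proof. by rewrite /ii; simpc. Qed.

(** In the coordinates of [assemble] the system decouples: [linear_solve] covers the three scalar
    equations and [mid_shift_solve] the hyperbolic block. *)
Lemma mode_solve m : (m <= 3)%N -> exists2 K : R, 0 <= K &
  forall f : R -> 'cV[C]_n, vcont f -> vper f -> exists c tau1 tau0,
    [/\ mode_eq m c f tau1 tau0, vper c, mode_norm m c tau1 tau0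
      & forall M, 0 <= M -> vbound M f ->
          [/\ vbound (K * M) c, cn tau1 <= K * M & cn tau0 <= K * M]].
Proof.
move=> m3.
have [Ku Ku0 hu] := linear_solve (muu_cond m3).
have [Kw Kw0 hw] := linear_solve (res := false) (muw_cond m3).
have [Kl Kl0 hl] := linear_solve (mul_cond m3).
have [[Km Km0 hm] _] := mid_shift_solve m.
exists (2 * Ku + 2 * Kw + Kl + Km); first by rewrite !addr_ge0 ?mulr_ge0.
move=> f cf pf.
have pfi i : cper (fun t => f t i 0) by move=> t; rewrite pf.
have cu : ccont (fun t => f t ix1 0 + ii * f t ix2 0).
  by apply: ccontD => //; apply: ccontM => //; exact: ccont_cst.
have cw : ccont (fun t => f t ix1 0 + - ii * f t ix2 0).
  by apply: ccontD => //; apply: ccontM => //; exact: ccont_cst.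
have pu' : cper (fun t => f t ix1 0 + ii * f t ix2 0) by move=> t; rewrite pf.
have pw' : cper (fun t => f t ix1 0 + - ii * f t ix2 0) by move=> t; rewrite pf.
have cv : vcont (fun t => midpart (f t)).
  move=> j; rewrite (_ : (fun t => _) = fun t => f t (ixm j) 0) //.
  by apply/funext => t; rewrite mxE.
have pv' : vper (fun t => midpart (f t)) by move=> t; rewrite pf.
have [u [tu [du pu nu bu]]] := hu _ cu pu'.
have [w [tw [dw pw nw bw]]] := hw _ cw pw'.
have [l [tl [dl pl nl bl]]] := hl _ (cf ixn) (pfi ixn).
have [v [dv pv bv]] := hm _ cv pv'.
have mid_as t : midpart (assemble (u t) (w t) (v t) (l t)) = v t.
  by apply/colP => j; rewrite mxE assemblem.
have W2 : (2 : C) != 0 by rewrite pnatr_eq0.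
have muuE : muu m = ii * ((1 - m%:R) * rc w0) by rewrite /muu iiM rmorphM rmorphB rmorph1 rmorph_nat.
have muwE : muw m = - ii * ((1 + m%:R) * rc w0).
  by rewrite /muw iiM rmorphN rmorphM rmorphD rmorph1 rmorph_nat mulrN mulNr.
have mulE : mul m = - ii * (m%:R * rc w0) by rewrite /mul iiM rmorphN rmorphM rmorph_nat mulrN mulNr.
have mE : Complex 0 (m%:R * w0) = ii * (m%:R * rc w0) by rewrite iiM rmorphM rmorph_nat.
have ent (a c g r s : 'cV[C]_n) (z p q : C) i : (a - z *: c + g - p *: r - q *: s) i 0 =
   a i 0 - z * c i 0 + g i 0 - p * r i 0 - q * s i 0 by rewrite !mxE.
have entk (a : 'M[C]_k) (c g : 'cV[C]_k) (z : C) i : ((a - z%:M) *m c + g) i 0 =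
   (a *m c) i 0 - z * c i 0 + g i 0.
  by rewrite mulmxBl mul_scalar_mx; move: (a *m c) => x; rewrite !mxE.
(* The vector [rvec] has [u]-component 2 and [w]-component 0, hence the factor one half in
   [tau1]. *)
exists (fun t => assemble (u t) (w t) (v t) (l t)), (2^-1 * tu), tl; split.
- move=> i; case: (ixP i).
  + rewrite (_ : (fun t => _) = fun t => 2^-1 * (u t + w t)); last first.
      by apply/funext => t; rewrite assemble1.
    apply: cder_eq (cderZ _ (cderD du dw)) => t.
    rewrite ent EC_ix1 assemble1 assemble2 rvec1 nvec1 muuE muwE mE nw iiN.
    by field.
  + rewrite (_ : (fun t => _) = fun t => Complex 0 (-1) * (2^-1 * (u t - w t))); last first.
      by apply/funext => t; rewrite assemble2.
    apply: cder_eq (cderZ _ (cderZ _ (cderB du dw))) => t.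
    rewrite ent EC_ix2 assemble1 assemble2 rvec2 nvec2 muuE muwE mE nw iiN.
    by field : ii_sq.
  + move=> j; rewrite (_ : (fun t => _) = fun t => v t j 0); last first.
      by apply/funext => t; rewrite assemblem.
    apply: cder_eq (dv j) => t.
    rewrite ent EC_ixm mid_as assemblem rvecm nvecm entk [midpart (f t) j 0]mxE.
    by ring.
  + rewrite (_ : (fun t => _) = l); last by apply/funext => t; rewrite assemblen.
    apply: cder_eq dl => t.
    rewrite ent EC_ixn assemblen rvecn nvecn mulE mE.
    by ring.
- by move=> t; rewrite pu pw pv pl.
- split; last first.
    by case: eqP nl => // _ nl; rewrite -nl; congr cavg; apply/funext => t; rewrite assemblen.
  case: eqP nu => [_ nu|_ ->]; last by rewrite mulr0.
  rewrite -nu; congr cavg; apply/funext => t; rewrite assemble1 assemble2 iiN -/ii.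
  by field : ii_sq.
- have cnii : cn ii = 1 by rewrite /cn /= normr0 normr1 add0r.
  have cnh : cn (2^-1 : C) <= 1.
    have -> : (2^-1 : C) = rc 2^-1 by rewrite fmorphV rmorph_nat.
    by rewrite /cn /= normr0 addr0 ger0_norm ?invr_ge0 // invf_le1 // ler1n.
  have cnh' (x : C) : cn (2^-1 * x) <= cn x.
    by rewrite (le_trans (cnM _ _)) // ler_piMl // cn_ge0.
  have cni (x : C) : cn (ii * x) <= cn x by rewrite (le_trans (cnM _ _)) // cnii mul1r.
  move=> M M0 fM.
  have [btu bu'] : cn tu <= Ku * (2 * M) /\ forall t, cn (u t) <= Ku * (2 * M).
    apply: bu => t; rewrite (le_trans (cnD _ _)) // mulr_natl mulr2n lerD //.
    by rewrite (le_trans (cni _)).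
  have [_ bw'] : cn tw <= Kw * (2 * M) /\ forall t, cn (w t) <= Kw * (2 * M).
    apply: bw => t; rewrite (le_trans (cnD _ _)) // mulr_natl mulr2n lerD //.
    by rewrite mulNr cnN (le_trans (cni _)).
  have [btl bl'] := bl M (fM ^~ ixn).
  have bv' : vbound (Km * M) v by apply: bv => // t j; rewrite mxE; exact: fM.
  have q1 : 0 <= Ku * M by rewrite mulr_ge0.
  have q2 : 0 <= Kw * M by rewrite mulr_ge0.
  have q3 : 0 <= Kl * M by rewrite mulr_ge0.
  have q4 : 0 <= Km * M by rewrite mulr_ge0.
  split.
  + move=> t i; case: (ixP i).
    * rewrite assemble1 (le_trans (cnh' _)) // (le_trans (cnD _ _)) //.
      by have := bu' t; have := bw' t; lra.
    * rewrite assemble2 iiN mulNr cnN (le_trans (cni _)) // (le_trans (cnh' _)) // (le_trans (cnB _ _)) //.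
      by have := bu' t; have := bw' t; lra.
    * by move=> j; rewrite assemblem; have := bv' t j; lra.
    * by rewrite assemblen; have := bl' t; lra.
  + by rewrite (le_trans (cnh' _)) //; lra.
  + by lra.
Qed.

Lemma mode_uniq m (c : R -> 'cV[C]_n) tau1 tau0 : (m <= 3)%N ->
  mode_eq m c (fun=> 0) tau1 tau0 -> vper c -> mode_norm m c tau1 tau0 ->
  [/\ forall t, c t = 0, tau1 = 0 & tau0 = 0].
Proof.
move=> m3 dc pc [n1 n0].
pose u t := c t ix1 0 + ii * c t ix2 0.
pose w t := c t ix1 0 - ii * c t ix2 0.
have muuE : muu m = ii * ((1 - m%:R) * rc w0) by rewrite /muu iiM rmorphM rmorphB rmorph1 rmorph_nat.
have muwE : muw m = - ii * ((1 + m%:R) * rc w0).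
  by rewrite /muw iiM rmorphN rmorphM rmorphD rmorph1 rmorph_nat mulrN mulNr.
have mulE : mul m = - ii * (m%:R * rc w0) by rewrite /mul iiM rmorphN rmorphM rmorph_nat mulrN mulNr.
have mE : Complex 0 (m%:R * w0) = ii * (m%:R * rc w0) by rewrite iiM rmorphM rmorph_nat.
have ent (a b r s : 'cV[C]_n) (z p q : C) i : (a - z *: b + 0 - p *: r - q *: s) i 0 =
   a i 0 - z * b i 0 - p * r i 0 - q * s i 0 by rewrite !mxE addr0.
have [t10 u0] : 2 * tau1 = 0 /\ forall t, u t = 0.
  apply: (linear_uniq (muu_cond m3)).
  - apply: cder_eq (cderD (dc ix1) (cderZ ii (dc ix2))) => t.
    rewrite !ent EC_ix1 EC_ix2 rvec1 rvec2 nvec1 nvec2 muuE mE iiN /u.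
    by ring : ii_sq.
  - by move=> t; rewrite /u pc.
  - by case: eqP n1 => // _ ->; rewrite mulr0.
have {}t10 : tau1 = 0 by move/eqP: t10; rewrite mulf_eq0 pnatr_eq0 => /eqP.
have [_ w00] : 0 = 0 :> C /\ forall t, w t = 0.
  apply: (linear_uniq (res := false) (muw_cond m3)) => //.
  - apply: cder_eq (cderB (dc ix1) (cderZ ii (dc ix2))) => t.
    rewrite !ent EC_ix1 EC_ix2 rvec1 rvec2 nvec1 nvec2 muwE mE iiN /w.
    by ring : ii_sq.
  - by move=> t; rewrite /w pc.
have [t00 l0] : tau0 = 0 /\ forall t, c t ixn 0 = 0.
  apply: (linear_uniq (mul_cond m3)) => //; last by move=> t; rewrite pc.
  apply: cder_eq (dc ixn) => t; rewrite ent EC_ixn rvecn nvecn mulE mE.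
  by ring.
have v0 : forall t, midpart (c t) = 0.
  have [_] := mid_shift_solve m; apply.
    move=> j; rewrite (_ : (fun t => _) = fun t => c t (ixm j) 0); last first.
      by apply/funext => t; rewrite mxE.
    apply: cder_eq (dc (ixm j)) => t; rewrite ent EC_ixm rvecm nvecm.
    rewrite mulmxBl mul_scalar_mx !mulr0 !subr0; move: (ECt *m _) => x.
    by rewrite !mxE.
  by move=> t; rewrite pc.
have W2 : (2 : C) != 0 by rewrite pnatr_eq0.
split=> // t; apply/colP => i; rewrite [RHS]mxE; case: (ixP i).
- have e : 2 * c t ix1 0 = u t + w t by rewrite /u /w; ring.
  by apply: (mulfI W2); rewrite mulr0 e u0 w00 addr0.
- have e : 2 * c t ix2 0 = - ii * (u t - w t) by rewrite /u /w; ring : ii_sq.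
  by apply: (mulfI W2); rewrite mulr0 e u0 w00 subrr mulr0.
- by move=> j; have /colP/(_ j) := v0 t; rewrite !mxE.
- exact: l0.
Qed.

End FloquetModes.

(** * Circle integrals depending on a parameter *)

Section TorusFunctions.
Context {R : realType}.
Notation C := R[i].

Definition tcont n (g : R -> R -> 'cV[R]_n) : Prop :=
  [/\ continuous (fun p : R * R => g p.1 p.2), forall phi, periodic (g ^~ phi) (2 * pi)
    & forall theta, periodic (g theta) (2 * pi)].

Lemma continuous_slice2 (f : R * R -> R) (t : R) : continuous f -> continuous (fun s => f (t, s)).
Proof.
move=> cf s; apply: (@continuous_comp _ _ _ (fun s => (t, s)) f); last exact: cf.
apply: (@Ck_continuous _ _ _ 0 setT) => //.
by apply: Ck_pair; [exact: Ck_cst|exact: Ck_id].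
Qed.

Lemma rect_bound (f : R * R -> R) (a b : R) : continuous f ->
  exists2 M, 0 <= M & forall p : R * R, p.1 \in `[a, b] -> 0 <= p.2 <= 2 * pi -> `|f p| <= M.
Proof.
move=> cf.
have cK : compact (`[a, b]%classic `*` `[0, 2 * pi]%classic : set (R * R)).
  by apply: compact_setX; exact: segment_compact.
have [M M0 hM] := compact_bound cK (fun p _ => cf p).
exists M; first exact: M0.
by move=> p p1 p2; apply: (hM p); split=> //=; rewrite in_itv.
Qed.

(** Dominated convergence: for parameters near [t] the integrand is bounded by a constant, by
    compactness of a rectangle. *)
Lemma circle_int_param_continuous (f : R -> R -> R) :
  continuous (fun p : R * R => f p.1 p.2) -> continuous (fun t => circle_int (f t)).
Proof.
move=> cf t.
have [M M0 hM] := rect_bound (t - 1) (t + 1) cf.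
have ht : t \in `]t - 1, t + 1[ by rewrite in_itv /=; lra.
have int_f x : (`]t - 1, t + 1[%classic : set R) x ->
    (@lebesgue_measure R).-integrable `[0, 2 * pi] (EFin \o f x).
  by move=> _; apply: continuous_integrable; exact: (continuous_slice2 (f := fun p => f p.1 p.2)).
have cfa : {ae (@lebesgue_measure R), forall y, (`[0, 2 * pi]%classic : set R) y ->
    {in (`]t - 1, t + 1[%classic : set R), continuous (f ^~ y)}}.
  apply: aeW => y _ x _; apply: (@continuous_comp _ _ _ (fun x => (x, y)) (fun p => f p.1 p.2)); last exact: cf.
  apply: (@Ck_continuous _ _ _ 0 setT) => //.
  by apply: Ck_pair; [exact: Ck_id|exact: Ck_cst].
have int_M : (@lebesgue_measure R).-integrable `[0, 2 * pi] (EFin \o (fun=> M)).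
  by apply: continuous_integrable => x; exact: cvg_cst.
have ub x : (`]t - 1, t + 1[%classic : set R) x ->
    {ae (@lebesgue_measure R), forall y, (`[0, 2 * pi]%classic : set R) y -> `|f x y| <= M}.
  move=> xI; apply: aeW => y yI; apply: (hM (x, y)) => /=.
    by apply: subset_itv_oo_cc.
  by move: yI; rewrite /= in_itv.
have mI : measurable (`[0, 2 * pi]%classic : set R) by exact: measurable_itv.
have h := @continuity_under_integral R _ _ (@lebesgue_measure R) f _ mI _ _ int_f cfa _ int_M ub.
by apply: (h t); rewrite inE.
Qed.

(** The dominating function is the constant that bounds [f'] on a compact rectangle around [t]. *)
Lemma circle_int_param_derive (f f' : R -> R -> R) :
  continuous (fun p : R * R => f p.1 p.2) -> continuous (fun p : R * R => f' p.1 p.2) ->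
  (forall t s, is_derive t (1 : R) (f ^~ s) (f' t s)) ->
  forall t, is_derive t (1 : R) (fun t => circle_int (f t)) (circle_int (f' t)).
Proof.
move=> cf cf' df t.
have [M M0 hM] := rect_bound (t - 1) (t + 1) cf'.
have ht : (`]t - 1, t + 1[%classic : set R) t by rewrite /= in_itv /=; lra.
have int_f x : (`]t - 1, t + 1[%classic : set R) x ->
    (@lebesgue_measure R).-integrable `[0, 2 * pi] (EFin \o f x).
  by move=> _; apply: continuous_integrable; exact: (continuous_slice2 (f := fun p => f p.1 p.2)).
have df1 (x y : R) : (`]t - 1, t + 1[%classic : set R) x -> (`[0, 2 * pi]%classic : set R) y ->
    derivable (f ^~ y) x 1.
  by move=> _ _; have h := df x y; exact: ex_derive.
have int_M : (@lebesgue_measure R).-integrable `[0, 2 * pi] (EFin \o (fun=> M)).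
  by apply: continuous_integrable => x; exact: cvg_cst.
have ub (x y : R) : (`]t - 1, t + 1[%classic : set R) x -> (`[0, 2 * pi]%classic : set R) y ->
    `|partial1of2 f x y| <= M.
  move=> xI yI; rewrite partial1of2E (@derive_val _ _ _ _ _ _ _ (df x y)).
  by apply: (hM (x, y)) => /=; [exact: subset_itv_oo_cc | move: yI; rewrite /= in_itv].
have mI : measurable (`[0, 2 * pi]%classic : set R) by exact: measurable_itv.
have h1 := @derivable_under_integral R _ _ (@lebesgue_measure R) f _ mI _ _ _ ht int_f df1 _ (fun=> M0) int_M ub.
have h2 := @differentiation_under_integral R _ _ (@lebesgue_measure R) f _ mI _ _ _ ht int_f df1 _ (fun=> M0) int_M ub.
apply: (DeriveDef h1); rewrite -derive1E h2; congr Rintegral.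
by apply/funext => y; rewrite partial1of2E (@derive_val _ _ _ _ _ _ _ (df t y)).
Qed.

End TorusFunctions.

(** * Fourier modes in phi *)

Section FourierModes.
Context {R : realType} {n : nat}.
Notation C := R[i].
Implicit Types (z g : R -> R -> 'cV[R]_n) (c : nat -> R -> 'cV[C]_n).

Lemma is_derive_mx (V : normedModType R) a b (M : V -> 'M[R]_(a, b)) (N : 'M[R]_(a, b)) (x v : V) :
  (forall i j, is_derive x v (fun t => M t i j) (N i j)) -> is_derive x v M N.
Proof.
move=> dM; have h : derivable M x v.
  by apply/derivable_mxP => i j; have h := dM i j; exact: ex_derive.
apply: DeriveDef => //; rewrite derive_mx //; apply/matrixP => i j; rewrite mxE.
by have h' := dM i j; exact: derive_val.
Qed.

Lemma is_derive_coord (V : normedModType R) a b (M : V -> 'M[R]_(a, b)) (N : 'M[R]_(a, b)) (x v : V) i j :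
  is_derive x v M N -> is_derive x v (fun t => M t i j) (N i j).
Proof.
move=> dM; have h : derivable M x v by exact: ex_derive.
apply: DeriveDef; first by move/derivable_mxP: h.
by rewrite -(@derive_val _ _ _ _ _ _ _ dM) derive_mx // mxE.
Qed.

Definition reV (v : 'cV[C]_n) : 'cV[R]_n := \col_i complex.Re (v i 0).
Definition imV (v : 'cV[C]_n) : 'cV[R]_n := \col_i complex.Im (v i 0).

(* The real trigonometric sum [Re sum_(m < 4) c_m(theta) e^(i m phi)]. *)
Definition tsum c (theta phi : R) : 'cV[R]_n :=
  \sum_(m < 4) (cos (m%:R * phi) *: reV (c m theta) - sin (m%:R * phi) *: imV (c m theta)).

(** The combination a_m - i b_m, for which the real part of its product with e^(i m phi) is the
    [m]-th phi-mode; it turns the real system into one complex equation per mode. *)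
Definition fcoef (m : nat) z (theta : R) : 'cV[C]_n :=
  \col_i Complex (acoef m z theta i 0) (- bcoef m z theta i 0).

Lemma tsumE c theta phi i : tsum c theta phi i 0 =
  \sum_(m < 4) (complex.Re (c m theta i 0) * cos (m%:R * phi) -
    complex.Im (c m theta i 0) * sin (m%:R * phi)).
Proof. by rewrite summxE; apply: eq_bigr => m _; rewrite !mxE mulrC [X in _ - X]mulrC. Qed.

Lemma circle_int_trig (r s : nat -> R) (T : R -> R) : continuous T ->
  circle_int (fun phi : R => (\sum_(j < 4) (r j * cos (j%:R * phi) - s j * sin (j%:R * phi))) * T phi) =
  \sum_(j < 4) (r j * circle_int (fun phi : R => cos (j%:R * phi) * T phi) -
    s j * circle_int (fun phi : R => sin (j%:R * phi) * T phi)).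
Proof.
move=> cT.
have c1 (j : nat) : continuous (fun phi : R => cos (j%:R * phi) * T phi).
  by move=> x; apply: cvgM; [exact: continuous_cosM|exact: cT].
have c2 (j : nat) : continuous (fun phi : R => sin (j%:R * phi) * T phi).
  by move=> x; apply: cvgM; [exact: continuous_sinM|exact: cT].
have cZ (a : R) (f : R -> R) : continuous f -> continuous (fun x : R => a * f x).
  by move=> cf x; apply: cvgM; [exact: cvg_cst|exact: cf].
rewrite (_ : (fun phi : R => _) = fun phi : R => \sum_(j < 4) (r j * (cos (j%:R * phi) * T phi)
    + - s j * (sin (j%:R * phi) * T phi))); last first.
  by apply/funext => phi; rewrite mulr_suml; apply: eq_bigr => j _; ring.
rewrite circle_int_sum; last first.
  by move=> j x; apply: cvgD; [exact: (cZ _ _ (c1 _))|exact: (cZ _ _ (c2 _))].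
apply: eq_bigr => j _; rewrite circle_intD; [|exact: cZ|exact: cZ].
by rewrite !circle_intZ // mulNr.
Qed.

Lemma fourier_weightK m : fourier_weight m * (if m is 0 then 2 * pi else pi) = 1 :> R.
Proof.
have p0 : pi != 0 :> R by rewrite gt_eqF // pi_gt0.
by case: m => [|m] /=; rewrite mulVf // mulf_neq0.
Qed.

Lemma acoef_trig (r s : nat -> R) m : (m < 4)%N ->
  fourier_weight m * circle_int (fun phi : R => (\sum_(j < 4)
    (r j * cos (j%:R * phi) - s j * sin (j%:R * phi))) * cos (m%:R * phi)) = r m.
Proof.
move=> m4; rewrite circle_int_trig; last exact: continuous_cosM.
rewrite (bigD1 (Ordinal m4)) //= circle_int_coscos circle_int_sincos eqxx mulr0 subr0.
rewrite big1 => [|j /negP jm]; first by rewrite addr0 mulrCA fourier_weightK mulr1.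
rewrite circle_int_coscos circle_int_sincos mulr0 subr0.
by case: eqP => [e|]; rewrite ?mulr0 //; case: jm; apply/eqP/val_inj.
Qed.

Lemma bcoef_trig (r s : nat -> R) m : (m < 4)%N ->
  fourier_weight m * circle_int (fun phi : R => (\sum_(j < 4)
    (r j * cos (j%:R * phi) - s j * sin (j%:R * phi))) * sin (m%:R * phi)) =
  if m is 0 then 0 else - s m.
Proof.
move=> m4; rewrite circle_int_trig; last exact: continuous_sinM.
have cs (j l : nat) : circle_int (fun x : R => cos (j%:R * x) * sin (l%:R * x)) = 0.
  by rewrite -(circle_int_sincos l j); congr circle_int; apply/funext => x; rewrite mulrC.
rewrite (bigD1 (Ordinal m4)) //= circle_int_sinsin cs eqxx mulr0 sub0r.
rewrite big1 => [|j /negP jm].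
  rewrite addr0; case: m {m4} => [|m]; first by rewrite mulr0 oppr0 mulr0.
  by rewrite mulrN mulrCA (fourier_weightK m.+1) mulr1.
rewrite circle_int_sinsin cs mulr0 sub0r.
by case: eqP => [e|]; rewrite ?mulr0 ?oppr0 //; case: jm; apply/eqP/val_inj.
Qed.

(** In mode 0 the sine vanishes, so [tsum] forgets the imaginary part of [c 0] and only the real
    part can be recovered. *)
Lemma fcoef_tsum m c theta : (m < 4)%N ->
  fcoef m (tsum c) theta = if m is 0 then \col_i Complex (complex.Re (c 0%N theta i 0)) 0 else c m theta.
Proof.
move=> m4; apply/colP => i; rewrite !mxE.
have := acoef_trig (fun j => complex.Re (c j theta i 0)) (fun j => complex.Im (c j theta i 0)) m4.
have := bcoef_trig (fun j => complex.Re (c j theta i 0)) (fun j => complex.Im (c j theta i 0)) m4.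
under eq_fun do rewrite -tsumE; move=> ->.
under eq_fun do rewrite -tsumE; move=> ->.
case: m m4 => [|m] m4; first by rewrite mxE oppr0.
by rewrite opprK; case: (c _ _ _ _).
Qed.

Lemma phi_modeE m z theta phi : phi_mode m z theta phi =
  cos (m%:R * phi) *: reV (fcoef m z theta) - sin (m%:R * phi) *: imV (fcoef m z theta).
Proof. by apply/colP => i; rewrite !mxE /=; ring. Qed.

Lemma S_infE z theta phi : S_inf 3 z theta phi = tsum (fun m => fcoef m z) theta phi.
Proof. by apply: eq_bigr => m _; exact: phi_modeE. Qed.

Lemma modes0123E z : has_only_phi_modes [:: 0; 1; 2; 3]%N z <->
  z = tsum (fun m => fcoef m z).
Proof.
have e theta phi : \sum_(m <- [:: 0; 1; 2; 3]%N) phi_mode m z theta phi =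
    tsum (fun m => fcoef m z) theta phi.
  by rewrite -S_infE /S_inf -(big_mkord xpredT (fun m => phi_mode m z theta phi)).
split=> [h|h theta phi]; last by rewrite e {1}h.
by apply/funext => theta; apply/funext => phi; rewrite -e; exact: h.
Qed.

Lemma tsum_eq c c' theta phi : (forall m, (m < 4)%N -> reV (c m theta) = reV (c' m theta)) ->
  (forall m, (0 < m < 4)%N -> imV (c m theta) = imV (c' m theta)) ->
  tsum c theta phi = tsum c' theta phi.
Proof.
move=> e1 e2; apply: eq_bigr => -[m m4] _ /=; rewrite e1 //; congr (_ - _).
by case: m m4 => [|m] m4; [rewrite mul0r sin0 !scale0r|rewrite e2].
Qed.

Lemma fcoef_tsum0 c theta phi : tsum (fun m => fcoef m (tsum c)) theta phi = tsum c theta phi.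
Proof.
apply: tsum_eq => [m m4|m /andP[m0 m4]]; rewrite fcoef_tsum //.
  by case: m m4 => [|//] _; apply/colP => i; rewrite !mxE.
by case: m m0 m4.
Qed.

Lemma tsum_modes c : has_only_phi_modes [:: 0; 1; 2; 3]%N (tsum c).
Proof.
by apply/modes0123E/funext => theta; apply/funext => phi; rewrite fcoef_tsum0.
Qed.

Lemma mx_entry_le a b (M : 'M[R]_(a, b)) i j : `|M i j| <= `|M|.
Proof. by rewrite [leRHS]/Num.norm /= mx_normrE; exact: (le_bigmax _ _ (i, j)). Qed.

(** The weight is at most 1/pi and the circle has length 2 pi, whence [2 * M] for each coefficient
    and twice that for the l^1 norm of the complex one. *)
Lemma fcoef_bound m z (theta M : R) : (forall i, continuous (fun phi : R => z theta phi i 0)) ->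
  (forall phi, `|z theta phi| <= M) -> forall i, 
  [/\ `|acoef m z theta i 0| <= 2 * M, `|bcoef m z theta i 0| <= 2 * M
    & cn (fcoef m z theta i 0) <= 4 * M].
Proof.
move=> cz zM i; have p0 := @pi_gt0 R.
have M0 : 0 <= M by exact: le_trans (zM 0).
have b (T : R -> R) : continuous T -> (forall x, `|T x| <= 1) ->
    `|fourier_weight m * circle_int (fun phi : R => z theta phi i 0 * T phi)| <= 2 * M.
  move=> cT T1; rewrite normrM.
  have w0 : 0 <= fourier_weight m :> R.
    by rewrite /fourier_weight; case: (m) => [|_]; rewrite invr_ge0 ?mulr_ge0 // ltW.
  rewrite (ger0_norm w0).
  apply: (@le_trans _ _ (fourier_weight m * (2 * pi * M))).
    rewrite ler_wpM2l // circle_int_le //.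
      by move=> x; apply: cvgM; [exact: cz|exact: cT].
    move=> x _; rewrite normrM -[M]mulr1 ler_pM // (le_trans _ (zM x)) //.
    exact: mx_entry_le.
  have h : fourier_weight m * (2 * pi * M) <= pi^-1 * (2 * pi * M).
    rewrite ler_wpM2r //; first by rewrite !mulr_ge0 // ltW.
    rewrite /fourier_weight; case: (m) => [|_] //.
    by rewrite lef_pV2 ?posrE ?mulr_gt0 //; lra.
  by rewrite (le_trans h) // [2 * pi]mulrC -mulrA mulKf // gt_eqF.
have ha : `|acoef m z theta i 0| <= 2 * M.
  by rewrite mxE b //; [exact: continuous_cosM|move=> x; exact: cos_max].
have hb : `|bcoef m z theta i 0| <= 2 * M.
  by rewrite mxE b //; [exact: continuous_sinM|move=> x; exact: sin_max].
split=> //; rewrite mxE /cn /= normrN; lra.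
Qed.

Lemma continuous_entry z (cz : continuous (fun p : R * R => z p.1 p.2)) i :
  continuous (fun p : R * R => z p.1 p.2 i 0).
Proof.
move=> p; apply: (@continuous_comp _ _ _ (fun p : R * R => z p.1 p.2) (fun M : 'cV[R]_n => M i 0)).
  exact: cz.
exact: coord_continuous.
Qed.

Lemma continuous_slice z (cz : continuous (fun p : R * R => z p.1 p.2)) theta i :
  continuous (fun phi : R => z theta phi i 0).
Proof. exact: (@continuous_slice2 R (fun p => z p.1 p.2 i 0) theta (@continuous_entry z cz i)). Qed.

Lemma continuous_comp_snd (T : R -> R) : continuous T -> continuous (fun p : R * R => T p.2).
Proof.
by move=> cT p; apply: (@continuous_comp _ _ _ snd T); [exact: cvg_snd|exact: cT].
Qed.

Lemma fcoef_vcont m z : continuous (fun p : R * R => z p.1 p.2) -> vcont (fcoef m z).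
Proof.
move=> cz i.
have h (T : R -> R) : continuous T ->
    continuous (fun t => circle_int (fun phi : R => z t phi i 0 * T phi)).
  move=> cT; apply: (@circle_int_param_continuous R (fun t phi => z t phi i 0 * T phi)).
  by move=> p; apply: cvgM; [exact: (continuous_entry cz)|exact: continuous_comp_snd].
split=> t.
- rewrite (_ : (fun s => _) = fun s => fourier_weight m *
    circle_int (fun phi : R => z s phi i 0 * cos (m%:R * phi))).
    apply: cvgM; [exact: cvg_cst|apply: h; exact: continuous_cosM].
  by apply/funext => s; rewrite !mxE.
- rewrite (_ : (fun s => _) = fun s => - (fourier_weight m *
    circle_int (fun phi : R => z s phi i 0 * sin (m%:R * phi)))).
    apply: cvgN; apply: cvgM; [exact: cvg_cst|apply: h; exact: continuous_sinM].
  by apply/funext => s; rewrite !mxE.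
Qed.

Lemma fcoef_vper m z : (forall phi, periodic (z ^~ phi) (2 * pi)) -> vper (fcoef m z).
Proof.
move=> pz t; apply/colP => i; rewrite !mxE.
by congr (Complex (_ * circle_int _) (- (_ * circle_int _))); apply/funext => phi; rewrite (pz phi).
Qed.

Definition dtheta z (theta phi : R) : 'cV[R]_n := derive1 (z ^~ phi) theta.
Definition dphi z (theta phi : R) : 'cV[R]_n := derive1 (z theta) phi.

Lemma torus_C1_dtheta z : torus_C1 z ->
  continuous (fun p : R * R => dtheta z p.1 p.2) /\
  forall theta phi, is_derive theta (1 : R) (z ^~ phi) (dtheta z theta phi).
Proof.
move=> [_ _ [dz cz]].
have h theta phi : is_derive theta (1 : R) (z ^~ phi)
   ('D_((1, 0) : R * R) (fun p : R * R => z p.1 p.2) (theta, phi)).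
  have := @is_derive_line R _ _ (fun p : R * R => z p.1 p.2) (0, phi) (1, 0) theta.
  have -> : ((0, phi) : R * R) + theta *: ((1, 0) : R * R) = (theta, phi).
    by congr pair => /=; [rewrite add0r; exact: mulr1|rewrite scaler0 addr0].
  move=> /(_ (dz _ Logic.I)); congr is_derive.
  by apply/funext => s /=; rewrite add0r scaler0 addr0; congr (z _ phi); exact: mulr1.
have e theta phi : dtheta z theta phi = 'D_((1, 0) : R * R) (fun p : R * R => z p.1 p.2) (theta, phi).
  by rewrite /dtheta derive1E; have hh := h theta phi; exact: derive_val.
split; last by move=> theta phi; rewrite e.
rewrite (_ : (fun p => _) = fun p => 'D_((1, 0) : R * R) (fun p : R * R => z p.1 p.2) p).
  by move=> p; exact: cz.
by apply/funext => -[a b]; rewrite -e.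
Qed.

Lemma torus_C1_continuous z : torus_C1 z -> continuous (fun p : R * R => z p.1 p.2).
Proof. by move=> [_ _ [dz _]] p; exact/differentiable_continuous/dz. Qed.

(** Differentiation under the phi-integral, justified by the joint continuity of [dtheta z]. *)
Lemma fcoef_vder m z : torus_C1 z -> vder (fcoef m z) (fcoef m (dtheta z)).
Proof.
move=> Cz i; have [cd dd] := torus_C1_dtheta Cz; have cz := torus_C1_continuous Cz.
have h (T : R -> R) : continuous T -> forall t,
    is_derive t (1 : R) (fun t => circle_int (fun phi : R => z t phi i 0 * T phi))
     (circle_int (fun phi : R => dtheta z t phi i 0 * T phi)).
  move=> cT; apply: (@circle_int_param_derive R (fun t phi => z t phi i 0 * T phi)
    (fun t phi => dtheta z t phi i 0 * T phi)).
  - by move=> p; apply: cvgM; [exact: (continuous_entry cz)|exact: continuous_comp_snd].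
  - by move=> p; apply: cvgM; [exact: (continuous_entry cd)|exact: continuous_comp_snd].
  - move=> t s; have d1 := is_derive_coord i 0 (dd t s).
    have := is_deriveZ (T s) d1; rewrite [_ *: _]mulrC.
    by congr is_derive; apply/funext => u; exact: mulrC.
move=> t; split.
- rewrite (_ : (fun s => _) = fun s => fourier_weight m *
    circle_int (fun phi : R => z s phi i 0 * cos (m%:R * phi))); last first.
    by apply/funext => s; rewrite !mxE.
  by rewrite !mxE; apply: (is_deriveZ (fourier_weight m) (h _ _ t)); exact: continuous_cosM.
- rewrite (_ : (fun s => _) = fun s => (- fourier_weight m) *
    circle_int (fun phi : R => z s phi i 0 * sin (m%:R * phi))); last first.
    by apply/funext => s; rewrite !mxE mulNr.
  rewrite !mxE /= -mulNr.
  by apply: (is_deriveZ (- fourier_weight m) (h _ _ t)); exact: continuous_sinM.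
Qed.

End FourierModes.

(** * Calculus of trigonometric sums with four phi-modes *)

Section TrigSums.
Context {R : realType} {n : nat}.
Notation C := R[i].
Implicit Types (c d : nat -> R -> 'cV[C]_n).

Lemma tsum_dtheta c c' theta phi : (forall m, vder (c m) (c' m)) ->
  is_derive theta (1 : R) (fun t => tsum c t phi) (tsum c' theta phi).
Proof.
move=> dc; apply: is_derive_mx => i j; rewrite (ord1 j).
rewrite (_ : (fun t => _) = \sum_(m < 4) (fun t => complex.Re (c m t i 0) * cos (m%:R * phi)
   - complex.Im (c m t i 0) * sin (m%:R * phi))); last first.
  by apply/funext => t; rewrite tsumE fct_sumE.
rewrite tsumE; apply: is_derive_sum => m; have [d1 d2] := dc m i theta.
have e1 := is_deriveZ (cos (m%:R * phi)) d1.
have e2 := is_deriveZ (sin (m%:R * phi)) d2.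
have := is_deriveB e1 e2; rewrite ![_ *: _]mulrC.
by congr is_derive; apply/funext => t; congr (_ - _); exact: mulrC.
Qed.

Lemma tsum_dphi c theta phi : is_derive phi (1 : R) (tsum c theta)
  (tsum (fun m t => Complex 0 m%:R *: c m t) theta phi).
Proof.
apply: is_derive_mx => i j; rewrite (ord1 j).
rewrite (_ : (fun t => _) = \sum_(m < 4) (fun t => complex.Re (c m theta i 0) * cos (m%:R * t)
   - complex.Im (c m theta i 0) * sin (m%:R * t))); last first.
  by apply/funext => t; rewrite tsumE fct_sumE.
rewrite tsumE; apply: is_derive_sum => m.
have e1 := is_deriveZ (complex.Re (c m theta i 0)) (is_derive_cosM m%:R phi).
have e2 := is_deriveZ (complex.Im (c m theta i 0)) (is_derive_sinM m%:R phi).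
have := is_deriveB e1 e2; congr is_derive; rewrite /GRing.scale /= mxE.
by case: (c m theta i 0) => a b /=; ring.
Qed.

Lemma tsum_bound c theta phi B : 0 <= B -> (forall m i, (m < 4)%N -> cn (c m theta i 0) <= B) ->
  `|tsum c theta phi| <= 4 * B.
Proof.
move=> B0 cB; apply/mx_normP => [|i j]; first by rewrite mulr_ge0.
rewrite (ord1 j) tsumE (le_trans (ler_norm_sum _ _ _)) //.
rewrite (_ : 4 * B = \sum_(m < 4) B); last by rewrite sumr_const card_ord mulr_natl.
apply: ler_sum => m _; rewrite (le_trans (ler_normB _ _)) // (le_trans _ (cB m i _)) //.
rewrite /cn !normrM lerD // ler_piMr //; [exact: cos_max|exact: sin_max].
Qed.

Lemma Ck1_real (f f' : R -> R) : (forall x, is_derive x (1 : R) f (f' x)) ->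
  continuous f' -> Ck 1 setT f.
Proof.
move=> df cf'; split=> [x _|d].
  by apply/derivable1_diffP; have h := df x; exact: ex_derive.
exists (fun x => d * f' x); last by move=> x _; apply: cvgM; [exact: cvg_cst|exact: cf'].
move=> x _; have dd : differentiable f x.
  by apply/derivable1_diffP; have h := df x; exact: ex_derive.
rewrite deriveE // -[d in LHS]mulr1 -[d * 1]/(d *: (1 : R)) linearZ -deriveE //.
by have h := df x; rewrite (@derive_val _ _ _ _ _ _ _ h).
Qed.

Lemma tsum_periodic_phi c theta : periodic (tsum c theta) (2 * pi).
Proof. by move=> phi; apply: eq_bigr => m _; rewrite cosM2pi sinM2pi. Qed.

Lemma tsum_torus_C1 c c' : (forall m, vder (c m) (c' m)) -> (forall m, vcont (c' m)) ->
  (forall m, vper (c m)) -> torus_C1 (tsum c).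
Proof.
move=> dc cc' pc; split.
- by move=> phi theta; apply: eq_bigr => m _; rewrite pc.
- exact: tsum_periodic_phi.
- apply: Ck_Cdiff; apply: Ck_mx => i j; rewrite (ord1 j).
  rewrite (_ : (fun p => _) = fun p : R * R => \sum_(m < 4) (complex.Re (c m p.1 i 0) * cos (m%:R * p.2)
    + - (complex.Im (c m p.1 i 0) * sin (m%:R * p.2)))); last first.
    by apply/funext => p; rewrite tsumE.
  have R1 (f f' : R -> R) (g : R * R -> R) : (forall x, is_derive x (1 : R) f (f' x)) ->
      continuous f' -> Ck 1 setT g -> Ck 1 setT (fun p => f (g p)).
    move=> df cf' cg; apply: (@Ck_comp _ _ R R 1 setT setT g f) => //; [exact: fin_basisR..|].
    exact: Ck1_real df cf'.
  have id1 := Ck_fst (@Ck_id R _ 1 setT : Ck 1 setT (id : R * R -> R * R)).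
  have id2 := Ck_snd (@Ck_id R _ 1 setT : Ck 1 setT (id : R * R -> R * R)).
  apply: Ck_sum => m; have [c1 c2] := cc' m i.
  apply: Ck_add; last apply: Ck_opp; apply: Ck_mulR.
  + exact: (R1 _ _ _ (fun t => (dc m i t).1) c1 id1).
  + apply: (R1 _ _ _ (is_derive_cosM m%:R) _ id2).
    by move=> x; apply: cvgM; [exact: cvg_cst|exact: continuous_sinM].
  + exact: (R1 _ _ _ (fun t => (dc m i t).2) c2 id1).
  + apply: (R1 _ _ _ (is_derive_sinM m%:R) _ id2).
    by move=> x; apply: cvgM; [exact: cvg_cst|exact: continuous_cosM].
Qed.

Lemma tsumD c d theta phi : tsum (fun m t => c m t + d m t) theta phi =
  tsum c theta phi + tsum d theta phi.
Proof.
apply/colP => i; rewrite mxE !tsumE -big_split; apply: eq_bigr => m _ /=.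
by rewrite !mxE; case: (c _ _ _ _) (d _ _ _ _) => [? ?] [? ?] /=; ring.
Qed.

Lemma tsumN c theta phi : tsum (fun m t => - c m t) theta phi = - tsum c theta phi.
Proof.
apply/colP => i; rewrite mxE !tsumE -sumrN; apply: eq_bigr => m _ /=.
by rewrite !mxE; case: (c _ _ _ _) => [? ?] /=; ring.
Qed.

Lemma tsumZ (a : R) c theta phi : tsum (fun m t => a%:C%C *: c m t) theta phi = a *: tsum c theta phi.
Proof.
apply/colP => i; rewrite mxE !tsumE mulr_sumr; apply: eq_bigr => m _ /=.
by rewrite !mxE; case: (c _ _ _ _) => [? ?] /=; ring.
Qed.

Lemma ReM_real (a : R) (z : C) : complex.Re (a%:C%C * z) = a * complex.Re z.
Proof. by case: z => x y /=; ring. Qed.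
Lemma ImM_real (a : R) (z : C) : complex.Im (a%:C%C * z) = a * complex.Im z.
Proof. by case: z => x y /=; ring. Qed.
Lemma Re_sum (I : Type) (s : seq I) (F : I -> C) :
  complex.Re (\sum_(i <- s) F i) = \sum_(i <- s) complex.Re (F i).
Proof. by apply: (big_morph (@complex.Re R)) => // -[? ?] []. Qed.
Lemma Im_sum (I : Type) (s : seq I) (F : I -> C) :
  complex.Im (\sum_(i <- s) F i) = \sum_(i <- s) complex.Im (F i).
Proof. by apply: (big_morph (@complex.Im R)) => // -[? ?] []. Qed.

Lemma reV_mulmx (A : 'M[R]_n) (v : 'cV[C]_n) :
  reV (map_mx (real_complex R) A *m v) = A *m reV v.
Proof.
apply/colP => i; rewrite !mxE Re_sum; apply: eq_bigr => j _.
by rewrite !mxE ReM_real.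
Qed.

Lemma imV_mulmx (A : 'M[R]_n) (v : 'cV[C]_n) :
  imV (map_mx (real_complex R) A *m v) = A *m imV v.
Proof.
apply/colP => i; rewrite !mxE Im_sum; apply: eq_bigr => j _.
by rewrite !mxE ImM_real.
Qed.

Lemma mulmx_tsum (A : 'M[R]_n) c theta phi :
  A *m tsum c theta phi = tsum (fun m t => map_mx (real_complex R) A *m c m t) theta phi.
Proof.
rewrite /tsum mulmx_sumr; apply: eq_bigr => m _.
by rewrite reV_mulmx imV_mulmx mulmxBr !scalemxAr.
Qed.

End TrigSums.

(** * Amplitude and phase conditions as averages of the modes *)

Section LinearTheorem.
Context {R : realType} {k : nat}.
Notation C := R[i].
Notation n := (2 + k + 1)%N.
Notation ix1 := (@ix1 k).
Notation ix2 := (@ix2 k).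
Notation ixn := (@ixn k).
Local Notation rc := (real_complex R).

Lemma vderN l (x x' : R -> 'cV[C]_l) : vder x x' -> vder (fun t => - x t) (fun t => - x' t).
Proof.
move=> dx i; rewrite (_ : (fun t => _) = fun t => - x t i 0).
  by apply: cder_eq (cderN (dx i)) => t; rewrite mxE.
by apply/funext => t; rewrite mxE.
Qed.

Lemma vcontD l (x y : R -> 'cV[C]_l) : vcont x -> vcont y -> vcont (fun t => x t + y t).
Proof.
move=> cx cy i; rewrite (_ : (fun t => _) = fun t => x t i 0 + y t i 0); first exact: ccontD.
by apply/funext => t; rewrite mxE.
Qed.

Lemma vcontM l l' (A : 'M[C]_(l', l)) (x : R -> 'cV[C]_l) : vcont x -> vcont (fun t => A *m x t).
Proof.
move=> cx i; rewrite (_ : (fun t => _) = fun t => \sum_j A i j * x t j 0).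
  by apply: ccont_sum => j; apply: ccontM => //; exact: ccont_cst.
by apply/funext => t; rewrite mxE.
Qed.

Lemma vcont_cst l (v : 'cV[C]_l) : vcont (fun=> v).
Proof. by move=> i; exact: ccont_cst. Qed.

Lemma dotv_sum (u : 'cV[R]_n) (a b : R) :
  dotv u (a *: e1 k + b *: e2 k) = a * u ix1 0 + b * u ix2 0.
Proof.
rewrite /dotv (bigD1 ix1) //= (bigD1 ix2) //= big1 ?addr0 => [|i].
  by rewrite !mxE !eqxx /= !mulr0 !mulr1 addr0 add0r [u _ _ * _]mulrC [u _ _ * _]mulrC.
move=> /andP[/negPf i1 /negPf i2]; rewrite !mxE -/ix1 -/ix2.
by rewrite /ix1 /ix2 in i1 i2; rewrite i1 i2 /= !mulr0 addr0 mulr0.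
Qed.

Lemma dotv_en (u : 'cV[R]_n) : dotv u (en k) = u ixn 0.
Proof.
rewrite /dotv (bigD1 ixn) //= big1 ?addr0 => [|i /negPf i1].
  by rewrite !mxE !eqxx /= mulr1.
by rewrite !mxE; rewrite /ixn in i1; rewrite i1 /= mulr0.
Qed.

Lemma circle_int_tsum (c : nat -> R -> 'cV[C]_n) phi i : (forall m, vcont (c m)) ->
  circle_int (fun theta => tsum c theta phi i 0) = \sum_(m < 4)
    (circle_int (fun t => complex.Re (c m t i 0)) * cos (m%:R * phi)
     - circle_int (fun t => complex.Im (c m t i 0)) * sin (m%:R * phi)).
Proof.
move=> cc.
have cZ (a : R) (f : R -> R) : continuous f -> continuous (fun x : R => a * f x).
  by move=> cf x; apply: cvgM; [exact: cvg_cst|exact: cf].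
rewrite (_ : (fun theta => _) = fun theta => \sum_(m < 4)
   (cos (m%:R * phi) * complex.Re (c m theta i 0) + - sin (m%:R * phi) * complex.Im (c m theta i 0))); last first.
  by apply/funext => t; rewrite tsumE; apply: eq_bigr => m _; ring.
have c1 (m : nat) := (cc m i).1; have c2 (m : nat) := (cc m i).2.
rewrite circle_int_sum; last first.
  by move=> j x; apply: cvgD; [exact: (cZ _ _ (c1 _))|exact: (cZ _ _ (c2 _))].
apply: eq_bigr => m _; rewrite circle_intD; [|exact: cZ|exact: cZ].
by rewrite !circle_intZ //; ring.
Qed.

Lemma continuous_tsum_theta (c : nat -> R -> 'cV[C]_n) phi i : (forall m, vcont (c m)) ->
  continuous (fun theta => tsum c theta phi i 0).
Proof.
move=> cc; have c1 (m : nat) := (cc m i).1; have c2 (m : nat) := (cc m i).2.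
have cZ (a : R) (f : R -> R) : continuous f -> continuous (fun x : R => f x * a).
  by move=> cf x; apply: cvgM; [exact: cf|exact: cvg_cst].
rewrite (_ : (fun theta => _) = fun theta => \sum_(m < 4)
   (complex.Re (c m theta i 0) * cos (m%:R * phi) - complex.Im (c m theta i 0) * sin (m%:R * phi))).
  move=> x; apply: (@Ck_sum R _ _ 0 setT) => // m y _.
  by apply: cvgB; [exact: (cZ _ _ (c1 _))|exact: (cZ _ _ (c2 _))].
by apply/funext => t; rewrite tsumE.
Qed.

Lemma continuous_trig4 (r s : nat -> R) :
  continuous (fun phi : R => \sum_(j < 4) (r j * cos (j%:R * phi) - s j * sin (j%:R * phi))).
Proof.
have cZ (a : R) (f : R -> R) : continuous f -> continuous (fun x : R => a * f x).
  by move=> cf x; apply: cvgM; [exact: cvg_cst|exact: cf].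
have cB (f g : R -> R) : continuous f -> continuous g -> continuous (fun x : R => f x - g x : R).
  by move=> cf cg x; apply: cvgB; [exact: cf|exact: cg].
move=> x; apply: (@Ck_sum R _ _ 0 setT) => // m y _; apply: cB; [apply: (cZ _ (fun x => cos (m%:R * x)))|apply: (cZ _ (fun x => sin (m%:R * x)))].
  exact: continuous_cosM.
exact: continuous_sinM.
Qed.

(** One computation for both amplitude conditions: (a, b) = (1, 0) gives [astar] and (0, 1) gives
    [dastar] as test function. Orthogonality in phi leaves mode 1 only, and the factor one half is
    the mean of cos^2. *)
Lemma inner2_rotating (c : nat -> R -> 'cV[C]_n) (a b : R) : (forall m, vcont (c m)) ->
  inner2 (tsum c) (fun _ phi => (a * cos phi - b * sin phi) *: e1 k + (b * cos phi + a * sin phi) *: e2 k)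
  = 2^-1 * (a * complex.Re (cavg (fun t => c 1%N t ix1 0 + Complex 0 1 * c 1%N t ix2 0))
    + b * complex.Im (cavg (fun t => c 1%N t ix1 0 + Complex 0 1 * c 1%N t ix2 0))).
Proof.
move=> cc; have pi0 := @pi_gt0 R.
pose A m i := circle_int (fun t => complex.Re (c m t i 0)).
pose B m i := circle_int (fun t => complex.Im (c m t i 0)).
pose T i phi := \sum_(m < 4) (A m i * cos (m%:R * phi) - B m i * sin (m%:R * phi)).
have cT i : continuous (T i) by exact: (@continuous_trig4 (A ^~ i) (B ^~ i)).
have c1 (i : 'I_n) := (cc 1%N i).1; have c2 (i : 'I_n) := (cc 1%N i).2.
have cZ (x0 : R) (f : R -> R) : continuous f -> continuous (fun x : R => x0 * f x).
  by move=> cf x; apply: cvgM; [exact: cvg_cst|exact: cf].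
have ccos : continuous (fun x : R => cos (1%:R * x)) by exact: continuous_cosM.
have csin : continuous (fun x : R => sin (1%:R * x)) by exact: continuous_sinM.
have ac i : circle_int (fun phi : R => T i phi * cos (1%:R * phi)) = pi * A 1%N i.
  have := acoef_trig (A ^~ i) (B ^~ i) (isT : (1 < 4)%N); rewrite /= => <-.
  by rewrite mulVKf // gt_eqF.
have bc i : circle_int (fun phi : R => T i phi * sin (1%:R * phi)) = - pi * B 1%N i.
  have := bcoef_trig (A ^~ i) (B ^~ i) (isT : (1 < 4)%N); rewrite /= => h.
  by rewrite mulNr -mulrN -h mulVKf // gt_eqF.
have cTc i : continuous (fun phi : R => T i phi * cos (1%:R * phi)).
  by move=> x; apply: cvgM; [exact: cT|exact: ccos].
have cTs i : continuous (fun phi : R => T i phi * sin (1%:R * phi)).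
  by move=> x; apply: cvgM; [exact: cT|exact: csin].
have e phi : circle_int (fun theta => dotv (tsum c theta phi)
      ((a * cos phi - b * sin phi) *: e1 k + (b * cos phi + a * sin phi) *: e2 k)) =
    (a * (T ix1 phi * cos (1%:R * phi)) + - b * (T ix1 phi * sin (1%:R * phi)))
    + (b * (T ix2 phi * cos (1%:R * phi)) + a * (T ix2 phi * sin (1%:R * phi))).
  have ct i := @continuous_tsum_theta c phi i cc.
  pose f1 (theta : R) := (a * cos phi - b * sin phi) * tsum c theta phi ix1 0.
  pose f2 (theta : R) := (b * cos phi + a * sin phi) * tsum c theta phi ix2 0.
  have -> : (fun theta => dotv (tsum c theta phi)
      ((a * cos phi - b * sin phi) *: e1 k + (b * cos phi + a * sin phi) *: e2 k)) =
      fun theta => f1 theta + f2 theta.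
    by apply/funext => theta; rewrite dotv_sum.
  have cf1 : continuous f1 := cZ _ _ (ct ix1).
  have cf2 : continuous f2 := cZ _ _ (ct ix2).
  transitivity (circle_int f1 + circle_int f2); first exact: (circle_intD cf1 cf2).
  rewrite /f1 /f2 (circle_intZ _ (ct ix1)) (circle_intZ _ (ct ix2)) !circle_int_tsum //.
  by rewrite mul1r /T /A /B; ring.
rewrite /inner2 (_ : circle_int _ = circle_int (fun phi : R =>
    (a * (T ix1 phi * cos (1%:R * phi)) + - b * (T ix1 phi * sin (1%:R * phi)))
    + (b * (T ix2 phi * cos (1%:R * phi)) + a * (T ix2 phi * sin (1%:R * phi))))); last first.
  by congr circle_int; apply/funext => phi; exact: e.
have cD (f g : R -> R) : continuous f -> continuous g -> continuous (fun x : R => f x + g x).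
  by move=> cf cg x; apply: cvgD; [exact: cf|exact: cg].
rewrite circle_intD; [|by apply: cD; exact: cZ|by apply: cD; exact: cZ].
rewrite !circle_intD; try exact: cZ.
rewrite !circle_intZ // !ac !bc.
have -> : complex.Re (cavg (fun t => c 1%N t ix1 0 + Complex 0 1 * c 1%N t ix2 0)) =
    (2 * pi)^-1 * (A 1%N ix1 - B 1%N ix2).
  rewrite /cavg /=; congr (_ * _); rewrite -[- B _ _]mulN1r -circle_intZ // -circle_intD //; last exact: cZ.
  by congr circle_int; apply/funext => t; case: (c _ _ _ _) (c _ _ ix2 _) => [? ?] [? ?] /=; ring.
have -> : complex.Im (cavg (fun t => c 1%N t ix1 0 + Complex 0 1 * c 1%N t ix2 0)) =
    (2 * pi)^-1 * (B 1%N ix1 + A 1%N ix2).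
  rewrite /cavg /=; congr (_ * _); rewrite -circle_intD //.
  by congr circle_int; apply/funext => t; case: (c _ _ _ _) (c _ _ ix2 _) => [? ?] [? ?] /=; ring.
move: (lt0r_neq0 pi0); rewrite -/pi; move: (@pi R) (A 1%N) (B 1%N) => p A1 B1 p0.
by field.
Qed.

Lemma gamma1_tsum (c : nat -> R -> 'cV[C]_n) : (forall m, vcont (c m)) ->
  let U := cavg (fun t => c 1%N t ix1 0 + Complex 0 1 * c 1%N t ix2 0) in
  gamma1 (tsum c) = \col_i (if i == ord0 then 2^-1 * complex.Re U else 2^-1 * complex.Im U).
Proof.
move=> cc U; apply/colP => i; rewrite !mxE; case: ifP => _.
  have := inner2_rotating 1 0 cc; rewrite mul1r mul0r addr0 => <-; congr inner2.
  by apply/funext => _; apply/funext => phi; rewrite /astar !mul1r !mul0r subr0 add0r.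
have := inner2_rotating 0 1 cc; rewrite mul1r mul0r add0r => <-; congr inner2.
by apply/funext => _; apply/funext => phi; rewrite /dastar !mul1r !mul0r sub0r addr0.
Qed.

(** Identifies the homogeneous amplitude condition with the normalization that [mode_norm] imposes
    on mode 1. *)
Lemma gamma1_tsum_eq0 (c : nat -> R -> 'cV[C]_n) : (forall m, vcont (c m)) ->
  gamma1 (tsum c) = 0 <-> cavg (fun t => c 1%N t ix1 0 + Complex 0 1 * c 1%N t ix2 0) = 0.
Proof.
move=> cc; rewrite gamma1_tsum //; move: (cavg _) => [a b]; split=> [/colP h|e]; last first.
  have [-> ->] : a = 0 /\ b = 0 by case: e.
  by apply/colP => i; rewrite !mxE /= mulr0 if_same.
  have := h ord0; have := h ord_max; rewrite !mxE /= => /eqP h1 /eqP h2.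
  have h0 : (2^-1 : R) != 0 by rewrite invr_eq0.
  move: h1 h2; rewrite !mulf_eq0 (negPf h0) /=.
  by move=> /eqP -> /eqP ->.
Qed.

Lemma gamma2_tsum (c : nat -> R -> 'cV[C]_n) : (forall m, vcont (c m)) ->
  gamma2 (tsum c) = complex.Re (cavg (fun t => c 0%N t ixn 0)).
Proof.
move=> cc; have pi0 := @pi_gt0 R.
pose A m i := circle_int (fun t => complex.Re (c m t i 0)).
pose B m i := circle_int (fun t => complex.Im (c m t i 0)).
pose T i phi := \sum_(m < 4) (A m i * cos (m%:R * phi) - B m i * sin (m%:R * phi)).
have e0 phi : circle_int (fun theta => dotv (tsum c theta phi) (en k)) = T ixn phi * cos (0%:R * phi).
  have -> : (fun theta => dotv (tsum c theta phi) (en k)) = fun theta => tsum c theta phi ixn 0.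
    by apply/funext => theta; rewrite dotv_en.
  by rewrite mul0r cos0 mulr1 circle_int_tsum.
rewrite /gamma2 /inner2 (_ : circle_int _ = circle_int (fun phi : R => T ixn phi * cos (0%:R * phi))); last first.
  by congr circle_int; apply/funext => phi; exact: e0.
have := acoef_trig (A ^~ ixn) (B ^~ ixn) (isT : (0 < 4)%N); rewrite /= -/(T ixn) => h.
have e : circle_int (fun phi => T ixn phi * cos (0%:R * phi)) = 2 * pi * A 0%N ixn.
  by rewrite -h mulVKf // mulf_neq0 // gt_eqF.
rewrite e /cavg /= -/(A 0%N ixn); move: (lt0r_neq0 pi0); move: (@pi R) (A 0%N ixn) => p A0 p0.
by field.
Qed.

End LinearTheorem.

(** * The linearized problem *)

Section LinearizedProblem.
Context {R : realType} {k : nat}.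
Notation C := R[i].
Notation n := (2 + k + 1)%N.
Notation ix1 := (@ix1 k).
Notation ix2 := (@ix2 k).
Notation ixn := (@ixn k).
Local Notation rc := (real_complex R).
Variable D : ns_data R k.
Hypothesis hD : neimark_sacker D.
Hypothesis h13 : omega_star D != 3^-1.
Hypothesis h14 : omega_star D != 4^-1.
Let w0 := omega_star D.
Let E0 := Emat D (lambda_star D).
Let aR := derive1 (alphaR D) (lambda_star D).
Let aI := derive1 (alphaI D) (lambda_star D).

Lemma mode_eq_vcont m (c f : R -> 'cV[C]_n) tau1 tau0 : vcont f -> mode_eq D m c f tau1 tau0 ->
  vcont (fun t => EC D *m c t - Complex 0 (m%:R * omega_star D) *: c t + f t
    - tau1 *: rvec - tau0 *: nvec).
Proof.
move=> cf dc; have cc := vder_vcont dc.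
apply: vcontD; last exact: vcont_cst.
apply: vcontD; last exact: vcont_cst.
apply: vcontD => //; apply: vcontD; first exact: vcontM.
rewrite (_ : (fun t => _) = fun t => (- Complex 0 (m%:R * omega_star D))%:M *m c t).
  exact: vcontM.
by apply/funext => t; rewrite mul_scalar_mx scaleNr.
Qed.

Lemma mode_norm_sub m (c d : R -> 'cV[C]_n) t1 t0 s1 s0 : vcont c -> vcont d ->
  mode_norm m c t1 t0 -> mode_norm m d s1 s0 -> mode_norm m (fun t => c t - d t) (t1 - s1) (t0 - s0).
Proof.
move=> cc cd [n1 n0] [p1 p0].
have cU (x : R -> 'cV[C]_n) : vcont x -> ccont (fun t => x t ix1 0 + Complex 0 1 * x t ix2 0).
  by move=> h; apply: ccontD => //; apply: ccontM => //; exact: ccont_cst.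
split.
  case: eqP n1 p1 => [_|_] n1 p1; last by rewrite n1 p1 subrr.
  rewrite -[RHS](subrr 0) -{1}n1 -p1 -cavgB; [|exact: cU..].
  by congr cavg; apply/funext => t; rewrite !mxE; ring.
case: eqP n0 p0 => [_|_] n0 p0; last by rewrite n0 p0 subrr.
rewrite -[RHS](subrr 0) -{1}n0 -p0 -cavgB //.
by congr cavg; apply/funext => t; rewrite !mxE.
Qed.

(** Existence with a bound, together with uniqueness, gives the bound for every solution; the sum
    over the four modes serves as a common constant. *)
Lemma mode_apriori : exists2 K : R, 0 <= K & forall m, (m <= 3)%N ->
  forall (f c : R -> 'cV[C]_n) tau1 tau0, vcont f -> vper f ->
  mode_eq D m c f tau1 tau0 -> vper c -> mode_norm m c tau1 tau0 ->
  forall M, 0 <= M -> vbound M f -> [/\ vbound (K * M) c, cn tau1 <= K * M & cn tau0 <= K * M].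
Proof.
have /choice[K hK] (m : nat) : exists K : R, 0 <= K /\ ((m <= 3)%N ->
    forall f : R -> 'cV[C]_n, vcont f -> vper f -> exists c tau1 tau0,
    [/\ mode_eq D m c f tau1 tau0, vper c, mode_norm m c tau1 tau0
      & forall M, 0 <= M -> vbound M f ->
          [/\ vbound (K * M) c, cn tau1 <= K * M & cn tau0 <= K * M]]).
  have [m3|m3] := leqP m 3; last by exists 0.
  by have [K K0 hK] := mode_solve hD h13 h14 m3; exists K.
exists (\sum_(m < 4) K m); first by apply: sumr_ge0 => m _; case: (hK m).
move=> m m3 f c t1 t0 cf pf dc pc nc M M0 fM.
have Km : K m <= \sum_(m < 4) K m.
  rewrite (bigD1 (Ordinal (m3 : (m < 4)%N))) //= lerDl.
  by apply: sumr_ge0 => j _; case: (hK j).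
have [d [s1 [s0 [dd pd nd bd]]]] := (hK m).2 m3 f cf pf.
have cc := vder_vcont dc; have cd := vder_vcont dd.
have d0 : mode_eq D m (fun t => c t - d t) (fun=> 0) (t1 - s1) (t0 - s0).
  apply: vder_eq (vderD dc (vderN dd)) => t; rewrite mulmxBr.
  move: (EC D *m c t) (EC D *m d t) (c t) (d t) (f t) (@rvec R k) (@nvec R k) => x y c' d' f' r v.
  by apply/colP => i; rewrite !mxE; ring.
have p0 : vper (fun t => c t - d t) by move=> t; rewrite pc pd.
have [cd0 /eqP e1 /eqP e0] := mode_uniq hD h13 h14 m3 d0 p0 (mode_norm_sub cc cd nc nd).
have ecd t : c t = d t by apply/eqP; rewrite -subr_eq0; apply/eqP.
have [bdd bs1 bs0] := bd M M0 fM.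
have KM : K m * M <= (\sum_(m < 4) K m) * M by rewrite ler_wpM2r.
rewrite !subr_eq0 in e1 e0; rewrite (eqP e1) (eqP e0); split.
- by move=> t i; rewrite ecd (le_trans (bdd t i)).
- exact: le_trans bs1 KM.
- exact: le_trans bs0 KM.
Qed.

(** Here [lam], [om] and [eta] are deviations from the critical values; the first bracket is the
    derivative of [Emat D lam *m astar k phi] in the parameter at the bifurcation. *)
Definition lin_forcing (lam om eta phi : R) : 'cV[R]_n :=
  lam *: (aR *: astar k phi + aI *: dastar k phi) - om *: dastar k phi - eta *: en k.

Definition lin_op (z : R -> R -> 'cV[R]_n) (theta phi : R) : 'cV[R]_n :=
  dtheta z theta phi + w0 *: dphi z theta phi - E0 *m z theta phi.

Definition lin_sol (g z : R -> R -> 'cV[R]_n) (lam om eta : R) : Prop :=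
  [/\ torus_C1 z, has_only_phi_modes [:: 0; 1; 2; 3]%N z,
      forall theta phi, lin_op z theta phi = S_inf 3 g theta phi + lin_forcing lam om eta phi,
      gamma1 z = 0 & gamma2 z = 0].

(** The complex phi-modes of [lin_forcing]: the unknown parameters enter exactly along the
    directions of [tau1] and [tau0]. *)
Definition fmode (lam om eta : R) (m : nat) : 'cV[C]_n :=
  if m == 1%N then Complex (lam * aR) (lam * aI - om) *: rvec
  else if m == 0%N then (- rc eta) *: nvec else 0.

Lemma e1E i : (e1 k : 'cV[R]_n) i 0 = (i == ix1)%:R.
Proof. by rewrite mxE eqxx andbT. Qed.
Lemma e2E i : (e2 k : 'cV[R]_n) i 0 = (i == ix2)%:R.
Proof. by rewrite mxE eqxx andbT. Qed.
Lemma enE i : (en k : 'cV[R]_n) i 0 = (i == ixn)%:R.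
Proof. by rewrite mxE eqxx andbT. Qed.

Lemma lin_forcing_tsum lam om eta theta phi :
  lin_forcing lam om eta phi = tsum (fun m _ => fmode lam om eta m) theta phi.
Proof.
apply/colP => i; rewrite tsumE !big_ord_recl big_ord0 /= /bump /= /fmode /=.
have -> : lin_forcing lam om eta phi i 0 =
    lam * (aR * (cos phi * (i == ix1)%:R + sin phi * (i == ix2)%:R) +
      aI * (- sin phi * (i == ix1)%:R + cos phi * (i == ix2)%:R))
    - om * (- sin phi * (i == ix1)%:R + cos phi * (i == ix2)%:R) - eta * (i == ixn)%:R.
  rewrite -e1E -e2E -enE /lin_forcing /astar /dastar.
  by move: (e1 k) (e2 k) (en k) => x y z; rewrite !mxE.
rewrite !mxE mul0r cos0 sin0 !mul1r.
case: (ixP i) => [|| j|].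
- by rewrite eqxx /=; ring.
- by rewrite eqxx /=; ring.
- by rewrite /ixm eq_lrshift /=; ring.
- by rewrite eqxx /=; ring.
Qed.

Lemma dphi_tsum c theta phi : dphi (tsum c) theta phi =
  tsum (fun m t => Complex 0 m%:R *: c m t) theta phi :> 'cV[R]_n.
Proof. by rewrite /dphi derive1E; have h := tsum_dphi c theta phi; exact: derive_val. Qed.

Lemma dtheta_tsum c c' theta phi : (forall m, vder (c m) (c' m)) ->
  dtheta (tsum c) theta phi = tsum c' theta phi :> 'cV[R]_n.
Proof. by move=> dc; rewrite /dtheta derive1E; have h := tsum_dtheta theta phi dc; exact: derive_val. Qed.

Lemma tcont_fcoef m (g : R -> R -> 'cV[R]_n) : tcont g -> vcont (fcoef m g) /\ vper (fcoef m g).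
Proof. by move=> [cg pg _]; split; [exact: fcoef_vcont|exact: fcoef_vper]. Qed.

Lemma lin_exists g : tcont g -> exists z lam om eta, lin_sol g z lam om eta.
Proof.
move=> tg; have aR0 : aR != 0 := ns_transversal hD.
have /choice[q hq] (m : nat) : exists q : (R -> 'cV[C]_n) * (R -> 'cV[C]_n) * C * C,
    [/\ vder q.1.1.1 q.1.1.2, vcont q.1.1.2, vper q.1.1.1
      & (m <= 3)%N -> (forall t, q.1.1.2 t = EC D *m q.1.1.1 t - Complex 0 (m%:R * w0) *: q.1.1.1 t
           + fcoef m g t - q.1.2 *: rvec - q.2 *: nvec) /\ mode_norm m q.1.1.1 q.1.2 q.2].
  have [m3|m3] := leqP m 3; last first.
    (* Choice runs over all [m], while [tsum] stops at mode 3; beyond it zero is a default. *)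
    exists (fun=> 0, fun=> 0, 0, 0); split=> //= i.
      rewrite (_ : (fun t => _) = fun=> 0); last by apply/funext => t; rewrite mxE.
      exact: cder_cst.
    exact: ccont_cst.
  have [cf pf] := tcont_fcoef m tg.
  have [K _ hK] := mode_solve hD h13 h14 m3.
  have [c [t1 [t0 [dc pc nc _]]]] := hK _ cf pf.
  exists (c, fun t => EC D *m c t - Complex 0 (m%:R * omega_star D) *: c t + fcoef m g t
    - t1 *: rvec - t0 *: nvec, t1, t0); split=> //=.
  exact: mode_eq_vcont.
pose c m := (q m).1.1.1; pose c' m := (q m).1.1.2.
have dc m : vder (c m) (c' m) by have [] := hq m.
have cc m : vcont (c m) := vder_vcont (dc m).
(* Matches [- tau1] with the coefficient lam aR + i (lam aI - om) of [rvec] in [fmode]: the real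
   part determines [lam] because [aR] is nonzero by transversality, and the imaginary part then
   determines [om]. *)
pose lam := - complex.Re (q 1%N).1.2 / aR.
pose om := lam * aI + complex.Im (q 1%N).1.2.
(* Mode 0 enters [tsum] through its real part only, so the real part of [tau0] is what [eta] has to
   absorb. *)
pose eta := complex.Re (q 0%N).2.
exists (tsum c), lam, om, eta; split.
- by apply: (tsum_torus_C1 dc) => m; have [] := hq m.
- exact: tsum_modes.
- move=> theta phi; rewrite /lin_op (dtheta_tsum _ _ dc) dphi_tsum mulmx_tsum S_infE.
  rewrite (lin_forcing_tsum _ _ _ theta) -tsumZ -tsumD -tsumN -!tsumD.
  have mE m : (m < 4)%N -> c' m theta + (rc w0 *: (Complex 0 m%:R *: c m theta)) - EC D *m c m theta =
      fcoef m g theta - (q m).1.2 *: rvec - (q m).2 *: nvec.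
    move=> m4; have [_ _ _ /(_ m4)[e _]] := hq m; rewrite /c' e -/(c m) scalerA.
    have -> : rc w0 * Complex 0 m%:R = Complex 0 (m%:R * w0).
      by simpc; rewrite mulrC.
    move: (EC D *m c m theta) (c m theta) (fcoef m g theta) (@rvec R k) (@nvec R k) => x y u r v.
    by apply/colP => i; rewrite !mxE; ring.
  have t1E m : (m < 4)%N -> m != 1%N -> (q m).1.2 = 0.
    by move=> m4 m1; have [_ _ _ /(_ m4)[_ [+ _]]] := hq m; rewrite (negPf m1).
  have t0E m : (m < 4)%N -> m != 0%N -> (q m).2 = 0.
    by move=> m4 m1; have [_ _ _ /(_ m4)[_ [_ +]]] := hq m; rewrite (negPf m1).
  have fE m : (m < 4)%N -> m != 0%N ->
      fcoef m g theta - (q m).1.2 *: rvec - (q m).2 *: nvec = fcoef m g theta + fmode lam om eta m.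
    move=> m4 m0; rewrite (t0E m) // scale0r subr0 /fmode (negPf m0).
    have [->|m1] := eqVneq m 1%N; last by rewrite t1E // scale0r subr0 addr0.
    rewrite -scaleNr; congr (_ + _ *: _); rewrite /om /lam.
    case: (q 1%N).1.2 => a b; apply/eqP; rewrite eq_complex /=; apply/andP; split; apply/eqP.
      by field.
    by ring.
  apply: tsum_eq => m; last first.
    by move=> /andP[m0 m4]; rewrite mE // fE // -lt0n.
  move=> m4; have [m0|m0] := eqVneq m 0%N; last by rewrite mE // fE.
  rewrite mE // t1E // ?m0 // scale0r subr0 /fmode /=.
  apply/colP => i; rewrite !mxE /eta /=; case: (q 0%N).2 => a b.
  by case: ifP => _ /=; rewrite ?mulr0 ?mulr1 /=; ring.
- apply/gamma1_tsum_eq0 => //.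
  by have [_ _ _ /(_ isT)[_ [+ _]]] := hq 1%N.
- rewrite gamma2_tsum //.
  have h : cavg (fun t => c 0%N t ixn 0) = 0.
    by have [_ _ _ /(_ isT)[_ [_ h]]] := hq 0%N; exact: h.
  by rewrite h.
Qed.

(** The Fourier coefficients of a solution solve the mode equations, so [mode_apriori] applies to
    each of them. The bound on [dphi z] costs only a factor 3, because there are no higher modes. *)
Lemma lin_apriori : exists2 K : R, 0 <= K & forall g z lam om eta, tcont g ->
  lin_sol g z lam om eta -> forall M, (forall theta phi, `|g theta phi| <= M) ->
  [/\ forall theta phi, `|z theta phi| <= K * M, forall theta phi, `|dphi z theta phi| <= K * M,
      `|lam| <= K * M, `|om| <= K * M & `|eta| <= K * M].
Proof.
have aR0 : aR != 0 := ns_transversal hD.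
have [K K0 hK] := mode_apriori.
(* Recovering [lam] from [tau1] divides by [aR], and recovering [om] involves [lam * aI]; [L]
   collects both losses. In the 48 below, 4 stems from [fcoef_bound], 4 from the number of modes and
   3 from the phi-derivative. *)
pose L := 1 + `|aR|^-1 * (1 + `|aI|).
have L1 : 1 <= L by rewrite lerDl mulr_ge0 ?invr_ge0 ?addr_ge0.
exists (48 * K * L); first by rewrite !mulr_ge0 // (le_trans _ L1).
move=> g z lam om eta tg [Cz mz ez g1 g2] M gM.
have M0 : 0 <= M by exact: le_trans (gM 0 0).
pose c m := fcoef m z.
have zE : z = tsum c by apply/modes0123E.
have dc m : vder (c m) (fcoef m (dtheta z)) by exact: fcoef_vder.
have cc m : vcont (c m) := vder_vcont (dc m).
have pc m : vper (c m) by apply: fcoef_vper; case: Cz.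
pose d m t := EC D *m c m t - rc w0 *: (Complex 0 m%:R *: c m t) + (fcoef m g t + fmode lam om eta m).
have dE : dtheta z = tsum d.
  apply/funext => theta; apply/funext => phi.
  have -> : dtheta z theta phi = E0 *m z theta phi - w0 *: dphi z theta phi + lin_op z theta phi.
    rewrite /lin_op; move: (E0 *m z theta phi) (dtheta z theta phi) (dphi z theta phi) => x y u.
    by apply/colP => i; rewrite !mxE; ring.
  rewrite ez (lin_forcing_tsum _ _ _ theta) S_infE.
  have -> : dphi z theta phi = tsum (fun m t => Complex 0 m%:R *: c m t) theta phi.
    by rewrite [in LHS]zE dphi_tsum.
  by rewrite [in LHS]zE mulmx_tsum -tsumZ -tsumN -!tsumD.
have im0 (h : R -> R -> 'cV[R]_n) theta i : complex.Im (fcoef 0 h theta i 0) = 0.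
  rewrite !mxE /= (_ : (fun phi => _) = fun=> 0) ?circle_int_cst ?mulr0 ?oppr0 //.
  by apply/funext => phi; rewrite mul0r sin0 mulr0.
pose t1 (m : nat) := if m == 1%N then - Complex (lam * aR) (lam * aI - om) else 0.
pose t0 (m : nat) := if m == 0%N then rc eta else 0.
have dm m t : (m <= 3)%N -> fcoef m (dtheta z) t =
    EC D *m c m t - Complex 0 (m%:R * omega_star D) *: c m t + fcoef m g t - t1 m *: rvec - t0 m *: nvec.
  move=> m3.
  have -> : EC D *m c m t - Complex 0 (m%:R * omega_star D) *: c m t + fcoef m g t
      - t1 m *: rvec - t0 m *: nvec = d m t.
    rewrite /d scalerA (_ : rc w0 * Complex 0 m%:R = Complex 0 (m%:R * omega_star D)); last first.
      by simpc; rewrite mulrC.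
    rewrite /t1 /t0 /fmode; move: (EC D *m c m t) (c m t) (fcoef m g t) (@rvec R k) (@nvec R k) => x y u r v.
    by case: m m3 => [|[|m]] m3 /=; apply/colP => i; rewrite !mxE; ring.
  rewrite dE fcoef_tsum //; case: m m3 => [|//] _.
  (* A series determines its mode 0 only up to the imaginary part, so the right-hand side of the
     equation for mode 0 has to be shown real. *)
  apply/colP => i; rewrite mxE.
  suff : complex.Im (d 0%N t i 0) = 0 by case: (d 0%N t i 0) => a b /= ->.
  rewrite /d; have : complex.Im ((EC D *m c 0%N t) i 0) = 0.
    have /colP/(_ i) := imV_mulmx E0 (c 0%N t); rewrite !mxE => ->.
    by apply: big1 => j _; rewrite [imV _ _ _]mxE im0 mulr0.
  move: (EC D *m c 0%N t) => x x0; have g0 := im0 g t i.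
  rewrite /fmode /= !mxE -/(fcoef 0 g t i 0).
  move: g0; rewrite !mxE /= => g0.
  by case: (x i 0) x0 => a b /= ->; case: ifP => _ /=; rewrite g0; ring.
have bnd m : (m <= 3)%N -> [/\ vbound (K * (4 * M)) (c m), cn (t1 m) <= K * (4 * M) & cn (t0 m) <= K * (4 * M)].
  move=> m3; have [cf pf] := tcont_fcoef m tg.
  apply: (hK m m3 _ _ _ _ cf pf) => //.
  - by apply: vder_eq (dc m) => t; exact: dm.
  - split.
      rewrite /t1; case: eqP => [->|//]; rewrite zE in g1.
      by apply/(gamma1_tsum_eq0 cc).
    rewrite /t0; case: eqP => [->|//]; rewrite zE gamma2_tsum // in g2.
    have h : complex.Im (cavg (fun t => c 0%N t ixn 0)) = 0.
      rewrite /cavg /= (_ : (fun t => _) = fun=> 0) ?circle_int_cst ?mulr0 //.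
      by apply/funext => t; exact: im0.
    by move: h g2; case: (cavg _) => a b /= -> ->.
  - by rewrite mulr_ge0.
  - move=> t i; have [cg _ _] := tg.
    by have [] := fcoef_bound m (@continuous_slice _ _ g cg t) (gM t) i.
have B0 : 0 <= K * (4 * M) by rewrite !mulr_ge0.
have BL B : 0 <= B -> B <= B * L by move=> b0; rewrite ler_peMr.
have eB : 48 * K * L * M = 12 * (K * (4 * M)) * L by ring.
have [_ bt1 _] := bnd 1%N isT; have [_ _ bt0] := bnd 0%N isT.
set B := K * (4 * M) in B0 eB bt1 bt0 *.
have Bx : 0 <= B * `|aR|^-1 by rewrite mulr_ge0 ?invr_ge0.
have By : 0 <= B * `|aR|^-1 * `|aI| by rewrite mulr_ge0.
have eL : 12 * B * L = 12 * (B + B * `|aR|^-1 + B * `|aR|^-1 * `|aI|) by rewrite /L; ring.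
have h1 : `|lam * aR| <= B by apply: le_trans bt1; rewrite /t1 /= cnN /cn /= lerDl.
have h2 : `|lam| <= B * `|aR|^-1 by rewrite ler_pdivlMr ?normr_gt0 // -normrM.
rewrite eB; split.
- move=> theta phi; rewrite zE; apply: le_trans (tsum_bound phi B0 _) _.
    by move=> m i m4; have [b _ _] := bnd m m4; exact: b.
  by rewrite eL; lra.
- move=> theta phi; rewrite zE dphi_tsum.
  have B3 : 0 <= 3 * B by rewrite mulr_ge0.
  apply: le_trans (tsum_bound phi B3 _) _; last by rewrite eL; lra.
  move=> m i m4; rewrite mxE (le_trans (cnM _ _)) // ler_pM ?cn_ge0 //.
    by rewrite /cn /= normr0 add0r ger0_norm // ler_nat.
  by have [b _ _] := bnd m m4; exact: b.
- by apply: le_trans h2 _; rewrite eL; lra.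
- have h3 : `|lam * aI - om| <= B.
    by apply: le_trans bt1; rewrite /t1 /= cnN /cn /= lerDr.
  have h4 : `|lam * aI| <= B * `|aR|^-1 * `|aI| by rewrite normrM ler_wpM2r.
  have h5 : `|om| <= `|lam * aI| + `|lam * aI - om|.
    by rewrite -[om in leLHS](subKr (lam * aI)) ler_normB.
  by apply: le_trans h5 _; rewrite eL; lra.
- have h6 : `|eta| <= B by apply: le_trans bt0; rewrite /t0 /cn /= normr0 addr0.
  by apply: le_trans h6 _; rewrite eL; lra.
Qed.

End LinearizedProblem.

(** * Smooth matrix inverses, and a contraction principle for families *)

Section MoreCk.
Context {R : realType}.
Implicit Types V W X : normedModType R.

Lemma Ck_prod V j (U : set V) (I : Type) (s : seq I) (f : I -> V -> R) :
  (forall i, Ck j U (f i)) -> Ck j U (fun x => \prod_(i <- s) f i x).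
Proof.
move=> h; elim: s => [|i s IH].
  rewrite (_ : (fun x => _) = fun=> 1); first exact: Ck_cst.
  by apply/funext => x; rewrite big_nil.
rewrite (_ : (fun x => _) = fun x => f i x * \prod_(i <- s) f i x).
  exact: Ck_mulR.
by apply/funext => x; rewrite big_cons.
Qed.

Lemma Ck_det V j (U : set V) n (f : V -> 'M[R]_n) :
  Ck j U f -> Ck j U (fun x => \det (f x)).
Proof.
move=> cf; apply: Ck_sum => s; apply: Ck_mulR; first exact: Ck_cst.
by apply: Ck_prod => i; exact: Ck_coord.
Qed.

Lemma Ck_inv V j (U : set V) (f : V -> R) : (forall x, U x -> f x != 0) ->
  Ck j U f -> Ck j U (fun x => (f x)^-1).
Proof.
move=> f0; elim: j f f0 => [|j IH] f f0 cf.
  by move=> x Ux; apply: cvgV; [exact: f0|exact: cf].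
have [df ddf] := cf; split=> [x Ux|d].
  by apply: differentiableV; [exact: df|exact: f0].
have [g fg cg] := ddf d.
exists (fun x => - ((f x)^-1 * (f x)^-1 * g x)); last first.
  apply: Ck_opp; apply: Ck_mulR => //.
  by apply: Ck_mulR; apply: IH => //; exact: CkS.
move=> x Ux; rewrite -fg // deriveV; [|exact: f0|by apply: diff_derivable; exact: df].
by rewrite -[_ *: _]/(_ * _) mulNr expr2 invfM.
Qed.

(** The cofactor formula is built from polynomials and one scalar inverse, so its smoothness follows
    from the rules for [Ck]; it agrees with [invmx] on invertible matrices. *)
Definition cramer_inv n (A : 'M[R]_n) : 'M[R]_n := (\det A)^-1 *: \adj A.

Lemma cramer_invE n (A : 'M[R]_n) : A \in unitmx -> invmx A = cramer_inv A.
Proof. by move=> h; rewrite /invmx h. Qed.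

Lemma Ck_cramer_inv V j (U : set V) n (f : V -> 'M[R]_n) :
  (forall x, U x -> f x \in unitmx) -> Ck j U f -> Ck j U (fun x => cramer_inv (f x)).
Proof.
move=> fu cf; apply: Ck_scale; first exact: fin_basis_mx.
  apply: Ck_inv; last exact: Ck_det.
  by move=> x /fu; rewrite unitmxE unitfE.
apply: Ck_mx => p q; rewrite (_ : (fun x => _) = fun x => (-1) ^+ (q + p) *
    \det (row' q (col' p (f x)))); last by apply/funext => x; rewrite mxE.
apply: Ck_mulR; first exact: Ck_cst.
apply: Ck_det; apply: Ck_mx => a b.
rewrite (_ : (fun x => _) = fun x => f x (lift q a) (lift p b)); first exact: Ck_coord.
by apply/funext => x; rewrite !mxE.
Qed.

Lemma Ck_block V j (U : set V) a b c d (A : V -> 'M[R]_(a, b)) (B : V -> 'M[R]_(a, d))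
    (A' : V -> 'M[R]_(c, b)) (B' : V -> 'M[R]_(c, d)) :
  Ck j U A -> Ck j U B -> Ck j U A' -> Ck j U B' ->
  Ck j U (fun x => block_mx (A x) (B x) (A' x) (B' x)).
Proof.
move=> cA cB cA' cB'; apply: Ck_mx => p q.
case: (split_ordP p) => p' ->; case: (split_ordP q) => q' ->.
- rewrite (_ : (fun x => _) = fun x => A x p' q'); first exact: Ck_coord.
  by apply/funext => x; rewrite block_mxEul.
- rewrite (_ : (fun x => _) = fun x => B x p' q'); first exact: Ck_coord.
  by apply/funext => x; rewrite block_mxEur.
- rewrite (_ : (fun x => _) = fun x => A' x p' q'); first exact: Ck_coord.
  by apply/funext => x; rewrite block_mxEdl.
- rewrite (_ : (fun x => _) = fun x => B' x p' q'); first exact: Ck_coord.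
  by apply/funext => x; rewrite block_mxEdr.
Qed.

Lemma segment_convex (a b : R) : convex_set (`[a, b]%classic : set R).
Proof.
move=> x y t /=; rewrite !in_itv /= => /andP[ax xb] /andP[ay yb] /andP[t0 t1].
have e : x + t *: (y - x) = (1 - t) * x + t * y by rewrite /GRing.scale /=; ring.
have s0 : 0 <= 1 - t by rewrite subr_ge0.
have h1 := ler_wpM2l s0 ax; have h2 := ler_wpM2l s0 xb.
have h3 := ler_wpM2l t0 ay; have h4 := ler_wpM2l t0 yb.
by rewrite e; apply/andP; split; lra.
Qed.

Lemma norm_ball_convex V (r : R) : convex_set [set x : V | `|x| <= r].
Proof.
move=> x y t /= xr yr /andP[t0 t1].
have -> : x + t *: (y - x) = (1 - t) *: x + t *: y.
  by rewrite scalerBr scalerBl scale1r addrAC addrA addrAC.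
rewrite (le_trans (ler_normD _ _)) // !normrZ (ger0_norm t0) ger0_norm ?subr_ge0 //.
have s0 : 0 <= 1 - t by rewrite subr_ge0.
by have := ler_wpM2l s0 xr; have := ler_wpM2l t0 yr; lra.
Qed.

Lemma setX_convex V W (A : set V) (B : set W) : convex_set A -> convex_set B ->
  convex_set (A `*` B).
Proof. by move=> cA cB [x1 x2] [y1 y2] t [/= ? ?] [/= ? ?] t01; split; [exact: cA|exact: cB]. Qed.

(** Completeness for geometric sequences, with an explicit rate: convergence of a family indexed by
    torus points is then automatically uniform, and the property passes to products of spaces. *)
Definition geo_complete X := forall (u : nat -> X) (M : R), 0 <= M ->
  (forall j, `|u j.+1 - u j| <= M / 2 ^+ j) ->
  exists l, forall j, `|u j - l| <= 2 * M / 2 ^+ j.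

(** The intervals with centre [u j] and radius [2 * M / 2 ^+ j] are nested; the supremum of their
    left ends lies in all of them. *)
Lemma geo_completeR : geo_complete R.
Proof.
move=> u M M0 hu.
have p2 j : 0 < 2 ^+ j :> R by rewrite exprn_gt0.
pose e j := 2 * M / 2 ^+ j.
have e0 j : 0 <= e j by rewrite /e divr_ge0 ?mulr_ge0 // ltW.
have eS j : e j.+1 = e j - M / 2 ^+ j by rewrite /e exprS; field; rewrite gt_eqF.
have st j m : u j - e j <= u (j + m)%N - e (j + m)%N /\ u (j + m)%N + e (j + m)%N <= u j + e j.
  elim: m => [|m [h1 h2]]; first by rewrite addn0.
  by rewrite addnS eS; have := hu (j + m)%N; rewrite ler_norml => /andP[a b]; split; lra.
have ab i j : u i - e i <= u j + e j.
  have [h1 _] := st i j; have [_ h2] := st j i; rewrite addnC in h2.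
  by have := e0 (i + j)%N; lra.
pose S := [set x : R | exists j, x = u j - e j].
have S0 : S (u 0%N - e 0%N) by exists 0%N.
have bS j : ubound S (u j + e j) by move=> _ [i ->]; exact: ab.
have hS : has_sup S by split; [exists (u 0%N - e 0%N)|exists (u 0%N + e 0%N)].
exists (sup S) => j.
have h1 : u j - e j <= sup S by apply: (sup_upper_bound hS); exists j.
have h2 : sup S <= u j + e j by apply: ge_sup; [exists (u 0%N - e 0%N)|exact: bS].
by rewrite -/(e j) ler_norml; lra.
Qed.

Lemma geo_complete_mx m n : geo_complete 'M[R]_(m, n).
Proof.
move=> u M M0 hu.
have /choice[l hl] (p : 'I_m * 'I_n) : exists l, forall j, `|u j p.1 p.2 - l| <= 2 * M / 2 ^+ j.
  apply: (geo_completeR (u := fun j => u j p.1 p.2)) => // j.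
  by apply: le_trans (hu j); have := mx_entry_le (u j.+1 - u j) p.1 p.2; rewrite !mxE.
exists (\matrix_(i, j) l (i, j)) => j; apply/mx_normP => [|a b].
  by rewrite divr_ge0 ?mulr_ge0 // exprn_ge0.
by rewrite !mxE; exact: (hl (a, b)).
Qed.

Lemma norm_fst V W (x : V * W) : `|x.1| <= `|x|.
Proof. by rewrite prod_normE le_max lexx. Qed.
Lemma norm_snd V W (x : V * W) : `|x.2| <= `|x|.
Proof. by rewrite prod_normE le_max lexx orbT. Qed.

Lemma geo_complete_prod V W : geo_complete V -> geo_complete W -> geo_complete (V * W)%type.
Proof.
move=> cV cW u M M0 hu.
have [l hl] := cV (fun j => (u j).1) M M0 (fun j => le_trans (norm_fst (u j.+1 - u j)) (hu j)).
have [l' hl'] := cW (fun j => (u j).2) M M0 (fun j => le_trans (norm_snd (u j.+1 - u j)) (hu j)).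
by exists (l, l') => j; rewrite prod_normE ge_max hl hl'.
Qed.

(** Contraction principle for functions [I -> X] with all distances written pointwise, which avoids
    setting up a normed space of functions; [Om] is assumed closed under uniform limits. *)
Lemma geo_fixpoint (I : Type) X (Om : (I -> X) -> Prop) (Phi : (I -> X) -> I -> X) (x0 : I -> X) (M : R) :
  geo_complete X -> 0 <= M -> Om x0 -> (forall x, Om x -> Om (Phi x)) ->
  (forall x y d, Om x -> Om y -> (forall i, `|x i - y i| <= d) ->
     forall i, `|Phi x i - Phi y i| <= d / 2) ->
  (forall x, (forall e, 0 < e -> exists2 y, Om y & forall i, `|y i - x i| <= e) -> Om x) ->
  (forall i, `|Phi x0 i - x0 i| <= M) -> exists2 x, Om x & forall i, Phi x i = x i.
Proof.
move=> cX M0 Om0 OmS cPhi Omc bM.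
pose u j := iter j Phi x0.
have Omu j : Om (u j) by elim: j => //= j; exact: OmS.
have du j i : `|u j.+1 i - u j i| <= M / 2 ^+ j.
  elim: j i => [|j IH] i; first by rewrite expr0 divr1; exact: bM.
  by rewrite exprSr invfM mulrA; apply: (cPhi _ _ _ (Omu j.+1) (Omu j) IH).
have /choice[l hl] i := cX (fun j => u j i) M M0 (fun j => du j i).
have small e : 0 < e -> exists j, 2 * M / 2 ^+ j <= e.
  move=> e0; exists (Num.truncn (2 * M / e)).+1.
  have h : 2 * M / e < 2 ^+ (Num.truncn (2 * M / e)).+1.
    apply: (@lt_trans _ _ (Num.truncn (2 * M / e)).+1%:R).
      by apply: truncnS_gt.
    by rewrite -natrX ltr_nat ltn_expl.
  by rewrite ler_pdivrMr ?exprn_gt0 // [X in _ <= X]mulrC -ler_pdivrMr // ltW.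
have Oml : Om l.
  apply: Omc => e /small[j hj]; exists (u j) => // i.
  exact: le_trans (hl i j) hj.
exists l => // i; apply/eqP; rewrite -subr_eq0 -normr_le0; apply/ler_addgt0Pr => e e0.
have [j hj] := small (e / 2) (divr_gt0 e0 (ltr0n R 2)).
rewrite add0r -(subrKA (u j.+1 i)) (le_trans (ler_normD _ _)) //.
have h1 : `|Phi l i - u j.+1 i| <= 2 * M / 2 ^+ j / 2.
  by apply: (cPhi l (u j)) => // i'; rewrite distrC.
have h2 := hl i j.+1.
have -> : e = e / 2 / 2 + e / 2 / 2 + e / 2 by field.
have h3 : 2 * M / 2 ^+ j.+1 = 2 * M / 2 ^+ j / 2 by rewrite exprSr invfM mulrA.
by rewrite h3 in h2; lra.
Qed.

(** Iterating M -> M / 2 + r from the crude bound [B] tends to [2 * r]. This replaces taking a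
    supremum and absorbing half of it into the left-hand side. *)
Lemma half_absorb (I : Type) (d : I -> R) (B r : R) : (forall i, d i <= B) ->
  (forall M, 0 <= M -> (forall i, d i <= M) -> forall i, d i <= M / 2 + r) -> 0 <= r ->
  forall i, d i <= 2 * r.
Proof.
move=> dB h r0 i.
have hj j i' : d i' <= `|B| / 2 ^+ j + 2 * r.
  elim: j i' => [|j IH] i'.
    by rewrite expr0 divr1; have := dB i'; have := ler_norm B; lra.
  have M0 : 0 <= `|B| / 2 ^+ j + 2 * r by rewrite addr_ge0 ?mulr_ge0 ?divr_ge0 ?exprn_ge0.
  have := h _ M0 IH i'; rewrite exprSr invfM mulrA.
  by set q := `|B| / 2 ^+ j; lra.
apply/ler_addgt0Pr => e e0.
pose j := (Num.truncn (`|B| / e)).+1.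
apply: le_trans (hj j i) _; rewrite addrC lerD2l ler_pdivrMr ?exprn_gt0 // [X in _ <= X]mulrC -ler_pdivrMr //.
rewrite ltW // (@lt_trans _ _ j%:R) //; first by apply: truncnS_gt.
by rewrite -natrX ltr_nat ltn_expl.
Qed.

End MoreCk.

(** * Second-order Taylor remainder in eps of the vector field near the orbit *)

Section QuadraticRemainder.
Context {R : realType} {k : nat}.
Notation n := (2 + k + 1)%N.
Implicit Types V : normedModType R.
Variable D : ns_data R k.
Hypothesis hD : neimark_sacker D.
Let ls := lambda_star D.
(** Half the radius, so that the closed interval used for compactness lies inside the open region of
    smoothness. *)
Let rad := lambda_radius D / 2.

Lemma rad_gt0 : 0 < rad. Proof. by rewrite divr_gt0 // (ns_radius_gt0 hD). Qed.

Lemma near_rad lam : `|lam - ls| <= rad -> near_lambda D lam.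
Proof.
by move=> h; rewrite /near_lambda (le_lt_trans h) // /rad; have := ns_radius_gt0 hD; lra.
Qed.

Definition near2 : set (R * R) := [set p | near_lambda D p.2].

Lemma Ck_theta_lambda V j (U : set V) (W : normedModType R) (f : R * R -> W) (th lam : V -> R) :
  fin_basis W -> Ck j near2 f -> (forall x, U x -> near_lambda D (lam x)) ->
  Ck j U th -> Ck j U lam -> Ck j U (fun x => f (th x, lam x)).
Proof.
move=> bW cf hU c1 c2; apply: (@Ck_comp R V (R * R)%type W j U near2 (fun x => (th x, lam x)) f) => //.
- by apply: fin_basis_prod; exact: fin_basisR.
- exact: Ck_pair.
Qed.

Lemma Ck_lambda V j (U : set V) (W : normedModType R) (f : R -> W) (lam : V -> R) :
  fin_basis W -> Ck j [set l | near_lambda D l] f -> (forall x, U x -> near_lambda D (lam x)) ->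
  Ck j U lam -> Ck j U (fun x => f (lam x)).
Proof.
move=> bW cf hU c2; apply: (@Ck_comp R V R W j U [set l | near_lambda D l] lam f) => //.
exact: fin_basisR.
Qed.

Lemma Ck_vfield V j (U : set V) (x : V -> 'cV[R]_n) (lam : V -> R) :
  Ck j U x -> Ck j U lam -> Ck j U (fun v => vfield D (x v) (lam v)).
Proof.
move=> c1 c2; apply: (@Ck_comp R V ('cV[R]_n * R)%type 'cV[R]_n j U setT
  (fun v => (x v, lam v)) (fun p => vfield D p.1 p.2)) => //.
- by apply: fin_basis_prod; [exact: fin_basis_mx|exact: fin_basisR].
- exact: fin_basis_mx.
- exact: Ck_pair.
- exact: Cdiff_Ck (ns_smooth_vfield hD j).
Qed.

(** Arguments in the order eps, theta, lambda, z. *)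
Definition quad := (R * R * R * 'cV[R]_n)%type.
Definition near4 : set quad := [set x | near_lambda D x.1.2].

Definition hfun (x : quad) : 'cV[R]_n := period D x.1.2 *:
  vfield D (Defs.orbit D x.1.1.2 x.1.2 + x.1.1.1 *: (floquet D x.1.1.2 x.1.2 *m x.2)) x.1.2.

Lemma Ck_along V j (U : set V) (eps th lam : V -> R) (z : V -> 'cV[R]_n) :
  (forall x, U x -> near_lambda D (lam x)) ->
  Ck j U eps -> Ck j U th -> Ck j U lam -> Ck j U z ->
  Ck j U (fun x => hfun (eps x, th x, lam x, z x)).
Proof.
move=> hU ce ct cl cz; apply: Ck_scale; first exact: fin_basis_mx.
  by apply: Ck_lambda => //; [exact: fin_basisR|exact: Cdiff_Ck (ns_smooth_period hD j)].
apply: Ck_vfield => //; apply: Ck_add.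
  apply: (@Ck_theta_lambda V j U _ (fun p => Defs.orbit D p.1 p.2)) => //; first exact: fin_basis_mx.
  exact: Cdiff_Ck (ns_smooth_orbit hD j).
apply: Ck_scale => //; first exact: fin_basis_mx.
apply: Ck_mulmx => //.
apply: (@Ck_theta_lambda V j U _ (fun p => floquet D p.1 p.2)) => //; first exact: fin_basis_mx.
exact: Cdiff_Ck (ns_smooth_floquet hD j).
Qed.

Lemma Ck_hfun j : Ck j near4 hfun.
Proof.
have i0 := @Ck_id R quad j near4.
have e : (fun x : quad => hfun (x.1.1.1, x.1.1.2, x.1.2, x.2)) = hfun.
  by apply/funext => -[[[? ?] ?] ?].
rewrite -e; apply: Ck_along => //.
- by apply: Ck_fst; apply: Ck_fst; exact: (Ck_fst i0).
- by apply: Ck_snd; apply: Ck_fst; exact: (Ck_fst i0).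
- by apply: Ck_snd; exact: (Ck_fst i0).
- exact: (Ck_snd i0).
Qed.

(** One period in theta, half the radius in lambda, and [|z| <= 2], which contains the unit ball
    around every [astar]. *)
Definition box4 : set quad :=
  ((`[-1, 1]%classic `*` `[0, 2 * pi]%classic) `*` `[ls - rad, ls + rad]%classic)
    `*` [set z | `|z| <= 2].

Lemma box4_near : box4 `<=` near4.
Proof.
move=> [[[e t] l] z] [[_ /= hl] _]; apply: near_rad.
by move: hl; rewrite in_itv /= ler_norml => /andP[h1 h2]; apply/andP; split; lra.
Qed.

Lemma box4_compact : compact box4.
Proof.
apply: compact_setX; last exact: mx_ball_compact.
by do 2! (apply: compact_setX; last exact: segment_compact); exact: segment_compact.
Qed.

Lemma box4_convex : convex_set box4.
Proof.
apply: setX_convex; last exact: norm_ball_convex.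
by do 2! (apply: setX_convex; last exact: segment_convex); exact: segment_convex.
Qed.

Lemma fin_basis_quad : fin_basis quad.
Proof.
apply: fin_basis_prod; last exact: fin_basis_mx.
by do 2! (apply: fin_basis_prod; last exact: fin_basisR); exact: fin_basisR.
Qed.

Definition eps_dir : quad := (1, 0, 0, 0).

Lemma quad_line (th lam : R) (z : 'cV[R]_n) (s : R) :
  ((0, th, lam, z) : quad) + s *: eps_dir = (s, th, lam, z).
Proof.
by congr (_, _, _, _) => /=; rewrite ?scaler0 ?addr0 // add0r; exact: mulr1.
Qed.

Lemma jac_derive x lam y : near_lambda D lam -> 'D_y (vfield D ^~ lam) x = jac D x lam *m y.
Proof.
move=> nl.
have df : differentiable (vfield D ^~ lam) x.
  have := @Ck_vfield _ 1 setT id (fun=> lam) (@Ck_id R _ 1 setT) (@Ck_cst R _ _ 1 setT lam).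
  by case=> + _; apply.
rewrite deriveE // {1}(_ : y = \sum_j y j 0 *: delta_mx j 0); last first.
  by rewrite [LHS]matrix_sum_delta; apply: eq_bigr => j _; rewrite big_ord1.
rewrite linear_sum; apply/colP => i; rewrite summxE mxE; apply: eq_bigr => j _.
by rewrite linearZ -deriveE // !mxE mulrC.
Qed.

(** The increment of [hfun] in eps beyond first order: the derivative of [hfun] at eps = 0 is the
    Jacobian term. *)
Definition qfun (eps th lam : R) (z : 'cV[R]_n) : 'cV[R]_n :=
  hfun (eps, th, lam, z) - hfun (0, th, lam, z)
  - eps *: (period D lam *: (jac D (Defs.orbit D th lam) lam *m (floquet D th lam *m z))).

Lemma qfun_est : exists2 C, 0 <= C & forall eps th lam lam' z z',
  `|eps| < 1 -> 0 <= th <= 2 * pi -> `|lam - ls| <= rad -> `|lam' - ls| <= rad ->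
  `|z| <= 2 -> `|z'| <= 2 ->
  `|qfun eps th lam z| <= C * `|eps| ^+ 2 /\
  `|qfun eps th lam z - qfun eps th lam' z'| <= C * `|eps| ^+ 2 * (`|lam - lam'| + `|z - z'|).
Proof.
have [gs [g0 cg dg]] := Ck_chain eps_dir (Ck_hfun 3).
have c2 : Ck 1 near4 (gs 2%N) := cg 2%N isT.
have [B B0 hB] := compact_bound box4_compact (fun x hx => Ck_continuous c2 (box4_near hx)).
have [L L0 hL] := Ck_lipschitz fin_basis_quad (@fin_basis_mx R n 1) box4_near box4_compact box4_convex c2.
have dline j (th lam : R) z s : (j < 3)%N -> near_lambda D lam ->
    is_derive s (1 : R) (fun s => gs j (s, th, lam, z)) (gs j.+1 (s, th, lam, z)).
  move=> j3 nl; have := @is_derive_line R _ _ (gs j) (0, th, lam, z) eps_dir s.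
  rewrite quad_line dg // => h.
  have j3' : (0 < 3 - j)%N by rewrite subn_gt0.
  move: (h (Ck_differentiable j3' (cg j (ltnW j3)) (nl : near4 (s, th, lam, z)))); congr is_derive.
  by apply/funext => u; rewrite quad_line.
have gs1 th lam z : near_lambda D lam -> gs 1%N (0, th, lam, z) =
    period D lam *: (jac D (Defs.orbit D th lam) lam *m (floquet D th lam *m z)).
  move=> nl; have h1 := dline 0%N th lam z 0 isT nl.
  have df : differentiable (vfield D ^~ lam) (Defs.orbit D th lam + (0 : R) *: (floquet D th lam *m z)).
    have := @Ck_vfield _ 1 setT id (fun=> lam) (@Ck_id R _ 1 setT) (@Ck_cst R _ _ 1 setT lam).
    by case=> + _; apply.
  have h2 := is_deriveZ (period D lam) (is_derive_line df).
  rewrite scale0r addr0 jac_derive // in h2.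
  rewrite -(@derive_val _ _ _ _ _ _ _ h2) -(@derive_val _ _ _ _ _ _ _ h1) g0.
  by congr derive.
exists (B + L) => [|eps th lam lam' z z' e1 th1 l1 l1' z2 z2']; first exact: addr_ge0.
have inbox s lam0 z0 : `|s| < 1 -> `|lam0 - ls| <= rad -> `|z0| <= 2 -> box4 (s, th, lam0, z0).
  move=> s1 hl hz; split=> //=; split=> /=; last first.
    by rewrite in_itv /=; move: hl; rewrite ler_norml => /andP[? ?]; apply/andP; split; lra.
  split=> /=; rewrite in_itv //=.
  by move: s1; rewrite ltr_norml => /andP[? ?]; apply/andP; split; exact: ltW.
have sum2 (f : nat -> R) (x : R) : \sum_(j < 2) f j / j`!%:R * x ^+ j = f 0%N + f 1%N * x.
  by rewrite !big_ord_recl big_ord0 /= /bump /= !divr1 expr0 mulr1 expr1 addr0.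
have qE s lam0 z0 : near_lambda D lam0 -> qfun s th lam0 z0 =
    gs 0%N (s, th, lam0, z0) - gs 0%N (0, th, lam0, z0) - s *: gs 1%N (0, th, lam0, z0).
  by move=> nl; rewrite /qfun gs1 // g0.
have nl := near_rad l1; have nl' := near_rad l1'.
have e20 : 0 <= `|eps| ^+ 2 by rewrite exprn_ge0.
split.
- apply: (@le_trans _ _ (B * `|eps| ^+ 2)); last by rewrite ler_wpM2r // lerDl.
  apply/mx_normP => [|i j]; first by rewrite mulr_ge0.
  rewrite (ord1 j) qE //.
  have := @taylor_bound R 2 (fun j s => gs j (s, th, lam, z) i 0) 1 B B0 _ _ eps e1.
  rewrite (sum2 (fun j => gs j (0, th, lam, z) i 0)) => h.
  have {}h : `|gs 0%N (eps, th, lam, z) i 0 - (gs 0%N (0, th, lam, z) i 0 +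
      gs 1%N (0, th, lam, z) i 0 * eps)| <= B * `|eps| ^+ 2.
    apply: h => [j' x j2 x1|x x1]; first by apply: is_derive_coord; apply: dline => //; exact: ltnW.
    by apply: le_trans (hB _ (inbox x lam z x1 l1 z2)); exact: mx_entry_le.
  by apply: le_trans h; rewrite !mxE opprD addrA [_ * eps]mulrC.
- set d := `|lam - lam'| + `|z - z'|.
  have d0 : 0 <= d by rewrite addr_ge0.
  apply: (@le_trans _ _ (L * d * `|eps| ^+ 2)); last first.
    by rewrite mulrAC ler_wpM2r // ler_wpM2r // lerDr.
  apply/mx_normP => [|i j]; first by rewrite !mulr_ge0.
  rewrite (ord1 j) !qE //.
  have Ld : 0 <= L * d by rewrite mulr_ge0.
  have := @taylor_bound R 2 (fun j s => gs j (s, th, lam, z) i 0 - gs j (s, th, lam', z') i 0) 1 _ Ld _ _ eps e1.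
  rewrite (sum2 (fun j => gs j (0, th, lam, z) i 0 - gs j (0, th, lam', z') i 0)) => h.
  have {}h : `|gs 0%N (eps, th, lam, z) i 0 - gs 0%N (eps, th, lam', z') i 0 -
      (gs 0%N (0, th, lam, z) i 0 - gs 0%N (0, th, lam', z') i 0 +
      (gs 1%N (0, th, lam, z) i 0 - gs 1%N (0, th, lam', z') i 0) * eps)| <= L * d * `|eps| ^+ 2.
    apply: h => [j' x j2 x1|x x1].
      by apply: is_deriveB; apply: is_derive_coord; apply: dline => //; exact: ltnW.
    have h := hL _ _ (inbox x lam' z' x1 l1' z2') (inbox x lam z x1 l1 z2).
    apply: (@le_trans _ _ `|gs 2%N (x, th, lam, z) - gs 2%N (x, th, lam', z')|).
      have := mx_entry_le (gs 2%N (x, th, lam, z) - gs 2%N (x, th, lam', z')) i 0.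
      by rewrite !mxE.
    apply: le_trans h _; rewrite ler_wpM2l // !prod_normE /= !subrr !normr0.
    by rewrite !ge_max addr_ge0 //= /d lerDl lerDr !normr_ge0.
  apply: le_trans h; rewrite !mxE le_eqVlt; apply/orP; left; apply/eqP; congr (`|_|).
  by ring.
Qed.

End QuadraticRemainder.

Lemma half_sub1 (R : realType) : 2^-1 - 1 <= - 4^-1 :> R.
Proof. by lra. Qed.

(** The derivative of the remainder at [u] is [g u - g c], which is at most [L * kap] on the
    [kap]-ball; the mean value inequality does the rest. *)
Lemma linearization_lip (R : realType) (f g : R -> R) (c r L : R) : 0 <= L ->
  (forall x : R, `|x - c| <= r -> is_derive x (1 : R) f (g x)) ->
  (forall x : R, `|x - c| <= r -> `|g x - g c| <= L * `|x - c|) ->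
  forall kap x y : R, kap <= r -> `|x - c| <= kap -> `|y - c| <= kap ->
  `|(f x - f c - (x - c) * g c) - (f y - f c - (y - c) * g c)| <= L * kap * `|x - y|.
Proof.
move=> L0 df lg kap x y kr.
pose q (x : R) := f x - f c - (x - c) * g c.
have dq (u : R) : `|u - c| <= r -> is_derive u (1 : R) q (g u - g c).
  move=> ur; have d2 := is_deriveB (df u ur) (is_derive_cst (f c) u (1 : R)).
  have d3 := is_deriveB (is_derive_id u (1 : R)) (is_derive_cst c u (1 : R)).
  have := is_deriveB d2 (is_deriveZ (g c) d3).
  rewrite !subr0 -[g c *: 1]/(g c * 1) mulr1; congr is_derive.
  by apply/funext => v; rewrite /q [_ * g c]mulrC.
have le_case (u v : R) : u <= v -> `|u - c| <= kap -> `|v - c| <= kap ->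
    `|q v - q u| <= L * kap * (v - u).
  move=> uv; rewrite ler_distl => /andP[u1 _]; rewrite ler_distl => /andP[_ v2].
  have hb (w : R) : w \in `[u, v] -> `|w - c| <= kap.
    rewrite in_itv /= ler_distl => /andP[h1 h2].
    by rewrite (le_trans u1 h1) (le_trans h2 v2).
  apply: (@mvt_le R q (fun w => g w - g c)) => // w /hb wk.
    by apply: dq; exact: le_trans wk kr.
  by rewrite (le_trans (lg w (le_trans wk kr))) // ler_wpM2l.
move=> xk yk; rewrite -/(q x) -/(q y); have [xy|/ltW yx] := leP x y.
  by rewrite distrC [`|x - y|]distrC [`|y - x|]ger0_norm ?subr_ge0 // le_case.
by rewrite [`|x - y|]ger0_norm ?subr_ge0 // le_case.
Qed.

(** * The nonlinear remainder *)

Section NonlinearEstimate.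
Context {R : realType} {k : nat}.
Notation n := (2 + k + 1)%N.
Variable D : ns_data R k.
Hypothesis hD : neimark_sacker D.
Implicit Types W X Y Z : normedModType R.
Let ls := lambda_star D.
Let w0 := omega_star D.

(* The values of (z, dz/dphi, lambda, omega, eta) at one point of the torus. *)
Definition point : Type := ('cV[R]_n * 'cV[R]_n * R * R * R)%type.
Definition pz (p : point) : 'cV[R]_n := p.1.1.1.1.
Definition py (p : point) : 'cV[R]_n := p.1.1.1.2.
Definition plam (p : point) : R := p.1.1.2.
Definition pom (p : point) : R := p.1.2.
Definition peta (p : point) : R := p.2.
Definition base (ph : R) : point := (astar k ph, dastar k ph, ls, w0, 0).

(** The bound 1/2 keeps [1 + eps * eta] away from zero; half the radius keeps lambda in the region
    of smoothness. *)
Definition kap0 : R := Num.min 2^-1 (lambda_radius D / 2).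

Lemma kap0_gt0 : 0 < kap0.
Proof. by rewrite lt_min invr_gt0 ltr0n /= (rad_gt0 hD). Qed.
Lemma kap0_half : kap0 <= 2^-1. Proof. by rewrite ge_min lexx. Qed.
Lemma kap0_rad : kap0 <= lambda_radius D / 2. Proof. by rewrite ge_min lexx orbT. Qed.

(* [b] and [l] are the orders in [kap] of the size and of the Lipschitz constant
   on the [kap]-ball around the base point; products add up these orders. *)
Definition small_lip (b l : nat) (X : normedModType R) (u : point -> R -> R -> R -> X) : Prop :=
  exists2 C, 0 <= C & forall kap eps th ph (p p' : point), 0 <= kap <= kap0 -> `|eps| <= kap ->
    0 <= th <= 2 * pi -> `|(p : 'cV[R]_n * 'cV[R]_n * R * R * R) - base ph| <= kap ->
    `|(p' : 'cV[R]_n * 'cV[R]_n * R * R * R) - base ph| <= kap ->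
    `|u p eps th ph| <= C * kap ^+ b /\
    `|u p eps th ph - u p' eps th ph| <= C * kap ^+ l * `|(p : 'cV[R]_n * 'cV[R]_n * R * R * R) - p'|.

Lemma astar_norm ph : `|astar k ph : 'cV[R]_n| <= 1 /\ `|dastar k ph : 'cV[R]_n| <= 1.
Proof.
have c1 := cos_max ph; have s1 := sin_max ph.
split; apply/mx_normP => // i j; rewrite (ord1 j).
  have -> : (astar k ph : 'cV[R]_n) i 0 = cos ph * (i == ix1)%:R + sin ph * (i == ix2)%:R.
    by rewrite -e1E -e2E /astar; move: (e1 k) (e2 k) => x y; rewrite !mxE.
  by case: (ixP i) => [||j'|] /=; rewrite ?mulr1 ?mulr0 ?addr0 ?add0r ?normr0.
have -> : (dastar k ph : 'cV[R]_n) i 0 = - sin ph * (i == ix1)%:R + cos ph * (i == ix2)%:R.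
  by rewrite -e1E -e2E /dastar; move: (e1 k) (e2 k) => x y; rewrite !mxE.
by case: (ixP i) => [||j'|] /=; rewrite ?mulr1 ?mulr0 ?addr0 ?add0r ?normrN ?normr0.
Qed.

Lemma point_norms (p : 'cV[R]_n * 'cV[R]_n * R * R * R) :
  [/\ `|p.1.1.1.1| <= `|p|, `|p.1.1.1.2| <= `|p|, `|p.1.1.2| <= `|p|, `|p.1.2| <= `|p| & `|p.2| <= `|p|].
Proof.
have h1 := norm_fst p; have h2 := norm_fst p.1; have h3 := norm_fst p.1.1; have h4 := norm_fst p.1.1.1.
have h5 := norm_snd p; have h6 := norm_snd p.1; have h7 := norm_snd p.1.1; have h8 := norm_snd p.1.1.1.
split=> //.
- by rewrite (le_trans h4) // (le_trans h3) // (le_trans h2).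
- by rewrite (le_trans h8) // (le_trans h3) // (le_trans h2).
- by rewrite (le_trans h7) // (le_trans h2).
- by rewrite (le_trans h6).
Qed.

Lemma small_lip_ext b l X (u v : point -> R -> R -> R -> X) :
  (forall p eps th ph, `|plam p - ls| <= lambda_radius D / 2 -> `|eps| <= 2^-1 -> `|peta p| <= 2^-1 ->
    u p eps th ph = v p eps th ph) ->
  small_lip b l u -> small_lip b l v.
Proof.
move=> uv [C C0 hC]; exists C => // kap eps th ph p p' k0 e0 t0 hp hp'.
have /andP[k0' k1] := k0.
have e1 : `|eps| <= 2^-1 by rewrite (le_trans e0) // (le_trans k1) // kap0_half.
have [_ _ a1 _ a2] := point_norms (p - base ph).
have [_ _ b1 _ b2] := point_norms (p' - base ph).
rewrite /= subr0 in a2; rewrite /= subr0 in b2.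
rewrite -!uv //; first exact: hC.
- by rewrite (le_trans b1) // (le_trans hp') // (le_trans k1) // kap0_rad.
- by rewrite (le_trans b2) // (le_trans hp') // (le_trans k1) // kap0_half.
- by rewrite (le_trans a1) // (le_trans hp) // (le_trans k1) // kap0_rad.
- by rewrite (le_trans a2) // (le_trans hp) // (le_trans k1) // kap0_half.
Qed.

Lemma kap_pow (kap : R) (i j : nat) : 0 <= kap <= kap0 -> (j <= i)%N -> kap ^+ i <= kap ^+ j.
Proof.
move=> /andP[k0 k1] ji; apply: ler_wiXn2l => //.
by rewrite (le_trans k1) // (le_trans kap0_half) // invf_le1 // ler1n.
Qed.

Lemma small_lip_weak b l b' l' X (u : point -> R -> R -> R -> X) : (b' <= b)%N -> (l' <= l)%N ->
  small_lip b l u -> small_lip b' l' u.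
Proof.
move=> bb ll [C C0 hC]; exists C => // kap eps th ph p p' k0 e0 t0 hp hp'.
have [h1 h2] := hC kap eps th ph p p' k0 e0 t0 hp hp'; split.
  by rewrite (le_trans h1) // ler_wpM2l // kap_pow.
by rewrite (le_trans h2) // ler_wpM2r // ler_wpM2l // kap_pow.
Qed.

Lemma small_lipD b l X (u v : point -> R -> R -> R -> X) : small_lip b l u -> small_lip b l v ->
  small_lip b l (fun p eps th ph => u p eps th ph + v p eps th ph).
Proof.
move=> [C C0 hC] [C' C0' hC']; exists (C + C'); first exact: addr_ge0.
move=> kap eps th ph p p' k0 e0 t0 hp hp'.
have [h1 h2] := hC kap eps th ph p p' k0 e0 t0 hp hp'.
have [h1' h2'] := hC' kap eps th ph p p' k0 e0 t0 hp hp'.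
split; first by rewrite (le_trans (ler_normD _ _)) // mulrDl lerD.
by rewrite opprD addrACA (le_trans (ler_normD _ _)) // !mulrDl lerD.
Qed.

(** Product rule for the orders, from B(x, y) - B(x', y') = B(x - x', y) + B(x', y - y'). *)
Lemma small_lip_bilin b l b1 l1 b2 l2 (X Y Z : normedModType R) (B : X -> Y -> Z) (N : R)
  (u : point -> R -> R -> R -> X) (v : point -> R -> R -> R -> Y) : 0 <= N ->
  (forall x y, `|B x y| <= N * (`|x| * `|y|)) -> (forall x x' y, B x y - B x' y = B (x - x') y) ->
  (forall x y y', B x y - B x y' = B x (y - y')) -> small_lip b1 l1 u -> small_lip b2 l2 v ->
  (b <= b1 + b2)%N -> (l <= b1 + l2)%N -> (l <= l1 + b2)%N ->
  small_lip b l (fun p eps th ph => B (u p eps th ph) (v p eps th ph)).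
Proof.
move=> N0 bB Bl Br [C C0 hC] [C' C0' hC'] hb hl hl'.
exists (2 * (N * (C * C'))); first by rewrite !mulr_ge0.
move=> kap eps th ph p p' k0 e0 t0 hp hp'; have /andP[k00 _] := k0.
have [h1 h2] := hC kap eps th ph p p' k0 e0 t0 hp hp'.
have [h1' h2'] := hC' kap eps th ph p p' k0 e0 t0 hp hp'.
have [g1 _] := hC kap eps th ph p' p k0 e0 t0 hp' hp.
have Q0 : 0 <= N * (C * C') by rewrite !mulr_ge0.
set d := `|(p : 'cV[R]_n * 'cV[R]_n * R * R * R) - p'| in h2 h2' *.
have d0 : 0 <= d by exact: normr_ge0.
split.
  apply: le_trans (bB _ _) _; apply: (@le_trans _ _ (N * (C * C') * kap ^+ (b1 + b2))).
    rewrite exprD -mulrA ler_wpM2l // (_ : C * C' * _ = (C * kap ^+ b1) * (C' * kap ^+ b2)).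
      by rewrite ler_pM.
    by ring.
  have := kap_pow k0 hb => h; rewrite ler_pM ?exprn_ge0 //.
  by rewrite ler_peMl // ler1n.
set x := u p eps th ph in h1 h2 *; set x' := u p' eps th ph in h2 g1 *.
set y := v p eps th ph in h1' h2' *; set y' := v p' eps th ph in h2' *.
have -> : B x y - B x' y' = B (x - x') y + B x' (y - y') by rewrite -Bl -Br addrA subrK.
rewrite (le_trans (ler_normD _ _)) // (_ : 2 * _ * _ * _ = N * (C * C') * kap ^+ l * d
  + N * (C * C') * kap ^+ l * d); last by ring.
apply: lerD; apply: le_trans (bB _ _) _.
  apply: (@le_trans _ _ (N * (C * C') * kap ^+ (l1 + b2) * d)).
    rewrite exprD -!mulrA ler_wpM2l // (_ : C * _ = (C * kap ^+ l1 * d) * (C' * kap ^+ b2)); last by ring.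
    by rewrite ler_pM.
  by rewrite ler_wpM2r // ler_wpM2l // kap_pow.
apply: (@le_trans _ _ (N * (C * C') * kap ^+ (b1 + l2) * d)).
  rewrite exprD -!mulrA ler_wpM2l // (_ : C * _ = (C * kap ^+ b1) * (C' * kap ^+ l2 * d)); last by ring.
  by rewrite ler_pM.
by rewrite ler_wpM2r // ler_wpM2l // kap_pow.
Qed.

Lemma small_lipZ b l b1 l1 b2 l2 (Y : normedModType R)
  (u : point -> R -> R -> R -> R) (v : point -> R -> R -> R -> Y) :
  small_lip b1 l1 u -> small_lip b2 l2 v ->
  (b <= b1 + b2)%N -> (l <= b1 + l2)%N -> (l <= l1 + b2)%N ->
  small_lip b l (fun p eps th ph => u p eps th ph *: v p eps th ph).
Proof.
apply: (@small_lip_bilin b l b1 l1 b2 l2 R Y Y ( *:%R ) 1) => //.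
- by move=> x y; rewrite normrZ mul1r.
- by move=> x x' y; rewrite scalerBl.
- by move=> x y y'; rewrite scalerBr.
Qed.

Lemma small_lipM b l b1 l1 b2 l2 (u v : point -> R -> R -> R -> R) :
  small_lip b1 l1 u -> small_lip b2 l2 v ->
  (b <= b1 + b2)%N -> (l <= b1 + l2)%N -> (l <= l1 + b2)%N ->
  small_lip b l (fun p eps th ph => u p eps th ph * v p eps th ph).
Proof. exact: (@small_lipZ b l b1 l1 b2 l2 R). Qed.

Lemma mulmx_norm m a c (A : 'M[R]_(m, a)) (B : 'M[R]_(a, c)) : `|A *m B| <= a%:R * (`|A| * `|B|).
Proof.
apply/mx_normP => [|i j]; first by rewrite !mulr_ge0.
rewrite mxE (le_trans (ler_norm_sum _ _ _)) //.
rewrite -[a in a%:R](card_ord a) mulr_natl -sumr_const; apply: ler_sum => b _.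
by rewrite normrM ler_pM // mx_entry_le.
Qed.

Lemma small_lip_mulmx b l b1 l1 b2 l2 m a c
  (u : point -> R -> R -> R -> 'M[R]_(m, a)) (v : point -> R -> R -> R -> 'M[R]_(a, c)) :
  small_lip b1 l1 u -> small_lip b2 l2 v ->
  (b <= b1 + b2)%N -> (l <= b1 + l2)%N -> (l <= l1 + b2)%N ->
  small_lip b l (fun p eps th ph => u p eps th ph *m v p eps th ph).
Proof.
apply: (@small_lip_bilin b l b1 l1 b2 l2 'M[R]_(m, a) 'M[R]_(a, c) 'M[R]_(m, c) (fun x y => x *m y) a%:R) => //.
- exact: mulmx_norm.
- by move=> x x' y; rewrite mulmxBl.
- by move=> x y y'; rewrite mulmxBr.
Qed.

(** A term that does not depend on the point has Lipschitz constant zero, hence any order [l]. *)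
Lemma small_lip_param l X (v : R -> R -> R -> X) (C : R) :
  (forall eps th ph, `|eps| <= 2^-1 -> 0 <= th <= 2 * pi -> `|v eps th ph| <= C) ->
  small_lip 0 l (fun _ => v).
Proof.
move=> hv; exists `|C| => // kap eps th ph p p' k0 e0 t0 hp hp'; have /andP[k00 k1] := k0.
rewrite subrr normr0 expr0 mulr1 !mulr_ge0 ?exprn_ge0 //; split=> //.
rewrite (le_trans _ (ler_norm C)) // hv // (le_trans e0) // (le_trans k1) //.
exact: kap0_half.
Qed.

Lemma small_lip_eps l : small_lip 1 l (fun _ eps _ _ => eps).
Proof.
exists 1 => // kap eps th ph p p' /andP[k0 _] e0 t0 hp hp'.
by rewrite subrr normr0 expr1 !mul1r mulr_ge0 ?exprn_ge0.
Qed.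

(** A deviation from the base point has size [kap] but a Lipschitz constant of order 0 only; the
    product of two such deviations reaches order 1 in both respects. *)
Lemma small_lip_proj (X : normedModType R) (pr : point -> X) (prb : R -> X) :
  (forall ph, pr (base ph) = prb ph) ->
  (forall p p', `|pr p - pr p'| <= `|(p : 'cV[R]_n * 'cV[R]_n * R * R * R) - p'|) ->
  small_lip 1 0 (fun p _ _ ph => pr p - prb ph).
Proof.
move=> e h; exists 1 => // kap eps th ph p p' k0 e0 t0 hp hp'.
by rewrite -e expr1 expr0 !mul1r; split; [exact: le_trans (h _ _) hp|rewrite opprB addrA subrK].
Qed.

Lemma small_lip_proj0 (X : normedModType R) (pr : point -> X) (prb : R -> X) (C : R) :
  (forall ph, pr (base ph) = prb ph) -> (forall ph, `|prb ph| <= C) ->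
  (forall p p', `|pr p - pr p'| <= `|(p : 'cV[R]_n * 'cV[R]_n * R * R * R) - p'|) ->
  small_lip 0 0 (fun p _ _ _ => pr p).
Proof.
move=> e hb h.
have := small_lipD (small_lip_weak (leq0n 1) (leqnn 0) (small_lip_proj e h))
  (@small_lip_param 0 X (fun _ _ ph => prb ph) C (fun _ _ ph _ _ => hb ph)).
by apply: small_lip_ext => p eps th ph _ _ _; rewrite subrK.
Qed.

Lemma lip_pz p p' : `|pz p - pz p'| <= `|(p : 'cV[R]_n * 'cV[R]_n * R * R * R) - p'|.
Proof. by have [] := point_norms (p - p'). Qed.
Lemma lip_py p p' : `|py p - py p'| <= `|(p : 'cV[R]_n * 'cV[R]_n * R * R * R) - p'|.
Proof. by have [] := point_norms (p - p'). Qed.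
Lemma lip_plam p p' : `|plam p - plam p'| <= `|(p : 'cV[R]_n * 'cV[R]_n * R * R * R) - p'|.
Proof. by have [] := point_norms (p - p'). Qed.
Lemma lip_pom p p' : `|pom p - pom p'| <= `|(p : 'cV[R]_n * 'cV[R]_n * R * R * R) - p'|.
Proof. by have [] := point_norms (p - p'). Qed.
Lemma lip_peta p p' : `|peta p - peta p'| <= `|(p : 'cV[R]_n * 'cV[R]_n * R * R * R) - p'|.
Proof. by have [] := point_norms (p - p'). Qed.

Lemma small_lip_theta_lambda W (g : R * R -> W) : fin_basis W -> Ck 1 (near2 D) g ->
  small_lip 0 0 (fun p _ th _ => g (th, plam p)).
Proof.
move=> bW cg; pose rad := lambda_radius D / 2.
pose K : set (R * R) := `[0, 2 * pi]%classic `*` `[ls - rad, ls + rad]%classic.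
have KU : K `<=` near2 D.
  move=> [t l] [_ /=]; rewrite in_itv /= => /andP[h1 h2]; apply: (near_rad hD).
  by rewrite -/ls -/rad ler_distl h1.
have cK : compact K by apply: compact_setX; exact: segment_compact.
have vK : convex_set K by apply: setX_convex; exact: segment_convex.
have [B B0 hB] := compact_bound cK (fun x hx => Ck_continuous cg (KU x hx)).
have [L L0 hL] := Ck_lipschitz (fin_basis_prod (@fin_basisR R) (@fin_basisR R)) bW KU cK vK cg.
exists (B + L) => [|kap eps th ph p p' k0 e0 t0 hp hp']; first exact: addr_ge0.
have /andP[k00 k1] := k0.
have inK (q : point) : `|(q : 'cV[R]_n * 'cV[R]_n * R * R * R) - base ph| <= kap -> K (th, plam q).
  move=> hq; split=> /=; rewrite in_itv //=.
  have [_ _ a1 _ _] := point_norms (q - base ph).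
  have : `|plam q - ls| <= rad := le_trans a1 (le_trans hq (le_trans k1 kap0_rad)).
  by rewrite ler_distl.
rewrite !expr0 mulr1; split.
  by rewrite (le_trans (hB _ (inK p hp))) // lerDl.
rewrite (le_trans (hL _ _ (inK p' hp') (inK p hp))) //.
rewrite mulrDl ler_wpDl ?mulr_ge0 // ler_wpM2l //.
have -> : `|((th, plam p) : R * R) - (th, plam p')| = Num.max `|th - th| `|plam p - plam p'|.
  by rewrite prod_normE.
rewrite subrr normr0 ge_max normr_ge0 /=.
exact: lip_plam.
Qed.

Lemma small_lip_lambda W (g : R -> W) : fin_basis W -> Ck 1 [set l | near_lambda D l] g ->
  small_lip 0 0 (fun p _ _ _ => g (plam p)).
Proof.
move=> bW cg; apply: (@small_lip_theta_lambda W (fun q => g q.2) bW).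
apply: (@Ck_lambda R k D _ 1 (near2 D) W g (fun q => q.2)) => //.
exact: (Ck_snd (@Ck_id R (R * R)%type 1 (near2 D))).
Qed.

(** Beyond its linear part a C^2 function has derivative O([kap]). The size is even of second order,
    but order 1 is all that is claimed. *)
Lemma small_lip_taylor (f : R -> R) : Ck 2 [set l | near_lambda D l] f ->
  small_lip 1 1 (fun p _ _ _ => f (plam p) - f ls - (plam p - ls) * derive1 f ls).
Proof.
move=> [df ddf]; 
have [g fg cg] : exists2 g : R -> R, forall x : R, near_lambda D x -> 'D_1 f x = g x &
  Ck 1 [set l | near_lambda D l] g := ddf (1 : R).
pose rad := lambda_radius D / 2.
pose K : set R := `[ls - rad, ls + rad]%classic.
have inK l : `|l - ls| <= rad -> K l.
  by rewrite /K /= in_itv /= ler_distl.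
have KU : K `<=` [set l | near_lambda D l].
  move=> l; rewrite /K /= in_itv /= => /andP[h1 h2]; apply: (near_rad hD).
  by rewrite -/ls -/rad ler_distl h1.
have [L L0 hL] := Ck_lipschitz (@fin_basisR R) (@fin_basisR R) KU (@segment_compact R _ _)
  (@segment_convex R _ _) cg.
have Kls : K ls by apply: inK; rewrite subrr normr0 ltW // (rad_gt0 hD).
have e1 : derive1 f ls = g ls by rewrite derive1E; exact/fg/KU.
have rle kap l l' : kap <= rad -> `|l - ls| <= kap -> `|l' - ls| <= kap ->
    `|(f l - f ls - (l - ls) * g ls) - (f l' - f ls - (l' - ls) * g ls)| <= L * kap * `|l - l'|.
  apply: (@linearization_lip R f g ls rad L L0) => x /inK xr.
    by apply: DeriveDef; [apply: diff_derivable; exact/df/KU|exact/fg/KU].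
  exact: hL Kls xr.
exists L => // kap eps th ph p p' k0 e0 t0 hp hp'; have /andP[k00 k1] := k0.
have [_ _ a1 _ _] := point_norms (p - base ph).
have [_ _ b1 _ _] := point_norms (p' - base ph).
have hl : `|plam p - ls| <= kap by exact: le_trans a1 hp.
have hl' : `|plam p' - ls| <= kap by exact: le_trans b1 hp'.
have kr : kap <= rad := le_trans k1 kap0_rad.
rewrite expr1 e1; split.
  have := rle kap (plam p) ls kr hl; rewrite !subrr mul0r !subr0 normr0 => /(_ k00) h.
  apply: le_trans h _; rewrite -[leRHS]mulr1 ler_wpM2l ?mulr_ge0 // (le_trans hl) //.
  by rewrite (le_trans k1) // (le_trans kap0_half) // invf_le1 // ler1n.
apply: le_trans (rle kap _ _ kr hl hl') _.
by rewrite ler_wpM2l ?mulr_ge0 // lip_plam.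
Qed.

(** As [qfun] is quadratic in eps, one factor [|eps| <= kap] is left after the division. *)
Lemma small_lip_q : small_lip 1 1 (fun p eps th _ => eps^-1 *: qfun D eps th (plam p) (pz p)).
Proof.
have [C C0 hC] := qfun_est hD.
exists (2 * C) => [|kap eps th ph p p' k0 e0 t0 hp hp']; first by rewrite mulr_ge0.
have /andP[k00 k1] := k0.
have e1 : `|eps| < 1.
  by rewrite (le_lt_trans e0) // (le_lt_trans k1) // (le_lt_trans kap0_half) // invf_lt1 // ltr1n.
have hz (q : point) : `|(q : 'cV[R]_n * 'cV[R]_n * R * R * R) - base ph| <= kap ->
    `|plam q - ls| <= lambda_radius D / 2 /\ `|pz q| <= 2.
  move=> hq; have [a0 _ a1 _ _] := point_norms (q - base ph); split.
    by rewrite (le_trans a1) // (le_trans hq) // (le_trans k1) // kap0_rad.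
  rewrite -(subrK (astar k ph) (pz q)) (le_trans (ler_normD _ _)) //.
  have h1 : `|pz q - astar k ph| <= 1.
    rewrite (le_trans a0) // (le_trans hq) // (le_trans k1) // (le_trans kap0_half) //.
    by rewrite invf_le1 // ler1n.
  exact: lerD h1 (astar_norm ph).1.
have [l1 z1] := hz p hp; have [l2 z2] := hz p' hp'.
have [h1 h2] := hC eps th _ _ _ _ e1 t0 l1 l2 z1 z2.
have ei (x : R) : 0 <= x -> `|eps^-1| * (C * `|eps| ^+ 2 * x) <= C * kap * x.
  (* At eps = 0 the convention that the inverse of 0 is 0 makes the term vanish. *)
  move=> x0; have [->|en0] := eqVneq eps 0.
    by rewrite invr0 normr0 mul0r !mulr_ge0.
  have a0 : `|eps| != 0 by rewrite normr_eq0.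
  have -> : `|eps^-1| * (C * `|eps| ^+ 2 * x) = C * `|eps| * x.
    by rewrite normrV ?unitfE //; move: `|eps| a0 => a a0; field.
  by rewrite ler_wpM2r // ler_wpM2l.
rewrite expr1; split.
  rewrite normrZ; have := ei 1 ler01; rewrite !mulr1 => h.
  apply: le_trans (_ : `|eps^-1| * (C * `|eps| ^+ 2) <= _); first by rewrite ler_wpM2l.
  by rewrite (le_trans h) // ler_wpM2r // ler_peMl // ler1n.
rewrite -scalerBr normrZ.
have d0 : 0 <= `|plam p - plam p'| + `|pz p - pz p'| by rewrite addr_ge0.
apply: le_trans (_ : `|eps^-1| * (C * `|eps| ^+ 2 * (`|plam p - plam p'| + `|pz p - pz p'|)) <= _).
  by rewrite ler_wpM2l.
apply: le_trans (ei _ d0) _.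
have := lip_plam p p'; have := lip_pz p p'; set d := `|_ - p'| => a1 a2.
rewrite (_ : 2 * C * kap * d = C * kap * (d + d)); last by ring.
by rewrite ler_wpM2l ?mulr_ge0 // lerD.
Qed.

Definition sfac (eps eta : R) : R := (1 + eps * eta)^-1.

(** Both estimates come from sfac - 1 = - eps eta sfac and its analogue for differences, with [sfac]
    bounded by 2. *)
Lemma small_lip_sfac : small_lip 1 1 (fun p eps _ _ => sfac eps (peta p) - 1).
Proof.
exists 4 => // kap eps th ph p p' /andP[k0 k1] e0 t0 hp hp'.
have [_ _ _ _ a2] := point_norms (p - base ph).
have [_ _ _ _ b2] := point_norms (p' - base ph).
rewrite /= subr0 -/(peta p) in a2; rewrite /= subr0 -/(peta p') in b2.
have k2 := le_trans k1 kap0_half.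
have pe (q : R) : `|q| <= kap -> `|eps * q| <= 4^-1 /\ 2^-1 <= 1 + eps * q.
  move=> hq; have h : `|eps * q| <= 4^-1.
    rewrite normrM (_ : 4^-1 = 2^-1 * 2^-1); last by field.
    by rewrite ler_pM // (le_trans _ k2).
  split=> //; rewrite -lerBlDl; apply: le_trans (_ : - 4^-1 <= _); first exact: half_sub1.
  by move: h; rewrite ler_norml => /andP[].
have [h1 s1] := pe _ (le_trans a2 hp); have [h2 s2] := pe _ (le_trans b2 hp').
have sb (s : R) : 2^-1 <= s -> `|s^-1| <= 2.
  move=> hs; have s0 : 0 < s by rewrite (lt_le_trans _ hs) // invr_gt0.
  have i0 : 0 <= s^-1 by rewrite invr_ge0 ltW.
  by rewrite (ger0_norm i0) -[leLHS]mul1r ler_pdivrMr // mulrC -ler_pdivrMr // div1r.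
have n1 : 1 + eps * peta p != 0 by rewrite gt_eqF // (lt_le_trans _ s1) // invr_gt0.
have n2 : 1 + eps * peta p' != 0 by rewrite gt_eqF // (lt_le_trans _ s2) // invr_gt0.
rewrite /sfac expr1; split.
  rewrite (_ : _ - 1 = - (eps * peta p) * (1 + eps * peta p)^-1); last by field.
  rewrite normrM normrN normrM (_ : 4 * kap = kap * 2 * 2); last by ring.
  rewrite ler_pM ?mulr_ge0 ?sb // ler_pM //.
  by rewrite (le_trans a2) // (le_trans hp) // (le_trans k2) // (le_trans (_ : _ <= 1)) // ?ler1n // invf_le1 // ler1n.
rewrite (_ : _ - _ = - eps * (peta p - peta p') * ((1 + eps * peta p)^-1 * (1 + eps * peta p')^-1)); last first.
  by field; rewrite n1 n2.
rewrite normrM normrM normrN (_ : 4 * kap * _ = kap * `|(p : 'cV[R]_n * 'cV[R]_n * R * R * R) - p'| * (2 * 2)); last by ring.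
rewrite ler_pM ?mulr_ge0 //; last by rewrite normrM ler_pM // sb.
by rewrite ler_pM // lip_peta.
Qed.

End NonlinearEstimate.

(** * Floquet form of the remainder and its smallness *)

Section NonlinearRemainder.
Context {R : realType} {k : nat}.
Notation n := (2 + k + 1)%N.
Notation ix1 := (@ix1 k).
Notation ix2 := (@ix2 k).
Notation ixn := (@ixn k).
Notation point := (@point R k).
Variable D : ns_data R k.
Hypothesis hD : neimark_sacker D.
Notation ls := (lambda_star D).
Notation w0 := (omega_star D).
Notation E0 := (Emat D (lambda_star D)).
Notation aR := (derive1 (alphaR D) (lambda_star D)).
Notation aI := (derive1 (alphaI D) (lambda_star D)).
Notation small_lip := (@small_lip R k D).

(** On the critical plane [Emat] is a dilation plus a rotation generator, and [dastar] is [astar]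
    turned by a right angle. *)
Lemma Emat_astar lam phi : Emat D lam *m astar k phi =
  alphaR D lam *: astar k phi + alphaI D lam *: dastar k phi.
Proof.
have c1 : Emat D lam *m e1 k = alphaR D lam *: e1 k + alphaI D lam *: e2 k.
  rewrite /e1 -colE; apply/colP => i; rewrite [RHS]mxE [X in _ = X + _]mxE [X in _ = _ + X]mxE.
  rewrite e1E e2E mxE /Emat; case: (ixP i) => [||j|].
  - by rewrite /ix1 block_mxEul block_mxEul mxE !eqxx /=; ring.
  - by rewrite /ix2 block_mxEul block_mxEul mxE !eqxx /=; ring.
  - by rewrite /ixm block_mxEul block_mxEdl mxE /=; ring.
  - by rewrite /ixn block_mxEdl mxE /=; ring.
have c2 : Emat D lam *m e2 k = alphaR D lam *: e2 k - alphaI D lam *: e1 k.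
  rewrite /e2 -colE; apply/colP => i; rewrite [RHS]mxE [X in _ = X + _]mxE [X in _ = _ + X]mxE [in X in _ = _ + X]mxE.
  rewrite e1E e2E mxE /Emat; case: (ixP i) => [||j|].
  - by rewrite /ix1 block_mxEul block_mxEul mxE !eqxx /=; ring.
  - by rewrite /ix2 block_mxEul block_mxEul mxE !eqxx /=; ring.
  - by rewrite /ixm block_mxEul block_mxEdl mxE /=; ring.
  - by rewrite /ixn block_mxEdl mxE /=; ring.
rewrite /astar /dastar mulmxDr -!scalemxAr c1 c2.
by move: (e1 k) (e2 k) => x y; apply/colP => i; rewrite !mxE; ring.
Qed.

Lemma Ck_Emat j : Ck j [set l | near_lambda D l] (Emat D).
Proof.
apply: Ck_block; try exact: Ck_cst.
apply: Ck_block; try exact: Ck_cst; last exact: Cdiff_Ck (ns_smooth_Etilde hD j).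
apply: Ck_mx => p q; rewrite (_ : (fun x => _) = fun x => if p == q then alphaR D x
  else if (p < q)%N then - alphaI D x else alphaI D x); last by apply/funext => x; rewrite mxE.
case: eqP => _; first exact: Cdiff_Ck (ns_smooth_alphaR hD j).
by case: (p < q)%N; [apply: Ck_opp|]; exact: Cdiff_Ck (ns_smooth_alphaI hD j).
Qed.

Lemma floquet_dot_Ck j : exists2 g : R * R -> 'M[R]_n,
  (forall th lam, near_lambda D lam -> floquet_dot D th lam = g (th, lam)) & Ck j (near2 D) g.
Proof.
have [df ddf] : Ck j.+1 (near2 D) (fun p : R * R => floquet D p.1 p.2) :=
  Cdiff_Ck (ns_smooth_floquet hD j.+1).
have [g fg cg] : exists2 g : R * R -> 'M[R]_n, forall x : R * R, near2 D x ->
   'D_((1, 0) : R * R) (fun p : R * R => floquet D p.1 p.2) x = g x & Ck j (near2 D) g := ddf (1, 0).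
exists g => // th lam nl.
have el (t : R) : (0, lam) + t *: ((1, 0) : R * R) = (t, lam).
  by congr (_, _) => /=; rewrite ?scaler0 ?addr0 // add0r; exact: mulr1.
have h : is_derive th (1 : R) (fun t : R => floquet D t lam) (g (th, lam)).
  have h0 := @is_derive_line R (R * R)%type 'M[R]_n (fun p => floquet D p.1 p.2) (0, lam) (1, 0) th.
  rewrite el in h0; move: (h0 (df (th, lam) nl)); rewrite (fg (th, lam) nl); congr is_derive.
  by apply/funext => t; rewrite el.
by rewrite /floquet_dot derive1E; apply: derive_val.
Qed.

(** The Floquet equation T J P - P' = P E replaces the Jacobian term by P E z + P' z; the latter
    cancels the leading part of the P' term and leaves only its part with [eps * eta]. With the
    inverse of 0 equal to 0 the formula includes eps = 0. *)
Lemma Gmap_split z lam eta th eps : near_lambda D lam -> Gmap D z lam eta th eps =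
  Emat D lam *m z + cramer_inv (floquet D th lam) *m
    (eps^-1 *: qfun D eps th lam z - (eps * eta) *: (floquet_dot D th lam *m z)).
Proof.
move=> nl; rewrite /Gmap; have [->|e0] := eqVneq eps 0.
  by rewrite invr0 scale0r mul0r scale0r subrr mulmx0 addr0.
have Pu := ns_floquet_unit hD th nl; rewrite -cramer_invE //.
have fe := ns_floquet_eq hD th nl.
rewrite /qfun /hfun /= scale0r addr0.
set h1 := period D lam *: vfield D (_ + _) lam; set h0 := period D lam *: vfield D _ lam.
set d := floquet_dot D th lam *m z; pose u := floquet D th lam *m (Emat D lam *m z).
have -> : period D lam *: (jac D (Defs.orbit D th lam) lam *m (floquet D th lam *m z)) =
    u + d.
  by rewrite /u mulmxA scalemxAl mulmxA -fe mulmxBl subrK.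
have -> : Emat D lam *m z = invmx (floquet D th lam) *m u by rewrite mulKmx.
rewrite -mulmxDr scalemxAr; congr (_ *m _).
move: u h1 h0 d => u h1 h0 d; apply/colP => i; rewrite !mxE.
by field.
Qed.

(* What remains of the equation, divided by [1 + eps eta], beyond the linear
   operator [lin_op] and the forcing [lin_forcing]. *)
Definition gN (p : point) (eps th ph : R) : 'cV[R]_n :=
  sfac eps (peta p) *: Gmap D (pz p) (plam p) (peta p) th eps - E0 *m pz p
  - (plam p - ls) *: (aR *: astar k ph + aI *: dastar k ph)
  + (1 - sfac eps (peta p)) *: (peta p *: en k)
  - (sfac eps (peta p) * pom p - w0) *: py p + (pom p - w0) *: dastar k ph.

(** Rearrangement of [gN] into products with known orders: each summand contains either a factor of
    order (1, 1) or two deviations from the base point. Signs are moved inside so that only sums and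
    products have to be estimated. *)
Definition gN_split (p : point) (eps th ph : R) : 'cV[R]_n :=
  (sfac eps (peta p) - 1) *: (Emat D (plam p) *m pz p + cramer_inv (floquet D th (plam p)) *m
    (eps^-1 *: qfun D eps th (plam p) (pz p)
      + (eps * peta p) *: (- floquet_dot D th (plam p) *m pz p)))
  + cramer_inv (floquet D th (plam p)) *m
    (eps^-1 *: qfun D eps th (plam p) (pz p)
      + (eps * peta p) *: (- floquet_dot D th (plam p) *m pz p))
  + (Emat D (plam p) - E0) *m (pz p - astar k ph)
  + (alphaR D (plam p) - alphaR D ls - (plam p - ls) * aR) *: astar k ph
  + (alphaI D (plam p) - alphaI D ls - (plam p - ls) * aI) *: dastar k ph
  + (sfac eps (peta p) - 1) *: (peta p *: - en k)
  + (sfac eps (peta p) - 1) *: (pom p *: - py p)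
  + (pom p - w0) *: (- (py p - dastar k ph)).

(** The terms in [astar] and [dastar] match because at the critical parameter [alphaR] vanishes and
    [alphaI] is [omega_star]. *)
Lemma gN_splitE p eps th ph : near_lambda D (plam p) -> gN p eps th ph = gN_split p eps th ph.
Proof.
move=> nl; rewrite /gN Gmap_split // /gN_split.
rewrite [- floquet_dot _ _ _ *m _]mulNmx scalerN.
move: (cramer_inv _ *m _) => Q.
rewrite mulmxBl !mulmxBr !Emat_astar (ns_alphaR_star hD) -/w0.
move: (Emat D (plam p) *m pz p) (E0 *m pz p) => x y.
move: (astar k ph) (dastar k ph) (en k) (py p) => a b c d.
by apply/colP => i; rewrite !mxE; ring.
Qed.

Lemma small_lip_param1 b l (X : normedModType R) (v : R -> X) (C : R) : (b <= 0)%N -> (forall ph, `|v ph| <= C) ->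
  small_lip b l (fun _ _ _ ph => v ph).
Proof.
rewrite leqn0 => /eqP -> hv.
by apply: (@small_lip_param R k D l X (fun _ _ ph => v ph) C).
Qed.

Lemma small_lip_base (X : normedModType R) (u : point -> R -> R -> R -> X) : small_lip 0 0 u ->
  small_lip 1 0 (fun p eps th ph => u p eps th ph - u (base D ph) eps th ph).
Proof.
move=> [C C0 hC]; exists C => // kap eps th ph p p' k0 e0 t0 hp hp'.
have hb : `|(base D ph : 'cV[R]_n * 'cV[R]_n * R * R * R) - base D ph| <= kap.
  by rewrite subrr normr0; case/andP: k0.
split.
  have [_ h] := hC kap eps th ph p (base D ph) k0 e0 t0 hp hb.
  rewrite expr0 mulr1 in h; rewrite expr1; apply: le_trans h _; exact: ler_wpM2l.
by rewrite opprB addrA subrK; exact: (hC kap eps th ph p p' k0 e0 t0 hp hp').2.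
Qed.

Lemma small_lip_gN : small_lip 1 1 gN.
Proof.
apply: (@small_lip_ext R k D 1 1 'cV[R]_n gN_split gN).
  by move=> p eps th ph hl _ _; rewrite gN_splitE //; exact: near_rad.
have sz : small_lip 0 0 (fun p _ _ _ => pz p).
  apply: (@small_lip_proj0 R k D _ (@pz R k) (astar k) 1) => // [ph|p p'].
    exact: (astar_norm ph).1.
  exact: lip_pz.
have sy : small_lip 0 0 (fun p _ _ _ => py p).
  apply: (@small_lip_proj0 R k D _ (@py R k) (dastar k) 1) => // [ph|p p'].
    exact: (astar_norm ph).2.
  exact: lip_py.
have so : small_lip 0 0 (fun p _ _ _ => pom p).
  by apply: (@small_lip_proj0 R k D R (@pom R k) (fun=> w0) `|w0|) => // p p'; exact: lip_pom.
have se : small_lip 0 0 (fun p _ _ _ => peta p).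
  by apply: (@small_lip_proj0 R k D R (@peta R k) (fun=> 0) 0) => // [ph|p p']; [rewrite normr0|exact: lip_peta].
have sE : small_lip 0 0 (fun p _ _ _ => Emat D (plam p)).
  by apply: small_lip_lambda => //; [exact: fin_basis_mx|exact: Ck_Emat].
have sP : small_lip 0 0 (fun p _ th _ => cramer_inv (floquet D th (plam p))).
  apply: (@small_lip_theta_lambda R k D hD _ (fun q => cramer_inv (floquet D q.1 q.2))) => //.
    exact: fin_basis_mx.
  apply: Ck_cramer_inv; last exact: Cdiff_Ck (ns_smooth_floquet hD 1).
  by move=> q nq; exact: ns_floquet_unit.
have sF : small_lip 0 0 (fun p _ th _ => - floquet_dot D th (plam p)).
  have [g fg cg] := floquet_dot_Ck 1.
  apply: (@small_lip_ext R k D 0 0 _ (fun p _ th _ => - g (th, plam p))).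
    by move=> p eps th ph hl _ _; rewrite fg //; exact: near_rad.
  apply: (@small_lip_theta_lambda R k D hD _ (fun q => - g q)) => //.
    exact: fin_basis_mx.
  exact: Ck_opp.
have ss := @small_lip_sfac R k D.
have sQ : small_lip 1 1 (fun p eps th ph => cramer_inv (floquet D th (plam p)) *m
    (eps^-1 *: qfun D eps th (plam p) (pz p)
      + (eps * peta p) *: (- floquet_dot D th (plam p) *m pz p))).
  apply: (small_lip_mulmx sP (b2 := 1) (l2 := 1)) => //; apply: small_lipD; first exact: small_lip_q.
  apply: (@small_lipZ R k D 1 1 1 1 0 0) => //.
    apply: (@small_lipM R k D 1 1 1 1 0 0) => //; first exact: small_lip_eps.
  exact: (small_lip_mulmx sF sz).
have sEz : small_lip 0 0 (fun p _ _ _ => Emat D (plam p) *m pz p) by exact: (small_lip_mulmx sE sz).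
have w01 : (0 <= 1)%N by [].
apply: small_lipD; last first.
  apply: (@small_lipZ R k D 1 1 1 0 1 0) => //.
    exact: (small_lip_base so).
  rewrite (_ : (fun p eps th ph => _) = fun p (_ _ ph : R) => (-1) *: (py p - dastar k ph)); last first.
    by apply/funext => p; apply/funext => ?; apply/funext => ?; apply/funext => ph; rewrite scaleN1r.
  apply: (@small_lipZ R k D 1 0 0 0 1 0 _ (fun _ _ _ _ => -1)) => //.
    by apply: (@small_lip_param1 0 0 R (fun=> -1) 1) => // ph; rewrite normrN1.
  exact: (small_lip_base sy).
apply: small_lipD; last first.
  apply: (small_lipZ ss (b2 := 0) (l2 := 0)) => //.
  apply: (small_lipZ so (b2 := 0) (l2 := 0)) => //.
  rewrite (_ : (fun p eps th ph => _) = fun p (_ _ _ : R) => (-1) *: py p); last first.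
    by apply/funext => p; apply/funext => ?; apply/funext => ?; apply/funext => ph; rewrite scaleN1r.
  apply: (@small_lipZ R k D 0 0 0 0 0 0 _ (fun _ _ _ _ => -1)) => //.
  by apply: (@small_lip_param1 0 0 R (fun=> -1) 1) => // ph; rewrite normrN1.
apply: small_lipD; last first.
  apply: (small_lipZ ss (b2 := 0) (l2 := 0)) => //.
  apply: (small_lipZ se (b2 := 0) (l2 := 0)) => //.
  exact: (@small_lip_param1 0 0 _ (fun=> - en k) `|- en k|).
apply: small_lipD; last first.
  apply: (@small_lipZ R k D 1 1 1 1 0 1) => //.
    by apply: small_lip_taylor => //; exact: Cdiff_Ck (ns_smooth_alphaI hD 2).
  by apply: (@small_lip_param1 0 1 _ _ 1) => // ph; exact: (astar_norm ph).2.
apply: small_lipD; last first.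
  apply: (@small_lipZ R k D 1 1 1 1 0 1) => //.
    by apply: small_lip_taylor => //; exact: Cdiff_Ck (ns_smooth_alphaR hD 2).
  by apply: (@small_lip_param1 0 1 _ _ 1) => // ph; exact: (astar_norm ph).1.
apply: small_lipD; last first.
  apply: (@small_lip_mulmx R k D 1 1 1 0 1 0) => //.
    exact: (small_lip_base sE).
  exact: (small_lip_base sz).
apply: small_lipD; last exact: sQ.
apply: (small_lipZ ss (b2 := 0) (l2 := 0)) => //.
by apply: small_lipD => //; exact: (small_lip_weak _ _ sQ).
Qed.

End NonlinearRemainder.

(** * Linearity of Fourier coefficients, truncation, inner products and derivatives *)

Section LinearCombination.
Context {R : realType} {n : nat}.
Implicit Types (z : R -> R -> 'cV[R]_n) (a b : R).

Definition lc a z b z' (t p : R) : 'cV[R]_n := a *: z t p + b *: z' t p.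

Definition jcont z : Prop := continuous (fun q : R * R => z q.1 q.2).

Lemma circle_int_lin a b (f g : R -> R) : continuous f -> continuous g ->
  circle_int (fun x => a * f x + b * g x) = a * circle_int f + b * circle_int g.
Proof.
move=> cf cg; have cZ (c : R) (h : R -> R) : continuous h -> continuous (fun x => c * h x).
  by move=> ch x; apply: cvgM; [exact: cvg_cst|exact: ch].
by rewrite circle_intD ?circle_intZ //; exact: cZ.
Qed.

Lemma circle_int_lin_mx a b z z' theta i (T : R -> R) : jcont z -> jcont z' -> continuous T ->
  circle_int (fun phi => lc a z b z' theta phi i 0 * T phi) =
  a * circle_int (fun phi => z theta phi i 0 * T phi) + b * circle_int (fun phi => z' theta phi i 0 * T phi).
Proof.
move=> cz cz' cT.
have cM (f : R -> R) : continuous f -> continuous (fun x => f x * T x).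
  by move=> cf x; apply: cvgM; [exact: cf|exact: cT].
rewrite -circle_int_lin; [|exact/cM/continuous_slice..].
by congr circle_int; apply/funext => phi; rewrite /lc !mxE; ring.
Qed.

Lemma acoef_lin m a b z z' theta : jcont z -> jcont z' ->
  acoef m (lc a z b z') theta = a *: acoef m z theta + b *: acoef m z' theta.
Proof.
move=> cz cz'; apply/colP => i; rewrite !mxE circle_int_lin_mx //; last exact: continuous_cosM.
by ring.
Qed.

Lemma bcoef_lin m a b z z' theta : jcont z -> jcont z' ->
  bcoef m (lc a z b z') theta = a *: bcoef m z theta + b *: bcoef m z' theta.
Proof.
move=> cz cz'; apply/colP => i; rewrite !mxE circle_int_lin_mx //; last exact: continuous_sinM.
by ring.
Qed.

Lemma phi_mode_lin m a b z z' theta phi : jcont z -> jcont z' ->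
  phi_mode m (lc a z b z') theta phi = a *: phi_mode m z theta phi + b *: phi_mode m z' theta phi.
Proof.
move=> cz cz'; rewrite /phi_mode acoef_lin // bcoef_lin //.
move: (acoef _ _ _) (acoef _ _ _) (bcoef _ _ _) (bcoef _ _ _) => w x y v.
by apply/colP => i; rewrite !mxE; ring.
Qed.

Lemma S_inf_lin m a b z z' theta phi : jcont z -> jcont z' ->
  S_inf m (lc a z b z') theta phi = a *: S_inf m z theta phi + b *: S_inf m z' theta phi.
Proof.
move=> cz cz'; rewrite /S_inf !scaler_sumr -big_split; apply: eq_bigr => i _.
exact: phi_mode_lin.
Qed.

Lemma modes_lin s a b z z' : jcont z -> jcont z' -> has_only_phi_modes s z ->
  has_only_phi_modes s z' -> has_only_phi_modes s (lc a z b z').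
Proof.
move=> cz cz' mz mz' theta phi; rewrite {1}/lc mz mz' !scaler_sumr -big_split.
by apply: eq_bigr => i _; rewrite phi_mode_lin.
Qed.

Lemma inner2_lin a b z z' (w : R -> 'cV[R]_n) : jcont z -> jcont z' -> continuous w ->
  inner2 (lc a z b z') (fun _ => w) = a * inner2 z (fun _ => w) + b * inner2 z' (fun _ => w).
Proof.
move=> cz cz' cw; rewrite /inner2.
have cd (y : R -> R -> 'cV[R]_n) : jcont y -> continuous (fun q : R * R => dotv (y q.1 q.2) (w q.2)).
  move=> cy; rewrite /dotv => q0.
  have : Ck 0 setT (fun q : R * R => \sum_i y q.1 q.2 i 0 * w q.2 i 0); last exact.
  apply: Ck_sum => i; apply: Ck_mulR.
    by move=> q _; exact: (continuous_entry cy).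
  move=> q _; apply: (@continuous_comp _ _ _ snd (fun t : R => w t i 0)); first exact: cvg_snd.
  apply: (@continuous_comp _ _ _ w (fun M : 'cV[R]_n => M i 0)); first exact: cw.
  exact: coord_continuous.
have ct (y : R -> R -> 'cV[R]_n) phi : jcont y -> continuous (fun t : R => dotv (y t phi) (w phi)).
  move=> cy t; apply: (@continuous_comp _ _ _ (fun t : R => (t, phi)) (fun q : R * R => dotv (y q.1 q.2) (w q.2))).
    by apply: (@Ck_continuous _ _ _ 0 setT) => //; apply: Ck_pair; [exact: Ck_id|exact: Ck_cst].
  exact: cd.
have cs (y : R -> R -> 'cV[R]_n) : jcont y ->
    continuous (fun phi => circle_int (fun t : R => dotv (y t phi) (w phi))).
  move=> cy; apply: (@circle_int_param_continuous R (fun phi t => dotv (y t phi) (w phi))) => q.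
  apply: (@continuous_comp _ _ _ (fun q : R * R => (q.2, q.1)) (fun q : R * R => dotv (y q.1 q.2) (w q.2))).
    have ci := @Ck_id R (R * R)%type 0 setT.
    by apply: (@Ck_continuous _ _ _ 0 setT) => //; apply: Ck_pair; [exact: Ck_snd ci|exact: Ck_fst ci].
  exact: cd.
rewrite [a * _]mulrCA [b * _]mulrCA -mulrDr -circle_int_lin; [|exact: cs..].
congr (_ * circle_int _); apply/funext => phi; rewrite -circle_int_lin; [|exact: ct..].
congr circle_int; apply/funext => t; rewrite /dotv !mulr_sumr -big_split.
by apply: eq_bigr => i _; rewrite /lc !mxE /=; ring.
Qed.

Lemma torus_C1_lin a b z z' : torus_C1 z -> torus_C1 z' -> torus_C1 (lc a z b z').
Proof.
move=> [p1 p2 /Cdiff_Ck cz] [p1' p2' /Cdiff_Ck cz']; split.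
- by move=> phi t; rewrite /lc p1 p1'.
- by move=> t phi; rewrite /lc p2 p2'.
apply: Ck_Cdiff; apply: Ck_add; apply: Ck_scale => //; by [exact: fin_basis_mx|exact: Ck_cst].
Qed.

(** Exchanging the two variables reduces every fact about [dphi] to the one about [dtheta]. *)
Lemma torus_C1_swap z : torus_C1 z -> torus_C1 (fun a b => z b a).
Proof.
move=> [p1 p2 /Cdiff_Ck cz]; split => //; apply: Ck_Cdiff.
have ci := @Ck_id R (R * R)%type 1 setT.
apply: (@Ck_comp R (R * R)%type (R * R)%type 'cV[R]_n 1 setT setT (fun q => (q.2, q.1))
  (fun q => z q.1 q.2) _ _ _ _ cz).
- by apply: fin_basis_prod; exact: fin_basisR.
- exact: fin_basis_mx.
- by [].
- by apply: Ck_pair; [exact: Ck_snd ci|exact: Ck_fst ci].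
Qed.

Lemma jcont_swap z : jcont z -> jcont (fun a b => z b a).
Proof.
move=> cz q; have ci := @Ck_id R (R * R)%type 0 setT.
apply: (@continuous_comp _ _ _ (fun q : R * R => (q.2, q.1)) (fun q : R * R => z q.1 q.2)); last exact: cz.
by apply: (@Ck_continuous _ _ _ 0 setT) => //; apply: Ck_pair; [exact: Ck_snd ci|exact: Ck_fst ci].
Qed.

Lemma torus_C1_dphi z : torus_C1 z -> jcont (dphi z) /\
  forall theta phi, is_derive phi (1 : R) (z theta) (dphi z theta phi).
Proof.
move=> /torus_C1_swap/torus_C1_dtheta[c d]; split; last by move=> theta phi; exact: d.
exact: (@jcont_swap (fun a b => dphi z b a)).
Qed.

Lemma dtheta_lin a b z z' theta phi : torus_C1 z -> torus_C1 z' ->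
  dtheta (lc a z b z') theta phi = a *: dtheta z theta phi + b *: dtheta z' theta phi.
Proof.
move=> /torus_C1_dtheta[_ d] /torus_C1_dtheta[_ d'].
have h := is_deriveD (is_deriveZ a (d theta phi)) (is_deriveZ b (d' theta phi)).
by rewrite {1}/dtheta derive1E; apply: derive_val.
Qed.

Lemma dphi_lin a b z z' theta phi : torus_C1 z -> torus_C1 z' ->
  dphi (lc a z b z') theta phi = a *: dphi z theta phi + b *: dphi z' theta phi.
Proof.
by move=> /torus_C1_swap h /torus_C1_swap h'; exact: (dtheta_lin a b phi theta h h').
Qed.

Lemma derive1_periodic (W : normedModType R) (f : R -> W) (c : R) :
  periodic f c -> periodic (derive1 f) c.
Proof.
move=> pf x; rewrite /derive1.
have e : (fun h : R => h^-1 *: (f (h + (x + c)) - f (x + c))) = fun h : R => h^-1 *: (f (h + x) - f x).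
  by apply/funext => h; rewrite addrA !pf.
by rewrite e.
Qed.

Lemma dtheta_periodic z : torus_C1 z -> (forall phi, periodic (dtheta z ^~ phi) (2 * pi)) /\
  forall theta, periodic (dtheta z theta) (2 * pi).
Proof.
move=> [p1 p2 _]; split=> [phi|t phi]; first exact: derive1_periodic.
by rewrite /dtheta (_ : (z ^~ _) = z ^~ phi) //; apply/funext => x; exact: p2.
Qed.

Lemma dphi_periodic z : torus_C1 z -> (forall phi, periodic (dphi z ^~ phi) (2 * pi)) /\
  forall theta, periodic (dphi z theta) (2 * pi).
Proof. by move=> /torus_C1_swap/dtheta_periodic[h h']; split. Qed.

End LinearCombination.

(** * Reduction of the full equation to the linear problem *)

Section Reduction.
Context {R : realType} {k : nat}.
Notation n := (2 + k + 1)%N.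
Notation ix1 := (@ix1 k).
Notation ix2 := (@ix2 k).
Notation ixn := (@ixn k).
Notation point := (@point R k).
Notation modes03 := (has_only_phi_modes [:: 0; 1; 2; 3]%N).
Implicit Types (z g : R -> R -> 'cV[R]_n).
Variable D : ns_data R k.
Hypothesis hD : neimark_sacker D.
Notation ls := (lambda_star D).
Notation w0 := (omega_star D).
Notation E0 := (Emat D (lambda_star D)).

Lemma astarE (p : R) i : (astar k p : 'cV[R]_n) i 0 = cos p * (i == ix1)%:R + sin p * (i == ix2)%:R.
Proof. by rewrite -e1E -e2E /astar; move: (e1 k) (e2 k) => x y; rewrite !mxE. Qed.

Lemma Ck_cos j : Ck j setT (@cos R) /\ Ck j setT (@sin R).
Proof.
have [dc ds] : (forall x : R, is_derive x (1 : R) cos (- sin x)) /\ (forall x : R, is_derive x (1 : R) sin (cos x)).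
  by split=> x; [exact: is_derive_cos|exact: is_derive_sin].
have scale (f f' : R -> R) (d x : R) : is_derive x (1 : R) f (f' x) -> 'D_d f x = d * f' x.
  move=> h; have df : differentiable f x by apply/derivable1_diffP; exact: ex_derive.
  rewrite -[d in 'D_d _ _]mulr1 -[d * 1]/(d *: 1) deriveE // linearZ /= -deriveE //.
  by rewrite (@derive_val _ _ _ _ _ _ _ h).
elim: j => [|j [IHc IHs]].
  by split=> x _; [exact: continuous_cos|exact: continuous_sin].
split; split=> [x _|d]; try by apply/derivable1_diffP; apply: ex_derive.
  exists (fun x => d * - sin x) => [x _|]; first exact: (scale _ (fun x => - sin x)).
  by apply: Ck_mulR; [exact: Ck_cst|exact: Ck_opp].
exists (fun x => d * cos x) => [x _|]; first exact: (scale _ cos).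
by apply: Ck_mulR; first exact: Ck_cst.
Qed.

Lemma Ck_astar j : Ck j setT (astar k : R -> 'cV[R]_n) /\ Ck j setT (dastar k : R -> 'cV[R]_n).
Proof.
have [cc cs] := Ck_cos j; have fb := @fin_basis_mx R n 1.
by split; apply: Ck_add; apply: Ck_scale => //; try exact: Ck_cst; apply: Ck_opp.
Qed.

Lemma cos2pi (x : R) : cos (x + 2 * pi) = cos x /\ sin (x + 2 * pi) = sin x.
Proof. by have := cosM2pi 1 x; have := sinM2pi 1 x; rewrite !mul1r. Qed.

Lemma astar_periodic : periodic (astar k : R -> 'cV[R]_n) (2 * pi) /\
  periodic (dastar k : R -> 'cV[R]_n) (2 * pi).
Proof. by split=> x; rewrite /astar /dastar; have [-> ->] := cos2pi x. Qed.

Lemma astar_torus : torus_C1 (fun _ : R => astar k : R -> 'cV[R]_n).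
Proof.
split; [by move=> phi t|by move=> t; exact: astar_periodic.1|].
apply: Ck_Cdiff; apply: (@Ck_comp R (R * R)%type R 'cV[R]_n 1 setT setT (fun q => q.2) (astar k) _ _ _ _ (Ck_astar 1).1).
- exact: fin_basisR.
- exact: fin_basis_mx.
- by [].
- exact: (Ck_snd (@Ck_id R (R * R)%type 1 setT)).
Qed.

Lemma dtheta_astar t p : dtheta (fun _ : R => astar k : R -> 'cV[R]_n) t p = 0.
Proof. by rewrite /dtheta derive1E; apply: derive_val. Qed.

Lemma dphi_astar t p : dphi (fun _ : R => astar k : R -> 'cV[R]_n) t p = dastar k p.
Proof.
have h : is_derive p (1 : R) (astar k : R -> 'cV[R]_n) (dastar k p).
  apply: is_derive_mx => i j; rewrite (ord1 j).
  have e (q : R) : (astar k q : 'cV[R]_n) i 0 = e1 k i 0 * cos q + e2 k i 0 * sin q.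
    by rewrite /astar; move: (e1 k) (e2 k) => x y; rewrite !mxE; ring.
  rewrite (_ : (fun t : R => _) = fun q => e1 k i 0 * cos q + e2 k i 0 * sin q); last first.
    by apply/funext => q; exact: e.
  have -> : (dastar k p : 'cV[R]_n) i 0 = e1 k i 0 * (- sin p) + e2 k i 0 * cos p.
    by rewrite /dastar; move: (e1 k) (e2 k) => x y; rewrite !mxE; ring.
  exact: (is_deriveD (is_deriveZ (e1 k i 0) (is_derive_cos p)) (is_deriveZ (e2 k i 0) (is_derive_sin p))).
by rewrite /dphi derive1E; apply: derive_val.
Qed.

Lemma gamma1_lin a b z z' : jcont z -> jcont z' ->
  gamma1 (lc a z b z') = a *: gamma1 z + b *: gamma1 z'.
Proof.
move=> cz cz'.
have ca : continuous (astar k : R -> 'cV[R]_n) := fun x => (Ck_astar 0).1 x Logic.I.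
have cd : continuous (dastar k : R -> 'cV[R]_n) := fun x => (Ck_astar 0).2 x Logic.I.
have h1 := inner2_lin a b cz cz' ca; have h2 := inner2_lin a b cz cz' cd.
rewrite /gamma1 h1 h2; move: (inner2 z (fun=> astar k)) (inner2 z' (fun=> astar k)) => x y.
move: (inner2 z (fun=> dastar k)) (inner2 z' (fun=> dastar k)) => u v.
by apply/colP => i; rewrite !mxE; case: ifP.
Qed.

Lemma gamma2_lin a b z z' : jcont z -> jcont z' ->
  gamma2 (lc a z b z') = a * gamma2 z + b * gamma2 z'.
Proof. by move=> cz cz'; apply: (inner2_lin a b cz cz') => x; exact: cvg_cst. Qed.

Lemma gamma_astar : gamma1 (fun _ : R => astar k : R -> 'cV[R]_n) = ehat1 /\
  gamma2 (fun _ : R => astar k : R -> 'cV[R]_n) = 0.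
Proof.
have pi0 : pi != 0 :> R by rewrite gt_eqF // pi_gt0.
have x1 (p : R) : (astar k p : 'cV[R]_n) ix1 0 = cos p by rewrite astarE eqxx /= mulr1 mulr0 addr0.
have x2 (p : R) : (astar k p : 'cV[R]_n) ix2 0 = sin p by rewrite astarE eqxx /= mulr1 mulr0 add0r.
have xn (p : R) : (astar k p : 'cV[R]_n) ixn 0 = 0 by rewrite astarE /= !mulr0 addr0.
have cst2 (w : R -> 'cV[R]_n) (c : R) : (forall p, dotv (astar k p) (w p) = c) ->
    inner2 (fun _ => astar k) (fun _ => w) = c.
  move=> h; rewrite /inner2 (_ : (fun phi : R => _) = fun=> 2 * pi * c); last first.
    by apply/funext => p; rewrite h circle_int_cst.
  by rewrite circle_int_cst; move: (@pi R) pi0 => q q0; field.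
split; last by apply: (cst2 (fun=> en k)) => p; rewrite dotv_en xn.
apply/colP => i; rewrite !mxE; case: eqP => [i0|i0].
  rewrite (cst2 _ 1) => [|p]; first by rewrite ?eqxx.
  by rewrite {2}/astar dotv_sum x1 x2 -!expr2 cos2Dsin2.
rewrite (cst2 _ 0) => [|p]; first by [].
by rewrite /dastar dotv_sum x1 x2; ring.
Qed.

Lemma S_fix z t p : modes03 z -> S_inf 3 z t p = z t p.
Proof. by move=> /modes0123E e; rewrite S_infE -e. Qed.

Lemma modes_astar : modes03 (fun _ : R => astar k : R -> 'cV[R]_n).
Proof.
rewrite (_ : (fun=> _) = tsum (fun m (_ : R) => if m == 1%N then rvec else 0)); first exact: tsum_modes.
apply/funext => t; apply/funext => p; apply/colP => i; rewrite tsumE !big_ord_recl big_ord0 /= /bump /=.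
rewrite astarE !mxE !mul1r.
case: (ixP i) => [|| j|].
- by rewrite ?eqxx /=; ring.
- by rewrite ?eqxx /=; ring.
- by rewrite ?eq_lrshift /=; ring.
- by rewrite ?eqxx /=; ring.
Qed.

Lemma modes_dphi z : torus_C1 z -> modes03 z -> modes03 (dphi z).
Proof.
move=> Cz /modes0123E e; rewrite (_ : dphi z = tsum (fun m t => Complex 0 m%:R *: fcoef m z t)).
  exact: tsum_modes.
by apply/funext => t; apply/funext => p; rewrite -dphi_tsum -e.
Qed.

Lemma modes_dtheta z : torus_C1 z -> modes03 z -> modes03 (dtheta z).
Proof.
move=> Cz /modes0123E e; rewrite (_ : dtheta z = tsum (fun m => fcoef m (dtheta z))).
  exact: tsum_modes.
apply/funext => t; apply/funext => p.
by rewrite -(@dtheta_tsum _ _ (fun m => fcoef m z)) -?e // => m; exact: fcoef_vder.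
Qed.

Lemma modes_mulmx (A : 'M[R]_n) z : modes03 z -> modes03 (fun t p => A *m z t p).
Proof.
move=> /modes0123E e; rewrite (_ : (fun t => _) = tsum (fun m t => map_mx (real_complex R) A *m fcoef m z t)).
  exact: tsum_modes.
by apply/funext => t; apply/funext => p; rewrite -mulmx_tsum -e.
Qed.

Lemma modes_forcing lam om eta : modes03 (fun _ : R => lin_forcing D lam om eta).
Proof.
rewrite (_ : (fun _ => _) = tsum (fun m _ => fmode D lam om eta m)); first exact: tsum_modes.
by apply/funext => t; apply/funext => p; exact: lin_forcing_tsum.
Qed.

Lemma jcont_mulmx (A : 'M[R]_n) z : jcont z -> jcont (fun t p => A *m z t p).
Proof.
move=> cz q; have : Ck 0 setT (fun q : R * R => A *m z q.1 q.2); last exact.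
by apply: Ck_mulmx; [exact: Ck_cst|move=> x _; exact: cz].
Qed.

Lemma jcont_lc a b z z' : jcont z -> jcont z' -> jcont (lc a z b z').
Proof.
move=> cz cz' q; have : Ck 0 setT (fun q : R * R => lc a z b z' q.1 q.2); last exact.
have fb := @fin_basis_mx R n 1.
by apply: Ck_add; apply: Ck_scale => //; try exact: Ck_cst; move=> x _; [exact: cz|exact: cz'].
Qed.

Lemma jcont_snd (w : R -> 'cV[R]_n) : continuous w -> jcont (fun _ : R => w).
Proof. by move=> cw q; apply: (@continuous_comp _ _ _ snd w); [exact: cvg_snd|exact: cw]. Qed.

Lemma jcont_forcing lam om eta : jcont (fun _ : R => lin_forcing D lam om eta).
Proof.
apply: jcont_snd => x; have : Ck 0 setT (lin_forcing D lam om eta); last exact.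
have fb := @fin_basis_mx R n 1; have [ca cd] := Ck_astar 0.
apply: Ck_sub_fun; last exact: Ck_cst.
apply: Ck_sub_fun; last by apply: Ck_scale; [exact: fb|exact: Ck_cst|exact: cd].
apply: Ck_scale; [exact: fb|exact: Ck_cst|].
by apply: Ck_add; [apply: (Ck_scale fb _ ca)|apply: (Ck_scale fb _ cd)]; exact: Ck_cst.
Qed.

Lemma lin_op_lc a b z z' t p : torus_C1 z -> torus_C1 z' ->
  lin_op D (lc a z b z') t p = a *: lin_op D z t p + b *: lin_op D z' t p.
Proof.
move=> Cz Cz'; rewrite /lin_op dtheta_lin // dphi_lin // /lc mulmxDr -!scalemxAr.
move: (dtheta z t p) (dtheta z' t p) (dphi z t p) (dphi z' t p) (E0 *m _) (E0 *m _) => x y u v w s.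
by apply/colP => i; rewrite !mxE; ring.
Qed.

Lemma lin_forcing_lc a b l o e l' o' e' p :
  lin_forcing D (a * l + b * l') (a * o + b * o') (a * e + b * e') p =
  a *: lin_forcing D l o e p + b *: lin_forcing D l' o' e' p.
Proof.
rewrite /lin_forcing; move: (astar k p) (dastar k p) (en k) => x y u.
by apply/colP => i; rewrite !mxE; ring.
Qed.

(** Linearity is used twice later: for differences of solutions, and for averaging a solution with
    its image under the half turn. *)
Lemma lin_sol_lc a b g g' z z' l o e l' o' e' : jcont g -> jcont g' ->
  lin_sol D g z l o e -> lin_sol D g' z' l' o' e' ->
  lin_sol D (lc a g b g') (lc a z b z') (a * l + b * l') (a * o + b * o') (a * e + b * e').
Proof.
move=> cg cg' [Cz mz ez z1 z2] [Cz' mz' ez' z1' z2'].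
have cz := torus_C1_continuous Cz; have cz' := torus_C1_continuous Cz'; split.
- exact: torus_C1_lin.
- exact: modes_lin.
- move=> t p; rewrite (lin_op_lc _ _ _ _ Cz Cz') ez ez' (S_inf_lin _ _ _ _ _ cg cg') lin_forcing_lc !scalerDr; exact: addrACA.
- by rewrite gamma1_lin // z1 z1' !scaler0 addr0.
- by rewrite gamma2_lin // z2 z2' !mulr0 addr0.
Qed.

Lemma devE z : dev z = lc 1 z (-1) (fun _ : R => astar k).
Proof. by apply/funext => t; apply/funext => p; rewrite /dev /lc scale1r scaleN1r. Qed.

Lemma dev_torus z : torus_C1 z -> torus_C1 (dev z).
Proof. by move=> Cz; rewrite devE; exact: (torus_C1_lin 1 (-1) Cz astar_torus). Qed.

(** The base solution lies in the kernel of [lin_op], since [w0 *: dastar] equals [E0 *m astar]. *)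
Lemma lin_op_dev z t p : torus_C1 z -> lin_op D (dev z) t p = lin_op D z t p.
Proof.
move=> Cz; rewrite devE (lin_op_lc 1 (-1) t p Cz astar_torus).
have -> : lin_op D (fun _ : R => astar k) t p = 0.
  rewrite /lin_op dtheta_astar dphi_astar Emat_astar (ns_alphaR_star hD).
  by rewrite scale0r !add0r subrr.
by rewrite scaler0 addr0 scale1r.
Qed.

Definition pt z (lam om eta t p : R) : point := (z t p, dphi z t p, lam, om, eta).

(** Exact algebra: multiplying the equation by [sfac] gives [dtheta z] the coefficient 1, and
    everything beyond the linear part is collected in [gN]. *)
Lemma reduction_full z lam om eta eps t p : torus_C1 z -> 1 + eps * eta != 0 ->
  lin_op D (dev z) t p = gN D (pt z lam om eta t p) eps t p
    + lin_forcing D (lam - ls) (om - w0) eta p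
    - sfac eps eta *: full_residual D z lam om eta eps t p.
Proof.
move=> Cz s0; rewrite lin_op_dev // /lin_op /gN /full_residual /flow_terms /Gfun.
rewrite -/(dtheta z t p) -/(dphi z t p) /pt /pz /py /plam /pom /peta /= /lin_forcing.
have h : sfac eps eta * (1 + eps * eta) = 1 by rewrite /sfac mulVf.
move: (sfac _ _) h => s h.
move: (Gmap _ _ _ _ _ _) (E0 *m _) (dtheta z t p) (dphi z t p) (astar k p) (dastar k p) (en k) => G x y u v w q.
apply/colP => i; rewrite !mxE; move: (G _ _) (x _ _) (y _ _) (u _ _) (v _ _) (w _ _) (q _ _) => G' x' y' u' v' w' q'.
by rewrite -[y' in LHS]mul1r -{1}h; ring.
Qed.

End Reduction.

(** * The forcing on a ball of functions, and equivalence with the truncated system *)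

Section Forcing.
Context {R : realType} {k : nat}.
Notation n := (2 + k + 1)%N.
Notation point := (@point R k).
Notation npoint := ('cV[R]_n * 'cV[R]_n * R * R * R)%type.
Notation modes03 := (has_only_phi_modes [:: 0; 1; 2; 3]%N).
Implicit Types (z g : R -> R -> 'cV[R]_n).
Variable D : ns_data R k.
Hypothesis hD : neimark_sacker D.
Notation ls := (lambda_star D).
Notation w0 := (omega_star D).

(** Here eps is a constant, so the definition of [Gmap] splits into two cases, each given by a
    continuous formula. *)
Lemma C0_Gmap (V : normedModType R) (z : V -> 'cV[R]_n) (lam eta th : V -> R) (eps : R) :
  (forall x, near_lambda D (lam x)) -> Ck 0 setT z -> Ck 0 setT lam -> Ck 0 setT eta ->
  Ck 0 setT th -> Ck 0 setT (fun x => Gmap D (z x) (lam x) (eta x) (th x) eps).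
Proof.
move=> nl cz cl ce ct; have fb := @fin_basis_mx R n 1; have fbn := @fin_basis_mx R n n.
have [e0|e0] := eqVneq eps 0.
  rewrite (_ : (fun x => _) = fun x => Emat D (lam x) *m z x); last first.
    by apply/funext => x; rewrite /Gmap e0 eqxx.
  apply: (Ck_mulmx _ cz); apply: (Ck_lambda fbn _ _ cl); first exact: Ck_Emat.
  by move=> x _; exact: nl.
have [g fg cg] := floquet_dot_Ck hD 0.
have ch (s : R) : Ck 0 setT (fun x => hfun D (s, th x, lam x, z x)).
  by apply: (Ck_along hD _ _ ct cl cz) => [x _|]; [exact: nl|exact: Ck_cst].
rewrite (_ : (fun x => _) = fun x => eps^-1 *: (cramer_inv (floquet D (th x) (lam x)) *m
   (hfun D (eps, th x, lam x, z x) - hfun D (0, th x, lam x, z x)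
    - (eps * (1 + eps * eta x)) *: (g (th x, lam x) *m z x)))); last first.
  apply/funext => x; rewrite /Gmap (negPf e0) -cramer_invE; last exact: ns_floquet_unit.
  by rewrite /hfun /= scale0r addr0 fg.
apply: (Ck_scale fb); first exact: Ck_cst.
apply: Ck_mulmx.
  apply: Ck_cramer_inv => [x _|]; first exact: ns_floquet_unit.
  apply: (@Ck_theta_lambda R k D V 0 setT _ (fun q => floquet D q.1 q.2) th lam fbn) => //.
  exact: Cdiff_Ck (ns_smooth_floquet hD 0).
apply: Ck_sub_fun; first by apply: Ck_sub_fun; exact: ch.
apply: (Ck_scale fb).
  apply: Ck_mulR; first exact: Ck_cst.
  by apply: Ck_add; [exact: Ck_cst|apply: (Ck_mulR _ ce); exact: Ck_cst].
by apply: (Ck_mulmx _ cz); apply: (Ck_theta_lambda fbn cg _ ct cl) => x _; exact: nl.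
Qed.

Lemma C0_gN (z y : R * R -> 'cV[R]_n) (lam om eta : R * R -> R) (eps : R) :
  (forall x, near_lambda D (lam x)) -> (forall x, 1 + eps * eta x != 0) ->
  Ck 0 setT z -> Ck 0 setT y -> Ck 0 setT lam -> Ck 0 setT om -> Ck 0 setT eta ->
  Ck 0 setT (fun q => gN D (z q, y q, lam q, om q, eta q) eps q.1 q.2).
Proof.
move=> nl s0 cz cy cl co ce; have fb := @fin_basis_mx R n 1.
have ci := @Ck_id R (R * R)%type 0 setT; have c1 := Ck_fst ci; have c2 := Ck_snd ci.
have cs (f : R -> 'cV[R]_n) : Ck 0 setT f -> Ck 0 setT (fun q : R * R => f q.2).
  by move=> cf; apply: (@Ck_comp R (R * R)%type R 'cV[R]_n 0 setT setT (fun q => q.2) f) => //;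
     exact: fin_basisR.
have ca := cs _ (Ck_astar 0).1; have cd := cs _ (Ck_astar 0).2.
have cse : Ck 0 setT (fun q => sfac eps (eta q)).
  apply: Ck_inv; first by move=> x _; exact: s0.
  by apply: Ck_add; [exact: Ck_cst|apply: (Ck_mulR _ ce); exact: Ck_cst].
have cc (c : R) := @Ck_cst R (R * R)%type R 0 setT c.
rewrite (_ : (fun q => _) = fun q => sfac eps (eta q) *: Gmap D (z q) (lam q) (eta q) q.1 eps
  - Emat D ls *m z q
  - (lam q - ls) *: (derive1 (alphaR D) ls *: astar k q.2 + derive1 (alphaI D) ls *: dastar k q.2)
  + (1 - sfac eps (eta q)) *: (eta q *: en k)
  - (sfac eps (eta q) * om q - w0) *: y q + (om q - w0) *: dastar k q.2); last by apply/funext.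
apply: Ck_add; last by apply: (Ck_scale fb _ cd); exact: Ck_sub_fun co (cc _).
apply: Ck_sub_fun; last first.
  by apply: (Ck_scale fb _ cy); apply: Ck_sub_fun _ (cc _); exact: Ck_mulR.
apply: Ck_add; last first.
  apply: (Ck_scale fb); first exact: Ck_sub_fun (cc _) cse.
  by apply: (Ck_scale fb ce); exact: Ck_cst.
apply: Ck_sub_fun; last first.
  apply: (Ck_scale fb); first exact: Ck_sub_fun cl (cc _).
  by apply: Ck_add; [exact: (Ck_scale fb (cc _) ca)|exact: (Ck_scale fb (cc _) cd)].
apply: Ck_sub_fun; last by apply: (Ck_mulmx _ cz); exact: Ck_cst.
by apply: (Ck_scale fb cse); exact: C0_Gmap.
Qed.

Lemma gN_periodic (p : point) eps th ph : near_lambda D (plam p) ->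
  gN D p eps (th + 2 * pi) ph = gN D p eps th ph /\ gN D p eps th (ph + 2 * pi) = gN D p eps th ph.
Proof.
move=> nl; split; last by rewrite /gN !(astar_periodic.1, astar_periodic.2).
have e1 := ns_floquet_periodic hD nl; have e2 := ns_orbit_periodic hD nl.
have e3 : floquet_dot D (th + 2 * pi) (plam p) = floquet_dot D th (plam p).
  exact: (derive1_periodic e1).
by rewrite /gN /Gmap e3 (e1 th) (e2 th).
Qed.

(** The second component is any continuous function, not only [dphi] of the first, which makes the
    set closed under uniform limits. Values are compared with the base solution at the same phi. *)
Definition Om (kap : R) (X : R * R -> point) : Prop :=
  [/\ continuous (X : R * R -> npoint),
      forall t p, X (t + 2 * pi, p) = X (t, p) /\ X (t, p + 2 * pi) = X (t, p)
    & forall q : R * R, `|(X q : npoint) - base D q.2| <= kap].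

Definition forcing (eps : R) (X : R * R -> point) (t p : R) : 'cV[R]_n := gN D (X (t, p)) eps t p.

Lemma Om_near kap X q : 0 <= kap <= kap0 D -> Om kap X -> near_lambda D (plam (X q)).
Proof.
move=> /andP[k0 k1] [_ _ hX]; apply: (near_rad hD).
have [_ _ h _ _] := point_norms ((X q : npoint) - base D q.2).
exact: le_trans h (le_trans (hX q) (le_trans k1 (kap0_rad D))).
Qed.

Lemma small_unit (eps eta : R) : `|eps| <= 2^-1 -> `|eta| <= 2^-1 -> 1 + eps * eta != 0.
Proof.
move=> h1 h2; have h : `|eps * eta| <= 2^-1 * 2^-1 by rewrite normrM ler_pM.
apply/eqP => e; have : `|eps * eta| = 1.
  by rewrite (_ : eps * eta = -1) ?normrN1 //; lra.
by move=> e1; rewrite e1 in h; lra.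
Qed.

Lemma Om_unit kap X q eps : 0 <= kap <= kap0 D -> `|eps| <= kap -> Om kap X ->
  1 + eps * peta (X q) != 0.
Proof.
move=> /andP[k0 k1] ek [_ _ hX].
have [_ _ _ _ h] := point_norms ((X q : npoint) - base D q.2); rewrite /= subr0 in h.
have k2 := le_trans k1 (kap0_half D).
by apply: small_unit; [exact: le_trans ek k2|exact: le_trans h (le_trans (hX q) k2)].
Qed.

Lemma forcing_tcont kap eps X : 0 <= kap <= kap0 D -> `|eps| <= kap -> Om kap X ->
  tcont (forcing eps X).
Proof.
move=> k0 ek oX; have nl q := Om_near q k0 oX; have s0 q := Om_unit q k0 ek oX.
have [cX pX bX] := oX; split.
- have C5 : Ck 0 setT (X : R * R -> npoint) by move=> q _; exact: cX.
  have C4 := Ck_fst C5; have C3 := Ck_fst C4; have C2 := Ck_fst C3.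
  have h := @C0_gN (fun q => pz (X q)) (fun q => py (X q)) (fun q => plam (X q)) (fun q => pom (X q))
    (fun q => peta (X q)) eps nl s0 (Ck_fst C2) (Ck_snd C2) (Ck_snd C3) (Ck_snd C4) (Ck_snd C5).
  move=> q; have := h q Logic.I; congr continuous_at.
  by apply/funext => -[t p]; rewrite /forcing /=; case: (X _) => -[[[? ?] ?] ?] ?.
- by move=> p t; rewrite /forcing (pX t p).1 (gN_periodic _ _ _ (nl _)).1.
- by move=> t p; rewrite /forcing (pX t p).2 (gN_periodic _ _ _ (nl _)).2.
Qed.

Lemma forcing_bound : exists2 C, 0 <= C & forall kap eps X X' d, 0 <= kap <= kap0 D ->
  `|eps| <= kap -> Om kap X -> Om kap X' -> (forall q, `|(X q : npoint) - X' q| <= d) ->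
  forall t p, `|forcing eps X t p| <= C * kap /\
    `|forcing eps X t p - forcing eps X' t p| <= C * kap * d.
Proof.
have [C C0 hC] := small_lip_gN hD; exists C => // kap eps X X' d k0 ek oX oX' dX t p.
have [s s01 hs] := circle_rep t.
have [_ p1 _] := forcing_tcont k0 ek oX; have [_ p1' _] := forcing_tcont k0 ek oX'.
(* The estimate of [gN] is available for theta in one period; applying [circle_rep] to the pair
   moves both forcings to one and the same point. *)
have e : (forcing eps X t p, forcing eps X' t p) = (forcing eps X s p, forcing eps X' s p).
  by apply: (hs _ (fun t => (forcing eps X t p, forcing eps X' t p))) => u; rewrite (p1 p) (p1' p).
case: e => -> ->.
have [_ _ b] := oX; have [_ _ b'] := oX'.
have [h1 h2] := hC kap eps s p (X (s, p)) (X' (s, p)) k0 ek s01 (b (s, p)) (b' (s, p)).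
rewrite expr1 in h1 h2; split=> //; apply: le_trans h2 _.
apply: ler_wpM2l; first by rewrite mulr_ge0 //; case/andP: k0.
exact: dX.
Qed.

Definition ptq z (lam om eta : R) (q : R * R) : point := pt z lam om eta q.1 q.2.

Lemma jcont_dtheta z : torus_C1 z -> jcont (dtheta z).
Proof. by move=> /torus_C1_dtheta[]. Qed.
Lemma jcont_dphi z : torus_C1 z -> jcont (dphi z).
Proof. by move=> /torus_C1_dphi[]. Qed.

Lemma flow_lc z om eta eps : flow_terms z om eta eps =
  lc 1 (lc eta (fun _ _ => en k) (1 + eps * eta) (dtheta z)) om (dphi z).
Proof. by apply/funext => t; apply/funext => p; rewrite /flow_terms /lc scale1r. Qed.

Lemma jcont_flow z om eta eps : torus_C1 z -> jcont (flow_terms z om eta eps).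
Proof.
move=> Cz; rewrite flow_lc; apply: jcont_lc; last exact: jcont_dphi.
apply: jcont_lc; last exact: jcont_dtheta.
by move=> q; exact: cvg_cst.
Qed.

Lemma modes_en : modes03 (fun _ _ : R => en k : 'cV[R]_n).
Proof.
rewrite (_ : (fun=> _) = fun _ : R => lin_forcing D 0 0 (-1)); first exact: modes_forcing.
by apply/funext => t; apply/funext => p; rewrite /lin_forcing !scale0r subrr sub0r scaleN1r opprK.
Qed.

Lemma modes_flow z om eta eps : torus_C1 z -> modes03 z -> modes03 (flow_terms z om eta eps).
Proof.
move=> Cz mz; rewrite flow_lc; have ct := jcont_dtheta Cz; have cp := jcont_dphi Cz.
have ce : jcont (fun _ _ : R => en k : 'cV[R]_n) by move=> q; exact: cvg_cst.
apply: modes_lin; [exact: jcont_lc|exact: cp| |exact: modes_dphi].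
by apply: modes_lin; [exact: ce|exact: ct|exact: modes_en|exact: modes_dtheta].
Qed.

Lemma jcont_Gfun z lam eta eps : near_lambda D lam -> jcont z -> jcont (Gfun D z lam eta eps).
Proof.
move=> nl cz q; have ci := @Ck_id R (R * R)%type 0 setT.
have h := @C0_Gmap (R * R)%type (fun q => z q.1 q.2) (fun=> lam) (fun=> eta) (fun q => q.1) eps (fun _ => nl)
  (fun x _ => cz x) (@Ck_cst R _ _ 0 setT lam) (@Ck_cst R _ _ 0 setT eta) (Ck_fst ci).
exact: (h q Logic.I).
Qed.

(** The flow terms already have phi-modes at most 3, so the truncation acts on [Gfun] alone. *)
Lemma S_full_residual z lam om eta eps t p : near_lambda D lam -> torus_C1 z -> modes03 z ->
  S_inf 3 (full_residual D z lam om eta eps) t p = truncated_residual D z lam om eta eps t p.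
Proof.
move=> nl Cz mz; have cz := torus_C1_continuous Cz.
rewrite (_ : full_residual _ _ _ _ _ _ = lc 1 (Gfun D z lam eta eps) (-1) (flow_terms z om eta eps)).
  rewrite S_inf_lin; [|exact: jcont_Gfun|exact: jcont_flow].
  by rewrite scale1r scaleN1r (S_fix t p (modes_flow om eta eps Cz mz)).
by apply/funext => x; apply/funext => y; rewrite /lc scale1r scaleN1r.
Qed.

Lemma jcont_full_residual z lam om eta eps : near_lambda D lam -> torus_C1 z ->
  jcont (full_residual D z lam om eta eps).
Proof.
move=> nl Cz; have cz := torus_C1_continuous Cz.
rewrite (_ : full_residual _ _ _ _ _ _ = lc 1 (Gfun D z lam eta eps) (-1) (flow_terms z om eta eps)).
  by apply: jcont_lc; [exact: jcont_Gfun|exact: jcont_flow].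
by apply/funext => x; apply/funext => y; rewrite /lc scale1r scaleN1r.
Qed.

Lemma dev_modes z : torus_C1 z -> modes03 z -> modes03 (dev z).
Proof.
move=> Cz mz; rewrite devE; apply: modes_lin => //.
- exact: torus_C1_continuous.
- exact: torus_C1_continuous astar_torus.
- exact: modes_astar.
Qed.

Lemma lin_op_lcE z : lin_op D z = lc 1 (lc 1 (dtheta z) w0 (dphi z)) (-1) (fun t p => Emat D ls *m z t p).
Proof. by apply/funext => t; apply/funext => p; rewrite /lin_op /lc !scale1r scaleN1r. Qed.

Lemma jcont_lin_op z : torus_C1 z -> jcont (lin_op D z).
Proof.
move=> Cz; rewrite lin_op_lcE; apply: jcont_lc.
  by apply: jcont_lc; [exact: jcont_dtheta|exact: jcont_dphi].
exact: jcont_mulmx (torus_C1_continuous Cz).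
Qed.

Lemma modes_lin_op z : torus_C1 z -> modes03 z -> modes03 (lin_op D z).
Proof.
move=> Cz mz; rewrite lin_op_lcE; have ct := jcont_dtheta Cz; have cp := jcont_dphi Cz.
apply: modes_lin.
- exact: jcont_lc.
- exact: jcont_mulmx (torus_C1_continuous Cz).
- by apply: modes_lin => //; [exact: modes_dtheta|exact: modes_dphi].
- exact: modes_mulmx.
Qed.

(** Any function with the right modes and side conditions solves the linear problem once its own
    residual corrects the forcing. This serves both the equivalence with the truncated system and,
    with a small residual, the asymptotic solution. *)
Lemma lin_sol_full z lam om eta eps : torus_C1 z -> modes03 z -> 1 + eps * eta != 0 ->
  gamma1 z = ehat1 -> gamma2 z = 0 ->
  lin_sol D (lc 1 (forcing eps (ptq z lam om eta)) (- sfac eps eta) (full_residual D z lam om eta eps))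
    (dev z) (lam - ls) (om - w0) eta.
Proof.
move=> Cz mz s0 g1 g2; have Cd := dev_torus Cz; have md := dev_modes Cz mz.
have ca := torus_C1_continuous (@astar_torus R k); have cz := torus_C1_continuous Cz.
split; [exact: Cd|exact: md| | |]; last 2 first.
- by rewrite devE (gamma1_lin 1 (-1) cz ca) g1 gamma_astar.1 scale1r scaleN1r subrr.
- by rewrite devE (gamma2_lin 1 (-1) cz ca) g2 gamma_astar.2 !mulr0 addr0.
move=> t p; set lf := lin_forcing D (lam - ls) (om - w0) eta.
have cl : jcont (lin_op D (dev z)) by exact: jcont_lin_op.
have cf : jcont (fun _ : R => lf) by exact: jcont_forcing.
(* By [reduction_full] the corrected forcing is [lin_op] minus [lin_forcing]; both have phi-modes at
   most 3, so [S_inf 3] leaves it unchanged. *)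
have -> : lc 1 (forcing eps (ptq z lam om eta)) (- sfac eps eta) (full_residual D z lam om eta eps)
    = lc 1 (lin_op D (dev z)) (-1) (fun _ : R => lf).
  apply/funext => x; apply/funext => y; rewrite /lc !scale1r scaleN1r scaleNr.
  rewrite (reduction_full hD lam om x y Cz s0) /forcing /ptq /= -/lf.
  by rewrite [RHS]addrAC addrK.
rewrite (S_inf_lin 3 1 (-1) t p cl cf) scale1r scaleN1r (S_fix t p (modes_lin_op Cd md)).
by rewrite (S_fix t p (modes_forcing D _ _ _)) subrK.
Qed.

(** The truncated residual is [S_inf 3] of the full one and enters with the nonzero factor [sfac],
    so it vanishes exactly when the linear problem holds with the forcing generated by the solution
    itself. *)
Lemma lin_sol_fourier z lam om eta eps : torus_C1 z -> modes03 z -> 1 + eps * eta != 0 ->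
  near_lambda D lam -> gamma1 z = ehat1 -> gamma2 z = 0 ->
  jcont (forcing eps (ptq z lam om eta)) ->
  lin_sol D (forcing eps (ptq z lam om eta)) (dev z) (lam - ls) (om - w0) eta <->
  fourier_solution D eps lam om eta z.
Proof.
move=> Cz mz s0 nl g1 g2 cf.
have [C1 m1 h h1 h2] := lin_sol_full lam om Cz mz s0 g1 g2.
have e t p : lin_op D (dev z) t p = S_inf 3 (forcing eps (ptq z lam om eta)) t p
    - sfac eps eta *: truncated_residual D z lam om eta eps t p
    + lin_forcing D (lam - ls) (om - w0) eta p.
  rewrite h (S_inf_lin 3 1 _ t p cf (@jcont_full_residual z lam om eta eps nl Cz)) scale1r scaleNr.
  by rewrite (@S_full_residual z lam om eta eps t p nl Cz mz).
split=> [[_ _ h' _ _]|[_ _ tr _ _]].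
  split=> //; last by rewrite g1 subrr.
  move=> t p; have := h' t p; rewrite e => /(@addIr _ _) /eqP.
  rewrite -subr_eq0 addrAC subrr add0r oppr_eq0 scaler_eq0 => /orP[|/eqP //].
  by rewrite /sfac invr_eq0 (negPf s0).
split; [exact: C1|exact: m1| |exact: h1|exact: h2].
by move=> t p; rewrite e tr scaler0 subr0.
Qed.

End Forcing.

(** * Solving the truncated system *)

Section FixedPoint.
Context {R : realType} {k : nat}.
Notation n := (2 + k + 1)%N.
Notation point := (@point R k).
Notation npoint := ('cV[R]_n * 'cV[R]_n * R * R * R)%type.
Notation modes03 := (has_only_phi_modes [:: 0; 1; 2; 3]%N).
Implicit Types (z g : R -> R -> 'cV[R]_n).
Variable D : ns_data R k.
Hypothesis hD : neimark_sacker D.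
Hypothesis h13 : omega_star D != 3^-1.
Hypothesis h14 : omega_star D != 4^-1.
Notation ls := (lambda_star D).
Notation w0 := (omega_star D).
Notation Om := (Om D).
Notation forcing := (forcing D).
Notation nsol g z lam om eta := (lin_sol D g (dev z) (lam - ls) (om - w0) eta).
Variables K C : R.
Hypothesis K0 : 0 <= K.
Hypothesis C0 : 0 <= C.
Hypothesis hK : forall g z lam om eta, tcont g ->
  lin_sol D g z lam om eta -> forall M, (forall theta phi, `|g theta phi| <= M) ->
  [/\ forall theta phi, `|z theta phi| <= K * M, forall theta phi, `|dphi z theta phi| <= K * M,
      `|lam| <= K * M, `|om| <= K * M & `|eta| <= K * M].
Hypothesis hC : forall kap eps X X' d, 0 <= kap <= kap0 D ->
  `|eps| <= kap -> Om kap X -> Om kap X' -> (forall q, `|(X q : npoint) - X' q| <= d) ->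
  forall t p, `|forcing eps X t p| <= C * kap /\
    `|forcing eps X t p - forcing eps X' t p| <= C * kap * d.

Lemma npoint_norm_le (p : npoint) (M : R) : `|p.1.1.1.1| <= M -> `|p.1.1.1.2| <= M ->
  `|p.1.1.2| <= M -> `|p.1.2| <= M -> `|p.2| <= M -> `|p| <= M.
Proof. by move=> *; rewrite !prod_normE !ge_max; apply/andP; split=> //; apply/andP; split=> //; apply/andP; split=> //; apply/andP; split. Qed.

Lemma tcont_lc a b g g' : tcont g -> tcont g' -> tcont (lc a g b g').
Proof.
move=> [c p1 p2] [c' p1' p2']; split; first exact: jcont_lc.
  by move=> p t; rewrite /lc p1 p1'.
by move=> t p; rewrite /lc p2 p2'.
Qed.

Lemma dphi_dev z t p : torus_C1 z -> dphi (dev z) t p = dphi z t p - dastar k p.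
Proof. by move=> Cz; rewrite devE (dphi_lin 1 (-1) t p Cz astar_torus) dphi_astar scale1r scaleN1r. Qed.

Lemma ptq_bound g z lam om eta M : tcont g -> torus_C1 z -> nsol g z lam om eta ->
  (forall t p, `|g t p| <= M) -> forall q, `|(ptq z lam om eta q : npoint) - base D q.2| <= K * M.
Proof.
move=> tg Cz hz gM [t p]; have [b1 b2 b3 b4 b5] := hK tg hz gM.
apply: npoint_norm_le => //=; first exact: b1.
  by have := b2 t p; rewrite (dphi_dev t p Cz).
by rewrite subr0.
Qed.

(** By linearity the difference of two solutions belongs to the difference of the forcings, so the a
    priori bound becomes a Lipschitz bound for the solution operator. *)
Lemma ptq_sub g g' z z' lam om eta lam' om' eta' M : tcont g -> tcont g' ->
  torus_C1 z -> torus_C1 z' -> nsol g z lam om eta -> nsol g' z' lam' om' eta' ->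
  (forall t p, `|g t p - g' t p| <= M) ->
  forall q, `|(ptq z lam om eta q : npoint) - ptq z' lam' om' eta' q| <= K * M.
Proof.
move=> tg tg' Cz Cz' hz hz' gM [t p].
have cg : jcont g by case: tg.
have cg' : jcont g' by case: tg'.
have hs := lin_sol_lc 1 (-1) cg cg' hz hz'.
have gM' t' p' : `|lc 1 g (-1) g' t' p'| <= M by rewrite /lc scale1r scaleN1r.
have [b1 b2 b3 b4 b5] := hK (tcont_lc 1 (-1) tg tg') hs gM'.
apply: npoint_norm_le => /=.
- by have := b1 t p; rewrite /lc /dev scale1r scaleN1r opprB addrA subrK.
- have := b2 t p; rewrite (dphi_lin 1 (-1) t p (dev_torus Cz) (dev_torus Cz')) (dphi_dev t p Cz) (dphi_dev t p Cz').
  by rewrite scale1r scaleN1r opprB addrA subrK.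
- by move: b3; rewrite mul1r mulN1r opprB addrA subrK.
- by move: b4; rewrite mul1r mulN1r opprB addrA subrK.
- by move: b5; rewrite mul1r mulN1r.
Qed.

Lemma ptq_Om kap z lam om eta : torus_C1 z ->
  (forall q, `|(ptq z lam om eta q : npoint) - base D q.2| <= kap) -> Om kap (ptq z lam om eta).
Proof.
move=> Cz b; split; last exact: b.
  move=> q; have cz := torus_C1_continuous Cz; have cy := jcont_dphi Cz.
  have : Ck 0 setT (fun q : R * R => (z q.1 q.2, dphi z q.1 q.2, lam, om, eta) : npoint).
    have cc (c : R) := @Ck_cst R (R * R)%type R 0 setT c.
    apply: (Ck_pair _ (cc eta)); apply: (Ck_pair _ (cc om)); apply: (Ck_pair _ (cc lam)).
    by apply: Ck_pair => x _; [exact: cz|exact: cy].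
  by move=> /(_ q Logic.I).
move=> t p; rewrite /ptq /pt /=; have [p1 p2 _] := Cz; have [p1' p2'] := dphi_periodic Cz.
by rewrite (p1 p) (p2 t) (p1' p) (p2' t).
Qed.

Lemma linear_step g : tcont g -> exists z lam om eta, torus_C1 z /\ nsol g z lam om eta.
Proof.
move=> tg; have [z [lam [om [eta hz]]]] := lin_exists hD h13 h14 tg.
have [Cz _ _ _ _] := hz.
exists (lc 1 z 1 (fun _ => astar k)), (ls + lam), (w0 + om), eta; split.
  exact: torus_C1_lin Cz astar_torus.
rewrite ![_ + _ - _]addrAC !subrr !add0r (_ : dev _ = z) //.
by apply/funext => t; apply/funext => p; rewrite /dev /lc !scale1r addrK.
Qed.

Lemma Om_base : Om 0 (fun q => base D q.2).
Proof.
have -> : (fun q : R * R => base D q.2) = ptq (fun _ : R => astar k) ls w0 0.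
  by apply/funext => q; rewrite /ptq /pt dphi_astar.
apply: ptq_Om; first exact: astar_torus.
by move=> q; rewrite /ptq /pt dphi_astar subrr normr0.
Qed.

Lemma Om_le kap kap' X : kap <= kap' -> Om kap X -> Om kap' X.
Proof. by move=> h [c p b]; split=> // q; exact: le_trans (b q) h. Qed.

Lemma Om_closed kap (X : R * R -> npoint) :
  (forall e, 0 < e -> exists2 Y, Om kap Y & forall q, `|(Y q : npoint) - X q| <= e) -> Om kap X.
Proof.
move=> h; split.
- move=> q; apply/cvgrPdist_le => e e0.
  have e3 : 0 < e / 3 by rewrite divr_gt0.
  have [Y [cY _ _] hY] := h _ e3.
  have : \forall x \near q, `|(Y q : npoint) - Y x| <= e / 3.
    by move/cvgrPdist_le : (cY q); apply.
  apply: filterS => x hx.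
  have -> : X q - X x = - (Y q - X q) + ((Y q - Y x) + (Y x - X x)).
    by rewrite subrKA opprB subrKA.
  have -> : e = e / 3 + (e / 3 + e / 3) by field.
  by rewrite (le_trans (ler_normD _ _)) // lerD ?normrN // (le_trans (ler_normD _ _)) // lerD.
- have eq0 (x y : npoint) : (forall e, 0 < e -> `|x - y| <= e) -> x = y.
    move=> hxy; apply/eqP; rewrite -subr_eq0 -normr_le0; apply/ler_addgt0Pr => e e0.
    by rewrite add0r; exact: hxy.
  have close (x y : R * R) : (forall Y, Om kap Y -> Y x = Y y) -> X x = X y.
    move=> hY; apply: eq0 => e e0; have [Y oY cY] := h (e / 2) (divr_gt0 e0 (ltr0n R 2)).
    have -> : X x - X y = - ((Y x : npoint) - X x) + (Y y - X y).
      by rewrite (hY Y oY) opprB subrKA.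
    have -> : e = e / 2 + e / 2 by field.
    by rewrite (le_trans (ler_normD _ _)) // lerD ?normrN.
  by move=> t p; split; apply: close => Y [_ pY _]; case: (pY t p).
- move=> q; apply/ler_addgt0Pr => e e0; have [Y [_ _ bY] cY] := h e e0.
  have -> : X q - base D q.2 = - ((Y q : npoint) - X q) + (Y q - base D q.2).
    by rewrite opprB subrKA.
  rewrite [kap + e]addrC (le_trans (ler_normD _ _)) // lerD ?normrN //.
Qed.

(** If the distance is at most [M], then subtracting the two linear problems bounds it by
    [K * (C * kap * M + rho)], hence by [M / 2 + K * rho], and [half_absorb] concludes. With
    [rho = 0] this is local uniqueness, with [rho] of order eps^3 the first comparison. *)
Lemma stability kap eps g' z z' lam om eta lam' om' eta' rho : 0 <= rho ->
  0 <= kap <= kap0 D -> K * C * kap <= 2^-1 -> `|eps| <= kap -> torus_C1 z -> torus_C1 z' ->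
  let X := ptq z lam om eta in let X' := ptq z' lam' om' eta' in
  Om kap X -> Om kap X' -> nsol (forcing eps X) z lam om eta -> tcont g' ->
  nsol g' z' lam' om' eta' -> (forall t p, `|g' t p - forcing eps X' t p| <= rho) ->
  forall q, `|(X q : npoint) - X' q| <= 2 * (K * rho).
Proof.
move=> r0 k0 kC ek Cz Cz' X X' oX oX' hz tg' hz' hr.
have Kr : 0 <= K * rho by rewrite mulr_ge0.
apply: (@half_absorb R (R * R)%type (fun q => `|(X q : npoint) - X' q|) (kap + kap)) => //.
  move=> q; have [_ _ b] := oX; have [_ _ b'] := oX'.
  have -> : (X q : npoint) - X' q = (X q - base D q.2) + - ((X' q : npoint) - base D q.2).
    by rewrite opprB addrA subrK.
  by rewrite (le_trans (ler_normD _ _)) // lerD ?normrN.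
move=> M M0 dM q.
have hg t p : `|forcing eps X t p - g' t p| <= C * kap * M + rho.
  have [_ h1] := hC k0 ek oX oX' dM t p; have h2 := hr t p.
  rewrite distrC in h2.
  rewrite -(subrKA (forcing eps X' t p)) (le_trans (ler_normD _ _)) //.
  exact: lerD h1 h2.
have h := ptq_sub (forcing_tcont hD k0 ek oX) tg' Cz Cz' hz hz' hg q.
apply: le_trans h _; rewrite mulrDr lerD2r !mulrA [M / 2]mulrC.
exact: ler_wpM2r.
Qed.

(** The condition [K * C * kap <= 2^-1] makes the solution map a contraction, and
    [K * C * |eps| <= kap / 2] makes it preserve the [kap]-ball. *)
Lemma nonlinear_solution kap eps : 0 < kap <= kap0 D -> K * C * kap <= 2^-1 -> `|eps| <= kap ->
  K * C * `|eps| <= kap / 2 -> exists z lam om eta, let X := ptq z lam om eta in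
  [/\ torus_C1 z, Om kap X, nsol (forcing eps X) z lam om eta
    & forall q, `|(X q : npoint) - base D q.2| <= 2 * (K * C * `|eps|)].
Proof.
move=> /andP[k0 k1] kC ek e2.
have kk : 0 <= kap <= kap0 D by rewrite ltW.
have ee : 0 <= `|eps| <= kap0 D by rewrite normr_ge0 (le_trans ek).
have ob := Om_base.
(* The base solution also lies in the ball of radius [|eps|], so the estimate with [|eps|] in place
   of [kap] bounds its forcing by [C * |eps|]. *)
have fbase t p : `|forcing eps (fun q => base D q.2) t p| <= C * `|eps|.
  have oe := Om_le (normr_ge0 eps) ob.
  have [] // := hC (d := 0) ee (lexx _) oe oe _ t p.
  by move=> q; rewrite subrr normr0.
have fX X d : Om kap X -> (forall q, `|(X q : npoint) - base D q.2| <= d) ->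
    forall t p, `|forcing eps X t p| <= C * `|eps| + C * kap * d.
  move=> oX hd t p; have [_ h] := hC kk ek oX (Om_le (ltW k0) ob) hd t p.
  rewrite -(subrK (forcing eps (fun q => base D q.2) t p) (forcing eps X t p)).
  by rewrite (le_trans (ler_normD _ _)) // addrC lerD.
have /choice[S hS] (X : R * R -> npoint) : exists y : (R -> R -> 'cV[R]_n) * R * R * R, Om kap X ->
    torus_C1 y.1.1.1 /\ nsol (forcing eps X) y.1.1.1 y.1.1.2 y.1.2 y.2.
  (* Outside the ball the solution map is given a default value, to be total. *)
  have [oX|noX] := pselect (Om kap X); last by exists (fun _ _ => 0, 0, 0, 0).
  have [z [lam [om [eta h]]]] := linear_step (forcing_tcont hD kk ek oX).
  by exists (z, lam, om, eta).
pose Phi (X : R * R -> npoint) : R * R -> npoint := ptq (S X).1.1.1 (S X).1.1.2 (S X).1.2 (S X).2.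
have PhiOm X : Om kap X -> Om kap (Phi X).
  move=> oX; have [Cz hz] := hS X oX; have [_ _ bX] := oX; apply: (ptq_Om Cz) => q.
  apply: le_trans (ptq_bound (forcing_tcont hD kk ek oX) Cz hz (fX X kap oX bX) q) _.
  rewrite mulrDr !mulrA.
  have h : K * C * kap * kap <= 2^-1 * kap by apply: ler_wpM2r => //; exact: ltW.
  have e : kap / 2 + 2^-1 * kap = kap by field.
  by apply: le_trans (lerD e2 h) _; rewrite e.
have [X oX hX] : exists2 X : R * R -> npoint, Om kap X & forall q, Phi X q = X q.
  apply: (@geo_fixpoint R (R * R)%type npoint (Om kap) Phi (fun q => base D q.2) kap).
  - have gR := @geo_completeR R; have gM := @geo_complete_mx R n 1.
    exact: geo_complete_prod (geo_complete_prod (geo_complete_prod (geo_complete_prod gM gM) gR) gR) gR.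
  - exact: ltW.
  - exact: Om_le (ltW k0) ob.
  - exact: PhiOm.
  - move=> x y d ox oy hd q; have [Cx hx] := hS x ox; have [Cy hy] := hS y oy.
    have d0 : 0 <= d by exact: le_trans (normr_ge0 _) (hd q).
    have hg t p := (hC kk ek ox oy hd t p).2.
    apply: le_trans (ptq_sub (forcing_tcont hD kk ek ox) (forcing_tcont hD kk ek oy) Cx Cy hx hy hg q) _.
    by rewrite !mulrA [d / 2]mulrC; exact: ler_wpM2r.
  - exact: Om_closed.
  - by move=> q; have [_ _ b] := PhiOm _ (Om_le (ltW k0) ob); exact: b.
(* The fixed point is a value of [Phi], hence of the form [ptq]: its second component really is the
   phi-derivative of the first. *)
have eX : X = Phi X by apply/funext => q; rewrite hX.
have [Cz hz] := hS X oX.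
move: Cz hz eX; rewrite /Phi; case: (S X) => [[[z lam] om] eta] /= Cz hz eX; subst X.
exists z, lam, om, eta; split=> //.
have r0 : 0 <= K * C * `|eps| by rewrite !mulr_ge0.
(* Feeding the bound back into the estimate sharpens the radius from [kap] to a multiple of
   [|eps|]. *)
apply: (@half_absorb R (R * R)%type (fun q => `|(ptq z lam om eta q : npoint) - base D q.2|) kap) => //.
  by case: oX.
move=> M M0 dM q.
apply: le_trans (ptq_bound (forcing_tcont hD kk ek oX) Cz hz (fX _ M oX dM) q) _.
rewrite mulrDr !mulrA addrC lerD2r [M / 2]mulrC.
exact: ler_wpM2r.
Qed.

End FixedPoint.

(** * The half-turn symmetry *)

Section HalfTurn.
Context {R : realType} {n : nat}.
Implicit Types (z : R -> R -> 'cV[R]_n).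

Definition tau z (t p : R) : 'cV[R]_n := - z t (p + pi).

(** The increment of an antiderivative over a full period does not depend on the starting point,
    because its derivative there is zero by periodicity of [f]. *)
Lemma circle_int_shift (f : R -> R) : continuous f -> periodic f (2 * pi) ->
  circle_int (fun x => f (x + pi)) = circle_int f.
Proof.
move=> cf pf; have [F F0 dF] := antiderivative_exists cf.
have ds (c x : R) : is_derive x (1 : R) (fun x => F (x + c)) (f (x + c)).
  have h : is_derive x (1 : R) (fun x : R => x + c) (1 + 0).
    exact: (is_deriveD (is_derive_id x (1 : R)) (is_derive_cst c x (1 : R))).
  rewrite addr0 in h; rewrite -[f _]mulr1.
  exact: (@is_derive1_comp R F (fun x : R => x + c) x _ _ (dF (x + c)) h).
have cs : continuous (fun x => f (x + pi)).
  move=> x; apply: (@continuous_comp _ _ _ (fun x : R => x + pi) f); last exact: cf.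
  by apply: cvgD; [exact: cvg_id|exact: cvg_cst].
rewrite (circle_intE cs (ds pi)) (circle_intE cf dF).
have d0 (x : R) : is_derive x (1 : R) (fun x => F (x + 2 * pi) - F x) 0.
  by have := is_deriveB (ds (2 * pi) x) (dF x); rewrite pf subrr.
have := is_derive_cst_eq pi d0.
rewrite !add0r [pi + _]addrC => h.
by apply/eqP; rewrite -subr_eq0; apply/eqP; rewrite [RHS](_ : 0 = (F (2 * pi + pi) - F pi) - (F (2 * pi) - F 0)) // h subrr.
Qed.

Lemma cos_shift (m : nat) (x : R) : cos (m%:R * (x + pi)) = (-1) ^+ m * cos (m%:R * x) /\
  sin (m%:R * (x + pi)) = (-1) ^+ m * sin (m%:R * x).
Proof.
rewrite mulrDr; move: (m%:R * x) => y; elim: m y => [|m IH] y.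
  by rewrite mul0r addr0 !mul1r.
have [h1 h2] := IH y.
rewrite -natr1 mulrDl mul1r addrA cosDpi sinDpi h1 h2 exprS; split; ring.
Qed.

Lemma jcont_tau z : jcont z -> jcont (tau z).
Proof.
move=> cz q; apply: cvgN.
apply: (@continuous_comp _ _ _ (fun q : R * R => (q.1, q.2 + pi)) (fun q : R * R => z q.1 q.2)); last exact: cz.
have ci := @Ck_id R (R * R)%type 0 setT.
have : Ck 0 setT (fun q : R * R => (q.1, q.2 + pi)).
  by apply: Ck_pair; [exact: Ck_fst ci|apply: (Ck_add (Ck_snd ci)); exact: Ck_cst].
by move=> /(_ q Logic.I).
Qed.

(** A shift by pi multiplies both harmonics of order [m] by (-1)^m, and [tau] adds one more sign:
    odd modes are fixed and even modes change sign. *)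
Lemma coef_tau m z t : jcont z -> (forall t, periodic (z t) (2 * pi)) ->
  acoef m (tau z) t = - (-1) ^+ m *: acoef m z t /\ bcoef m (tau z) t = - (-1) ^+ m *: bcoef m z t.
Proof.
move=> cz pz.
have h (T : R -> R) i : continuous T -> (forall x, T (x + pi) = (-1) ^+ m * T x) ->
    circle_int (fun p => tau z t p i 0 * T p) = - (-1) ^+ m * circle_int (fun p => z t p i 0 * T p).
  move=> cT sT; have ss : (-1) ^+ m * (-1) ^+ m = 1 :> R by rewrite -exprMn mulrNN mulr1 expr1n.
  have cf : continuous (fun p => z t p i 0 * T p).
    by move=> x; apply: cvgM; [exact: (continuous_slice cz)|exact: cT].
  rewrite -(circle_int_shift cf); last first.
    move=> x; rewrite pz (_ : x + 2 * pi = x + pi + pi); last by ring.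
    by rewrite !sT mulrA ss mul1r.
  rewrite -circle_intZ.
    congr circle_int; apply/funext => p; rewrite sT /tau mxE.
    rewrite (_ : - (-1) ^+ m * _ = - (z t (p + pi) i 0 * T p * ((-1) ^+ m * (-1) ^+ m))); last by ring.
    by rewrite ss mulr1 mulNr.
  move=> x; apply: (@continuous_comp _ _ _ (fun x : R => x + pi) (fun p => z t p i 0 * T p)); last exact: cf.
  by apply: cvgD; [exact: cvg_id|exact: cvg_cst].
split; apply/colP => i; rewrite [LHS]mxE [RHS]mxE [X in _ = _ * X]mxE.
  have h1 := h (fun p => cos (m%:R * p)) i (@continuous_cosM R m%:R) (fun x => (cos_shift m x).1).
  exact: etrans (congr1 (fun u => fourier_weight m * u) h1) (mulrCA _ _ _).
have h1 := h (fun p => sin (m%:R * p)) i (@continuous_sinM R m%:R) (fun x => (cos_shift m x).2).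
exact: etrans (congr1 (fun u => fourier_weight m * u) h1) (mulrCA _ _ _).
Qed.

Lemma phi_mode_tau m z t p : jcont z -> (forall t, periodic (z t) (2 * pi)) ->
  phi_mode m (tau z) t p = - phi_mode m z t (p + pi).
Proof.
move=> cz pz; have [ha hb] := coef_tau m t cz pz; have [hc hs] := cos_shift m p.
rewrite /phi_mode ha hb hc hs; move: (acoef _ _ _) (bcoef _ _ _) => a b.
by apply/colP => i; rewrite !mxE; ring.
Qed.

Lemma torus_C1_tau z : torus_C1 z -> torus_C1 (tau z).
Proof.
move=> [p1 p2 /Cdiff_Ck cz]; split.
- by move=> p t; rewrite /tau p1.
- by move=> t p; rewrite /tau addrAC p2.
apply: Ck_Cdiff; apply: Ck_opp.
have ci := @Ck_id R (R * R)%type 1 setT.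
apply: (@Ck_comp R (R * R)%type (R * R)%type 'cV[R]_n 1 setT setT (fun q => (q.1, q.2 + pi))
  (fun q => z q.1 q.2)).
- by apply: fin_basis_prod; exact: fin_basisR.
- exact: fin_basis_mx.
- by [].
- by apply: Ck_pair; [exact: Ck_fst ci|apply: (Ck_add (Ck_snd ci)); exact: Ck_cst].
- exact: cz.
Qed.

Lemma dtheta_tau z t p : torus_C1 z -> dtheta (tau z) t p = - dtheta z t (p + pi).
Proof.
move=> /torus_C1_dtheta[_ d]; have h := is_deriveN (d t (p + pi)).
by rewrite {1}/dtheta derive1E; apply: derive_val.
Qed.

Lemma dphi_tau z t p : torus_C1 z -> dphi (tau z) t p = - dphi z t (p + pi).
Proof.
move=> /torus_C1_dphi[_ d].
have h : is_derive p (1 : R) (tau z t) (- dphi z t (p + pi)).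
  apply: is_deriveN; apply: is_derive_mx => i j.
  have dd := is_derive_coord i j (d t (p + pi)).
  have dt : is_derive p (1 : R) (fun x : R => x + pi) (1 + 0).
    exact: (is_deriveD (is_derive_id p (1 : R)) (is_derive_cst (pi : R) p (1 : R))).
  rewrite addr0 in dt; rewrite -[_ i j]mulr1.
  exact: (@is_derive1_comp R (fun x : R => z t x i j) (fun x : R => x + pi)).
by rewrite {1}/dphi derive1E; apply: derive_val.
Qed.

(** The condition [s * s = 1] covers [astar] and [dastar] with [s = -1] and the constant [en] with
    [s = 1], and it makes [w] periodic with period 2 pi. *)
Lemma inner2_tau z (w : R -> 'cV[R]_n) (s : R) : jcont z -> (forall t, periodic (z t) (2 * pi)) ->
  continuous w -> (forall p, w (p + pi) = s *: w p) -> s * s = 1 ->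
  inner2 (tau z) (fun _ => w) = - s * inner2 z (fun _ => w).
Proof.
move=> cz pz cw sw ss; rewrite /inner2 mulrCA; congr (_ * _).
have cd : continuous (fun q : R * R => dotv (z q.2 q.1) (w q.1)).
  have ci := @Ck_id R (R * R)%type 0 setT.
  have : Ck 0 setT (fun q : R * R => \sum_i z q.2 q.1 i 0 * w q.1 i 0); last first.
    by move=> h q; exact: (h q Logic.I).
  apply: Ck_sum => i; apply: Ck_mulR => q _.
    apply: (@continuous_comp _ _ _ (fun q : R * R => z q.2 q.1) (fun M : 'cV[R]_n => M i 0)).
      exact: (jcont_swap cz).
    exact: coord_continuous.
  apply: (@continuous_comp _ _ _ fst (fun t : R => w t i 0)); first exact: cvg_fst.
  apply: (@continuous_comp _ _ _ w (fun M : 'cV[R]_n => M i 0)); first exact: cw.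
  exact: coord_continuous.
pose f (p : R) := circle_int (fun t => dotv (z t p) (w p)).
have cf : continuous f by exact: (@circle_int_param_continuous R (fun p t => dotv (z t p) (w p))).
have pf : periodic f (2 * pi).
  move=> p; rewrite /f (_ : p + 2 * pi = p + pi + pi); last by ring.
  congr circle_int; apply/funext => t; rewrite !sw scalerA ss scale1r; congr dotv.
  by rewrite -(pz t p); congr (z t _); ring.
rewrite -[circle_int f in RHS](circle_int_shift cf pf) -circle_intZ; last first.
  move=> x; apply: (@continuous_comp _ _ _ (fun x : R => x + pi) f); last exact: cf.
  by apply: cvgD; [exact: cvg_id|exact: cvg_cst].
congr circle_int; apply/funext => p; rewrite /f -circle_intZ; last first.
  exact: (@continuous_slice2 R (fun q => dotv (z q.2 q.1) (w q.1)) (p + pi) cd).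
congr circle_int; apply/funext => t; rewrite /dotv mulr_sumr; apply: eq_bigr => i _.
rewrite sw /tau !mxE (_ : - s * _ = - (z t (p + pi) i 0 * w p i 0 * (s * s))); last by ring.
by rewrite ss mulr1 mulNr.
Qed.

End HalfTurn.

(** * Invariance of the linear problem under the half turn *)

Section HalfTurnLinear.
Context {R : realType} {k : nat}.
Notation n := (2 + k + 1)%N.
Notation modes03 := (has_only_phi_modes [:: 0; 1; 2; 3]%N).
Implicit Types (z g : R -> R -> 'cV[R]_n).
Variable D : ns_data R k.

Lemma tcont_tau g : tcont g -> tcont (tau g).
Proof.
move=> [c p1 p2]; split; first exact: jcont_tau.
  by move=> p t; rewrite /tau p1.
by move=> t p; rewrite /tau addrAC p2.
Qed.

Lemma astar_shift (p : R) : astar k (p + pi) = - astar k p :> 'cV[R]_n /\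
  dastar k (p + pi) = - dastar k p :> 'cV[R]_n.
Proof.
rewrite /astar /dastar cosDpi sinDpi; move: (e1 k) (e2 k) => x y.
by split; apply/colP => i; rewrite !mxE; ring.
Qed.

(** Under the half turn [astar] and [dastar] change sign while [en] does not; so the sign of [eta]
    is reversed and the other two parameters are kept. *)
Lemma lin_forcing_shift l o e (p : R) : lin_forcing D l o (- e) p = - lin_forcing D l o e (p + pi).
Proof.
rewrite /lin_forcing (astar_shift p).1 (astar_shift p).2.
move: (astar k p) (dastar k p) (en k) => x y u; by apply/colP => i; rewrite !mxE; ring.
Qed.

Lemma lin_sol_tau g z l o e : tcont g -> lin_sol D g z l o e -> lin_sol D (tau g) (tau z) l o (- e).
Proof.
move=> [cg _ pg] [Cz mz ez g1 g2]; have cz := torus_C1_continuous Cz; have [_ pz _] := Cz.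
split.
- exact: torus_C1_tau.
- by move=> t p; rewrite {1}/tau mz -sumrN; apply: eq_bigr => m _; rewrite phi_mode_tau.
- move=> t p; rewrite lin_forcing_shift.
  have -> : S_inf 3 (tau g) t p = - S_inf 3 g t (p + pi).
    by rewrite /S_inf -sumrN; apply: eq_bigr => m _; rewrite phi_mode_tau.
  rewrite -opprD -ez /lin_op (dtheta_tau t p Cz) (dphi_tau t p Cz) /tau mulmxN scalerN.
  move: (dtheta z t _) (dphi z t _) (Emat D _ *m _) => x y u.
  by apply/colP => i; rewrite !mxE; ring.
- have ca : continuous (astar k : R -> 'cV[R]_n) := fun x => (Ck_astar 0).1 x Logic.I.
  have cd : continuous (dastar k : R -> 'cV[R]_n) := fun x => (Ck_astar 0).2 x Logic.I.
  have sa p : astar k (p + pi) = (-1) *: astar k p :> 'cV[R]_n by rewrite scaleN1r (astar_shift p).1.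
  have sd p : dastar k (p + pi) = (-1) *: dastar k p :> 'cV[R]_n by rewrite scaleN1r (astar_shift p).2.
  have ss : -1 * -1 = 1 :> R by rewrite mulrNN mulr1.
  have h1 := inner2_tau cz pz ca sa ss; have h2 := inner2_tau cz pz cd sd ss.
  rewrite opprK mul1r in h1; rewrite opprK mul1r in h2.
  have eab (a b : R) : a = inner2 z (fun=> astar k) -> b = inner2 z (fun=> dastar k) ->
      \col_(i < 2) (if i == ord0 then a else b) = 0 by move=> -> ->; exact: g1.
  exact: eab h1 h2.
- have ce : continuous (fun _ : R => en k : 'cV[R]_n) by move=> x; exact: cvg_cst.
  have se (p : R) : en k = 1 *: en k :> 'cV[R]_n by rewrite scale1r.
  have h := inner2_tau cz pz ce se (mulr1 1).
  apply: (etrans h); have g2' : inner2 z (fun _ _ => en k) = 0 := g2.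
  by rewrite g2' mulr0.
Qed.

End HalfTurnLinear.

(** * Comparison with the asymptotic solution *)

Section PolynomialRemainder.
Context {R : realType}.

Lemma small_linear_eq0 (a K d : R) : 0 < d -> (forall x, 0 < x < d -> `|a| <= K * x) -> a = 0.
Proof.
move=> d0 h; apply/eqP; rewrite -normr_le0; apply/ler_addgt0Pr => e e0; rewrite add0r.
pose x := Num.min (d / 2) (e / (`|K| + 1)).
have K1 : 0 < `|K| + 1 by rewrite ltr_wpDl.
have x0 : 0 < x by rewrite lt_min !divr_gt0.
have xd : x < d.
  by rewrite (@le_lt_trans _ _ (d / 2)) // ?ge_min ?lexx // ltr_pdivrMr // ltr_pMr // ltr1n.
have xe : x <= e / (`|K| + 1) by rewrite ge_min lexx orbT.
have xx : 0 < x < d by rewrite x0.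
apply: le_trans (h x xx) _; apply: (@le_trans _ _ ((`|K| + 1) * x)).
  by rewrite ler_pM2r // (le_trans (ler_norm K)) // lerDl.
by rewrite mulrC -ler_pdivlMr.
Qed.

(** Dividing by the lower power and letting [x] tend to 0 gives [a = 0]; then [b = 0] follows in the
    same way. *)
Lemma two_term_eq0 (a b K d : R) (i j : nat) : (i < j)%N -> 0 < d ->
  (forall x, 0 < x < d -> `|a * x ^+ i + b * x ^+ j| <= K * x ^+ j.+1) -> a = 0 /\ b = 0.
Proof.
move=> ij d0 h.
have K0 : 0 <= K.
  have hd : 0 < d / 2 < d by rewrite divr_gt0 //= ltr_pdivrMr // ltr_pMr // ltr1n.
  have := le_trans (normr_ge0 _) (h _ hd); rewrite pmulr_lge0 // exprn_gt0 //.
  by case/andP: hd.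
have a0 : a = 0.
  apply: (@small_linear_eq0 a (`|b| + K) (Num.min d 1)); first by rewrite lt_min d0 ltr01.
  move=> x /andP[x0]; rewrite lt_min => /andP[xd x1].
  have xi : 0 < x ^+ i by rewrite exprn_gt0.
  rewrite -(ler_pM2r xi).
  have hx : 0 < x < d by rewrite x0.
  have h1 : `|a| * x ^+ i <= K * x ^+ j.+1 + `|b| * x ^+ j.
    rewrite -[x ^+ i]ger0_norm ?(ltW xi) // -normrM.
    have -> : a * x ^+ i = (a * x ^+ i + b * x ^+ j) - b * x ^+ j by rewrite addrK.
    rewrite (le_trans (ler_normB _ _)) // lerD // ?h // normrM (ger0_norm (_ : 0 <= x ^+ j)) //.
    by rewrite exprn_ge0 // ltW.
  apply: le_trans h1 _.
  have p1 (m : nat) : (i < m)%N -> x ^+ m <= x * x ^+ i.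
    by move=> im; rewrite -exprS; apply: ler_wiXn2l => //; exact: ltW.
  rewrite addrC -mulrA mulrDl lerD // ler_wpM2l // p1 // ltnW //.
split=> //; apply: (@small_linear_eq0 b K d d0) => x hx; have /andP[x0 _] := hx.
have xj : 0 < x ^+ j by rewrite exprn_gt0.
rewrite -(ler_pM2r xj) -{1}[x ^+ j]ger0_norm ?(ltW xj) // -normrM -mulrA -exprS.
by have := h x hx; rewrite a0 mul0r add0r.
Qed.

Lemma tcont_bound n (g : R -> R -> 'cV[R]_n) : tcont g ->
  exists2 M, 0 <= M & forall t p, `|g t p| <= M.
Proof.
move=> [cg p1 p2].
have cK : compact (`[0, 2 * pi]%classic `*` `[0, 2 * pi]%classic : set (R * R)).
  by apply: compact_setX; exact: segment_compact.
have [M M0 hM] := compact_bound cK (fun q _ => cg q).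
exists M => // t p.
have [s s01 hs] := circle_rep t; have [r r01 hr] := circle_rep p.
rewrite (hs _ (fun t => g t p) (p1 p)) (hr _ (g s) (p2 s)).
by apply: (hM (s, r)); split=> /=; rewrite in_itv.
Qed.

End PolynomialRemainder.

(** * Expansion of the residual in eps with frozen torus functions *)

Section ResidualExpansion.
Context {R : realType} {k : nat}.
Notation n := (2 + k + 1)%N.
Variable D : ns_data R k.
Hypothesis hD : neimark_sacker D.
Notation ls := (lambda_star D).
Notation w0 := (omega_star D).
Variables lam2 om2 eta2 : R.
Notation lamE := (lambdaE D lam2).
Notation omE := (omegaE D om2).
Notation etE := (etaE eta2).
Notation vec := ('cV[R]_n).

(* [g] agrees with [floquet_dot] on the parameters near [lambda_star]. *)
Variable g : R * R -> 'M[R]_n.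

(* The last eight arguments stand for [a^*], [z_2], [z_3], their theta-derivatives
   (that of [a^*] vanishes) and their phi-derivatives: the residual is a smooth
   function of eps, theta and these values, although [z_2], [z_3] are only C^1. *)
Definition kfun (eps th : R) (a z2 z3 tz2 tz3 da pz2 pz3 : vec) : vec :=
  let z := a + eps *: z2 + eps ^+ 2 *: z3 in
  hfun D (eps, th, lamE eps, z) - hfun D (0, th, lamE eps, z)
  - (eps * (1 + eps * etE eps)) *: (g (th, lamE eps) *m z)
  - eps *: (floquet D th (lamE eps) *m (etE eps *: en k
      + (1 + eps * etE eps) *: (eps *: tz2 + eps ^+ 2 *: tz3)
      + omE eps *: (da + eps *: pz2 + eps ^+ 2 *: pz3))).

Definition stack (s : seq vec) : 'M[R]_(n, 8) := \matrix_(i, j) (nth 0 s j) i 0.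
Definition cl (Y : 'M[R]_(n, 8)) (j : nat) : vec := col (inord j) Y.

Lemma cl_stack s j : (j < 8)%N -> cl (stack s) j = nth 0 s j.
Proof. by move=> j8; apply/colP => i; rewrite !mxE inordK. Qed.

Definition kstack (x : R * R * 'M[R]_(n, 8)) : vec :=
  kfun x.1.1 x.1.2 (cl x.2 0) (cl x.2 1) (cl x.2 2) (cl x.2 3) (cl x.2 4) (cl x.2 5) (cl x.2 6) (cl x.2 7).

Definition knear : set (R * R * 'M[R]_(n, 8)) := [set x | near_lambda D (lamE x.1.1)].

Lemma Ck_kstack j : Ck j (near2 D) g -> Ck j knear kstack.
Proof.
move=> cg; have fb := @fin_basis_mx R n 1; have fbn := @fin_basis_mx R n n.
have ci := @Ck_id R (R * R * 'M[R]_(n, 8))%type j knear.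
have ce := Ck_fst (Ck_fst ci); have ct := Ck_snd (Ck_fst ci); have cY := Ck_snd ci.
have cc (c : R) := @Ck_cst R (R * R * 'M[R]_(n, 8))%type R j knear c.
have cl' (m : nat) : Ck j knear (fun x => cl x.2 m).
  apply: Ck_mx => p q.
  have e : (fun x : R * R * 'M[R]_(n, 8) => cl x.2 m p q) = fun x => x.2 p (inord m).
    by apply/funext => x; rewrite mxE.
  by rewrite e; exact: Ck_coord cY.
have ce2 : Ck j knear (fun x => x.1.1 ^+ 2) := Ck_mulR ce ce.
have cl2 : Ck j knear (fun x => lamE x.1.1) := Ck_add (cc ls) (Ck_mulR ce2 (cc lam2)).
have co2 : Ck j knear (fun x => omE x.1.1) := Ck_add (cc w0) (Ck_mulR ce2 (cc om2)).
have cet : Ck j knear (fun x => etE x.1.1) := Ck_mulR ce (cc eta2).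
have cs : Ck j knear (fun x => 1 + x.1.1 * etE x.1.1) := Ck_add (cc 1) (Ck_mulR ce cet).
have cz : Ck j knear (fun x => cl x.2 0 + x.1.1 *: cl x.2 1 + x.1.1 ^+ 2 *: cl x.2 2) :=
  Ck_add (Ck_add (cl' 0%N) (Ck_scale fb ce (cl' 1%N))) (Ck_scale fb ce2 (cl' 2%N)).
have nl (x : R * R * 'M[R]_(n, 8)) : knear x -> near_lambda D (lamE x.1.1) by [].
have h1 := Ck_along hD nl ce ct cl2 cz.
have h2 := Ck_along hD nl (cc 0) ct cl2 cz.
have cgz : Ck j knear (fun x => g (x.1.2, lamE x.1.1)) := Ck_theta_lambda fbn cg nl ct cl2.
have cP : Ck j knear (fun x => floquet D x.1.2 (lamE x.1.1)) :=
  @Ck_theta_lambda R k D _ j knear _ (fun q => floquet D q.1 q.2) _ _ fbn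
    (Cdiff_Ck (ns_smooth_floquet hD j)) nl ct cl2.
have cfl : Ck j knear (fun x => etE x.1.1 *: en k
      + (1 + x.1.1 * etE x.1.1) *: (x.1.1 *: cl x.2 3 + x.1.1 ^+ 2 *: cl x.2 4)
      + omE x.1.1 *: (cl x.2 5 + x.1.1 *: cl x.2 6 + x.1.1 ^+ 2 *: cl x.2 7)).
  have c1 : Ck j knear (fun x => x.1.1 *: cl x.2 3 + x.1.1 ^+ 2 *: cl x.2 4) :=
    Ck_add (Ck_scale fb ce (cl' 3%N)) (Ck_scale fb ce2 (cl' 4%N)).
  have c2 : Ck j knear (fun x => cl x.2 5 + x.1.1 *: cl x.2 6 + x.1.1 ^+ 2 *: cl x.2 7) :=
    Ck_add (Ck_add (cl' 5%N) (Ck_scale fb ce (cl' 6%N))) (Ck_scale fb ce2 (cl' 7%N)).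
  have c3 := Ck_scale fb cet (@Ck_cst R (R * R * 'M[R]_(n, 8))%type vec j knear (en k)).
  exact: Ck_add (Ck_add c3 (Ck_scale fb cs c1)) (Ck_scale fb co2 c2).
have h3 := Ck_scale fb (Ck_mulR ce cs) (Ck_mulmx cgz cz).
have h4 := Ck_scale fb ce (Ck_mulmx cP cfl).
exact: Ck_sub_fun (Ck_sub_fun (Ck_sub_fun h1 h2) h3) h4.
Qed.

(** In the difference of the values at eps and - eps only the Taylor terms of orders 1 and 3 remain
    below order 5, and the assumed bound by eps^4 forces both to vanish. The constant [B] comes from
    the compact box and is independent of [c], [th] and [Y]. *)
Lemma kstack_even (e0 M : R) : Ck 5 (near2 D) g ->
  (forall eps, `|eps| <= e0 -> near_lambda D (lamE eps)) -> 
  exists2 B, 0 <= B & forall th Y c, 0 <= th <= 2 * pi -> `|Y| <= M -> 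
    (forall eps, `|eps| < e0 -> `|kstack (eps, th, Y)| <= c * `|eps| ^+ 4) ->
    forall eps, `|eps| < e0 -> `|kstack (eps, th, Y) - kstack (- eps, th, Y)| <= B * `|eps| ^+ 5.
Proof.
move=> cg nl; have [gs [g0 cgs dgs]] := Ck_chain ((1, 0, 0) : R * R * 'M[R]_(n, 8)) (Ck_kstack cg).
have c5 : Ck 0 knear (gs 5%N) := cgs 5%N isT.
pose box : set (R * R * 'M[R]_(n, 8)) :=
  (`[- e0, e0]%classic `*` `[0, 2 * pi]%classic) `*` [set Y | `|Y| <= M].
have cbox : compact box.
  apply: compact_setX; last exact: mx_ball_compact.
  by apply: compact_setX; exact: segment_compact.
have nbox x : box x -> knear x.
  by case: x => [[e t] Y] [[/= he _] _]; apply: nl; move: he; rewrite in_itv /= ler_norml.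
have [B B0 hB] := compact_bound cbox (fun x hx => Ck_continuous c5 (nbox x hx)).
exists (2 * B) => [|th Y c th1 YM hk eps ee]; first by rewrite mulr_ge0.
have inbox (s : R) : `|s| < e0 -> box (s, th, Y).
  move=> /ltW; rewrite ler_norml => hs.
  by split=> //=; split=> /=; rewrite in_itv.
have eline (s : R) : ((0, th, Y) : R * R * 'M[R]_(n, 8)) + s *: ((1, 0, 0) : R * R * 'M[R]_(n, 8)) = (s, th, Y).
  by congr (_, _, _) => /=; rewrite ?scaler0 ?addr0 // add0r; exact: mulr1.
have dline j (s : R) : (j < 5)%N -> `|s| < e0 ->
    is_derive s (1 : R) (fun s => gs j (s, th, Y)) (gs j.+1 (s, th, Y)).
  move=> j5 hs; have := @is_derive_line R _ _ (gs j) (0, th, Y) (1, 0, 0) s.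
  rewrite eline (dgs j _ j5 (nbox _ (inbox s hs))) => h.
  have j5' : (0 < 5 - j)%N by rewrite subn_gt0.
  move: (h (Ck_differentiable j5' (cgs j (ltnW j5)) (nbox _ (inbox s hs)))); congr is_derive.
  by apply/funext => u; rewrite eline.
have e00 : 0 < e0 by apply: le_lt_trans ee.
apply/mx_normP => [|i j]; first by rewrite !mulr_ge0.
rewrite (ord1 j).
pose c_ (j : nat) := gs j (0, th, Y) i 0.
pose P (x : R) := c_ 0%N + c_ 1%N * x + c_ 2%N / 2 * x ^+ 2 + c_ 3%N / 6 * x ^+ 3 + c_ 4%N / 24 * x ^+ 4.
have tay (x : R) : `|x| < e0 -> `|kstack (x, th, Y) i 0 - P x| <= B * `|x| ^+ 5.
  move=> hx; have := @taylor_bound R 5 (fun j s => gs j (s, th, Y) i 0) e0 B B0 _ _ x hx.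
  have -> : \sum_(j < 5) gs j (0, th, Y) i 0 / j`!%:R * x ^+ j = P x.
    rewrite !big_ord_recl big_ord0 /= /bump /= /P /c_ !factS fact0 /= !muln1.
    by rewrite !divr1 expr0 expr1 mulr1 addr0 !addrA.
  rewrite g0; apply => [j' y j5 hy|y hy].
    by apply: is_derive_coord; exact: dline.
  by apply: le_trans (hB _ (inbox y hy)); exact: mx_entry_le.
pose f (x : R) := kstack (x, th, Y) i 0 - kstack (- x, th, Y) i 0.
have fP (x : R) : `|x| < e0 -> `|f x - (2 * c_ 1%N * x ^+ 1 + 2 * (c_ 3%N / 6) * x ^+ 3)| <= 2 * B * `|x| ^+ 5.
  move=> hx; have hx' : `|- x| < e0 by rewrite normrN.
  have h1 := tay x hx; have h2 := tay _ hx'; rewrite normrN in h2.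
  have -> : f x - (2 * c_ 1%N * x ^+ 1 + 2 * (c_ 3%N / 6) * x ^+ 3) =
      (kstack (x, th, Y) i 0 - P x) - (kstack (- x, th, Y) i 0 - P (- x)).
    by rewrite /f /P; ring.
  rewrite (le_trans (ler_normB _ _)) // -mulrA mulr_natl mulr2n.
  exact: lerD h1 h2.
have fb (x : R) : `|x| < e0 -> `|f x| <= 2 * c * `|x| ^+ 4.
  move=> hx; have hx' : `|- x| < e0 by rewrite normrN.
  have h1 := le_trans (mx_entry_le _ i 0) (hk x hx).
  have h2 := le_trans (mx_entry_le _ i 0) (hk _ hx'); rewrite normrN in h2.
  rewrite /f (le_trans (ler_normB _ _)) // -mulrA mulr_natl mulr2n.
  exact: lerD h1 h2.
have [a0 b0] : 2 * c_ 1%N = 0 /\ 2 * (c_ 3%N / 6) = 0.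
  (* For small positive [x] the two odd terms together are at most a multiple of [x ^+ 4], one order
     beyond the larger exponent 3. *)
  apply: (@two_term_eq0 R _ _ (2 * c + 2 * B) (Num.min e0 1) 1 3) => //.
    by rewrite lt_min e00 ltr01.
  move=> x /andP[x0]; rewrite lt_min => /andP[xe x1].
  have hx : `|x| < e0 by rewrite gtr0_norm.
  have h1 := fP x hx; have h2 := fb x hx; rewrite (gtr0_norm x0) in h1; rewrite (gtr0_norm x0) in h2.
  set q := 2 * c_ 1%N * x ^+ 1 + _ in h1 *.
  have -> : q = f x - (f x - q) by rewrite opprB addrC subrK.
  apply: le_trans (ler_normB _ _) _; rewrite mulrDl; apply: (lerD h2); apply: le_trans h1 _.
  by rewrite ler_wpM2l ?mulr_ge0 //; apply: ler_wiXn2l => //; exact: ltW.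
have := fP eps ee; rewrite a0 b0 !mul0r addr0 subr0 /f => h.
by rewrite mxE [X in `|_ + X|]mxE.
Qed.

End ResidualExpansion.

(** * Symmetry, side conditions and residual of the asymptotic solution *)

Section AsymptoticSolution.
Context {R : realType} {k : nat}.
Notation n := (2 + k + 1)%N.
Notation vec := ('cV[R]_n).
Notation npoint := ('cV[R]_n * 'cV[R]_n * R * R * R)%type.
Notation modes03 := (has_only_phi_modes [:: 0; 1; 2; 3]%N).
Variable D : ns_data R k.
Hypothesis hD : neimark_sacker D.
Notation ls := (lambda_star D).
Notation w0 := (omega_star D).
Variables (lam2 om2 eta2 : R) (z2 z3 : R -> R -> vec).
Hypothesis hE : asymptotic_solution D lam2 om2 eta2 z2 z3.
Notation lamE := (lambdaE D lam2).
Notation omE := (omegaE D om2).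
Notation etE := (etaE eta2).
Notation zE := (zE z2 z3).
Notation res := (fun eps => full_residual D (zE eps) (lamE eps) (omE eps) (etE eps) eps).

Let Cz2 : torus_C1 z2. Proof. by case: hE => -[]. Qed.
Let Cz3 : torus_C1 z3. Proof. by case: hE => -[]. Qed.
Let Ca : torus_C1 (fun _ : R => astar k : R -> vec) := astar_torus.

(** The other modes get coefficient zero by construction, so [tsum_modes] applies without computing
    the coefficients of [z] there. *)
Lemma tsum_pair (i j : 'I_4) (z : R -> R -> vec) : (i < j)%N ->
  has_only_phi_modes [:: i : nat; j : nat] z -> modes03 z.
Proof.
move=> ij hz; rewrite (_ : z = tsum (fun m => if (m == i) || (m == j) then fcoef m z else fun=> 0)).
  exact: tsum_modes.
apply/funext => t; apply/funext => p; rewrite {1}hz !big_cons big_nil addr0 /tsum.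
have h (m : 'I_4) : cos (m%:R * p) *: reV ((if ((m : nat) == i) || ((m : nat) == j) then fcoef m z else fun=> 0) t) -
    sin (m%:R * p) *: imV ((if ((m : nat) == i) || ((m : nat) == j) then fcoef m z else fun=> 0) t) =
    if (m == i) || (m == j) then phi_mode m z t p else 0.
  rewrite -!val_eqE /=; case: ifP => _; first by rewrite phi_modeE.
  have e0 : reV (0 : 'cV[R[i]]_n) = 0 /\ imV (0 : 'cV[R[i]]_n) = 0.
    by split; apply/colP => a; rewrite !mxE.
  by rewrite e0.1 e0.2 !scaler0 subrr.
rewrite (eq_bigr _ (fun m _ => h m)) (bigD1 i) //= eqxx /= (bigD1 j) /=; last by rewrite -val_eqE gtn_eqF.
rewrite eqxx orbT big1 ?addr0 // => m /andP[/negPf -> /negPf ->].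
by [].
Qed.

Let m2 : modes03 z2. Proof. by case: hE => _ h _ _; exact: (@tsum_pair ord0 (@Ordinal 4 2 isT)). Qed.
Let m3 : modes03 z3.
Proof. by case: hE => _ _ h _; exact: (@tsum_pair (@Ordinal 4 1 isT) (@Ordinal 4 3 isT)). Qed.

Lemma phi_mode_shift m (z : R -> R -> vec) t p :
  phi_mode m z t (p + pi) = (-1) ^+ m *: phi_mode m z t p.
Proof.
have [hc hs] := cos_shift m p; rewrite /phi_mode hc hs; move: (acoef _ _ _) (bcoef _ _ _) => a b.
by apply/colP => i; rewrite !mxE; ring.
Qed.

(** Even phi-modes are pi-periodic and odd ones change sign after pi; with the sign change of
    [astar] this yields the symmetry [zE_tau]. *)
Lemma z2_shift t p : z2 t (p + pi) = z2 t p.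
Proof.
have [_ h _ _] := hE; rewrite !h; apply: eq_big_seq => m; rewrite !inE phi_mode_shift.
by case/orP => /eqP ->; rewrite ?expr0 ?expr2 ?mulrNN ?mulr1 scale1r.
Qed.

Lemma z3_shift t p : z3 t (p + pi) = - z3 t p.
Proof.
have [_ _ h _] := hE; rewrite !h -sumrN; apply: eq_big_seq => m; rewrite !inE phi_mode_shift.
by case/orP => /eqP ->; rewrite ?expr1 ?exprS ?expr0 ?mulr1 ?mulrNN ?mulr1 scaleN1r.
Qed.

Lemma zE_lc eps : zE eps = lc 1 (lc 1 (fun _ : R => astar k) eps z2) (eps ^+ 2) z3.
Proof. by apply/funext => t; apply/funext => p; rewrite /Defs.zE /lc !scale1r. Qed.

Lemma zE_torus eps : torus_C1 (zE eps).
Proof. rewrite zE_lc; exact: torus_C1_lin (torus_C1_lin _ _ Ca Cz2) Cz3. Qed.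

Lemma zE_modes eps : modes03 (zE eps).
Proof.
rewrite zE_lc; have ca := torus_C1_continuous Ca; have c2 := torus_C1_continuous Cz2.
apply: modes_lin (torus_C1_continuous Cz3) _ m3; first exact: jcont_lc.
exact: modes_lin ca c2 modes_astar m2.
Qed.

Lemma zE_tau eps : zE (- eps) = tau (zE eps).
Proof.
apply/funext => t; apply/funext => p; rewrite /tau /Defs.zE (astar_shift p).1 z2_shift z3_shift sqrrN.
by move: (astar k p) (z2 t p) (z3 t p) => x y u; apply/colP => i; rewrite !mxE; ring.
Qed.

Lemma dtheta_zE eps t p : dtheta (zE eps) t p = eps *: dtheta z2 t p + eps ^+ 2 *: dtheta z3 t p.
Proof.
rewrite zE_lc (dtheta_lin _ _ t p (torus_C1_lin 1 eps Ca Cz2) Cz3) (dtheta_lin _ _ t p Ca Cz2).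
by rewrite dtheta_astar scaler0 add0r scale1r.
Qed.

Lemma dphi_zE eps t p : dphi (zE eps) t p = dastar k p + eps *: dphi z2 t p + eps ^+ 2 *: dphi z3 t p.
Proof.
rewrite zE_lc (dphi_lin _ _ t p (torus_C1_lin 1 eps Ca Cz2) Cz3) (dphi_lin _ _ t p Ca Cz2).
by rewrite dphi_astar !scale1r.
Qed.

Lemma entry_enorm m (u : 'cV[R]_m) i : `|u i 0| <= enorm u.
Proof.
rewrite -sqrtr_sqr /enorm ler_wsqrtr // (bigD1 i) //= lerDl.
by apply: sumr_ge0 => j _; exact: sqr_ge0.
Qed.

Lemma norm_enorm m (u : 'cV[R]_m) : `|u| <= enorm u.
Proof. by apply/mx_normP => [|i j]; [exact: sqrtr_ge0|rewrite (ord1 j) entry_enorm]. Qed.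

Lemma asymptotic_bounds : exists C d, [/\ 0 <= C, 0 < d & forall eps, `|eps| < d ->
  [/\ forall t p, `|res eps t p| <= C * `|eps| ^+ 3,
      `|gamma1 (zE eps) - ehat1| <= C * `|eps| ^+ 3 & `|gamma2 (zE eps)| <= C * `|eps| ^+ 3]].
Proof.
have [_ _ _ [C hC]] := hE; have [d /= d0 hd] := hC.
exists `|C|, d; split=> // eps ed.
have hb : `|0 - eps| < d by rewrite sub0r normrN.
have [h1 h2 h3] := hd eps hb.
have CC : C * `|eps| ^+ 3 <= `|C| * `|eps| ^+ 3 by rewrite ler_wpM2r ?exprn_ge0 // ler_norm.
split=> [t p||]; apply: le_trans CC.
- exact: le_trans (norm_enorm _) (h1 t p).
- exact: le_trans (norm_enorm _) h2.
- exact: h3.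
Qed.

(** The defects are polynomials in eps with terms of orders 1 and 2 only, yet bounded by eps^3; so
    their coefficients vanish and the conditions hold exactly. *)
Lemma gamma_zE eps : gamma1 (zE eps) = ehat1 /\ gamma2 (zE eps) = 0.
Proof.
have ca := torus_C1_continuous Ca; have c2 := torus_C1_continuous Cz2; have c3 := torus_C1_continuous Cz3.
have cl e : jcont (lc 1 (fun _ : R => astar k : R -> vec) e z2) by exact: jcont_lc.
have G1 e : gamma1 (zE e) - ehat1 = e *: gamma1 z2 + e ^+ 2 *: gamma1 z3.
  rewrite zE_lc (gamma1_lin _ _ (cl e) c3) (gamma1_lin _ _ ca c2) gamma_astar.1 !scale1r.
  by rewrite addrC !addrA addNr add0r.
have G2 e : gamma2 (zE e) = e * gamma2 z2 + e ^+ 2 * gamma2 z3.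
  by rewrite zE_lc (gamma2_lin _ _ (cl e) c3) (gamma2_lin _ _ ca c2) gamma_astar.2 !mul1r add0r.
have [C [d [C0 d0 hC]]] := asymptotic_bounds.
have zero (a b : R) : (forall e, `|e| < d -> `|e * a + e ^+ 2 * b| <= C * `|e| ^+ 3) -> a = 0 /\ b = 0.
  move=> h; apply: (@two_term_eq0 R a b C d 1 2) => // x /andP[x0 xd].
  by have := h x; rewrite gtr0_norm // => /(_ xd); rewrite mulrC [_ * b]mulrC expr1.
have zeroV (x y : 'cV[R]_2) : (forall e, `|e| < d -> `|e *: x + e ^+ 2 *: y| <= C * `|e| ^+ 3) -> x = 0 /\ y = 0.
  move=> h; have hi i : x i 0 = 0 /\ y i 0 = 0.
    apply: zero => e ed; apply: le_trans (h e ed).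
    by have := mx_entry_le (e *: x + e ^+ 2 *: y) i 0; rewrite !mxE.
  by split; apply/colP => i; rewrite mxE; case: (hi i).
have g1 : gamma1 z2 = 0 /\ gamma1 z3 = 0.
  by apply: zeroV => e ed; have [_ h _] := hC e ed; rewrite -G1.
have g2 : gamma2 z2 = 0 /\ gamma2 z3 = 0.
  by apply: zero => e ed; have [_ _ h] := hC e ed; rewrite -G2.
split; last by rewrite G2 g2.1 g2.2 !mulr0 addr0.
by apply/eqP; rewrite -subr_eq0 G1 g1.1 g1.2 !scaler0 addr0.
Qed.

Lemma torus_tcont (z : R -> R -> vec) : torus_C1 z -> tcont z /\ tcont (dphi z).
Proof.
move=> Cz; have cz := torus_C1_continuous Cz; have cp := jcont_dphi Cz; have [p1 p2] := dphi_periodic Cz.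
by have [q1 q2 _] := Cz.
Qed.

Lemma torus_tcont_dtheta (z : R -> R -> vec) : torus_C1 z -> tcont (dtheta z).
Proof. by move=> Cz; have ct := jcont_dtheta Cz; have [p1 p2] := dtheta_periodic Cz. Qed.

(** Places the asymptotic solution, phi-derivative included, in a ball [Om] of radius proportional
    to [|eps|]. *)
Lemma zE_bound : exists2 B, 0 <= B & forall eps, `|eps| <= 1 -> forall q,
  `|(ptq (zE eps) (lamE eps) (omE eps) (etE eps) q : npoint) - base D q.2| <= B * `|eps|.
Proof.
have [B1 b1 h1] := tcont_bound (torus_tcont Cz2).1; have [B2 b2 h2] := tcont_bound (torus_tcont Cz2).2.
have [B3 b3 h3] := tcont_bound (torus_tcont Cz3).1; have [B4 b4 h4] := tcont_bound (torus_tcont Cz3).2.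
pose B := B1 + B2 + B3 + B4 + `|lam2| + `|om2| + `|eta2|.
have n0 : 0 <= `|lam2| /\ 0 <= `|om2| /\ 0 <= `|eta2| by split=> //; split.
have B0 : 0 <= B by case: n0 => ? [? ?]; rewrite !addr_ge0.
have e21 (eps : R) : `|eps| <= 1 -> `|eps ^+ 2| <= `|eps|.
  by move=> e1; rewrite normrX expr2 -[leRHS]mulr1 ler_wpM2l.
have two (x y : vec) b c (eps : R) : 0 <= b -> 0 <= c -> b + c <= B -> `|eps| <= 1 -> `|x| <= b -> `|y| <= c ->
    `|eps *: x + eps ^+ 2 *: y| <= B * `|eps|.
  move=> b0 c0 bc e1 xb yc; apply: le_trans (ler_normD _ _) _; rewrite !normrZ.
  apply: (@le_trans _ _ ((b + c) * `|eps|)); last by rewrite ler_wpM2r.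
  have i1 : `|eps| * `|x| <= b * `|eps| by rewrite [leLHS]mulrC ler_wpM2r.
  have i2 : `|eps| * `|eps| * `|y| <= c * `|eps|.
    by rewrite -normrM [leLHS]mulrC; exact: (ler_pM (normr_ge0 y) (normr_ge0 _) yc (e21 eps e1)).
  rewrite mulrDl. exact: lerD i1 i2.
exists B => // eps e1 [t p]; apply: npoint_norm_le => /=.
- have -> : zE eps t p - astar k p = eps *: z2 t p + eps ^+ 2 *: z3 t p.
    by rewrite /Defs.zE; move: (astar k p) (z2 t p) (z3 t p) => x y u; apply/colP => i; rewrite !mxE; ring.
  by apply: (two _ _ B1 B3) => //; case: n0 => ? [? ?]; rewrite /B; lra.
- have -> : dphi (zE eps) t p - dastar k p = eps *: dphi z2 t p + eps ^+ 2 *: dphi z3 t p.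
    by rewrite dphi_zE; move: (dastar k p) (dphi z2 t p) (dphi z3 t p) => x y u; apply/colP => i; rewrite !mxE; ring.
  by apply: (two _ _ B2 B4) => //; case: n0 => ? [? ?]; rewrite /B; lra.
- have -> : lamE eps - ls = eps ^+ 2 * lam2 by rewrite /lambdaE; ring.
  rewrite normrM [leLHS]mulrC; apply: (ler_pM (normr_ge0 _) (normr_ge0 _) _ (e21 eps e1)).
  by case: n0 => ? [? ?]; rewrite /B; lra.
- have -> : omE eps - w0 = eps ^+ 2 * om2 by rewrite /omegaE; ring.
  rewrite normrM [leLHS]mulrC; apply: (ler_pM (normr_ge0 _) (normr_ge0 _) _ (e21 eps e1)).
  by case: n0 => ? [? ?]; rewrite /B; lra.
- rewrite subr0 /etaE normrM [leLHS]mulrC; apply: ler_wpM2r => //.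
  by case: n0 => ? [? ?]; rewrite /B; lra.
Qed.

(** Reversing z, eta and eps together leaves eps z and eps eta unchanged; only the prefactor 1/eps
    changes sign. *)
Lemma Gmap_odd (z : vec) lam eta th eps : Gmap D (- z) lam (- eta) th (- eps) = - Gmap D z lam eta th eps.
Proof.
rewrite /Gmap oppr_eq0; case: ifP => _; first by rewrite mulmxN.
by rewrite !mulmxN scaleNr scalerN opprK mulrNN scalerN invrN scaleNr mulNr scaleNr opprK.
Qed.

Lemma residual_tau eps t p : res (- eps) t p = tau (res eps) t p.
Proof.
have eo : omE (- eps) = omE eps by rewrite /omegaE sqrrN.
have el : lamE (- eps) = lamE eps by rewrite /lambdaE sqrrN.
have ee : etE (- eps) = - etE eps by rewrite /etaE mulNr.
rewrite /tau /full_residual /flow_terms /Gfun -!/(dtheta _ _ _) -!/(dphi _ _ _) eo el ee zE_tau.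
rewrite (dtheta_tau t p (zE_torus eps)) (dphi_tau t p (zE_torus eps)) {1}/tau Gmap_odd mulrNN.
move: (Gmap _ _ _ _ _ _) (dtheta _ _ _) (dphi _ _ _) (en k) => x y u v.
by apply/colP => i; rewrite !mxE; ring.
Qed.

Lemma lamE_near : exists2 e0 : R, 0 < e0 <= 1 & forall eps, `|eps| <= e0 ->
  `|lamE eps - ls| <= lambda_radius D / 2.
Proof.
have r0 : 0 < lambda_radius D / 2 := rad_gt0 hD.
have l1 : 0 < `|lam2| + 1 by rewrite ltr_wpDl.
exists (Num.min 1 (lambda_radius D / 2 / (`|lam2| + 1))) => [|eps].
  by rewrite lt_min ltr01 divr_gt0 //= ge_min lexx.
rewrite le_min => /andP[e1 e2]; have -> : lamE eps - ls = eps ^+ 2 * lam2 by rewrite /lambdaE; ring.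
rewrite normrM normrX expr2.
apply: (@le_trans _ _ (`|eps| * (`|lam2| + 1))); last by rewrite -ler_pdivlMr.
rewrite -mulrA ler_wpM2l //; apply: (@le_trans _ _ `|lam2|); last by rewrite lerDl.
by rewrite ler_piMl.
Qed.

(** Multiplication by eps P removes both the inverse of P and the pole at eps = 0, leaving an
    expression that is smooth in eps. *)
Lemma kfun_residual (g : R * R -> 'M[R]_n) eps t p : near_lambda D (lamE eps) ->
  (forall th lam, near_lambda D lam -> floquet_dot D th lam = g (th, lam)) ->
  kfun D lam2 om2 eta2 g eps t (astar k p) (z2 t p) (z3 t p) (dtheta z2 t p) (dtheta z3 t p)
    (dastar k p) (dphi z2 t p) (dphi z3 t p) =
  eps *: (floquet D t (lamE eps) *m res eps t p).
Proof.
move=> nl fg; rewrite /full_residual /flow_terms /Gfun -/(dtheta (zE eps) t p) -/(dphi (zE eps) t p).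
rewrite dtheta_zE dphi_zE mulmxBr scalerBr /kfun -(fg t _ nl) -/(Defs.zE z2 z3 eps t p).
congr (_ - _); rewrite /Gmap /hfun /= scale0r addr0; have [->|e0] := eqVneq eps 0.
  by rewrite !scale0r addr0 subrr mul0r scale0r subr0.
rewrite -scalemxAr scalerA mulfV // scale1r mulKVmx //.
exact: ns_floquet_unit.
Qed.

Lemma tcont_full_residual z lam om eta eps : near_lambda D lam -> torus_C1 z ->
  tcont (full_residual D z lam om eta eps).
Proof.
move=> nl Cz; have [z1' z2' _] := Cz.
have [t1 t2] := dtheta_periodic Cz; have [p1 p2] := dphi_periodic Cz.
have pf := ns_floquet_periodic hD nl.
split; first exact: jcont_full_residual.
  move=> q s; rewrite /full_residual /flow_terms /Gfun -!/(dtheta _ _ _) -!/(dphi _ _ _) (t1 q) (p1 q) (z1' q).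
  rewrite /Gmap (pf s) (ns_orbit_periodic hD nl s).
  by have -> : floquet_dot D (s + 2 * pi) lam = floquet_dot D s lam by exact: (derive1_periodic pf).
by move=> s q; rewrite /full_residual /flow_terms /Gfun -!/(dtheta _ _ _) -!/(dphi _ _ _) (t2 s) (p2 s) (z2' s).
Qed.

(** Since the residual at - eps is [tau] of the one at eps, the sum times eps P equals the
    difference of [kstack] at eps and - eps. [kstack_even] bounds this by eps^5, and removing eps P
    leaves eps^4. *)
Lemma residual_odd : exists C d, [/\ 0 <= C, 0 < d & forall eps t p, `|eps| < d ->
  `|res eps t p + tau (res eps) t p| <= C * `|eps| ^+ 4].
Proof.
have [C [d [C0 d0 hC]]] := asymptotic_bounds.
have [e1 /andP[e10 e11] hl] := lamE_near.
have [g fg cg] := floquet_dot_Ck hD 5.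
pose e0 := Num.min e1 d.
have e00 : 0 < e0 by rewrite lt_min e10.
have nl eps : `|eps| <= e0 -> near_lambda D (lamE eps).
  by rewrite le_min => /andP[h _]; exact: (near_rad hD (hl eps h)).
(* The functions on the torus and their first derivatives enter only as the values of a bounded
   matrix parameter. *)
pose Y t p := stack [:: astar k p; z2 t p; z3 t p; dtheta z2 t p; dtheta z3 t p; dastar k p;
  dphi z2 t p; dphi z3 t p].
have kE eps t p : `|eps| <= e0 -> kstack D lam2 om2 eta2 g (eps, t, Y t p) =
    eps *: (floquet D t (lamE eps) *m res eps t p).
  by move=> ee; rewrite /kstack /= /Y !cl_stack //=; apply: kfun_residual => //; exact: nl.
have [M1 M10 h1] := tcont_bound (torus_tcont Cz2).1; have [M2 M20 h2] := tcont_bound (torus_tcont Cz3).1.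
have [M3 M30 h3] := tcont_bound (torus_tcont_dtheta Cz2); have [M4 M40 h4] := tcont_bound (torus_tcont_dtheta Cz3).
have [M5 M50 h5] := tcont_bound (torus_tcont Cz2).2; have [M6 M60 h6] := tcont_bound (torus_tcont Cz3).2.
pose M := 1 + (M1 + (M2 + (M3 + (M4 + (M5 + M6))))).
have MM : [/\ 1 <= M, M1 <= M, M2 <= M, M3 <= M & [/\ M4 <= M, M5 <= M & M6 <= M]].
  by rewrite /M; split; [lra..|split; lra].
have YM t p : `|Y t p| <= M.
  have [m0 m1 m2' m3' [m4 m5 m6]] := MM.
  apply/mx_normP => [|i j]; first exact: le_trans ler01 m0.
  rewrite mxE; have [a1 a2] := @astar_norm R k p.
  case: j => -[|[|[|[|[|[|[|[|//]]]]]]]] /= _; (apply: le_trans (mx_entry_le _ i 0) _).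
  - exact: le_trans a1 m0.
  - exact: le_trans (h1 t p) m1.
  - exact: le_trans (h2 t p) m2'.
  - exact: le_trans (h3 t p) m3'.
  - exact: le_trans (h4 t p) m4.
  - exact: le_trans a2 m0.
  - exact: le_trans (h5 t p) m5.
  - exact: le_trans (h6 t p) m6.
pose box : set (R * R) := `[0, 2 * pi]%classic `*` `[- e0, e0]%classic.
have cbox : compact box by apply: compact_setX; exact: segment_compact.
have nbox x : box x -> near_lambda D (lamE x.2).
  by case: x => t e [_ /= he]; apply: nl; move: he; rewrite in_itv /= ler_norml.
have cP : Ck 0 [set x : R * R | near_lambda D (lamE x.2)] (fun x => floquet D x.1 (lamE x.2)).
  have ci := @Ck_id R (R * R)%type 0 [set x : R * R | near_lambda D (lamE x.2)].
  have c2 := Ck_snd ci.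
  have cc (c : R) := @Ck_cst R (R * R)%type R 0 [set x : R * R | near_lambda D (lamE x.2)] c.
  have cl := Ck_add (cc ls) (Ck_mulR (Ck_mulR c2 c2) (cc lam2)).
  apply: (@Ck_theta_lambda R k D _ 0 _ _ (fun q => floquet D q.1 q.2) (fun x => x.1) (fun x => lamE x.2)
    (@fin_basis_mx R n n) (Cdiff_Ck (ns_smooth_floquet hD 0)) _ (Ck_fst ci) cl).
  by move=> x.
have [MP MP0 hMP] := compact_bound cbox (fun x hx => cP x (nbox x hx)).
have cI : Ck 0 [set x : R * R | near_lambda D (lamE x.2)] (fun x => cramer_inv (floquet D x.1 (lamE x.2))).
  by apply: Ck_cramer_inv cP => x nx; exact: ns_floquet_unit.
have [MI MI0 hMI] := compact_bound cbox (fun x hx => cI x (nbox x hx)).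
have [B B0 hB] := @kstack_even R k D hD lam2 om2 eta2 g e0 M cg nl.
exists (n%:R * (MI * B)), e0; split=> //; first by rewrite !mulr_ge0.
move=> eps t p ee.
have nle := nl eps (ltW ee).
have [_ rp _] := tcont_full_residual (omE eps) (etE eps) eps nle (zE_torus eps).
have per (s : R) : res eps (s + 2 * pi) p + tau (res eps) (s + 2 * pi) p = res eps s p + tau (res eps) s p.
  by rewrite /tau !rp.
have [s s01 hs] := circle_rep t; rewrite (hs _ (fun t => res eps t p + tau (res eps) t p) per).
(* Division by eps is not possible here; at eps = 0 the residual itself vanishes by its bound of
   order 3. *)
have [->|en0] := eqVneq eps 0.
  have -> : tau (res 0) s p = - res 0 s p.
    have := residual_tau 0 s p; rewrite oppr0 => <-.
    have hd0 : `|0 : R| < d by rewrite normr0.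
    have [hr _ _] := hC 0 hd0.
    have := hr s p; rewrite normr0 expr0n /= mulr0 normr_le0 => /eqP ->.
    by rewrite oppr0.
  by rewrite subrr normr0 !mulr_ge0 ?exprn_ge0.
(* The residual has order 3, so its product with eps P has the order 4 that [kstack_even] asks
   for. *)
have hk e : `|e| < e0 -> `|kstack D lam2 om2 eta2 g (e, s, Y s p)| <= n%:R * (MP * C) * `|e| ^+ 4.
  move=> he; rewrite (kE e s p (ltW he)) normrZ.
  have ed : `|e| < d by move: he; rewrite lt_min => /andP[].
  have [hr _ _] := hC e ed.
  have hp : `|floquet D s (lamE e)| <= MP.
    apply: (hMP (s, e)); split=> /=; rewrite in_itv //=; by move: he => /ltW; rewrite ler_norml.
  have -> : n%:R * (MP * C) * `|e| ^+ 4 = `|e| * (n%:R * (MP * (C * `|e| ^+ 3))) by ring.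
  apply: ler_wpM2l => //; apply: le_trans (mulmx_norm _ _) _; apply: ler_wpM2l => //.
  exact: (ler_pM (normr_ge0 _) (normr_ge0 _) hp (hr s p)).
have := hB s (Y s p) _ s01 (YM s p) hk eps ee.
have ee' : `|- eps| <= e0 by rewrite normrN ltW.
rewrite (kE eps s p (ltW ee)) (kE _ s p ee') residual_tau (_ : lamE (- eps) = lamE eps); last by rewrite /lambdaE sqrrN.
rewrite scaleNr opprK -scalerDr -mulmxDr normrZ.
rewrite (_ : B * `|eps| ^+ 5 = `|eps| * (B * `|eps| ^+ 4)); last by ring.
rewrite ler_pM2l ?normr_gt0 //; set r := res eps s p + tau (res eps) s p => h.
have Pu := ns_floquet_unit hD s nle.
have -> : r = cramer_inv (floquet D s (lamE eps)) *m (floquet D s (lamE eps) *m r).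
  by rewrite -cramer_invE // mulKmx.
apply: le_trans (mulmx_norm _ _) _; rewrite -!mulrA; apply: ler_wpM2l => //.
apply: (ler_pM (normr_ge0 _) (normr_ge0 _) _ h).
by apply: (hMI (s, eps)); split=> /=; rewrite in_itv //=; move: ee => /ltW; rewrite ler_norml.
Qed.

End AsymptoticSolution.

(** * Error orders of the comparison *)

Section Comparison.
Context {R : realType} {k : nat}.
Notation n := (2 + k + 1)%N.
Notation npoint := ('cV[R]_n * 'cV[R]_n * R * R * R)%type.
Notation modes03 := (has_only_phi_modes [:: 0; 1; 2; 3]%N).
Implicit Types (z g : R -> R -> 'cV[R]_n).
Variable D : ns_data R k.
Hypothesis hD : neimark_sacker D.
Notation ls := (lambda_star D).
Notation w0 := (omega_star D).
Notation Om := (Om D).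
Notation forcing := (forcing D).
Notation nsol g z lam om eta := (lin_sol D g (dev z) (lam - ls) (om - w0) eta).
Variables K C : R.
Hypothesis K0 : 0 <= K.
Hypothesis C0 : 0 <= C.
Hypothesis hK : forall g z lam om eta, tcont g ->
  lin_sol D g z lam om eta -> forall M, (forall theta phi, `|g theta phi| <= M) ->
  [/\ forall theta phi, `|z theta phi| <= K * M, forall theta phi, `|dphi z theta phi| <= K * M,
      `|lam| <= K * M, `|om| <= K * M & `|eta| <= K * M].
Hypothesis hC : forall kap eps X X' d, 0 <= kap <= kap0 D ->
  `|eps| <= kap -> Om kap X -> Om kap X' -> (forall q, `|(X q : npoint) - X' q| <= d) ->
  forall t p, `|forcing eps X t p| <= C * kap /\
    `|forcing eps X t p - forcing eps X' t p| <= C * kap * d.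

Lemma sfac_bound (eps eta : R) : `|eps| <= 2^-1 -> `|eta| <= 2^-1 -> `|sfac eps eta| <= 2.
Proof.
move=> h1 h2; have h : `|eps * eta| <= 2^-1 * 2^-1 by rewrite normrM ler_pM.
have s0 : 2^-1 <= 1 + eps * eta by move: h; rewrite ler_norml => /andP[? ?]; lra.
have s1 : 0 < 1 + eps * eta by lra.
rewrite /sfac normrV ?unitfE ?gt_eqF // gtr0_norm // -[leLHS]mul1r ler_pdivrMr //; lra.
Qed.

Variables (lam2 om2 eta2 : R) (z2 z3 : R -> R -> 'cV[R]_n).
Hypothesis hE : asymptotic_solution D lam2 om2 eta2 z2 z3.
Notation lamE := (lambdaE D lam2).
Notation omE := (omegaE D om2).
Notation etE := (etaE eta2).
Notation zE := (Defs.zE z2 z3).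
Notation res := (fun eps => full_residual D (zE eps) (lamE eps) (omE eps) (etE eps) eps).

(** Averaging with [tau] preserves the odd modes, because [tau] fixes them. *)
Lemma coef_odd m (ze : R -> R -> 'cV[R]_n) t : odd m -> jcont ze -> (forall t, periodic (ze t) (2 * pi)) ->
  acoef m (lc 2^-1 ze 2^-1 (tau ze)) t = acoef m ze t /\ bcoef m (lc 2^-1 ze 2^-1 (tau ze)) t = bcoef m ze t.
Proof.
move=> om cz pz; have ct := jcont_tau cz; have [ha hb] := coef_tau m t cz pz.
rewrite (acoef_lin m _ _ t cz ct) (bcoef_lin m _ _ t cz ct) ha hb -signr_odd om expr1 opprK !scale1r.
have h2 : 2^-1 + 2^-1 = 1 :> R by field.
by rewrite -!scalerDl h2 !scale1r.
Qed.

Lemma coef_bound m (ze : R -> R -> 'cV[R]_n) t (M : R) i : jcont ze -> (forall t p, `|ze t p| <= M) ->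
  `|acoef m ze t i 0| <= 2 * M /\ `|bcoef m ze t i 0| <= 2 * M.
Proof. by move=> cz hM; have [] := @fcoef_bound R n m ze t M (@continuous_slice R n ze cz t) (hM t) i. Qed.

(** Two passes: [stability] gives O(eps^3) for all unknowns; then the forcings are compared again in
    a ball of radius O(|eps|), and averaging with [tau] removes the eps^3 part of the residual. *)
Lemma comparison kap : 0 < kap <= kap0 D -> K * C * kap <= 2^-1 ->
  exists B d, [/\ 0 <= B, 0 < d & forall eps z lam om eta, `|eps| < d -> torus_C1 z ->
    Om kap (ptq z lam om eta) -> nsol (forcing eps (ptq z lam om eta)) z lam om eta ->
    [/\ `|etE eps - eta| <= B * `|eps| ^+ 3,
        `|lamE eps - lam| <= B * `|eps| ^+ 4, `|omE eps - om| <= B * `|eps| ^+ 4,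
        forall m t i, `|(acoef m (dev (zE eps)) t - acoef m (dev z) t) i 0| <= B * `|eps| ^+ 3 /\
          `|(bcoef m (dev (zE eps)) t - bcoef m (dev z) t) i 0| <= B * `|eps| ^+ 3
      & forall m t i, odd m -> `|(acoef m (dev (zE eps)) t - acoef m (dev z) t) i 0| <= B * `|eps| ^+ 4 /\
          `|(bcoef m (dev (zE eps)) t - bcoef m (dev z) t) i 0| <= B * `|eps| ^+ 4]].
Proof.
move=> /andP[k0 k1] kC; have kk : 0 <= kap <= kap0 D by rewrite ltW.
have [B1 B10 hB1] := zE_bound hE.
have [Cr [d1 [Cr0 d10 hCr]]] := asymptotic_bounds hE.
have [Co [d2 [Co0 d20 hCo]]] := residual_odd hD hE.
pose B2 := 2 * (K * (2 * Cr)); have B20 : 0 <= B2 by rewrite !mulr_ge0.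
(* Large enough for both solutions to lie within [B3 * |eps|] of the base solution; the 1 ensures
   [|eps| <= B3 * |eps|]. *)
pose B3 := B1 + B2 + 1; have B31 : 1 <= B3 by rewrite lerDr addr_ge0.
have B30 : 0 < B3 by exact: lt_le_trans ltr01 B31.
pose M4 := C * B3 * B2 + 2 * Co; have M40 : 0 <= M4 by rewrite addr_ge0 ?mulr_ge0 // ltW.
pose B := 2 * B2 + 2 * (K * M4).
have BB2 : 2 * B2 <= B by rewrite lerDl !mulr_ge0.
have BB2' : B2 <= B by apply: le_trans BB2; rewrite ler_peMl // ler1n.
have BM4 : 2 * (K * M4) <= B by rewrite lerDr mulr_ge0.
have BM4' : K * M4 <= B by apply: le_trans BM4; rewrite ler_peMl ?mulr_ge0 // ler1n.
pose d := Num.min (Num.min d1 d2) (kap / B3).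
have kB0 : 0 < kap / B3 by rewrite divr_gt0.
exists B, d; split; first by rewrite addr_ge0 ?mulr_ge0.
  by rewrite !lt_min d10 d20.
move=> eps z lam om eta; rewrite !lt_min -andbA => /and3P[e1 e2 e3] Cz oX hz.
have ek3 : B3 * `|eps| <= kap by rewrite mulrC -ler_pdivlMr // ltW.
have eB3 : `|eps| <= B3 * `|eps| by rewrite ler_peMl.
have ek : `|eps| <= kap := le_trans eB3 ek3.
have eh : `|eps| <= 2^-1 := le_trans ek (le_trans k1 (kap0_half D)).
have e11 : `|eps| <= 1 by apply: le_trans eh _; rewrite invf_le1 // ler1n.
have e0 := normr_ge0 eps.
set X := ptq z lam om eta; set X' := ptq (zE eps) (lamE eps) (omE eps) (etE eps).
have CzE := zE_torus hE eps.
have bX' := hB1 eps e11.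
have oX' : Om kap X'.
  apply: (ptq_Om CzE) => q; apply: le_trans (bX' q) (le_trans _ ek3).
  by apply: ler_wpM2r => //; rewrite /B3 -addrA lerDl addr_ge0.
have s0 := Om_unit (0, 0) kk ek oX'.
have nl := Om_near hD (0, 0) kk oX'.
have eth : `|etE eps| <= 2^-1.
  have [_ _ _ _ h] := point_norms ((X' (0, 0) : npoint) - base D 0); rewrite /= subr0 in h.
  apply: le_trans h (le_trans _ (kap0_half D)); apply: le_trans (le_trans _ ek3) k1.
  apply: le_trans (bX' (0, 0)) _; apply: ler_wpM2r => //; rewrite /B3 -addrA lerDl addr_ge0 //.
have sb := sfac_bound eh eth.
have [gE1 gE2] := gamma_zE hE eps.
have hzE := lin_sol_full hD (lamE eps) (omE eps) CzE (zE_modes hE eps) s0 gE1 gE2.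
have tr : tcont (res eps) := tcont_full_residual hD (omE eps) (etE eps) eps nl CzE.
have tX := forcing_tcont hD kk ek oX; have tX' := forcing_tcont hD kk ek oX'.
set s := sfac eps (etE eps) in sb hzE.
have tg' : tcont (lc 1 (forcing eps X') (- s) (res eps)) := tcont_lc 1 (- s) tX' tr.
have [hr _ _] := hCr eps e1.
have hrho t p : `|lc 1 (forcing eps X') (- s) (res eps) t p - forcing eps X' t p| <= 2 * Cr * `|eps| ^+ 3.
  rewrite /lc scale1r addrC addKr normrZ normrN -mulrA.
  exact: (ler_pM (normr_ge0 _) (normr_ge0 _) sb (hr t p)).
have rho0 : 0 <= 2 * Cr * `|eps| ^+ 3 by rewrite !mulr_ge0 ?exprn_ge0.
(* First pass: the asymptotic solution solves the linear problem with an error of order eps^3 in the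
   forcing. *)
have hXX := stability hD K0 hK hC rho0 kk kC ek Cz CzE oX oX' hz tg' hzE hrho.
have {}hXX q : `|(X q : npoint) - X' q| <= B2 * `|eps| ^+ 3.
  by apply: le_trans (hXX q) _; rewrite /B2 !mulrA.
have k3 : 0 <= B3 * `|eps| <= kap0 D by rewrite mulr_ge0 ?(ltW B30) //= (le_trans ek3).
have oX3' : Om (B3 * `|eps|) X'.
  apply: (ptq_Om CzE) => q; apply: le_trans (bX' q) _.
  by apply: ler_wpM2r => //; rewrite /B3 -addrA lerDl addr_ge0.
have oX3 : Om (B3 * `|eps|) X.
  apply: (ptq_Om Cz) => q; rewrite -(subrKA (X' q : npoint)) (le_trans (ler_normD _ _)) //.
  apply: le_trans (lerD (hXX q) (bX' q)) _; rewrite addrC /B3 !mulrDl mul1r -addrA; apply: lerD => //.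
  have h3 : `|eps| ^+ 3 <= `|eps| by rewrite -[leRHS]expr1; apply: ler_wiXn2l.
  by apply: le_trans (ler_wpM2l B20 h3) _; rewrite lerDl.
(* Second pass: with [B3 * |eps|] in place of [kap] the Lipschitz constant is O(|eps|), so the two
   forcings differ by O(eps^4). *)
have hDe t p := (hC k3 eB3 oX3 oX3' hXX t p).2.
set g' := lc 1 (forcing eps X') (- s) (res eps) in tg' hzE hrho.
have cX : jcont (forcing eps X) by case: tX.
have cg' : jcont g' by case: tg'.
have hs := lin_sol_lc 1 (-1) cX cg' hz hzE.
set G := lc 1 (forcing eps X) (-1) g' in hs.
set ze := lc 1 (dev z) (-1) (dev (zE eps)) in hs.
have tG : tcont G := tcont_lc 1 (-1) tX tg'.
have cG : jcont G by case: tG.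
have tGt := tcont_tau tG; have cGt : jcont (tau G) by case: tGt.
(* Average of the difference and its image under [tau]: lambda, omega and the odd modes are kept,
   while eta cancels, which is why eta gains no order. *)
have hh := lin_sol_lc 2^-1 2^-1 cG cGt hs (lin_sol_tau tG hs).
have e4 : 0 <= `|eps| ^+ 4 by rewrite exprn_ge0.
have hG t p : `|lc 2^-1 G 2^-1 (tau G) t p| <= M4 * `|eps| ^+ 4.
  (* The forcing differences already have order 4; the residual enters only through its sum with its
     image under [tau], which [residual_odd] bounds. *)
  have -> : lc 2^-1 G 2^-1 (tau G) t p = 2^-1 *: ((forcing eps X t p - forcing eps X' t p)
      - (forcing eps X t (p + pi) - forcing eps X' t (p + pi))) + (2^-1 * s) *: (res eps t p + tau (res eps) t p).
    rewrite /G /g' /tau /lc; move: (forcing eps X t p) (forcing eps X' t p) (forcing eps X t (p + pi))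
      (forcing eps X' t (p + pi)) (full_residual _ _ _ _ _ _ t p) (full_residual _ _ _ _ _ _ t (p + pi)).
    by move=> a b a' b' r r'; apply/colP => i; rewrite !mxE; ring.
  apply: le_trans (ler_normD _ _) _; rewrite [M4 * _]mulrDl; apply: lerD.
    rewrite normrZ ger0_norm ?invr_ge0 //.
    have := le_trans (ler_normB _ _) (lerD (hDe t p) (hDe t (p + pi))) => h.
    apply: (@le_trans _ _ (2^-1 * (C * (B3 * `|eps|) * (B2 * `|eps| ^+ 3) + C * (B3 * `|eps|) * (B2 * `|eps| ^+ 3)))).
      by apply: ler_wpM2l => //; rewrite invr_ge0.
    by rewrite le_eqVlt; apply/orP; left; apply/eqP; field.
  rewrite normrZ -mulrA; apply: (ler_pM (normr_ge0 _) (normr_ge0 _) _ (hCo eps t p e2)).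
  by rewrite normrM ger0_norm ?invr_ge0 // ler_pdivrMl // (le_trans sb) // ler_peMr // ler1n.
have [bz _ bl bo _] := hK (tcont_lc 2^-1 2^-1 tG tGt) hh hG.
have Cze : torus_C1 ze := torus_C1_lin 1 (-1) (dev_torus Cz) (dev_torus CzE).
have cze := torus_C1_continuous Cze; have [_ pze _] := Cze.
have cdz := torus_C1_continuous (dev_torus Cz); have cdE := torus_C1_continuous (dev_torus CzE).
have zeb t p : `|ze t p| <= B2 * `|eps| ^+ 3.
  have [h _ _ _ _] := point_norms ((X (t, p) : npoint) - X' (t, p)).
  apply: le_trans (hXX (t, p)); apply: le_trans h.
  by rewrite /ze /lc /dev scale1r scaleN1r opprB addrA subrK.
have ca m t : acoef m (dev (zE eps)) t - acoef m (dev z) t = - acoef m ze t.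
  by rewrite /ze (acoef_lin m _ _ t cdz cdE) scale1r scaleN1r opprB.
have cb m t : bcoef m (dev (zE eps)) t - bcoef m (dev z) t = - bcoef m ze t.
  by rewrite /ze (bcoef_lin m _ _ t cdz cdE) scale1r scaleN1r opprB.
have nN (u : 'cV[R]_n) i : `|(- u) i 0| = `|u i 0| by rewrite mxE normrN.
have e30 : 0 <= `|eps| ^+ 3 by rewrite exprn_ge0.
have KM : K * (M4 * `|eps| ^+ 4) <= B * `|eps| ^+ 4 by rewrite mulrA ler_wpM2r.
split.
- have [_ _ _ _ h] := point_norms ((X (0, 0) : npoint) - X' (0, 0)).
  rewrite distrC; apply: le_trans h (le_trans (hXX (0, 0)) _).
  exact: ler_wpM2r.
- rewrite (_ : lamE eps - lam = - (2^-1 * (1 * (lam - ls) + -1 * (lamE eps - ls)) +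
    2^-1 * (1 * (lam - ls) + -1 * (lamE eps - ls)))); last by field.
  by rewrite normrN; exact: le_trans bl KM.
- rewrite (_ : omE eps - om = - (2^-1 * (1 * (om - w0) + -1 * (omE eps - w0)) +
    2^-1 * (1 * (om - w0) + -1 * (omE eps - w0)))); last by field.
  by rewrite normrN; exact: le_trans bo KM.
- move=> m t i; rewrite ca cb !nN; have [h1 h2] := coef_bound m t i cze zeb.
  have hB : 2 * (B2 * `|eps| ^+ 3) <= B * `|eps| ^+ 3 by rewrite mulrA ler_wpM2r.
  by split; [exact: le_trans h1 hB|exact: le_trans h2 hB].
- move=> m t i om'; rewrite ca cb !nN; have [<- <-] := coef_odd t om' cze pze.
  have cl : jcont (lc 2^-1 ze 2^-1 (tau ze)) by exact: (jcont_lc cze (jcont_tau cze)).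
  have [h1 h2] := coef_bound m t i cl bz.
  have hB : 2 * (K * (M4 * `|eps| ^+ 4)) <= B * `|eps| ^+ 4.
    by rewrite (_ : 2 * (K * (M4 * `|eps| ^+ 4)) = 2 * (K * M4) * `|eps| ^+ 4) ?ler_wpM2r //; ring.
  by split; [exact: le_trans h1 hB|exact: le_trans h2 hB].
Qed.

End Comparison.

(** * Euclidean norms and side conditions in the form of the final statement *)

Section Assembly.
Context {R : realType} {k : nat}.
Notation n := (2 + k + 1)%N.
Notation npoint := ('cV[R]_n * 'cV[R]_n * R * R * R)%type.
Notation modes03 := (has_only_phi_modes [:: 0; 1; 2; 3]%N).
Implicit Types (z g : R -> R -> 'cV[R]_n).
Variable D : ns_data R k.
Hypothesis hD : neimark_sacker D.

Lemma enorm_le m (u : 'cV[R]_m) (b : R) : 0 <= b -> (forall i, `|u i 0| <= b) -> enorm u <= m%:R * b.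
Proof.
move=> b0 h; have nb : 0 <= m%:R * b by rewrite mulr_ge0.
rewrite /enorm -[leRHS]ger0_norm // -sqrtr_sqr ler_wsqrtr //.
apply: (@le_trans _ _ (m%:R * b ^+ 2)).
  rewrite -[m in leRHS]card_ord mulr_natl -sumr_const; apply: ler_sum => i _.
  by rewrite -real_normK ?num_real // lerXn2r ?nnegrE.
rewrite exprMn ler_wpM2r ?exprn_ge0 // -natrX ler_nat.
by case: (m) => // m'; rewrite expnS leq_pmulr // expn_gt0.
Qed.

Lemma addr_dev z : z = lc 1 (dev z) 1 (fun _ : R => astar k).
Proof. by apply/funext => t; apply/funext => p; rewrite /lc /dev !scale1r subrK. Qed.

Lemma from_dev z : torus_C1 z -> modes03 (dev z) -> gamma1 (dev z) = 0 -> gamma2 (dev z) = 0 ->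
  [/\ modes03 z, gamma1 z = ehat1 & gamma2 z = 0].
Proof.
move=> Cz md g1 g2; have cd := torus_C1_continuous (dev_torus Cz).
have ca := torus_C1_continuous (@astar_torus R k); rewrite (addr_dev z); split.
- exact: modes_lin cd ca md modes_astar.
- by rewrite (gamma1_lin 1 1 cd ca) g1 scaler0 add0r scale1r gamma_astar.1.
- by rewrite (gamma2_lin 1 1 cd ca) g2 gamma_astar.2 !mulr0 addr0.
Qed.

(** [close_to_star] does not speak of [dphi z], but the fixed-point ball does; this bound bridges
    the gap in the uniqueness proof. The constant is 4 modes times 3 from differentiation times 4
    from [fcoef_bound]. *)
Lemma dphi_bound z (M : R) : torus_C1 z -> modes03 z -> (forall t p, `|z t p| <= M) ->
  forall t p, `|dphi z t p| <= 48 * M.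
Proof.
move=> Cz /modes0123E e hM t p; have cz := torus_C1_continuous Cz.
have M0 : 0 <= M := le_trans (normr_ge0 _) (hM 0 0).
rewrite e dphi_tsum; have -> : 48 * M = 4 * (3 * (4 * M)) by ring.
apply: tsum_bound => [|m i m4]; first by rewrite !mulr_ge0.
have [_ _ h] := @fcoef_bound R n m z t M (@continuous_slice R n z cz t) (hM t) i.
rewrite mxE; move: (fcoef m z t i 0) h => -[x y] h.
have -> : cn (Complex 0 m%:R * Complex x y) = m%:R * cn (Complex x y).
  by rewrite /cn /= !mul0r sub0r add0r normrN !normrM ger0_norm // -mulrDr addrC.
apply: ler_pM => //; first exact: cn_ge0.
by rewrite ler_nat.
Qed.

Lemma expansion z t p : modes03 (dev z) -> z t p = astar k p + acoef 0 (dev z) t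
  + \sum_(1 <= m < 4) (cos (m%:R * p) *: acoef m (dev z) t + sin (m%:R * p) *: bcoef m (dev z) t).
Proof.
move=> /(_ t p) h; have e : z t p = astar k p + dev z t p by rewrite /dev addrC subrK.
rewrite e h !big_cons !big_nil /phi_mode /=.
by rewrite mul0r cos0 sin0 scale1r scale0r !addr0 !addrA.
Qed.

Lemma circle_int_addE (f g : R -> R) : continuous f -> continuous g ->
  circle_int f + circle_int g = circle_int (fun x => f x + g x).
Proof. by move=> cf cg; rewrite circle_intD. Qed.

(** These are the real and imaginary parts of the average of c1 + i c2 in mode 1, and the average of
    the last coordinate in mode 0, written out for coefficients a_m - i b_m. *)
Lemma amplitude_conditions z : torus_C1 z -> modes03 z -> gamma1 z = 0 -> gamma2 z = 0 ->
  [/\ inner1 (acoef 1 z) (fun _ => e1 k) + inner1 (bcoef 1 z) (fun _ => e2 k) = 0,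
      inner1 (acoef 1 z) (fun _ => e2 k) - inner1 (bcoef 1 z) (fun _ => e1 k) = 0
    & inner1 (acoef 0 z) (fun _ => en k) = 0].
Proof.
move=> Cz /modes0123E e g1 g2; have cz := torus_C1_continuous Cz.
have vc m : vcont (fcoef m z) := fcoef_vcont m cz.
have cN (f : R -> R) : continuous f -> continuous (fun t => - f t).
  by move=> cf t; apply: cvgN; exact: cf.
have ca m i : continuous (fun t => acoef m z t i 0).
  have [h _] := vc m i; have e' : (fun t => complex.Re (fcoef m z t i 0)) = fun t => acoef m z t i 0.
    by apply/funext => t; rewrite mxE.
  by rewrite e' in h.
have cb m i : continuous (fun t => - bcoef m z t i 0).
  have [_ h] := vc m i; have e' : (fun t => complex.Im (fcoef m z t i 0)) = fun t => - bcoef m z t i 0.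
    by apply/funext => t; rewrite mxE.
  by rewrite e' in h.
have cbb m i : continuous (fun t => bcoef m z t i 0).
  have e' : (fun t => bcoef m z t i 0) = fun t => - (- bcoef m z t i 0) by apply/funext => t; rewrite opprK.
  by rewrite e'; exact: cN.
have d1 (u : 'cV[R]_n) : dotv u (e1 k) = u (@ix1 k) 0.
  by have := dotv_sum u 1 0; rewrite scale1r scale0r addr0 mul1r mul0r addr0.
have d2 (u : 'cV[R]_n) : dotv u (e2 k) = u (@ix2 k) 0.
  by have := dotv_sum u 0 1; rewrite scale1r scale0r add0r mul1r mul0r add0r.
rewrite e in g1 g2; rewrite gamma2_tsum // in g2; move/(gamma1_tsum_eq0 vc): g1 => g1.
have h1 := congr1 (@complex.Re R) g1; have h2 := congr1 (@complex.Im R) g1.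
rewrite /cavg /= in h1 h2 g2.
have D1 (u : R -> 'cV[R]_n) : inner1 u (fun _ => e1 k) = (2 * pi)^-1 * circle_int (fun t => u t (@ix1 k) 0).
  by rewrite /inner1; congr (_ * circle_int _); apply/funext => t; exact: d1.
have D2 (u : R -> 'cV[R]_n) : inner1 u (fun _ => e2 k) = (2 * pi)^-1 * circle_int (fun t => u t (@ix2 k) 0).
  by rewrite /inner1; congr (_ * circle_int _); apply/funext => t; exact: d2.
split.
- rewrite D1 D2 -mulrDr circle_int_addE //; apply: etrans h1; congr (_ * circle_int _).
  by apply/funext => t; rewrite [fcoef 1 z t _ _]mxE [fcoef 1 z t _ _]mxE /=; ring.
- rewrite D1 D2 -mulrBr.
  have -> : circle_int (fun t => acoef 1 z t (@ix2 k) 0) - circle_int (fun t => bcoef 1 z t (@ix1 k) 0) =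
      circle_int (fun t => acoef 1 z t (@ix2 k) 0 + -1 * bcoef 1 z t (@ix1 k) 0).
    have cM : continuous (fun t => -1 * bcoef 1 z t (@ix1 k) 0).
      by move=> t; apply: cvgM; [exact: cvg_cst|exact: cbb].
    by rewrite -(circle_int_addE (ca _ _) cM) (circle_intZ (-1) (cbb 1%N (@ix1 k))) mulN1r.
  apply: etrans h2; congr (_ * circle_int _).
  by apply/funext => t; rewrite [fcoef 1 z t _ _]mxE [fcoef 1 z t _ _]mxE /=; ring.
- apply: etrans g2; rewrite /inner1; congr (_ * circle_int _); apply/funext => t.
  by rewrite dotv_en [fcoef 0 z t _ _]mxE.
Qed.

End Assembly.

Lemma rate_bigO (R : realType) (f : R -> R) (B d : R) (j : nat) : 0 <= B -> 0 < d ->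
  (forall x, `|x| < d -> `|f x| <= B * `|x| ^+ j) -> f =O_ (0 : R) (fun x => x ^+ j).
Proof.
move=> B0 d0 h; apply/eqO_exP; exists (B + 1); first by rewrite ltr_wpDl.
exists d => // x /= xd0; have xd : `|x| < d by move: xd0; rewrite /ball_ /= sub0r normrN.
apply: le_trans (h x xd) _; rewrite normrX ler_wpM2r ?exprn_ge0 //.
by rewrite lerDl.
Qed.

Lemma rate_unif_bigO (R : realType) n (f g : R -> R -> 'cV[R]_n) (B d : R) (j : nat) : 0 <= B -> 0 < d ->
  (forall x t i, `|x| < d -> `|(f x t - g x t) i 0| <= B * `|x| ^+ j) -> unif_bigO j f g.
Proof.
move=> B0 d0 h; exists (n%:R * B); exists d => // x /= xd0 t; have xd : `|x| < d by move: xd0; rewrite /ball_ /= sub0r normrN.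
rewrite -mulrA; apply: enorm_le => [|i]; first by rewrite mulr_ge0 ?exprn_ge0.
exact: h.
Qed.

Theorem theorem5p2 (R : realType) (k : nat) (D : ns_data R k)
    (hD : neimark_sacker D)
    (h13 : omega_star D != 3^-1) (h14 : omega_star D != 4^-1) :
  exists (delta eps0 : R) (lamF omF etaF : R -> R)
      (zF : R -> R -> R -> 'cV[R]_(2 + k + 1)),
    let aF m eps := acoef m (dev (zF eps)) in
    let bF m eps := bcoef m (dev (zF eps)) in
    [/\ 0 < delta <= lambda_radius D /\ 0 < eps0,
        forall eps : R, `|eps| < eps0 ->
          [/\ fourier_solution D eps (lamF eps) (omF eps) (etaF eps) (zF eps),
              close_to_star D delta (lamF eps) (omF eps) (etaF eps) (zF eps)
            & forall lam om eta z,
                fourier_solution D eps lam om eta z ->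
                close_to_star D delta lam om eta z ->
                [/\ lam = lamF eps, om = omF eps, eta = etaF eps
                  & z = zF eps]],
        forall eps theta phi : R, `|eps| < eps0 ->
          zF eps theta phi = astar k phi + aF 0%N eps theta
            + \sum_(1 <= m < 4) (cos (m%:R * phi) *: aF m eps theta
                                 + sin (m%:R * phi) *: bF m eps theta),
        forall eps : R, `|eps| < eps0 ->
          [/\ inner1 (aF 1%N eps) (fun _ => e1 k)
                + inner1 (bF 1%N eps) (fun _ => e2 k) = 0,
              inner1 (aF 1%N eps) (fun _ => e2 k)
                - inner1 (bF 1%N eps) (fun _ => e1 k) = 0
            & inner1 (aF 0%N eps) (fun _ => en k) = 0]
      & forall (lam2 omega2 eta2 : R) (z2 z3 : R -> R -> 'cV[R]_(2 + k + 1)),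
          asymptotic_solution D lam2 omega2 eta2 z2 z3 ->
          let aE m eps := acoef m (dev (zE z2 z3 eps)) in
          let bE m eps := bcoef m (dev (zE z2 z3 eps)) in
          [/\ (fun eps => etaE eta2 eps - etaF eps)
                =O_ (0 : R) (fun eps => eps ^+ 3),
              (fun eps => lambdaE D lam2 eps - lamF eps)
                =O_ (0 : R) (fun eps => eps ^+ 4),
              (fun eps => omegaE D omega2 eps - omF eps)
                =O_ (0 : R) (fun eps => eps ^+ 4),
              [/\ unif_bigO 3 (aE 0%N) (aF 0%N), unif_bigO 3 (aE 2%N) (aF 2%N)
                & unif_bigO 3 (bE 2%N) (bF 2%N)]
            & [/\ unif_bigO 4 (aE 1%N) (aF 1%N), unif_bigO 4 (aE 3%N) (aF 3%N),
                  unif_bigO 4 (bE 1%N) (bF 1%N) & unif_bigO 4 (bE 3%N) (bF 3%N)]]].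
Proof.
have [K K0 hK] := lin_apriori hD h13 h14.
have [C C0 hC] := forcing_bound hD.
pose Q := K * C; have Q0 : 0 <= Q by rewrite mulr_ge0.
have Q1 : 0 < Q + 1 by rewrite ltr_wpDl.
(* Makes [K * C * kap] at most 1/2; the summand 1 keeps the denominator positive when [Q] is
   zero. *)
pose kap := Num.min (kap0 D) (2 * (Q + 1))^-1.
have k0 : 0 < kap by rewrite lt_min kap0_gt0 // invr_gt0 mulr_gt0.
have k1 : kap <= kap0 D by rewrite ge_min lexx.
have kk : 0 < kap <= kap0 D by rewrite k0.
have kk' : 0 <= kap <= kap0 D by rewrite ltW.
have kC : K * C * kap <= 2^-1.
  apply: (@le_trans _ _ ((Q + 1) * (2 * (Q + 1))^-1)).
    by apply: ler_pM => //; [exact: ltW|rewrite lerDl|rewrite ge_min lexx orbT].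
  by rewrite invfM mulrCA mulfV ?mulr1 // gt_eqF.
pose nn : R := (2 + k + 1)%:R.
have nn1 : 1 <= nn by rewrite ler1n addn1.
have nn0 : 0 < nn by exact: lt_le_trans ltr01 nn1.
(* The 48 is that of [dphi_bound]: a candidate within [delta] of [astar] has its phi-derivative
   within [kap] of [dastar], hence lies in [Om D kap]. *)
pose delta := kap / 48; have de0 : 0 < delta by rewrite divr_gt0.
have dk : delta <= kap by rewrite ler_pdivrMr // ler_peMr ?ler1n // ltW.
have dk48 : 48 * delta = kap by rewrite /delta mulrCA mulfV ?mulr1 // pnatr_eq0.
(* Entries of the solution deviate by at most [2 * (K * C * |eps|)]; the factor [nn] passes to the
   Euclidean norm, and the rest leaves room for the two conditions of [nonlinear_solution]. *)
pose eps0 := delta / (4 * ((Q + 1) * nn)).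
have den : 0 < 4 * ((Q + 1) * nn) by rewrite !mulr_gt0.
have ep0 : 0 < eps0 by rewrite divr_gt0.
have small (eps : R) : `|eps| < eps0 -> [/\ `|eps| <= kap, K * C * `|eps| <= kap / 2 &
    nn * (2 * (K * C * `|eps|)) < delta].
  move=> ee; have h : 4 * ((Q + 1) * nn) * `|eps| < delta by rewrite mulrC -ltr_pdivlMr.
  have e0 := normr_ge0 eps.
  have hq : (Q + 1) * nn * `|eps| <= delta / 4 by rewrite ler_pdivlMr // mulrC mulrA ltW.
  have i1 : `|eps| <= (Q + 1) * nn * `|eps|.
    by rewrite ler_peMl // (le_trans nn1) // ler_peMl // ?lerDr // ltW.
  have i2 : Q * `|eps| <= (Q + 1) * nn * `|eps|.
    apply: ler_wpM2r => //; apply: (@le_trans _ _ (Q + 1)); first by rewrite lerDl.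
    by rewrite ler_peMr // ltW.
  have i3 : nn * (Q * `|eps|) <= (Q + 1) * nn * `|eps|.
    by rewrite mulrA ler_wpM2r // mulrC ler_wpM2r // ?(ltW nn0) // lerDl.
  have d4 : delta / 4 <= delta / 2 by rewrite ler_pM2l // lef_pV2 ?posrE // ler_nat.
  have d2 : delta / 2 <= kap / 2 by rewrite ler_pM2r.
  split.
  - apply: le_trans i1 (le_trans hq _); apply: le_trans dk.
    by rewrite ler_pdivrMr // ler_peMr ?ler1n // ltW.
  - exact: le_trans i2 (le_trans hq (le_trans d4 d2)).
  - rewrite mulrCA; apply: (@le_lt_trans _ _ (2 * (delta / 4))).
      by rewrite ler_wpM2l // (le_trans i3).
    by rewrite mulrCA gtr_pMr // ltr_pdivrMr // mul1r ltr_nat.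
have /choice[S hS] (eps : R) : exists y : (R -> R -> 'cV[R]_(2 + k + 1)) * R * R * R, `|eps| < eps0 ->
    let X := ptq y.1.1.1 y.1.1.2 y.1.2 y.2 in
    [/\ torus_C1 y.1.1.1, Om D kap X, lin_sol D (forcing D eps X) (dev y.1.1.1)
        (y.1.1.2 - lambda_star D) (y.1.2 - omega_star D) y.2
      & forall q, `|(X q : 'cV[R]_(2 + k + 1) * 'cV[R]_(2 + k + 1) * R * R * R) - base D q.2|
          <= 2 * (K * C * `|eps|)].
  have [ee|nee] := pselect (`|eps| < eps0); last by exists (fun _ _ => 0, 0, 0, 0).
  have [e1 e2 _] := small eps ee.
  have [z [lam [om [eta h]]]] := nonlinear_solution hD h13 h14 K0 C0 hK hC kk kC e1 e2.
  by exists (z, lam, om, eta).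
pose zF eps := (S eps).1.1.1; pose lamF eps := (S eps).1.1.2.
pose omF eps := (S eps).1.2; pose etaF eps := (S eps).2.
have hF eps (ee : `|eps| < eps0) := hS eps ee.
have four eps : `|eps| < eps0 -> fourier_solution D eps (lamF eps) (omF eps) (etaF eps) (zF eps) /\
    has_only_phi_modes [:: 0; 1; 2; 3]%N (dev (zF eps)).
  move=> ee; have [Cz oX hz _] := hF eps ee; have [e1 _ _] := small eps ee.
  have [_ md _ g1 g2] := hz; have [mz g1' g2'] := from_dev Cz md g1 g2; split; last exact: md.
  have [cf _ _] := forcing_tcont hD kk' e1 oX.
  exact: (lin_sol_fourier hD Cz mz (Om_unit (0, 0) kk' e1 oX) (Om_near hD (0, 0) kk' oX) g1' g2' cf).1 hz.
exists delta, eps0, lamF, omF, etaF, zF => aF bF; split.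
- split; last exact: ep0.
  rewrite de0 /=; apply: le_trans dk (le_trans k1 (le_trans (kap0_rad D) _)).
  by rewrite ler_pdivrMr // ler_peMr ?ler1n // ltW // (ns_radius_gt0 hD).
- move=> eps ee; have [e1 _ e3] := small eps ee.
  have [Cz oX hz bX] := hF eps ee.
  have b1 : 2 * (K * C * `|eps|) < delta.
    by apply: le_lt_trans e3; rewrite ler_peMl // !mulr_ge0.
  have pn q := point_norms ((ptq (zF eps) (lamF eps) (omF eps) (etaF eps) q
    : 'cV[R]_(2 + k + 1) * 'cV[R]_(2 + k + 1) * R * R * R) - base D q.2).
  split; first exact: (four eps ee).1.
    split.
    + by have [_ _ h _ _] := pn (0, 0); exact: le_lt_trans h (le_lt_trans (bX (0, 0)) b1).
    + by have [_ _ _ h _] := pn (0, 0); exact: le_lt_trans h (le_lt_trans (bX (0, 0)) b1).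
    + have [_ _ _ _ h] := pn (0, 0); rewrite /= subr0 in h.
      exact: le_lt_trans h (le_lt_trans (bX (0, 0)) b1).
    + move=> t p; have [h _ _ _ _] := pn (t, p).
      apply: le_lt_trans e3; apply: enorm_le => [|i]; first by rewrite !mulr_ge0.
      apply: le_trans (mx_entry_le _ i 0) _; exact: le_trans h (bX (t, p)).
  move=> lam om eta z fz [c1 c2 c3 c4].
  have [Cz' mz' _ /subr0_eq g1' g2'] := fz.
  have md' := dev_modes Cz' mz'.
  have zb t p : `|dev z t p| <= delta := le_trans (norm_enorm _) (ltW (c4 t p)).
  have yb := dphi_bound (dev_torus Cz') md' zb.
  have oX' : Om D kap (ptq z lam om eta).
    apply: (ptq_Om Cz') => -[t p]; apply: npoint_norm_le => /=.
    + exact: le_trans (zb t p) dk.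
    + by have := yb t p; rewrite (dphi_dev t p Cz') dk48.
    + exact: le_trans (ltW c1) dk.
    + exact: le_trans (ltW c2) dk.
    + by rewrite subr0; exact: le_trans (ltW c3) dk.
  have tc := forcing_tcont hD kk' e1 oX'; have [cf _ _] := tc.
  have hz' : lin_sol D (forcing D eps (ptq z lam om eta)) (dev z) (lam - lambda_star D) (om - omega_star D) eta.
    by apply/(lin_sol_fourier hD Cz' mz' (Om_unit (0, 0) kk' e1 oX') (Om_near hD (0, 0) kk' oX') g1' g2' cf).
  (* Both candidates solve the linear problem with the forcing they generate, so [stability] applies
     with [rho = 0] and gives distance zero. *)
  have z0 t p : `|forcing D eps (ptq z lam om eta) t p - forcing D eps (ptq z lam om eta) t p| <= 0.
    by rewrite subrr normr0.
  have d0 := stability hD K0 hK hC (lexx 0) kk' kC e1 Cz Cz' oX oX' hz tc hz' z0.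
  have eq q : ptq (zF eps) (lamF eps) (omF eps) (etaF eps) q = ptq z lam om eta q.
    by apply/eqP; rewrite -subr_eq0 -normr_le0; have := d0 q; rewrite !mulr0.
  have e00 := eq (0, 0); split; [by case: e00|by case: e00|by case: e00|].
  by apply/funext => t; apply/funext => p; have := eq (t, p); case.
- by move=> eps t p ee; apply: expansion; exact: (four eps ee).2.
- move=> eps ee; have [Cz _ [_ md _ g1 g2] _] := hF eps ee.
  exact: amplitude_conditions (dev_torus Cz) md g1 g2.
- move=> lam2 om2 eta2 z2 z3 hE aE bE.
  have [B [d [B0 d0 hB]]] := comparison hD K0 C0 hK hC hE kk kC.
  pose d' := Num.min d eps0; have d'0 : 0 < d' by rewrite lt_min d0.
  have hh eps : `|eps| < d' -> _ := fun ed => let: conj e1 e2 := andP (eq_ind _ is_true ed _ (lt_min _ _ _)) in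
    let: And4 Cz oX hz _ := hF eps e2 in hB eps _ _ _ _ e1 Cz oX hz.
  split.
  + by apply: (rate_bigO B0 d'0) => eps /hh[].
  + by apply: (rate_bigO B0 d'0) => eps /hh[].
  + by apply: (rate_bigO B0 d'0) => eps /hh[].
  + split; apply: (rate_unif_bigO B0 d'0) => eps t i /hh[_ _ _ h _].
    * exact: (h 0%N t i).1.
    * exact: (h 2%N t i).1.
    * exact: (h 2%N t i).2.
  + split; apply: (rate_unif_bigO B0 d'0) => eps t i /hh[_ _ _ _ h].
    * exact: (h 1%N t i isT).1.
    * exact: (h 3%N t i isT).1.
    * exact: (h 1%N t i isT).2.
    * exact: (h 3%N t i isT).2.
Qed.
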